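(* Let smooth initial data (Q) for an $m$-dimensional conjugate net $f$ in $\mathbb{R}^N$ and smooth initial data (J), with $a_i$ non-vanishing on $\mathcal{B}_i$, for a Jonas transform $f^+$ of $f$ be given. Let $f^\epsilon$ be the canonical discrete Q-nets for (Q), and let $(f^\epsilon)^+$ be their canonical discrete Jonas transforms for (J). Then for some $r>0$ the Q-nets $(f^\epsilon)^+:\mathcal{B}^\epsilon(r)\to\mathbb{R}^N$ (defined for all sufficiently small $\epsilon>0$) converge, as $\epsilon\to0$, to the unique Jonas transform $f^+:\mathcal{B}(r)\to\mathbb{R}^N$ of $f$ with the initial data (J). The convergence is with the order $O(\epsilon)$ in $C^\infty(\mathcal{B}(r))$.
   Context: Let $N\ge 3$. Coordinate axes and planes: $\mathcal{B}_i=\{u\in\mathbb{R}^m:u_k=0\ \text{for }k\ne i\}$, $\mathcal{B}_{ij}=\{u\in\mathbb{R}^m: u_k=0\ \text{for }k\neq i,j\}$. Put $\mathcal{B}(r)=[0,r]^m$, $\mathcal{B}^\epsilon(r)=(\epsilon\mathbb{Z})^m\cap[0,r]^m$, $\mathcal{B}_i^\epsilon=\mathcal{B}_i\cap(\epsilon\mathbb{Z})^m$, $\mathcal{B}_{ij}^\epsilon=\mathcal{B}_{ij}\cap(\epsilon\mathbb{Z})^m$. On lattices, $(\tau_i f)(u)=f(u+\epsilon e_i)$ and $\delta_i f=\epsilon^{-1}(\tau_i f-f)$; $\delta^\alpha=\delta_1^{\alpha_1}\cdots\delta_m^{\alpha_m}$. Smooth conjugate net: $\partial_i\partial_j f=c_{ji}\partial_i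 f+c_{ij}\partial_j f$ ($i\neq j$), with $\partial_i c_{jk}=c_{ij}c_{jk}+c_{ji}c_{ik}-c_{jk}c_{ik}$ ($i,j,k$ distinct). Initial data (Q): smooth curves $f|_{\mathcal{B}_i}$ with a common point $f(0)$ and smooth real functions $c_{ij}|_{\mathcal{B}_{ij}}$, $i\neq j$; $f$ is the solution with these data. Discrete Q-net: $\delta_i\delta_j f^\epsilon=c^\epsilon_{ji}\delta_i f^\epsilon+c^\epsilon_{ij}\delta_j f^\epsilon$ ($i\ne j$), with $\delta_i c^\epsilon_{jk}=(\tau_k c^\epsilon_{ij})c^\epsilon_{jk}+(\tau_k c^\epsilon_{ji})c^\epsilon_{ik}-(\tau_i c^\epsilon_{jk})c^\epsilon_{ik}$ ($i,j,k$ distinct). The canonical discrete Q-nets for (Q) are the solutions with $f^\epsilon=f$ on $\mathcal{B}^\epsilon_i$ and $c^\epsilon_{ij}(u)=c_{ij}(u)$ (or $c_{ij}(u+\frac\epsilon2e_i+\frac\epsilon2e_j)$) for $u\in\mathcal{B}_{ij}^\epsilon$. Smooth Jonas transform of $f$: a conjugate net $f^+$ with $\partial_i f^+=a_i\partial_i f+b_i(f^+-f)$, where the real functions $a_i,b_i$ ($1\le i\le m$) and the coefficients $c^+_{ij}$ of $f^+$ satisfy, for $i\ne j$: $\partial_ia_j=(a_i-a_j)c_{ij}+b_i(a_j-1)$, $\partial_ib_j=c_{ij}^+b_j+c_{ji}^+b_i-b_jb_i$, $a_jc_{ij}^+=a_ic_{ij}+b_i(a_j-1)$. Initial data (J): a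 point $f^+(0)\in\mathbb{R}^N$ and smooth real functions $a_i|_{\mathcal{B}_i}$, $b_i|_{\mathcal{B}_i}$, $1\le i\le m$. Discrete Jonas transform of $f^\epsilon$: a Q-net $(f^\epsilon)^+$ with $\delta_i (f^\epsilon)^+=a_i^\epsilon\delta_i f^\epsilon+b_i^\epsilon((f^\epsilon)^+-f^\epsilon)$, where (dropping the superscript $\epsilon$), for $i\neq j$: $\delta_ia_j=(\tau_jb_i)(a_j-1)+(\tau_ja_i-\tau_ia_j)c_{ij}$, $\delta_ib_j=c_{ij}^+b_j+c_{ji}^+b_i-(\tau_ib_j)b_i$, $a_jc_{ij}^+=(\tau_ja_i)c_{ij}+(\tau_jb_i)(a_j-1)$. The canonical one for (J) has $(f^\epsilon)^+(0)=f^+(0)$ and $a_i^\epsilon(u)=a_i(u)$, $b_i^\epsilon(u)=b_i(u)$ for $u\in\mathcal{B}_i^\epsilon$ (alternatively, values at the edge midpoints $u+\frac{\epsilon}{2}e_i$). Convergence $g^\epsilon\to g$ with the order $O(\epsilon)$ in $C^\infty(\mathcal{B}(r))$ means: for every multi-index $\alpha$ there is $c_\alpha$ such that $|\delta^\alpha(g^\epsilon-g)(u)|\le c_\alpha\epsilon$ for all sufficiently small $\epsilon$ and all $u\in\mathcal{B}^\epsilon(r)$ at which this difference quotient is defined on $\mathcal{B}^\epsilon(r)$. *)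

(* Defs.v *)
From HB Require Import structures.
From mathcomp Require Import all_boot all_order all_algebra.
From mathcomp Require Import all_classical all_reals all_analysis.

Set Implicit Arguments.
Unset Strict Implicit.
Unset Printing Implicit Defensive.

Import Order.TTheory GRing.Theory Num.Theory.
Import numFieldNormedType.Exports.

Local Open Scope classical_set_scope.
Local Open Scope ring_scope.

(* Points of R^m are row vectors and the norm of 'rV[R]_N is the sup norm.
   A function with a restricted domain (an axis, a coordinate plane, the cube
   [box r], a lattice) is a total function on 'rV[R]_m of which only the values
   on that domain matter. In [c i j] the first argument is the first index of
   the coefficient c_{ij}; the diagonal [c i i] is never used. *)

Section SmoothFunctions.
Context {R : realType} {m : nat}.
Implicit Types (S : {pred 'I_m}) (U A : set 'rV[R]_m) (i j : 'I_m).

Definition unitv i : 'rV[R]_m := delta_mx 0 i.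

Definition coord_subspace S : set 'rV[R]_m :=
  [set u | forall k, k \notin S -> u 0 k = 0].

Definition axis i := coord_subspace (pred1 i).
Definition plane i j := coord_subspace (pred2 i j).

Definition box (r : R) : set 'rV[R]_m := [set u | forall k, 0 <= u 0 k <= r].

Definition partial {V : normedModType R} i (g : 'rV[R]_m -> V) : 'rV[R]_m -> V :=
  fun u => 'D_(unitv i) g u.

Definition partials {V : normedModType R} (s : seq 'I_m) (g : 'rV[R]_m -> V) :=
  foldr partial g s.

(* Intended for U relatively open in [coord_subspace S]: there the partial
   derivatives in the directions of S depend only on the values of g on U. *)
Definition smooth_along {V : normedModType R} S U (g : 'rV[R]_m -> V) : Prop :=
  forall s : seq 'I_m, {subset s <= S} ->
    {within U, continuous (partials s g)} /\
    forall u i, U u -> i \in S -> derivable (partials s g) u (unitv i).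

(* On the closed cube, smooth means smooth in an open neighbourhood, so that the
   two-sided partial derivatives make sense up to the boundary. *)
Definition smooth_near {V : normedModType R} A (g : 'rV[R]_m -> V) : Prop :=
  exists2 U : set 'rV[R]_m, open U /\ A `<=` U & smooth_along predT U g.

End SmoothFunctions.

Section SmoothNets.
Context {R : realType} {m N : nat}.
Implicit Types (r : R) (f fp fQ : 'rV[R]_m -> 'rV[R]_N) (p : 'rV[R]_N).
Implicit Types (c cp cQ : 'I_m -> 'I_m -> 'rV[R]_m -> R).
Implicit Types (a b aJ bJ : 'I_m -> 'rV[R]_m -> R).

(* Only the restriction of fQ to the union of the axes matters; being one
   function, it gives all the curves the same value at 0. *)
Definition smooth_data_Q fQ cQ : Prop :=
  (forall i, smooth_along (pred1 i) (axis i) fQ) /\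
  (forall i j, i != j -> smooth_along (pred2 i j) (plane i j) (cQ i j)).

Definition smooth_data_J aJ bJ : Prop :=
  forall i, smooth_along (pred1 i) (axis i) (aJ i) /\
            smooth_along (pred1 i) (axis i) (bJ i).

Definition conjugate_net r f c : Prop :=
  [/\ smooth_near (box r) f,
      forall i j, i != j -> smooth_near (box r) (c i j),
      forall u i j, box r u -> i != j ->
        partial i (partial j f) u =
          c j i u *: partial i f u + c i j u *: partial j f u
    & forall u i j k, box r u -> i != j -> j != k -> i != k ->
        partial i (c j k) u =
          c i j u * c j k u + c j i u * c i k u - c j k u * c i k u].

Definition conjugate_net_for r fQ cQ f c : Prop :=
  [/\ conjugate_net r f c,
      forall u i, box r u -> axis i u -> f u = fQ u
    & forall u i j, box r u -> i != j -> plane i j u -> c i j u = cQ i j u].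

Definition jonas r f c fp a b cp : Prop :=
  [/\ conjugate_net r fp cp,
      forall i, smooth_near (box r) (a i) /\ smooth_near (box r) (b i),
      forall u i, box r u ->
        partial i fp u = a i u *: partial i f u + b i u *: (fp u - f u)
    & forall u i j, box r u -> i != j ->
        [/\ partial i (a j) u =
              (a i u - a j u) * c i j u + b i u * (a j u - 1),
            partial i (b j) u =
              cp i j u * b j u + cp j i u * b i u - b j u * b i u
          & a j u * cp i j u = a i u * c i j u + b i u * (a j u - 1)]].

Definition jonas_transform_for r f c p aJ bJ fp : Prop :=
  exists a b cp,
    [/\ jonas r f c fp a b cp,
        fp 0 = p
      & forall u i, box r u -> axis i u -> a i u = aJ i u /\ b i u = bJ i u].

End SmoothNets.

Section DiscreteNets.
Context {R : realType} {m N : nat}.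
Implicit Types (eps r : R) (f fp fQ : 'rV[R]_m -> 'rV[R]_N) (p : 'rV[R]_N).
Implicit Types (c cp cQ : 'I_m -> 'I_m -> 'rV[R]_m -> R).
Implicit Types (a b aJ bJ : 'I_m -> 'rV[R]_m -> R).

Definition lattice_box eps r : set 'rV[R]_m :=
  [set u | box r u /\ forall k, exists z : int, u 0 k = eps * z%:~R].

Definition tau {T : Type} eps (i : 'I_m) (g : 'rV[R]_m -> T) : 'rV[R]_m -> T :=
  fun u => g (u + eps *: unitv i).

Definition delta {V : lmodType R} eps (i : 'I_m) (g : 'rV[R]_m -> V)
    : 'rV[R]_m -> V :=
  fun u => eps^-1 *: (tau eps i g u - g u).

(* [enum 'I_m] is increasing: delta_1^alpha_1 is applied last. *)
Definition multi_delta {V : lmodType R} eps (alpha : 'I_m -> nat)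
    (g : 'rV[R]_m -> V) : 'rV[R]_m -> V :=
  foldr (fun i h => iter (alpha i) (delta eps i) h) g (enum 'I_m).

(* The elementary cell with lowest corner u and edge directions s; a cell lies
   in [0, r]^m if and only if its lowest and its highest corner do. *)
Definition cell eps r (s : seq 'I_m) (u : 'rV[R]_m) : Prop :=
  lattice_box eps r u /\
  lattice_box eps r (u + eps *: \sum_(i <- s) unitv i).

(* Every equation is required at those u for which the whole cell it lives on
   (edge, square or 3-cube) belongs to the lattice cube; thus a i, b i belong to
   the edges and c i j, cp i j to the squares. *)
Definition qnet eps r f c : Prop :=
  (forall u i j, i != j -> cell eps r [:: i; j] u ->
     delta eps i (delta eps j f) u =
       c j i u *: delta eps i f u + c i j u *: delta eps j f u) /\
  (forall u i j k, i != j -> j != k -> i != k -> cell eps r [:: i; j; k] u ->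
     delta eps i (c j k : _ -> R^o) u =
       tau eps k (c i j) u * c j k u + tau eps k (c j i) u * c i k u
       - tau eps i (c j k) u * c i k u).

(* [mid] selects one of the two admissible discretizations of the data: values
   at the lattice points, or at the midpoints of the squares (resp. edges). *)
Definition canonical_qnet (mid : bool) eps r fQ cQ f c : Prop :=
  [/\ qnet eps r f c,
      forall u i, lattice_box eps r u -> axis i u -> f u = fQ u
    & forall u i j, i != j -> lattice_box eps r u -> plane i j u ->
        c i j u =
          cQ i j (if mid then u + (eps / 2) *: unitv i + (eps / 2) *: unitv j
                  else u)].

Definition discrete_jonas eps r f c fp a b cp : Prop :=
  [/\ qnet eps r fp cp,
      forall u i, cell eps r [:: i] u ->
        delta eps i fp u = a i u *: delta eps i f u + b i u *: (fp u - f u)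
    & forall u i j, i != j -> cell eps r [:: i; j] u ->
        [/\ delta eps i (a j : _ -> R^o) u =
              tau eps j (b i) u * (a j u - 1)
              + (tau eps j (a i) u - tau eps i (a j) u) * c i j u,
            delta eps i (b j : _ -> R^o) u =
              cp i j u * b j u + cp j i u * b i u - tau eps i (b j) u * b i u
          & a j u * cp i j u =
              tau eps j (a i) u * c i j u + tau eps j (b i) u * (a j u - 1)]].

Definition canonical_jonas (mid : bool) eps r f c p aJ bJ fp : Prop :=
  exists a b cp,
    [/\ discrete_jonas eps r f c fp a b cp,
        fp 0 = p
      & forall u i, lattice_box eps r u -> axis i u ->
          let v := if mid then u + (eps / 2) *: unitv i else u in
          a i u = aJ i v /\ b i u = bJ i v].

(* The difference quotient delta^alpha at u uses the points u + eps beta with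
   beta <= alpha; they all lie in the cube if and only if those with beta = 0
   and beta = alpha do. *)
Definition converges_smoothly r (g : R -> 'rV[R]_m -> 'rV[R]_N)
    (g0 : 'rV[R]_m -> 'rV[R]_N) : Prop :=
  forall alpha : 'I_m -> nat, exists C : R,
    \forall eps \near 0^'+, forall u,
      lattice_box eps r u ->
      lattice_box eps r (u + eps *: \sum_i (alpha i)%:R *: unitv i) ->
      `|multi_delta eps alpha (fun v => g eps v - g0 v) u| <= C * eps.

End DiscreteNets.

(* Main.v *)
(* Both the smooth and the discrete equations linearize partially in rotation
   coefficients gamma_jk: writing delta_j f = H_j X_j and c_ij = delta_i H_j / H_j,
   they become the Darboux system delta_i gamma_jk = gamma_ji gamma_ik (with
   shifts in the discrete case). The tangent directions X_j, the Lame
   coefficients H_j and f itself are further entries of gamma, and the Jonas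
   transformation is one more lattice direction, of fixed step 1, so that the
   consistency of the discrete system around a 4-cube yields the transform.
   The smooth solution is a Picard limit, of which only the equations used to
   transport the data from the coordinate subspaces are needed: a contraction
   estimate for weighted norms of difference quotients shows that the explicitly
   known discrete solution is O(eps)-close to it, and all remaining smooth
   equations follow by passing to the limit. Uniqueness is a linear estimate on
   elementary cells in the discrete case, and a maximum principle with
   exponential weight in the smooth case. *)
Require Import Defs.
From HB Require Import structures.
From mathcomp Require Import all_boot all_order all_algebra.
From mathcomp Require Import all_classical all_reals all_analysis.
From mathcomp Require Import ring lra zify.
Set Implicit Arguments.
Unset Strict Implicit.
Unset Printing Implicit Defensive.
Import Order.TTheory GRing.Theory Num.Theory.
Import numFieldNormedType.Exports.
Local Open Scope classical_set_scope.
Local Open Scope ring_scope.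

(** * Weighted norms of iterated differences *)

(** The obstacle is that one radius r has to serve difference quotients of all orders, whereas a
    contraction in plain norms of order n would shrink r as n grows. The weight mu removes this:
    transporting a function into a new direction costs (rho + n mu) times the bound of its
    derivative, so rho is fixed once from sup bounds, and mu is chosen afterwards, depending on n.
    Returning to weight 1 divides by mu^n, which only enlarges the constant c_alpha. The norms are
    built over an abstract calculus, so that the same path estimate serves partial derivatives on a
    cube (Picard iteration) and difference quotients on a lattice. The convergence has to be proved
    for arbitrary canonical nets, of which only equations and data are given. The discrete equations
    are implicit, since shifted unknowns stand on both sides; hence uniqueness requires eps to be
    small against bounds of the explicit nets, and these bounds must be uniform in eps. *)

Section DifferenceNorms.
Context {R : realType} {m : nat}.
Local Notation fct := ('rV[R]_m -> R).
Implicit Types (P S : pred 'I_m) (v : 'I_m -> nat) (f g : fct) (u : 'rV[R]_m).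

Definition vadd v (i : 'I_m) : 'I_m -> nat := fun k => (v k + (k == i))%N.

Lemma vaddC v i j : vadd (vadd v i) j = vadd (vadd v j) i.
Proof. by apply/funext => k; rewrite /vadd addnAC. Qed.

Lemma vadd_le v w i : (forall k, v k <= w k)%N -> forall k, (vadd v i k <= vadd w i k)%N.
Proof. by move=> h k; rewrite leq_add2r. Qed.

Lemma le_vadd v i k : (v k <= vadd v i k)%N.
Proof. exact: leq_addr. Qed.

Definition padd P (i : 'I_m) : pred 'I_m := fun k => P k || (k == i).

Context (Dom : ('I_m -> nat) -> set 'rV[R]_m).
Context (D t : 'I_m -> fct -> fct) (ok : fct -> Prop) (rho mu : R).

(* [Bd n v P g M]: on the coordinate subspace B_P the sum of the sup norms of the
   iterated D_i g (i in P) of order at most n, weighted by powers of mu, is at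
   most M. The vector v counts the steps that can still be made from a point
   without leaving the domain. *)
Fixpoint Bd n v P g (M : R) : Prop :=
  match n with
  | 0 => 0 <= M /\ forall u, Dom v u -> coord_subspace P u -> `|g u| <= M
  | n'.+1 => exists M0 (Mi : 'I_m -> R),
      [/\ Bd n' v P g M0,
          forall i, P i -> Bd n' (vadd v i) P (D i g) (Mi i),
          forall i, 0 <= Mi i
        & M0 + mu * \sum_i Mi i <= M]
  end.

(** Common axioms of partial derivatives on a cube of half side [rho] (where [t i] is the identity
    and [ok] means smooth) and of difference quotients on a lattice cube of side [rho] (where [t i]
    is the shift and every function is [ok]). [dc_step] replaces the fundamental theorem of
    calculus: leaving B_P in a new direction i costs at most [rho] times a bound of [D i f]. *)
Record difference_calculus : Prop := DifferenceCalculus {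
  dc_rho : 0 <= rho;
  dc_mu : 0 <= mu;
  dc_dom : forall v w, (forall k, v k <= w k)%N -> Dom w `<=` Dom v;
  dc_okD : forall f i, ok f -> ok (D i f);
  dc_okt : forall f i, ok f -> ok (t i f);
  dc_okA : forall f g, ok f -> ok g -> ok (fun u => f u + g u);
  dc_okM : forall f g, ok f -> ok g -> ok (fun u => f u * g u);
  dc_okc : forall c : R, ok (fun=> c);
  dc_DA : forall f g i, ok f -> ok g ->
    D i (fun u => f u + g u) = fun u => D i f u + D i g u;
  dc_DM : forall f g i, ok f -> ok g ->
    D i (fun u => f u * g u) = fun u => D i f u * t i g u + f u * D i g u;
  dc_Dc : forall (c : R) i, D i (fun=> c) = fun=> 0;
  dc_DD : forall f i j, ok f -> D i (D j f) = D j (D i f);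
  dc_Dt : forall f i j, D i (t j f) = t j (D i f);
  dc_shift : forall f v P i M, P i ->
    (forall u, Dom v u -> coord_subspace P u -> `|f u| <= M) ->
    (forall u, Dom (vadd v i) u -> coord_subspace P u -> `|t i f u| <= M);
  dc_step : forall f v P i M M', ok f -> ~~ P i ->
    (forall u, Dom v u -> coord_subspace P u -> `|f u| <= M) ->
    0 <= M' ->
    (forall u, Dom (vadd v i) u -> coord_subspace (padd P i) u -> `|D i f u| <= M') ->
    forall u, Dom v u -> coord_subspace (padd P i) u -> `|f u| <= M + rho * M'
}.

Lemma Bd_nneg n v P g M : 0 <= mu -> Bd n v P g M -> 0 <= M.
Proof.
move=> mu0; elim: n v g M => [|n IH] v g M /=; first by case.
move=> [M0 [Mi [/IH h0 _ hi]]]; apply: le_trans.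
by rewrite addr_ge0 // mulr_ge0 // sumr_ge0.
Qed.

Hypothesis dc : difference_calculus.

Lemma coord_sub P S u : (forall k, P k -> S k) -> coord_subspace P u -> coord_subspace S u.
Proof. by move=> PS Pu k; rewrite -topredE /= => Sk; apply: Pu; rewrite -topredE /=; apply: contra Sk; exact: PS. Qed.

Lemma Bd_ge0 n v P g M : Bd n v P g M -> 0 <= M.
Proof. exact: Bd_nneg (dc_mu dc). Qed.

Lemma Bd_le n v P g M M' : M <= M' -> Bd n v P g M -> Bd n v P g M'.
Proof.
elim: n v g M M' => [|n IH] v g M M' MM' /=.
  by move=> [M0 h]; split=> [|u du pu]; [exact: le_trans MM'|exact: le_trans (h u du pu) MM'].
move=> [M0 [Mi [h0 h1 h2 h3]]]; exists M0, Mi; split => //.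
exact: le_trans MM'.
Qed.

Lemma Bd_sub n v w P S g M : (forall k, v k <= w k)%N -> (forall k, P k -> S k) ->
  Bd n v S g M -> Bd n w P g M.
Proof.
move=> vw PS; elim: n v w vw g M => [|n IH] v w vw g M /=.
  by move=> [M0 h]; split=> // u du pu; apply: h; [exact: dc_dom du|exact: coord_sub pu].
move=> [M0 [Mi [h0 h1 h2 h3]]]; exists M0, Mi; split => //; first exact: IH h0.
by move=> i Pi; apply: (IH (vadd v i)); [exact: vadd_le|exact/h1/PS].
Qed.

Lemma Bd_subv n v w P g M : (forall k, v k <= w k)%N -> Bd n v P g M -> Bd n w P g M.
Proof. by move=> vw; exact: Bd_sub. Qed.

Lemma Bd_vadd n v i P g M : Bd n v P g M -> Bd n (vadd v i) P g M.
Proof. by apply: Bd_subv => k; exact: le_vadd. Qed.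

Lemma Bd_subP n v P S g M : (forall k, P k -> S k) -> Bd n v S g M -> Bd n v P g M.
Proof. by move=> ?; exact: Bd_sub. Qed.

Lemma Bd_pred n v P g M : Bd n.+1 v P g M -> Bd n v P g M.
Proof.
move=> [M0 [Mi [h0 h1 h2 h3]]]; apply: Bd_le h0; apply: le_trans h3.
by rewrite lerDl mulr_ge0 ?(dc_mu dc) // sumr_ge0.
Qed.

Lemma Bd_leqn n n' v P g M : (n' <= n)%N -> Bd n v P g M -> Bd n' v P g M.
Proof.
move=> /subnK <-; elim: (n - n')%N => // k IH h; apply: IH; exact: Bd_pred.
Qed.

Lemma Bd_shift n v P i g M : P i -> Bd n v P g M -> Bd n (vadd v i) P (t i g) M.
Proof.
move=> Pi; elim: n v g M => [|n IH] v g M /=.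
  by move=> [M0 h]; split=> //; exact: (dc_shift dc).
move=> [M0 [Mi [h0 h1 h2 h3]]]; exists M0, Mi; split => //; first exact: IH.
by move=> j Pj; rewrite (dc_Dt dc) vaddC; apply/IH/h1.
Qed.

Lemma Bd_const n v P (c : R) : Bd n v P (fun=> c) `|c|.
Proof.
elim: n v c => [|n IH] v c /=; first by [].
exists `|c|, (fun=> 0); split => //; last by rewrite big1 ?mulr0 ?addr0.
by move=> i Pi; rewrite (dc_Dc dc); have := IH (vadd v i) 0; rewrite normr0.
Qed.

Lemma Bd_add n v P f g M M' : ok f -> ok g -> Bd n v P f M -> Bd n v P g M' ->
  Bd n v P (fun u => f u + g u) (M + M').
Proof.
elim: n v f g M M' => [|n IH] v f g M M' okf okg /=.
  move=> [M0 hf] [M0' hg]; split=> [|u du pu]; first exact: addr_ge0.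
  by apply: le_trans (ler_normD _ _) _; apply: lerD; [exact: hf|exact: hg].
move=> [A [Ai [h0 h1 h2 h3]]] [B [Bi [k0 k1 k2 k3]]].
exists (A + B), (fun i => Ai i + Bi i); split; first exact: IH.
- by move=> i Pi; rewrite (dc_DA dc) //; apply: IH; auto; exact: (dc_okD dc).
- by move=> i; rewrite addr_ge0.
- by rewrite big_split /=; lra.
Qed.

(** The two halves of the Leibniz rule, mu times the sum of the [Ai] times B and A times mu times
    the sum of the [Bi], are among the terms in the expansion of the product of the two weighted
    norms. *)
Lemma Bd_mul n v P f g M M' : ok f -> ok g -> Bd n v P f M -> Bd n v P g M' ->
  Bd n v P (fun u => f u * g u) (M * M').
Proof.
elim: n v f g M M' => [|n IH] v f g M M' okf okg /=.
  move=> [M0 hf] [M0' hg]; split=> [|u du pu]; first exact: mulr_ge0.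
  by rewrite normrM; apply: ler_pM => //; [exact: hf|exact: hg].
move=> [A [Ai [h0 h1 h2 h3]]] [B [Bi [k0 k1 k2 k3]]].
have A0 := Bd_ge0 h0; have B0 := Bd_ge0 k0.
exists (A * B), (fun i => Ai i * B + A * Bi i); split; first exact: IH.
- move=> i Pi; rewrite (dc_DM dc) //; apply: Bd_add.
  + by apply: (dc_okM dc); [exact: (dc_okD dc)|exact: (dc_okt dc)].
  + by apply: (dc_okM dc); last exact: (dc_okD dc).
  + by apply: IH; [exact: (dc_okD dc)|exact: (dc_okt dc)|exact: h1|exact: Bd_shift].
  + by apply: IH; [exact: okf|exact: (dc_okD dc)|exact: Bd_vadd|exact: k1].
- by move=> i; rewrite addr_ge0 ?mulr_ge0.
- rewrite big_split /= -mulr_suml -mulr_sumr.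
  have SA : 0 <= mu * \sum_i Ai i by rewrite mulr_ge0 ?(dc_mu dc) // sumr_ge0.
  have SB : 0 <= mu * \sum_i Bi i by rewrite mulr_ge0 ?(dc_mu dc) // sumr_ge0.
  rewrite mulrDr mulrA mulrCA.
  apply: le_trans (ler_pM _ _ h3 k3); rewrite ?addr_ge0 //.
  rewrite mulrDl !mulrDr; nra.
Qed.

(* The top order enters a product only linearly; this is what turns an a priori
   bound of order n into one of order n + 1. *)
Lemma Bd_mulS n v P f g A Z : ok f -> ok g -> Bd n v P f A -> Bd n v P g A ->
  Bd n.+1 v P f Z -> Bd n.+1 v P g Z ->
  Bd n.+1 v P (fun u => f u * g u) (2 * A * Z).
Proof.
move=> okf okg fA gA /= [M0 [Mi [h0 h1 h2 h3]]] [N0 [Ni [k0 k1 k2 k3]]].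
have A0 := Bd_ge0 fA.
exists (A * N0), (fun i => Mi i * A + A * Ni i); split.
- exact: Bd_mul.
- move=> i Pi; rewrite (dc_DM dc) //; apply: Bd_add.
  + by apply: (dc_okM dc); [exact: (dc_okD dc)|exact: (dc_okt dc)].
  + by apply: (dc_okM dc); last exact: (dc_okD dc).
  + by apply: Bd_mul; [exact: (dc_okD dc)|exact: (dc_okt dc)|exact: h1|exact: Bd_shift].
  + by apply: Bd_mul; [exact: okf|exact: (dc_okD dc)|exact: Bd_vadd|exact: k1].
- by move=> i; rewrite addr_ge0 ?mulr_ge0.
- rewrite big_split /= -mulr_suml -mulr_sumr.
  have M00 := Bd_ge0 h0.
  have h4 : A * (M0 + mu * \sum_i Mi i) <= A * Z by rewrite ler_wpM2l.
  have h5 : A * (N0 + mu * \sum_i Ni i) <= A * Z by rewrite ler_wpM2l.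
  have h6 : 0 <= A * M0 by rewrite mulr_ge0.
  by rewrite !mulrDr in h4 h5 *; rewrite [mu * (_ * A)]mulrA [mu * (A * _)]mulrCA; lra.
Qed.

Lemma Bd_scale n v P (c : R) g M : ok g -> Bd n v P g M ->
  Bd n v P (fun u => c * g u) (`|c| * M).
Proof. by move=> okg; apply: Bd_mul => //; [exact: (dc_okc dc)|exact: Bd_const]. Qed.

Lemma dc_okZ (c : R) f : ok f -> ok (fun u => c * f u).
Proof. by move=> okf; apply: (dc_okM dc) => //; exact: (dc_okc dc). Qed.

Lemma dc_okB f g : ok f -> ok g -> ok (fun u => f u - g u).
Proof.
move=> okf okg.
have -> : (fun u => f u - g u) = (fun u => f u + -1 * g u) by apply/funext => u; rewrite mulN1r.
by apply: (dc_okA dc) => //; exact: dc_okZ.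
Qed.

Lemma Bd_sub2 n v P f g M M' : ok f -> ok g -> Bd n v P f M -> Bd n v P g M' ->
  Bd n v P (fun u => f u - g u) (M + M').
Proof.
move=> okf okg hf hg.
have -> : (fun u => f u - g u) = (fun u => f u + -1 * g u) by apply/funext => u; rewrite mulN1r.
apply: Bd_add => //; first exact: dc_okZ.
by have := Bd_scale (-1) okg hg; rewrite normrN normr1 mul1r.
Qed.

(** Derivatives that contain the new direction i are derivatives of [D i g], and they enter with an
    extra factor mu once per order, which adds up to n mu. All other derivatives are propagated from
    B_P by [dc_step] at the cost [rho]. *)
Lemma Bd_step n v P i g M M' : ok g -> ~~ P i -> Bd n v P g M ->
  Bd n (vadd v i) (padd P i) (D i g) M' ->
  Bd n v (padd P i) g (M + (rho + n%:R * mu) * M').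
Proof.
move=> + Pi; elim: n v g M M' => [|n IH] v g M M' okg /=.
  move=> [M0 hf] [M0' hg]; rewrite mul0r addr0; split.
    by rewrite addr_ge0 ?mulr_ge0 ?(dc_rho dc).
  exact: (dc_step dc).
move=> [A [Ai [h0 h1 h2 h3]]] [B [Bi [k0 k1 k2 k3]]].
have B0 := Bd_ge0 k0.
set th := rho + n%:R * mu.
have th0 : 0 <= th by rewrite addr_ge0 ?mulr_ge0 ?(dc_rho dc) ?(dc_mu dc).
(* The extra [B] in direction i bounds [D i g] itself, about which the norm on B_P says nothing. *)
exists (A + th * B), (fun j => Ai j + th * Bi j + (if j == i then B else 0)); split.
- exact: IH.
- move=> j /orP[Pj|/eqP ->].
    apply: (@Bd_le _ _ _ _ (Ai j + th * Bi j)); first by rewrite lerDl; case: ifP.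
    apply: IH; [exact: (dc_okD dc)|exact: h1|].
    by rewrite vaddC (dc_DD dc) //; apply: k1; rewrite /padd Pj.
  by apply: Bd_le k0; rewrite eqxx lerDr addr_ge0 // mulr_ge0.
- by move=> j; rewrite addr_ge0 ?addr_ge0 ?mulr_ge0 //; case: ifP.
- rewrite !big_split /= -mulr_sumr -big_mkcond /= big_pred1_eq.
  have SB : 0 <= mu * \sum_i Bi i by rewrite mulr_ge0 ?(dc_mu dc) // sumr_ge0.
  have mu0 := dc_mu dc.
  have h4 : (th + mu) * (B + mu * \sum_i Bi i) <= (th + mu) * M'.
    by apply: ler_wpM2l k3; exact: addr_ge0.
  have -> : rho + n.+1%:R * mu = th + mu by rewrite -natr1 /th mulrDl mul1r addrA.
  have h5 : 0 <= mu * (mu * \sum_i Bi i) by rewrite mulr_ge0.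
  nra.
Qed.

Definition ppath S (k : nat) : pred 'I_m := fun l => S l || (l < k)%N.

Lemma Bd_eqP n v P S g M : P =1 S -> Bd n v P g M -> Bd n v S g M.
Proof. by move=> PS; apply: Bd_subP => k; rewrite PS. Qed.

(** The directions outside S are added in increasing order, each by [Bd_step]. The derivative in
    direction i has to be known only on the subspace reached when i is added. *)
Lemma Bd_path n v S g M M' : ok g -> 0 <= M' -> Bd n v S g M ->
  (forall i : 'I_m, ~~ S i -> Bd n (vadd v i) (ppath S i.+1) (D i g) M') ->
  Bd n v predT g (M + m%:R * ((rho + n%:R * mu) * M')).
Proof.
move=> okg M'0 h0 h1; set c := _ * M'.
have c0 : 0 <= c by rewrite mulr_ge0 ?addr_ge0 ?mulr_ge0 ?(dc_rho dc) ?(dc_mu dc).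
suff H k : (k <= m)%N -> Bd n v (ppath S k) g (M + k%:R * c).
  apply: Bd_subP (H m _) => // k _; by rewrite /ppath ltn_ord orbT.
elim: k => [_|k IH km].
  rewrite mul0r addr0; apply: Bd_eqP h0 => k; by rewrite /ppath ltn0 orbF.
have := IH (ltnW km); set i := Ordinal km.
rewrite -[k.+1%:R]natr1 mulrDl mul1r addrA.
have [Si|nSi] := boolP (S i) => hk.
  apply: (@Bd_le _ _ _ _ (M + k%:R * c)); first by rewrite lerDl.
  apply: Bd_eqP hk => l; rewrite /ppath ltnS [(l <= k)%N]leq_eqVlt.
  have [lk|] := eqVneq (l : nat) k => //=; rewrite (_ : l = i) ?Si //; exact: val_inj.
have nPi : ~~ ppath S k i by rewrite /ppath negb_or nSi /= ltnn.
have e : padd (ppath S k) i =1 ppath S k.+1.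
  by move=> l; rewrite /padd /ppath ltnS [(l <= k)%N]leq_eqVlt -orbA [(l < k)%N || _]orbC.
apply: (Bd_eqP e); apply: Bd_step => //.
by apply: Bd_eqP (h1 i nSi) => l; rewrite e.
Qed.

(** The map M -> M/2 + B has the fixed point 2B, so finitely many iterations bring any starting
    bound below 3B. Of [M0] only the existence matters. *)
Lemma halving_iterate (Q : R -> Prop) (M0 B : R) : 0 < B ->
  (forall M M', M <= M' -> Q M -> Q M') ->
  (forall M, 0 <= M -> Q M -> Q (M / 2 + B)) -> 0 <= M0 -> Q M0 -> Q (3 * B).
Proof.
move=> B0 Qle Qh M00 Q0.
have H k : Q (M0 / 2 ^+ k + 2 * B).
  elim: k => [|k IH]; first by apply: Qle Q0; rewrite expr0 divr1; lra.
  apply: Qle (Qh _ _ IH); first by rewrite exprS invfM; lra.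
  by rewrite addr_ge0 ?divr_ge0 ?exprn_ge0 //; lra.
have [k hk] : exists k, M0 / 2 ^+ k <= B.
  exists (Num.trunc (M0 / B)).+1; rewrite ler_pdivrMr ?exprn_gt0 // mulrC -ler_pdivrMr //.
  have h : M0 / B < (Num.trunc (M0 / B)).+1%:R by apply: truncnS_gt.
  apply: le_trans (ltW h) _; rewrite -natrX ler_nat; exact: ltnW (ltn_expl _ _).
by apply: Qle (H k); lra.
Qed.

(** A bootstrap: the derivatives along the path are bounded linearly by the family itself, with
    factor [A], and the path is so short that [Bd_path] halves the old bound. As [M0] disappears
    from the result, it may depend on the mesh size. *)
Lemma Bd_contraction (K : finType) n v (S : K -> pred 'I_m) (e : K -> fct) (A B0 B M0 : R) :
  (forall k, ok (e k)) -> 0 <= A -> 0 < B0 -> 0 <= B -> m%:R * ((rho + n%:R * mu) * A) <= 2^-1 ->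
  (forall k, Bd n v (S k) (e k) B0) ->
  (forall M, 0 <= M -> (forall k, Bd n v predT (e k) M) ->
    forall k i, ~~ S k i -> Bd n (vadd v i) (ppath (S k) i.+1) (D i (e k)) (A * M + B)) ->
  0 <= M0 -> (forall k, Bd n v predT (e k) M0) ->
  forall k, Bd n v predT (e k) (3 * (B0 + m%:R * ((rho + n%:R * mu) * B))).
Proof.
move=> oke A0 B00 Bp small hB0 hD M00 hM0.
set th := rho + n%:R * mu in small *.
have th0 : 0 <= th by rewrite addr_ge0 ?mulr_ge0 ?(dc_rho dc) ?(dc_mu dc).
apply: (@halving_iterate (fun M => forall k, Bd n v predT (e k) M)) hM0 => //.
- by rewrite ltr_wpDr // !mulr_ge0.
- by move=> M M' MM' h k; exact: Bd_le (h k).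
- move=> M Mp h k.
  have := Bd_path (oke k) (addr_ge0 (mulr_ge0 A0 Mp) Bp) (hB0 k) (hD M Mp h k).
  apply: Bd_le; rewrite -/th mulrDr mulrDr !mulrA -mulrA.
  have : m%:R * (th * A) * M <= 2^-1 * M by exact: ler_wpM2r.
  by rewrite !mulrA; lra.
Qed.

End DifferenceNorms.

(** * Change of the weight *)

Section WeightChange.
Context {R : realType} {m : nat} (Dom : ('I_m -> nat) -> set 'rV[R]_m).
Context (D : 'I_m -> ('rV[R]_m -> R) -> 'rV[R]_m -> R).

Lemma Bd_weight_le mu n v P g M : 0 <= mu <= 1 ->
  Bd Dom D 1 n v P g M -> Bd Dom D mu n v P g M.
Proof.
move=> /andP[mu0 mu1]; elim: n v g M => // k IH w f A [B [Bi [h0 h1 h2 h3]]].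
exists B, Bi; split; [exact: IH| |by []|]; first by move=> i Pi; exact/IH/h1.
by apply: le_trans h3; rewrite lerD2l mul1r ler_piMl ?sumr_ge0.
Qed.

(** For fixed n and C a small weight brings the norm of order n arbitrarily close to the sup norm,
    so that conditions on the size of the domain can be stated with sup bounds. *)
Lemma Bd_small_weight mu n v P g M0 C : 0 <= mu <= 1 ->
  Bd Dom D mu 0 v P g M0 -> Bd Dom D 1 n v P g C -> Bd Dom D mu n v P g (M0 + mu * C).
Proof.
move=> mu01; have /andP[mu0 mu1] := mu01; elim: n v g C M0 => [|n IH] v g C M0.
  move=> [a h] [c _] /=; split; first by rewrite addr_ge0 ?mulr_ge0.
  by move=> u du pu; apply: le_trans (h u du pu) _; rewrite lerDl mulr_ge0.
move=> h0 [B [Bi [k0 k1 k2 k3]]]; exists (M0 + mu * B), Bi; split => //; first exact: IH.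
- by move=> i Pi; exact/Bd_weight_le/k1.
- by rewrite -addrA -mulrDr lerD2l ler_wpM2l // (le_trans _ k3) // mul1r.
Qed.

Lemma Bd_unit_weight mu n v P g M : 0 < mu <= 1 ->
  Bd Dom D mu n v P g M -> Bd Dom D 1 n v P g (M / mu ^+ n).
Proof.
move=> /andP[mu0 mu1]; elim: n v g M => [|n IH] v g M; first by rewrite expr0 divr1.
move=> [B [Bi [h0 h1 h2 h3]]].
have B0 : 0 <= B.
  exact: Bd_nneg (ltW mu0) h0.
exists (B / mu ^+ n), (fun i => Bi i / mu ^+ n); split; [exact: IH| | |].
- by move=> i Pi; exact/IH/h1.
- by move=> i; apply: divr_ge0 => //; apply: exprn_ge0; exact: ltW.
- have e : (0 : R) <= (mu ^+ n)^-1 by rewrite invr_ge0; apply: exprn_ge0; exact: ltW.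
  have -> : M / mu ^+ n.+1 = M / mu * (mu ^+ n)^-1 by rewrite exprS invfM mulrA.
  rewrite mul1r -mulr_suml -mulrDl ler_wpM2r // ler_pdivlMr //.
  apply: le_trans h3; rewrite mulrDl [_ * mu + _]addrC [X in X + _]mulrC addrC lerD2r.
  by rewrite ler_piMr.
Qed.

End WeightChange.

(** * Smooth functions of several real variables *)

Section Directional.
Context {R : realType} {m : nat}.
Local Notation pt := 'rV[R]_m.
Implicit Types (g : pt -> R) (u : pt) (i j : 'I_m) (U : set pt).

Lemma line_is_derive g u i s : derivable g (u + s *: unitv i) (unitv i) ->
  is_derive s 1 (fun x => g (u + x *: unitv i)) (partial i g (u + s *: unitv i)).
Proof.
have e : (fun h : R => h^-1 *: (((fun x => g (u + x *: unitv i)) \o shift s) (h *: 1) - g (u + s *: unitv i))) =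
         (fun h : R => h^-1 *: ((g \o shift (u + s *: unitv i)) (h *: unitv i) - g (u + s *: unitv i))).
  apply/funext => h /=; congr (_ *: (g _ - _)).
  by rewrite scaler1 scalerDl addrCA.
move=> dg; split; first by rewrite /derivable e.
by rewrite /partial /derive e.
Qed.

Lemma shift_quotient g u w i :
  (fun h : R => h^-1 *: (((fun x => g (x + w)) \o shift u) (h *: unitv i) - g (u + w))) =
  (fun h : R => h^-1 *: ((g \o shift (u + w)) (h *: unitv i) - g (u + w))).
Proof. by apply/funext => x /=; rewrite -addrA. Qed.

Lemma derivable_shift g u w i : derivable g (u + w) (unitv i) ->
  derivable (fun x => g (x + w)) u (unitv i).
Proof. by rewrite /derivable shift_quotient. Qed.

Lemma partial_shift g u w i : partial i (fun x => g (x + w)) u = partial i g (u + w).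
Proof. by rewrite /partial /derive shift_quotient. Qed.

Lemma mvt_dir g u i t :
  (forall s, (0 <= s <= t) || (t <= s <= 0) -> derivable g (u + s *: unitv i) (unitv i)) ->
  exists2 s, (0 <= s <= t) || (t <= s <= 0) &
    g (u + t *: unitv i) - g u = t * partial i g (u + s *: unitv i).
Proof.
move=> dg; set f := fun x => g (u + x *: unitv i); set df := fun x => partial i g (u + x *: unitv i).
have hd s : (0 <= s <= t) || (t <= s <= 0) -> is_derive s 1 f (df s).
  by move=> /dg; exact: line_is_derive.
have f0 : f 0 = g u by rewrite /f scale0r addr0.
have [t0|t0] := leP 0 t.
  have [s||s ss e] := @MVT_segment R f df 0 t t0.
  - by rewrite in_itv /= => /andP[a b]; apply: hd; rewrite (ltW a) (ltW b).
  - apply: derivable_within_continuous => s; rewrite in_itv /= => st.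
    by have := hd s; rewrite st => /(_ isT) [].
  - exists s; first by move: ss; rewrite in_itv /= => ->.
    by move: e; rewrite f0 subr0 mulrC.
have [s||s ss e] := @MVT_segment R f df t 0 (ltW t0).
- by rewrite in_itv /= => /andP[a b]; apply: hd; rewrite (ltW a) (ltW b) orbT.
- apply: derivable_within_continuous => s; rewrite in_itv /= => st.
  by have := hd s; rewrite st orbT => /(_ isT) [].
- exists s; first by move: ss; rewrite in_itv /= => ->; rewrite orbT.
  by move: e; rewrite f0 sub0r => /eqP; rewrite eq_sym mulrN eqr_oppLR opprB mulrC eq_sym => /eqP.
Qed.

Lemma btw_norm (s t : R) : (0 <= s <= t) || (t <= s <= 0) -> `|s| <= `|t|.
Proof.
case/orP=> /andP[a b]; first by rewrite !ger0_norm // (le_trans a).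
by rewrite !ler0_norm ?lerN2 // (le_trans a).
Qed.

Lemma mvt_bound g u i t M :
  (forall s, (0 <= s <= t) || (t <= s <= 0) ->
     derivable g (u + s *: unitv i) (unitv i) /\ `|partial i g (u + s *: unitv i)| <= M) ->
  `|g (u + t *: unitv i) - g u| <= M * `|t|.
Proof.
move=> h; have [s st ->] := @mvt_dir g u i t (fun s st => (h s st).1).
by rewrite normrM mulrC ler_wpM2r // (h s st).2.
Qed.

Lemma taylor_bound g u i t M :
  (forall s, (0 <= s <= t) || (t <= s <= 0) ->
     [/\ derivable g (u + s *: unitv i) (unitv i),
         derivable (partial i g) (u + s *: unitv i) (unitv i)
       & `|partial i (partial i g) (u + s *: unitv i)| <= M]) ->
  `|g (u + t *: unitv i) - g u - t * partial i g u| <= M * t ^+ 2.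
Proof.
move=> h; have [s st ->] : exists2 s, (0 <= s <= t) || (t <= s <= 0) &
    g (u + t *: unitv i) - g u = t * partial i g (u + s *: unitv i).
  by apply: mvt_dir => s /h [].
rewrite -mulrBr normrM -real_normK ?num_real // expr2 mulrCA ler_wpM2l //.
have := @mvt_bound (partial i g) u i s M; rewrite mulrC => H.
have M0 : 0 <= M by apply: le_trans (normr_ge0 _) _; have [_ _] := h _ st; exact.
apply: le_trans (H _) _.
  move=> x xs; have [|h1 h2 h3] := h x; last by [].
  case/orP: xs => /andP[a b]; case/orP: st => /andP[c d]; apply/orP; lra.
by rewrite mulrC ler_wpM2l // btw_norm.
Qed.

Lemma nbhs_eq_on U (T : Type) (f g : pt -> T) u : open U -> U u ->
  (forall w, U w -> f w = g w) -> \near u, f u = g u.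
Proof.
move=> oU Uu fg; have := open_nbhs_nbhs (conj oU Uu); apply: filterS => w; exact: fg.
Qed.

Lemma partial_eq_on {V : normedModType R} U (f g : pt -> V) i : open U ->
  (forall w, U w -> f w = g w) -> forall w, U w -> partial i f w = partial i g w.
Proof. by move=> oU fg w Uw; apply: near_eq_derive; exact: nbhs_eq_on fg. Qed.

Lemma derivable_eq_on {V : normedModType R} U (f g : pt -> V) i w : open U -> U w ->
  (forall w, U w -> f w = g w) -> derivable f w (unitv i) -> derivable g w (unitv i).
Proof. by move=> oU Uw fg; apply: near_eq_derivable; exact: nbhs_eq_on fg. Qed.

Lemma continuous_eq_on {V : topologicalType} U (f g : pt -> V) w : open U -> U w ->
  (forall w, U w -> f w = g w) -> {for w, continuous f} -> {for w, continuous g}.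
Proof.
move=> oU Uw fg cf; rewrite /prop_for /continuous_at -(fg w Uw).
apply: cvg_trans cf; by apply: (@near_eq_cvg _ _ (nbhs w)); exact: nbhs_eq_on fg.
Qed.

End Directional.

Section Boxes.
Context {R : realType} {m : nat}.
Local Notation pt := 'rV[R]_m.
Implicit Types (g : pt -> R) (u w : pt) (i j : 'I_m) (U : set pt).

Definition itvbox (lo hi : 'I_m -> R) : set pt := [set u | forall k, lo k <= u 0 k <= hi k].

Lemma itvbox_compact lo hi : compact (itvbox lo hi).
Proof.
rewrite (_ : itvbox lo hi =
    [set v : 'rV[R]_m | forall k, [set` `[lo k, hi k]] (v ord0 k)]).
  by apply: (@rV_compact R m (fun k => [set` `[lo k, hi k]])) => k; exact: segment_compact.
by apply/seteqP; split => u /= h k; have := h k; rewrite /= in_itv.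
Qed.

Lemma nbhs_boxP u (P : set pt) : nbhs u P <->
  exists2 d : R, 0 < d & forall w, (forall k, `|w 0 k - u 0 k| < d) -> P w.
Proof.
split.
- move=> /nbhs_ballP[d /= d0 h]; exists d => // w hw; apply: h; split=> // i j.
  by rewrite ord1 /ball /= distrC.
- move=> [d d0 h]; apply/nbhs_ballP; exists d => //= w hw; apply: h => k.
  by have [_ /(_ 0 k)] := hw; rewrite /ball /= distrC.
Qed.

Lemma addu_coord u i (t : R) k : (u + t *: unitv i) 0 k = u 0 k + (if k == i then t else 0).
Proof. by rewrite !mxE eqxx /=; case: (k == i); rewrite ?mulr1 ?mulr0. Qed.

Lemma bounded_on_box g lo hi : (forall u, itvbox lo hi u -> {for u, continuous g}) ->
  exists2 M, 0 <= M & forall u, itvbox lo hi u -> `|g u| <= M.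
Proof.
move=> cg; have [[u0 u0K]|nK] := pselect (exists u, itvbox lo hi u); last first.
  by exists 0 => // u uK; case: nK; exists u.
have cg' : {within itvbox lo hi, continuous (fun u => `|g u|)}.
  apply: continuous_in_subspaceT => u /[!inE] uK.
  by apply: (@continuous_comp _ _ _ g); [exact: cg|exact: norm_continuous].
have [c _ hc] := compact_EVT_max (ex_intro _ u0 u0K : itvbox lo hi !=set0) (@itvbox_compact lo hi) cg'.
by exists `|g c| => // u uK; apply: hc; rewrite inE.
Qed.

Lemma box_segment lo hi u i t s : itvbox lo hi u -> itvbox lo hi (u + t *: unitv i) ->
  (0 <= s <= t) || (t <= s <= 0) -> itvbox lo hi (u + s *: unitv i).
Proof.
move=> hu ht st k; have := hu k; have := ht k; rewrite !addu_coord; case: eqP => // _.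
by case/orP: st => /andP[a b] /andP[c d] /andP[e f]; apply/andP; split; lra.
Qed.

Lemma lip_box g lo hi (M d : R) u w :
  (forall z, itvbox lo hi z -> forall k, derivable g z (unitv k) /\ `|partial k g z| <= M) ->
  itvbox lo hi u -> itvbox lo hi w -> 0 <= M -> (forall k, `|w 0 k - u 0 k| <= d) ->
  `|g w - g u| <= m%:R * (M * d).
Proof.
move=> hg hu hw M0 hd.
(* [hyb n] has the first n coordinates of w and the others of u. Consecutive hybrids differ in one
   coordinate, and the box contains them all. *)
pose hyb n : pt := \row_k (if (k < n)%N then w 0 k else u 0 k).
have hybK n : itvbox lo hi (hyb n) by move=> k; rewrite mxE; case: ifP.
have e0 : hyb 0%N = u by apply/rowP => k; rewrite mxE.
have em : hyb m = w by apply/rowP => k; rewrite mxE ltn_ord.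
suff H n : (n <= m)%N -> `|g (hyb n) - g u| <= n%:R * (M * d) by rewrite -em; exact: H.
elim: n => [_|n IH nm]; first by rewrite e0 subrr normr0 mul0r.
have := IH (ltnW nm); set i := Ordinal nm => h.
have es : hyb n.+1 = hyb n + (w 0 i - u 0 i) *: unitv i.
  apply/rowP => k; rewrite addu_coord !mxE ltnS leq_eqVlt.
  have [ki|ki] := eqVneq k i; first by rewrite ki /= ltnn eqxx addrC subrK.
  rewrite addr0; case: eqP => // kn; case/eqP: ki; exact: val_inj.
rewrite -(subrKA (g (hyb n))) -natr1 mulrDl mul1r addrC.
apply: le_trans (ler_normD _ _) _; apply: lerD => //.
apply: le_trans (_ : M * `|w 0 i - u 0 i| <= _); last by rewrite ler_wpM2l.
rewrite es; apply: mvt_bound => s st; apply: hg.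
by apply: box_segment st => //; rewrite -es.
Qed.

Lemma continuous_of_bounded_partials g u :
  (exists2 d : R, 0 < d & exists M, forall w, (forall k, `|w 0 k - u 0 k| <= d) ->
     forall k, derivable g w (unitv k) /\ `|partial k g w| <= M) ->
  {for u, continuous g}.
Proof.
move=> [d d0 [M0 hM0]]; pose M := Num.max M0 1.
have M1 : 0 < M by rewrite lt_max ltr01 orbT.
have hM w : (forall k, `|w 0 k - u 0 k| <= d) ->
     forall k, derivable g w (unitv k) /\ `|partial k g w| <= M.
  move=> /hM0 h k; have [? h'] := h k; split=> //; apply: le_trans h' _.
  by rewrite le_max lexx.
apply/cvgrPdist_le => [|e e0]; first exact: (nbhs_filter u).
(* [m.+1] instead of m avoids a division by zero in dimension 0. *)
pose d' := Num.min d (e / (m.+1%:R * M)).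
have d'0 : 0 < d' by rewrite lt_min d0 divr_gt0 // mulr_gt0.
apply/nbhs_boxP; exists d' => // w hw; rewrite distrC.
have inb z : itvbox (fun k => u 0 k - d) (fun k => u 0 k + d) z <-> forall k, `|z 0 k - u 0 k| <= d.
  by split => h k; have := h k; rewrite ler_distl.
have hd k : `|w 0 k - u 0 k| <= d' by exact/ltW.
have hdd k : `|w 0 k - u 0 k| <= d by apply: le_trans (hd k) _; rewrite ge_min lexx.
have := @lip_box g (fun k => u 0 k - d) (fun k => u 0 k + d) M d' u w.
move=> /(_ (fun z zb => hM z ((inb z).1 zb))) H.
apply: le_trans (H _ _ (ltW M1) hd) _.
- by apply/inb => k; rewrite subrr normr0 ltW.
- exact/inb.
- apply: (@le_trans _ _ (m.+1%:R * (M * d'))).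
    by apply: ler_wpM2r; [rewrite mulr_ge0 // ltW|rewrite ler_nat].
  rewrite mulrA mulrC -ler_pdivlMr ?mulr_gt0 //.
  by rewrite ge_min lexx orbT.
Qed.

End Boxes.

Section SmoothFunctions.
Context {R : realType} {m : nat}.
Local Notation pt := 'rV[R]_m.
Implicit Types (g : pt -> R) (u w : pt) (i j : 'I_m) (U : set pt).

Definition sm U g : Prop := forall s u, U u ->
  {for u, continuous (partials s g)} /\ forall i, derivable (partials s g) u (unitv i).

Lemma sm_partial U g i : sm U g -> sm U (partial i g).
Proof. by move=> h s; have := h (rcons s i); rewrite /partials foldr_rcons. Qed.

Lemma sm_partials U g s : sm U g -> sm U (partials s g).
Proof. by move=> h; elim: s => [//|i s IH]; exact: (sm_partial i IH). Qed.

Lemma sm_continuous U g u : sm U g -> U u -> {for u, continuous g}.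
Proof. by move=> h /(h [::]) []. Qed.

Lemma sm_derivable U g u i : sm U g -> U u -> derivable g u (unitv i).
Proof. by move=> h /(h [::]) []. Qed.

Lemma sm_sub U U' g : U' `<=` U -> sm U g -> sm U' g.
Proof. by move=> UU h s u /UU; exact: h. Qed.

(** Coinduction: if a class of differentiable functions is closed under partial derivatives up to
    equality on U, then every iterated derivative agrees on U with a member of the class, hence is
    itself continuous and differentiable. *)
Lemma sm_coind U (C : (pt -> R) -> Prop) : open U ->
  (forall g, C g ->
     (forall u, U u -> {for u, continuous g} /\ forall i, derivable g u (unitv i)) /\
     forall i, exists2 h, C h & forall u, U u -> partial i g u = h u) ->
  forall g, C g -> sm U g.
Proof.
move=> oU hC g Cg s.
have [h Ch e] : exists2 h, C h & forall u, U u -> partials s g u = h u.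
  elim: s => [|i s [h Ch e]]; first by exists g.
  have [_ /(_ i) [h' Ch' e']] := hC _ Ch; exists h' => // u Uu.
  by rewrite -e' //; exact: (@partial_eq_on _ _ R^o U _ _ i oU e).
move=> u Uu; have [/(_ u Uu) [c d] _] := hC _ Ch.
have e' w : U w -> h w = partials s g w by move=> /e.
split; first exact: continuous_eq_on e' c.
by move=> i; apply: (@derivable_eq_on _ _ R^o U h) => //; exact: d.
Qed.

Lemma sm_eq U f g : open U -> (forall u, U u -> f u = g u) -> sm U f -> sm U g.
Proof.
move=> oU fg hf; apply: (@sm_coind U (fun g => exists2 f, sm U f & forall u, U u -> f u = g u)) => //.
- move=> {}g [{}f {}hf {}fg]; split.
    move=> u Uu; split; first by apply: continuous_eq_on fg _ => //; exact: sm_continuous hf Uu.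
    by move=> i; apply: (@derivable_eq_on _ _ R^o U f) => //; exact: sm_derivable hf Uu.
  move=> i; exists (partial i f).
    by exists (partial i f); [exact: sm_partial|].
  by move=> u Uu; apply/esym; exact: (@partial_eq_on _ _ R^o U _ _ i oU fg).
- by exists f.
Qed.

Lemma sm_cst U (c : R) : open U -> sm U (fun=> c).
Proof.
move=> oU; apply: (@sm_coind U (fun g => exists c, g = fun=> c)) => //; last by exists c.
move=> g [{}c ->]; split=> [u Uu|i]; last first.
  by exists (fun=> 0) => [|u Uu]; [exists 0|exact: derive_cst].
split; first exact: cst_continuous.
by move=> i; exact: (derivable_cst (c : R^o)).
Qed.

(** A derivative of a product, an inverse or an exponential is not of the same kind, but it stays in
    the algebra generated by these operations. This is the class to which [sm_coind] is applied. *)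
Inductive salg U : (pt -> R) -> Prop :=
| salg_sm g : sm U g -> salg U g
| salg_add f g : salg U f -> salg U g -> salg U (fun u => f u + g u)
| salg_mul f g : salg U f -> salg U g -> salg U (fun u => f u * g u)
| salg_inv g : salg U g -> (forall u, U u -> g u != 0) -> salg U (fun u => (g u)^-1)
| salg_exp g : salg U g -> salg U (fun u => expR (g u)).

Lemma partial_expR g u i : derivable g u (unitv i) ->
  derivable (fun u => expR (g u)) u (unitv i) /\
  partial i (fun u => expR (g u)) u = expR (g u) * partial i g u.
Proof.
move=> dg; have := @line_is_derive R m g u i 0; rewrite scale0r addr0 => /(_ dg) h.
have := @is_derive1_comp R expR (fun x => g (u + x *: unitv i)) 0 (expR (g u)) _ _ h.
rewrite scale0r addr0 => /(_ (is_derive_expR _)).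
have e : (fun h : R => h^-1 *: (((fun x => expR (g (u + x *: unitv i))) \o shift 0) (h *: 1) - expR (g (u + 0 *: unitv i)))) =
         (fun h : R => h^-1 *: (((fun u => expR (g u)) \o shift u) (h *: unitv i) - expR (g u))).
  by apply/funext => k /=; rewrite scaler1 addr0 scale0r addr0 [_ + u]addrC.
move=> [d v]; split; first by move: d; rewrite /derivable e.
by move: v; rewrite /partial /derive e.
Qed.

Lemma salg_sm_all U g : open U -> salg U g -> sm U g.
Proof.
move=> oU; apply: (@sm_coind U (salg U)) => //.
move=> {}g; elim => {g}.
- move=> g hg; split.
    by move=> u Uu; split=> [|i]; [exact: sm_continuous hg Uu|exact: sm_derivable hg Uu].
  by move=> i; exists (partial i g) => //; apply: salg_sm; exact: sm_partial.
- move=> f g sf [hf kf] sg [hg kg]; split.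
    move=> u Uu; have [cf df] := hf u Uu; have [cg dg] := hg u Uu.
    by split=> [|i]; [exact: continuousD|exact: derivableD].
  move=> i; have [f' sf' ef] := kf i; have [g' sg' eg] := kg i.
  exists (fun u => f' u + g' u); first exact: salg_add.
  move=> u Uu; have [cf df] := hf u Uu; have [cg dg] := hg u Uu.
  by rewrite -ef // -eg //; exact: deriveD.
- move=> f g sf [hf kf] sg [hg kg]; split.
    move=> u Uu; have [cf df] := hf u Uu; have [cg dg] := hg u Uu.
    by split=> [|i]; [exact: continuousM|exact: derivableM].
  move=> i; have [f' sf' ef] := kf i; have [g' sg' eg] := kg i.
  exists (fun u => f u * g' u + g u * f' u).
    by apply: salg_add; exact: salg_mul.
  move=> u Uu; have [cf df] := hf u Uu; have [cg dg] := hg u Uu.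
  by rewrite -ef // -eg //; exact: deriveM.
- move=> g sg [hg kg] g0; split.
    move=> u Uu; have [cg dg] := hg u Uu.
    by split=> [|i]; [apply: continuousV => //; exact: g0|apply: derivableV => //; exact: g0].
  move=> i; have [g' sg' eg] := kg i.
  exists (fun u => (-1 * ((g u)^-1 * (g u)^-1)) * g' u).
    apply: salg_mul => //; apply: salg_mul; first by apply: salg_sm; exact: sm_cst.
    by apply: salg_mul; exact: salg_inv.
  move=> u Uu; have [cg dg] := hg u Uu; rewrite -eg // /partial deriveV ?g0 //.
  by rewrite mulN1r -exprVn expr2.
- move=> g sg [hg kg]; split.
    move=> u Uu; have [cg dg] := hg u Uu.
    split; first by apply: continuous_comp => //; exact: continuous_expR.
    by move=> i; have [] := partial_expR (dg i).
  move=> i; have [g' sg' eg] := kg i.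
  exists (fun u => expR (g u) * g' u); first by apply: salg_mul => //; exact: salg_exp.
  move=> u Uu; have [cg dg] := hg u Uu; rewrite -eg //.
  by have [] := partial_expR (dg i).
Qed.

Lemma sm_add U f g : open U -> sm U f -> sm U g -> sm U (fun u => f u + g u).
Proof. by move=> oU hf hg; apply: salg_sm_all => //; apply: salg_add; exact: salg_sm. Qed.

Lemma sm_mul U f g : open U -> sm U f -> sm U g -> sm U (fun u => f u * g u).
Proof. by move=> oU hf hg; apply: salg_sm_all => //; apply: salg_mul; exact: salg_sm. Qed.

Lemma sm_inv U g : open U -> sm U g -> (forall u, U u -> g u != 0) -> sm U (fun u => (g u)^-1).
Proof. by move=> oU hg g0; apply: salg_sm_all => //; apply: salg_inv => //; exact: salg_sm. Qed.

Lemma sm_exp U g : open U -> sm U g -> sm U (fun u => expR (g u)).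
Proof. by move=> oU hg; apply: salg_sm_all => //; apply: salg_exp; exact: salg_sm. Qed.

Lemma sm_sub2 U f g : open U -> sm U f -> sm U g -> sm U (fun u => f u - g u).
Proof.
move=> oU hf hg; apply: (@sm_eq U (fun u => f u + -1 * g u)) => //.
  by move=> u _; rewrite mulN1r.
by apply: sm_add => //; apply: sm_mul => //; exact: sm_cst.
Qed.

Lemma partialC U g i j u : open U -> sm U g -> U u ->
  partial i (partial j g) u = partial j (partial i g) u.
Proof.
move=> oU hg Uu; apply/eqP; apply/negPn/negP => neq.
have [A [EA cA]] : exists A, A = partial i (partial j g) /\ {for u, continuous A}.
  exists (partial i (partial j g)); split; [reflexivity|exact: (sm_continuous (sm_partial i (sm_partial j hg)) Uu)].
have [B [EB cB]] : exists B, B = partial j (partial i g) /\ {for u, continuous B}.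
  exists (partial j (partial i g)); split; [reflexivity|exact: (sm_continuous (sm_partial j (sm_partial i hg)) Uu)].
rewrite -EA -EB in neq.
pose e := `|A u - B u| / 2.
have e0 : 0 < e by rewrite divr_gt0 // normr_gt0 subr_eq0.
have oUu : nbhs u U by exact: open_nbhs_nbhs.
have : \forall w \near u, [/\ U w, `|A u - A w| < e & `|B u - B w| < e].
  have nA : \forall w \near u, `|A u - A w| < e by move/cvgrPdist_lt: cA => /(_ _ e0).
  have nB : \forall w \near u, `|B u - B w| < e by move/cvgrPdist_lt: cB => /(_ _ e0).
  apply: (@filterS _ (nbhs u) (nbhs_filter u) (U `&` ([set w | `|A u - A w| < e] `&` [set w | `|B u - B w| < e]))).
    by move=> w [? []].
  apply: (@filterI _ _ (nbhs_filter u) _ _ oUu); exact: (@filterI _ _ (nbhs_filter u) _ _ nA nB).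
move=> /nbhs_boxP[d d0 hd].
(* A third of the distance keeps all points u + s e_k + s' e_l in the neighbourhood, also for k =
   l. *)
pose t := d / 3; have t0 : 0 < t by rewrite divr_gt0.
have near_uv s s' k l : 0 <= s <= t -> 0 <= s' <= t ->
    forall z, `|(u + s *: unitv k + s' *: unitv l) 0 z - u 0 z| < d.
  move=> /andP[a b] /andP[c f] z; rewrite !addu_coord.
  have t3 : 3 * t = d by rewrite mulrC divfK.
  rewrite ltr_norml; case: (z == k); case: (z == l); apply/andP; split; lra.
have btw0 s : (0 <= s <= t) || (t <= s <= 0) -> 0 <= s <= t.
  by case/orP => // /andP[a b]; lra.
have t00 : 0 <= t <= t by rewrite lexx ltW.
have Uuv s s' k l : 0 <= s <= t -> 0 <= s' <= t -> U (u + s *: unitv k + s' *: unitv l).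
  by move=> hs hs'; have [] := hd _ (near_uv s s' k l hs hs').
have Uuv1 s k : 0 <= s <= t -> U (u + s *: unitv k).
  by move=> hs; have := Uuv s 0 k k hs; rewrite scale0r addr0 lexx ltW //=; exact.
(* the second difference of g, expanded in either order by the mean value theorem *)
have Q k l : exists2 w : pt, (forall z, `|w 0 z - u 0 z| < d) &
    (g (u + t *: unitv k + t *: unitv l) - g (u + t *: unitv l)) -
    (g (u + t *: unitv k) - g u) = t * (t * partial l (partial k g) w).
  pose f x := g (x + t *: unitv l) - g x.
  have df s : 0 <= s <= t -> derivable (fun x => g (x + t *: unitv l)) (u + s *: unitv k) (unitv k)
     /\ partial k (fun x => g (x + t *: unitv l)) (u + s *: unitv k) = partial k g (u + s *: unitv k + t *: unitv l).
    move=> hs; have h : U (u + s *: unitv k + t *: unitv l) by exact: Uuv.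
    by rewrite partial_shift; split=> //; apply: derivable_shift; exact: (sm_derivable hg h).
  have [s /btw0 hs es] := @mvt_dir R m f u k t (fun s hs =>
     derivableB (df s (btw0 _ hs)).1 (sm_derivable hg (Uuv1 s k (btw0 _ hs)))).
  have [s' /btw0 hs' es'] := @mvt_dir R m (partial k g) (u + s *: unitv k) l t
     (fun s' hs' => sm_derivable (sm_partial k hg) (Uuv s s' k l hs (btw0 _ hs'))).
  exists (u + s *: unitv k + s' *: unitv l); first exact: near_uv.
  rewrite -es' -(df s hs).2.
  rewrite -/(f (u + t *: unitv k)) in es *.
  have -> : g (u + t *: unitv k + t *: unitv l) - g (u + t *: unitv l) - (g (u + t *: unitv k) - g u)
     = f (u + t *: unitv k) - f u by rewrite /f; ring.
  rewrite es; congr (_ * _); apply: deriveB; first exact: (df s hs).1.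
  exact: (sm_derivable hg (Uuv1 s k hs)).
have [w1 h1 q1] := Q i j; have [w2 h2 q2] := Q j i.
have : t * (t * B w1) = t * (t * A w2).
  rewrite EA EB -[LHS]q1 -[RHS]q2 [u + t *: unitv i + _]addrAC; ring.
have tn : t != 0 by rewrite gt_eqF.
move=> /(mulfI tn) /(mulfI tn) q.
have [_ _ b1] := hd _ h1; have [_ a2 _] := hd _ h2.
have : `|A u - B u| < e + e.
  have -> : A u - B u = (A u - A w2) - (B u - B w1) by rewrite q; ring.
  by apply: le_lt_trans (ler_normB _ _) _; exact: ltrD.
by rewrite /e -splitr ltxx.
Qed.

End SmoothFunctions.

(** * Primitives along a coordinate direction *)

Section Antiderivative.
Context {R : realType}.
Local Notation mu := (@lebesgue_measure R).
Implicit Types h F : R -> R.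

Lemma antiderivative_exists h : continuous h ->
  exists F, F 0 = 0 /\ forall t : R, is_derive t 1 F (h t).
Proof.
move=> ch; pose I a b := (\int[mu]_(x in `[a, b]) h x)%R.
have hi a b : mu.-integrable `[a, b] (EFin \o h).
  by apply: continuous_compact_integrable; [exact: segment_compact|exact: continuous_subspaceT].
have chasles a b x : a <= b -> b <= x -> I a x = I a b + I b x.
  move=> ab bx; apply/eqP; rewrite addrC -subr_eq; apply/eqP.
  rewrite /I (@Rintegral_itvB _ h (BLeft a) (BRight x) b (hi a x)) ?bnd_simp //.
  rewrite Rintegral_itv_obnd_cbnd //.
  by apply: integrableS (hi b x) => //; apply: subset_itvr; rewrite bnd_simp.
(* A lower limit below both t and 0 avoids oriented integrals. It moves with t, but near t0 it can
   be replaced by the fixed [- b], because the additional piece cancels in the difference. *)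
pose F t := I (- (`|t| + 1)) t - I (- (`|t| + 1)) 0.
exists F; split=> [|t0]; first by rewrite /F subrr.
pose b := `|t0| + 2; pose G t := I (- b) t.
have dG : is_derive t0 1 G (h t0).
  have := @continuous_FTC1_closed R h (- b) t0 (t0 + 1).
  case; [by rewrite ltrDl|exact: hi| |exact: ch|].
  - by rewrite /b; have := ler_norm (- t0); rewrite normrN; lra.
  - by move=> d e; split; [exact: d|rewrite -derive1E; exact: e].
have -> : h t0 = h t0 - 0 by rewrite subr0.
apply: (@near_eq_is_derive _ _ _ (fun t => G t - G 0)).
have := nbhsx_ballx t0 1 ltr01; apply: filterS => t; rewrite /ball /= => ht; rewrite /F.
have tb : `|t| + 1 <= b.
  by rewrite /b; have := ler_distD t0 t 0; rewrite !subr0 distrC; lra.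
have t1 : - (`|t| + 1) <= t by have := ler_norm (- t); rewrite normrN; lra.
have t2 : - (`|t| + 1) <= 0 by rewrite oppr_le0 addr_ge0.
have t3 : - b <= - (`|t| + 1) by rewrite lerN2.
by rewrite /G (chasles (- b) _ t t3 t1) (chasles (- b) _ 0 t3 t2); ring.
Qed.

Definition prim h : R -> R := get [set F | F 0 = 0 /\ forall t : R, is_derive t 1 F (h t)].

Lemma primP h : continuous h -> prim h 0 = 0 /\ forall t : R, is_derive t 1 (prim h) (h t).
Proof. by move=> /antiderivative_exists[F hF]; exact: (@getPex _ [set F | _ /\ _] (ex_intro _ F hF)). Qed.

End Antiderivative.

Section Primitive.
Context {R : realType} {m : nat}.
Local Notation pt := 'rV[R]_m.
Implicit Types (g h : pt -> R) (u w : pt) (i j : 'I_m).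

Definition setc i (s : R) u : pt := \row_k (if k == i then s else u 0 k).

Lemma setc_add i s u : setc i s u = u + (s - u 0 i) *: unitv i.
Proof.
apply/rowP => k; rewrite addu_coord mxE; case: eqP => [->|_]; first by rewrite addrC subrK.
by rewrite addr0.
Qed.

(** The integral of h along direction i, taken from the hyperplane u_i = 0. *)
Definition prim_dir i h : pt -> R := fun u => prim (fun s => h (setc i s u)) (u 0 i).

Lemma line_continuous h i u : (forall u, derivable h u (unitv i)) -> continuous (fun s => h (setc i s u)).
Proof.
move=> dh s; apply: differentiable_continuous; apply/derivable1_diffP.
have -> : (fun s => h (setc i s u)) = (fun s => h ((u - u 0 i *: unitv i) + s *: unitv i)).
  by apply/funext => x; rewrite setc_add scalerBl addrCA addrC.
by have [] := @line_is_derive _ _ h (u - u 0 i *: unitv i) i s (dh _).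
Qed.

Lemma prim_dir_line i h u s : prim_dir i h (setc i s u) = prim (fun s => h (setc i s u)) s.
Proof.
rewrite /prim_dir mxE eqxx; congr (prim _ _); apply/funext => x; congr h.
by apply/rowP => k; rewrite !mxE; case: eqP.
Qed.

Lemma setc_id i u : setc i (u 0 i) u = u.
Proof. by apply/rowP => k; rewrite mxE; case: eqP => [->|]. Qed.

Lemma line_derivable g u i (d : R) :
  is_derive (0 : R) 1 (fun x => g (u + x *: unitv i)) d ->
  derivable g u (unitv i) /\ partial i g u = d.
Proof.
have e : (fun h : R => h^-1 *: (((fun x => g (u + x *: unitv i)) \o shift 0) (h *: 1) - g (u + 0 *: unitv i))) =
         (fun h : R => h^-1 *: ((g \o shift u) (h *: unitv i) - g u)).
  by apply/funext => k /=; rewrite scaler1 addr0 scale0r addr0 [_ + u]addrC.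
move=> [dd v]; split; first by move: dd; rewrite /derivable e.
by move: v; rewrite /partial /derive e.
Qed.

Lemma prim_dir_derivable i h u : (forall u, derivable h u (unitv i)) ->
  derivable (prim_dir i h) u (unitv i) /\ partial i (prim_dir i h) u = h u.
Proof.
move=> dh; have [_ /(_ (u 0 i)) hP] := primP (@line_continuous h i u dh).
apply: line_derivable; rewrite setc_id in hP.
have -> : (fun x => prim_dir i h (u + x *: unitv i)) =
          (fun x => prim (fun s => h (setc i s u)) (x + u 0 i)).
  by apply/funext => x; rewrite -prim_dir_line setc_add addrK.
rewrite -[h u]mulr1; apply: (@is_derive1_comp _ _ (fun x => x + u 0 i)).
  by rewrite add0r.
by rewrite -[X in is_derive _ _ _ X]addr0; apply: is_deriveD.
Qed.

Lemma prim_dir0 i h u : (forall u, derivable h u (unitv i)) -> u 0 i = 0 -> prim_dir i h u = 0.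
Proof. by move=> dh u0; rewrite /prim_dir u0; have [] := primP (@line_continuous h i u dh). Qed.

Lemma prim_dir_bound i h u M (a : R) : (forall u, derivable h u (unitv i)) -> `|u 0 i| <= a ->
  (forall s, `|s| <= a -> `|h (setc i s u)| <= M) -> `|prim_dir i h u| <= M * a.
Proof.
move=> dh ua hM; have M0 : 0 <= M.
  by apply: le_trans (hM 0 _); rewrite ?normr0 // (le_trans _ ua).
have := @mvt_bound _ _ (prim_dir i h) (setc i 0 u) i (u 0 i) M.
have e s : setc i 0 u + s *: unitv i = setc i s u.
  apply/rowP => k; rewrite addu_coord !mxE; case: eqP; rewrite ?add0r ?addr0 //.
rewrite e setc_id (@prim_dir0 _ _ (setc i 0 u)) ?subr0 //; last by rewrite mxE eqxx.
move=> H; apply: le_trans (H _) _; last by rewrite ler_wpM2l.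
move=> s su; have [d ->] := prim_dir_derivable (setc i 0 u + s *: unitv i) dh.
by split=> //; rewrite e; apply: hM; exact: le_trans (btw_norm su) ua.
Qed.

End Primitive.

Section SmoothPrimitive.
Context {R : realType} {m : nat}.
Local Notation pt := 'rV[R]_m.
Implicit Types (g h : pt -> R) (u w : pt) (i j : 'I_m) (P : pred 'I_m).

(** A quadratic remainder survives integration and pointwise limits, so this criterion takes the
    place of theorems on differentiating integrals and limits of functions. *)
Lemma partial_of_quadratic g u i (d C e : R) : 0 < e ->
  (forall t, `|t| < e -> `|g (u + t *: unitv i) - g u - t * d| <= C * t ^+ 2) ->
  derivable g u (unitv i) /\ partial i g u = d.
Proof.
move=> e0 hC.
have H : (fun t : R => t^-1 *: ((g \o shift u) (t *: unitv i) - g u)) @ 0^' --> d.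
  apply/cvgrPdist_le => eta eta0.
  pose d' := Num.min e (eta / (`|C| + 1)).
  have d'0 : 0 < d' by rewrite lt_min e0 divr_gt0 // ltr_wpDl.
  near=> t.
  have t0 : t != 0 by near: t; exact: nbhs_dnbhs_neq.
  have td : `|t| < d' by near: t; apply: dnbhs0_lt.
  have te : `|t| < e by apply: lt_le_trans td _; rewrite ge_min lexx.
  have := hC t te; rewrite /= [_ + u]addrC => h.
  have -> : d - t^-1 *: (g (u + t *: unitv i) - g u) = - (t^-1 * (g (u + t *: unitv i) - g u - t * d)).
    by rewrite /GRing.scale /= [t^-1 * (_ - t * d)]mulrBr mulKf // opprB.
  rewrite normrN normrM normfV ler_pdivrMl ?normr_gt0 //.
  apply: le_trans h _; rewrite -real_normK ?num_real // expr2 mulrC -mulrA ler_wpM2l //.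
  apply: le_trans (_ : `|t| * (`|C| + 1) <= _).
    by apply: ler_wpM2l => //; apply: le_trans (ler_norm _) _; rewrite lerDl.
  rewrite -ler_pdivlMr ?ltr_wpDl //.
  by apply: le_trans (ltW td) _; rewrite ge_min lexx orbT.
by split; [exact: cvgP H|exact: cvg_lim H].
Unshelve. all: by end_near.
Qed.

Definition cube (a : R) : set pt := itvbox (fun=> - a) (fun=> a).

Lemma cubeP a u : cube a u <-> forall k, `|u 0 k| <= a.
Proof. by split => h k; have := h k; rewrite ler_norml. Qed.

Lemma cube_exists u : exists2 a, 0 <= a & cube a u.
Proof.
exists (\sum_k `|u 0 k|); first exact: sumr_ge0.
by apply/cubeP => k; rewrite (bigD1 k) //= lerDl sumr_ge0.
Qed.

Lemma smT_bounded g a : sm setT g -> exists2 M, 0 <= M & forall u, cube a u -> `|g u| <= M.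
Proof. by move=> hg; apply: bounded_on_box => u _; exact: (sm_continuous hg). Qed.

Lemma smT_derivable g u i : sm setT g -> derivable g u (unitv i).
Proof. by move=> hg; exact: (sm_derivable hg). Qed.

Lemma partial_comb3 (A B C : pt -> R) (t : R) u i : derivable A u (unitv i) ->
  derivable B u (unitv i) -> derivable C u (unitv i) ->
  derivable (fun x => A x - B x - t * C x) u (unitv i) /\
  partial i (fun x => A x - B x - t * C x) u = partial i A u - partial i B u - t * partial i C u.
Proof.
move=> dA dB dC; have dAB := derivableB dA dB; have dtC : derivable (t *: C) u (unitv i) := derivableZ dC.
split; first exact: derivableB dAB dtC.
rewrite /partial; transitivity ('D_(unitv i) (A - B - t *: C) u); first by [].
by rewrite (deriveB dAB dtC) (deriveB dA dB) (deriveZ t dC).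
Qed.

(** Differentiation under the integral: the defect [G] vanishes where u_i = 0, and its derivative in
    direction i is the Taylor remainder of h in direction j, hence O(t^2) uniformly. Integration
    along i keeps this order. *)
Lemma prim_dir_partial i j h u : i != j -> sm setT h ->
  derivable (prim_dir i h) u (unitv j) /\
  partial j (prim_dir i h) u = prim_dir i (partial j h) u.
Proof.
move=> ij hh; have [a a0 ua] := cube_exists u.
have hj := sm_partial j hh; have hjj := sm_partial j hj.
(* The cube is enlarged by 1 because the points are shifted by up to |t| < 1. *)
have [M M0 hM] := smT_bounded (a + 1) hjj.
apply: (@partial_of_quadratic _ _ _ _ (M * a) 1) => // t t1.
pose G := fun x => prim_dir i h (x + t *: unitv j) - prim_dir i h x - t * prim_dir i (partial j h) x.
have dh x : derivable h x (unitv i) by exact: smT_derivable.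
have dhj x : derivable (partial j h) x (unitv i) by exact: smT_derivable.
have ui0 : (setc i 0 u) 0 i = 0 by rewrite mxE eqxx.
have G0 : G (setc i 0 u) = 0.
  rewrite /G (prim_dir0 dhj ui0) (prim_dir0 dh ui0) (prim_dir0 dh); first by rewrite mulr0 !subrr.
  by rewrite addu_coord (negPf ij) ui0 addr0.
have e s : setc i 0 u + s *: unitv i = setc i s u.
  apply/rowP => k; rewrite addu_coord !mxE; case: eqP; rewrite ?add0r ?addr0 //.
have := @mvt_bound _ _ G (setc i 0 u) i (u 0 i) (M * t ^+ 2).
rewrite e setc_id G0 subr0 -/(G u) => H.
apply: le_trans (H _) _; last first.
  rewrite [M * a * _]mulrAC; apply: ler_wpM2l; first by rewrite mulr_ge0 // sqr_ge0.
  by move/cubeP : ua.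
move=> s su; rewrite e; set x := setc i s u.
have [d1 e1] := prim_dir_derivable (x + t *: unitv j) dh.
have [d2 e2] := prim_dir_derivable x dh.
have [d3 e3] := prim_dir_derivable x dhj.
have [dG eG] := partial_comb3 t (derivable_shift d1) d2 d3.
split; first exact: dG.
have -> : partial i G x = h (x + t *: unitv j) - h x - t * partial j h x.
  by rewrite /G eG partial_shift e1 e2 e3.
apply: taylor_bound => s' st'; split; [exact: smT_derivable|exact: smT_derivable|].
apply: hM; apply/cubeP => k; rewrite addu_coord mxE.
have h1 : `|s'| <= 1 by apply: le_trans (btw_norm st') (ltW t1).
have h2 : `|s| <= a by apply: le_trans (btw_norm su) _; move/cubeP : ua.
apply: le_trans (ler_normD _ _) _; apply: lerD; first by case: ifP => // _; move/cubeP : ua.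
by case: ifP; rewrite ?normr0.
Qed.

(** Smooth functions together with their primitives along i form a class closed under derivatives:
    direction i undoes the primitive, any other direction passes under it. *)
Lemma sm_prim_dir i h : sm setT h -> sm setT (prim_dir i h).
Proof.
move=> hh; apply: (@sm_coind _ _ _ (fun g => sm setT g \/ exists2 h, sm setT h & g = prim_dir i h)).
- exact: openT.
- move=> g [hg|[{hh}{}h hh ->]].
    split=> [u _|j]; last by exists (partial j g) => //; left; exact: sm_partial.
    by split=> [|j]; [exact: (sm_continuous hg)|exact: smT_derivable].
  have dh x : derivable h x (unitv i) by exact: smT_derivable.
  have all_der x j : derivable (prim_dir i h) x (unitv j) /\
     partial j (prim_dir i h) x = if j == i then h x else prim_dir i (partial j h) x.
    have [->|ji] := eqVneq j i; first exact: prim_dir_derivable.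
    by apply: prim_dir_partial => //; rewrite eq_sym.
  split=> [u _|j]; last first.
    have [ji|ji] := eqVneq j i.
      exists h; first by left.
      by move=> u _; rewrite (all_der u j).2 ji eqxx.
    exists (prim_dir i (partial j h)); first by right; exists (partial j h); [exact: sm_partial|reflexivity].
    by move=> u _; rewrite (all_der u j).2 (negPf ji).
  split; last by move=> j; have [] := all_der u j.
  apply: continuous_of_bounded_partials; exists 1 => //.
  have [a a0 /cubeP ua] := cube_exists u.
  have [M M0 hM] := smT_bounded (a + 1) hh.
  have /boolp.choice[N hN] : forall k, exists N, 0 <= N /\ forall w, cube (a + 1) w -> `|partial k h w| <= N.
    by move=> k; have [N N0 hN] := smT_bounded (a + 1) (sm_partial k hh); exists N.
  exists (M + \sum_k N k * (a + 1)) => w hw k.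
  have wa : cube (a + 1) w.
    apply/cubeP => l; rewrite -(subrK (u 0 l) (w 0 l)) addrC.
    by apply: le_trans (ler_normD _ _) _; apply: lerD.
  have N0 l : 0 <= N l * (a + 1) by rewrite mulr_ge0 ?addr_ge0 //; have [] := hN l.
  have [d ->] := all_der w k; split=> //; case: ifP => _.
    by apply: le_trans (hM _ wa) _; rewrite lerDl sumr_ge0.
  have := @prim_dir_bound _ _ i (partial k h) w (N k) (a + 1).
  move=> H; apply: le_trans (H _ _ _) _.
  + by move=> x; exact: smT_derivable (sm_partial k hh).
  + by move/cubeP : wa.
  + move=> s sa; apply: (hN k).2; apply/cubeP => l; rewrite mxE; case: ifP => // _.
    by move/cubeP : wa.
  + by rewrite (bigD1 k) //= addrCA lerDl addr_ge0 // sumr_ge0.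
- by right; exists h.
Qed.

Definition proj (P : pred 'I_m) u : pt := \row_k (if P k then u 0 k else 0).

Lemma proj_in P u : coord_subspace P (proj P u).
Proof. by move=> k Pk; rewrite mxE; move: Pk; rewrite -topredE /= => /negPf ->. Qed.

Lemma proj_id P u : coord_subspace P u -> proj P u = u.
Proof.
move=> h; apply/rowP => k; rewrite mxE; case: ifPn => // Pk.
by rewrite h // -topredE.
Qed.

Lemma proj_add P u t i : proj P (u + t *: unitv i) = if P i then proj P u + t *: unitv i else proj P u.
Proof.
apply/rowP => k; rewrite mxE addu_coord (fun_if (fun w : pt => w 0 k)) addu_coord mxE.
case: eqP => [->|_]; first by case: (P i).
by rewrite !addr0; case: (P i).
Qed.

Lemma proj_line g P u i :
  (fun x : R => g (proj P (u + x *: unitv i))) =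
  if P i then (fun x : R => g (proj P u + x *: unitv i)) else fun=> g (proj P u).
Proof. by apply/funext => x; rewrite proj_add; case: ifP. Qed.

Lemma partial_proj g P u i : (P i -> derivable g (proj P u) (unitv i)) ->
  derivable (fun x => g (proj P x)) u (unitv i) /\
  partial i (fun x => g (proj P x)) u = if P i then partial i g (proj P u) else 0.
Proof.
move=> dg; apply: line_derivable; rewrite proj_line; case: ifP => Pi.
  have := @line_is_derive _ _ g (proj P u) i 0; rewrite scale0r addr0; apply; exact: dg.
exact: is_derive_cst.
Qed.

Lemma proj_continuous P : continuous (proj P).
Proof.
move=> u A /nbhs_boxP[d d0 h]; apply/nbhs_boxP; exists d => // w hw; apply: h => k.
by rewrite !mxE; case: ifP => // _; rewrite subrr normr0.
Qed.

(* Only the derivatives along [coord_subspace P] are required to exist. *)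
Lemma sm_proj P g : smooth_along P (coord_subspace P) (g : pt -> R^o) ->
  sm setT (fun u => g (proj P u)).
Proof.
move=> hg; apply: (@sm_coind _ _ _ (fun f => f = (fun=> 0) \/ exists2 h : pt -> R,
   smooth_along P (coord_subspace P) (h : pt -> R^o) & f = (fun u => h (proj P u)))).
- exact: openT.
- move=> f [->|[h hh ->]].
    split=> [u _|i]; last by exists (fun=> 0); [left|move=> u _; exact: derive_cst].
    split; first exact: cst_continuous.
    by move=> i; exact: (derivable_cst (0 : R^o)).
  have [ch dh] : {within coord_subspace P, continuous h} /\
      forall u i, coord_subspace P u -> i \in P -> derivable h u (unitv i).
    by apply: (hh [::]).
  have dhP u i : P i -> derivable h (proj P u) (unitv i).
    by move=> Pi; apply: dh; [exact: proj_in|exact: Pi].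
  split.
    move=> u _; split; last by move=> i; exact: (partial_proj (dhP u i)).1.
    move=> V hV; have /subspace_continuousP/(_ (proj P u) (@proj_in P u))/(_ V hV) := ch.
    move=> /(@proj_continuous P u); apply: (@filterS _ _ (nbhs_filter u)) => w; apply; exact: proj_in.
  move=> i; have [Pi|Pi] := boolP (P i); last first.
    exists (fun=> 0); first by left.
    by move=> u _; rewrite (partial_proj (dhP u i)).2 (negPf Pi).
  exists (fun u => partial i h (proj P u)).
    right; exists (partial i h); last reflexivity.
    move=> s sP.
    have := hh (rcons s i); rewrite /partials foldr_rcons; apply.
    by move=> k; rewrite mem_rcons inE => /orP[/eqP ->|/sP].
  by move=> u _; rewrite (partial_proj (dhP u i)).2 Pi.
- by right; exists g.
Qed.

End SmoothPrimitive.

Section NormComplements.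
Context {R : realType} {m : nat}.
Local Notation fct := ('rV[R]_m -> R).
Implicit Types (P : pred 'I_m) (v : 'I_m -> nat) (f g : fct) (u : 'rV[R]_m).

Definition vword v (s : seq 'I_m) : 'I_m -> nat := fun k => (v k + count_mem k s)%N.

Lemma vword_rcons v s i : vword (vadd v i) s = vword v (rcons s i).
Proof.
apply/funext => k; rewrite /vword /vadd -cats1 count_cat /= addn0 -addnA eq_sym.
by congr addn; exact: addnC.
Qed.

Lemma vword_nil v : vword v [::] = v.
Proof. by apply/funext => k; rewrite /vword addn0. Qed.

Context (Dom : ('I_m -> nat) -> set 'rV[R]_m) (D : 'I_m -> fct -> fct).

Lemma Bd_word n v P g M s u : Bd Dom D 1 n v P g M -> (size s <= n)%N -> all P s ->
  Dom (vword v s) u -> coord_subspace P u -> `|foldr D g s u| <= M.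
Proof.
elim: n v g M s => [|n IH] v g M s.
  by move=> [_ h]; rewrite leqn0 => /nilP -> _ /=; rewrite vword_nil; exact: h.
move=> [M0 [Mi [h0 h1 h2 h3]]].
have S0 : 0 <= \sum_i Mi i by exact: sumr_ge0.
have M00 : 0 <= M0 by exact: (Bd_nneg ler01 h0).
rewrite mul1r in h3; case: (lastP s) => [_ _|s' i].
  move=> du pu; apply: (@le_trans _ _ M0); first exact: (IH _ _ _ [::] h0).
  by apply: le_trans h3; rewrite lerDl.
rewrite size_rcons ltnS all_rcons -vword_rcons foldr_rcons => ss /andP[Pi Ps] du pu.
apply: le_trans (IH _ _ _ _ (h1 i Pi) ss Ps du pu) _; apply: le_trans h3.
by rewrite (bigD1 i) //= addrCA lerDl addr_ge0 // sumr_ge0.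
Qed.

(** Each order multiplies the bound by at most m + 1: one summand for the lower order and m for the
    derivatives. *)
Lemma Bd_of_words n v P g M : 0 <= M ->
  (forall s u, (size s <= n)%N -> all P s -> Dom (vword v s) u -> coord_subspace P u ->
     `|foldr D g s u| <= M) ->
  Bd Dom D 1 n v P g (M * m.+1%:R ^+ n).
Proof.
move=> M0; elim: n v g => [|n IH] v g h.
  rewrite expr0 mulr1; split=> // u du pu.
  by apply: (h [::]) => //; rewrite vword_nil.
exists (M * m.+1%:R ^+ n), (fun=> M * m.+1%:R ^+ n); split.
- by apply: IH => s u ss; apply: h; exact: leqW.
- move=> i Pi; apply: IH => s u ss sP du pu; rewrite -foldr_rcons.
  by apply: h => //; rewrite ?size_rcons // ?all_rcons ?Pi // -vword_rcons.
- by move=> i; rewrite mulr_ge0 // exprn_ge0.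
- by rewrite sumr_const card_ord mul1r -[_ *+ m]mulr_natl exprSr mulrA -natr1 mulrDr mulr1 addrC mulrC.
Qed.

(** The norm sees a function only through its values on [E], a family of domains on which equality
    is inherited by [D]: the lattice domains in the discrete case, whole coordinate subspaces in the
    smooth case. *)
Lemma Bd_congr (E : ('I_m -> nat) -> set 'rV[R]_m) mu n v P f g M :
  (forall v, Dom v `<=` E v) ->
  (forall v i f g, P i -> (forall u, E v u -> coord_subspace P u -> f u = g u) ->
     forall u, E (vadd v i) u -> coord_subspace P u -> D i f u = D i g u) ->
  (forall u, E v u -> coord_subspace P u -> f u = g u) ->
  Bd Dom D mu n v P f M -> Bd Dom D mu n v P g M.
Proof.
move=> DE hE; elim: n v f g M => [|n IH] v f g M fg /=.
  by move=> [M0 h]; split=> // u du pu; rewrite -fg ?h //; exact: DE.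
move=> [M0 [Mi [h0 h1 h2 h3]]]; exists M0, Mi; split=> //; first exact: IH fg h0.
by move=> i Pi; apply: IH (h1 i Pi); exact: hE.
Qed.

End NormComplements.

Section DarbouxRhs.
Context {R : realType} {m : nat}.
Local Notation fct := ('rV[R]_m -> R).
Context (Dom : ('I_m -> nat) -> set 'rV[R]_m).
Context (D t : 'I_m -> fct -> fct) (ok : fct -> Prop) (rho mu : R).
Hypothesis dc : difference_calculus Dom D t ok rho mu.
Local Notation Bd := (Bd Dom D mu).
Implicit Types (p q r s : fct).

(** One discrete Darboux step, solved for the difference quotient, is delta_i gamma_jk = gamma_ji
    gamma_ik + c gamma_ik gamma_ki (tau_i gamma_jk), where c is the step in direction k. In the
    limit the cubic term disappears for lattice directions and remains, with c = 1, for the Jonas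
    direction. *)
Definition darboux_rhs (c : R) p q r s : fct := fun u => p u * q u + c * (q u * (r u * s u)).

Lemma Bd_rhs n v P c p q r s L : `|c| <= 1 -> ok p -> ok q -> ok r -> ok s ->
  Bd n v P p L -> Bd n v P q L -> Bd n v P r L -> Bd n v P s L ->
  Bd n v P (darboux_rhs c p q r s) (L ^+ 2 + L ^+ 3).
Proof.
move=> c1 op oq or os hp hq hr hs.
apply: (Bd_add dc); first exact: (dc_okM dc).
- by apply: (dc_okZ dc); apply: (dc_okM dc) => //; exact: (dc_okM dc).
- by rewrite expr2; exact: (Bd_mul dc).
- apply: (@Bd_le _ _ _ _ _ _ _ _ _ (`|c| * (L * (L * L)))).
    rewrite -!expr2 -exprS ler_piMl // exprn_ge0 //; exact: (Bd_ge0 dc hp).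
  apply: (Bd_scale dc); first by apply: (dc_okM dc) => //; exact: (dc_okM dc).
  by apply: (Bd_mul dc) => //; [exact: (dc_okM dc)|exact: (Bd_mul dc)].
Qed.

(* as [Bd_rhs], but linear in the bounds of order n + 1 *)
Lemma Bd_rhsS n v P c p q r s L Z : `|c| <= 1 -> ok p -> ok q -> ok r -> ok s -> 1 <= L ->
  Bd n v P p L -> Bd n v P q L -> Bd n v P r L -> Bd n v P s L ->
  Bd n.+1 v P p Z -> Bd n.+1 v P q Z -> Bd n.+1 v P r Z -> Bd n.+1 v P s Z ->
  Bd n.+1 v P (darboux_rhs c p q r s) ((2 * L + 4 * L ^+ 3) * Z).
Proof.
move=> c1 op oq or os L1 hp hq hr hs hp' hq' hr' hs'.
have Z0 := Bd_ge0 dc hp'; have L0 := Bd_ge0 dc hp.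
have ors : ok (fun u => r u * s u) by exact: (dc_okM dc).
have oqrs : ok (fun u => q u * (r u * s u)) by exact: (dc_okM dc).
rewrite mulrDl; apply: (Bd_add dc); [exact: (dc_okM dc)|exact: (dc_okZ dc)| |].
  exact: (Bd_mulS dc).
apply: (@Bd_le _ _ _ _ _ _ _ _ _ (`|c| * (2 * L ^+ 2 * (2 * L * Z)))).
  have -> : 2 * L ^+ 2 * (2 * L * Z) = 4 * L ^+ 3 * Z by ring.
  by rewrite ler_piMl // !mulr_ge0 // exprn_ge0.
apply: (Bd_scale dc) => //.
have hrs : Bd n v P (fun u => r u * s u) (L ^+ 2) by rewrite expr2; exact: (Bd_mul dc).
have hrs' : Bd n.+1 v P (fun u => r u * s u) (2 * L * Z) by exact: (Bd_mulS dc).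
apply: (Bd_mulS dc) => //.
- by apply: (Bd_le _ hq); rewrite expr2 ler_peMl.
- by apply: (Bd_le _ hq'); rewrite ler_peMl //; lra.
Qed.

(** Telescoping changes one factor at a time: each of the two factors of the quadratic term
    contributes L, each of the three of the cubic term L^2, and the change of the coefficient
    contributes d L^3. *)
Lemma Bd_rhs_diff n v P c c' p q r s p' q' r' s' L Z d :
  `|c| <= 1 -> `|c'| <= 1 -> `|c - c'| <= d ->
  ok p -> ok q -> ok r -> ok s -> ok p' -> ok q' -> ok r' -> ok s' ->
  Bd n v P p L -> Bd n v P q L -> Bd n v P r L -> Bd n v P s L ->
  Bd n v P p' L -> Bd n v P q' L -> Bd n v P r' L -> Bd n v P s' L ->
  Bd n v P (fun u => p u - p' u) Z -> Bd n v P (fun u => q u - q' u) Z ->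
  Bd n v P (fun u => r u - r' u) Z -> Bd n v P (fun u => s u - s' u) Z ->
  Bd n v P (fun u => darboux_rhs c p q r s u - darboux_rhs c' p' q' r' s' u)
     ((2 * L + 3 * L ^+ 2) * Z + d * L ^+ 3).
Proof.
move=> c1 c'1 cd op oq or os op' oq' or' os' hp hq hr hs hp' hq' hr' hs' zp zq zr zs.
have okM := dc_okM dc; have okB := @dc_okB _ _ _ _ _ _ _ _ dc; have okA := dc_okA dc.
have okZ := @dc_okZ _ _ _ _ _ _ _ _ dc.
have L0 := Bd_ge0 dc hp; have Z0 := Bd_ge0 dc zp.
have prod f g f' g' A B Y Y' : ok f -> ok g -> ok f' -> ok g' ->
    Bd n v P g A -> Bd n v P f' B -> Bd n v P (fun u => f u - f' u) Y -> Bd n v P (fun u => g u - g' u) Y' ->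
    Bd n v P (fun u => f u * g u - f' u * g' u) (Y * A + B * Y').
  move=> of_ og of'_ og' hg hf' hy hy'.
  have -> : (fun u => f u * g u - f' u * g' u) = (fun u => (f u - f' u) * g u + f' u * (g u - g' u)).
    by apply/funext => u; ring.
  by apply: (Bd_add dc); [apply: okM => //; exact: okB|apply: okM => //; exact: okB|
     apply: (Bd_mul dc) => //; exact: okB|apply: (Bd_mul dc) => //; exact: okB].
have z2 := prod _ _ _ _ _ _ _ _ op oq op' oq' hq hp' zp zq.
have z3 := prod _ _ _ _ _ _ _ _ or os or' os' hs hr' zr zs.
have hrs : Bd n v P (fun u => r u * s u) (L * L) by exact: (Bd_mul dc).
have z4 := prod _ _ _ _ _ _ _ _ oq (okM _ _ or os) oq' (okM _ _ or' os') hrs hq' zq z3.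
have hqrs : Bd n v P (fun u => q u * (r u * s u)) (L * (L * L)).
  by apply: (Bd_mul dc) => //; exact: okM.
have -> : (fun u => darboux_rhs c p q r s u - darboux_rhs c' p' q' r' s' u) =
  (fun u => (p u * q u - p' u * q' u) + (c' * (q u * (r u * s u) - q' u * (r' u * s' u)) +
     (c - c') * (q u * (r u * s u)))).
  by apply/funext => u; rewrite /darboux_rhs; ring.
have oqrs := okM _ _ oq (okM _ _ or os).
have oqrs' := okM _ _ oq' (okM _ _ or' os').
have o4 := okB _ _ oqrs oqrs'.
have h := Bd_add dc (okB _ _ (okM _ _ op oq) (okM _ _ op' oq')) (okA _ _ (okZ c' _ o4) (okZ (c - c') _ oqrs)) z2
  (Bd_add dc (okZ c' _ o4) (okZ (c - c') _ oqrs) (Bd_scale dc c' o4 z4) (Bd_scale dc (c - c') oqrs hqrs)).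
apply: Bd_le h.
have -> : (2 * L + 3 * L ^+ 2) * Z + d * L ^+ 3 =
  (Z * L + L * Z) + (1 * (Z * (L * L) + L * (Z * L + L * Z)) + d * (L * (L * L))) by ring.
rewrite lerD2l; apply: lerD; apply: ler_wpM2r => //; last by rewrite !mulr_ge0.
by rewrite !addr_ge0 ?mulr_ge0 ?addr_ge0 ?mulr_ge0.
Qed.

End DarbouxRhs.

Section SmoothCalculus.
Context {R : realType} {m : nat}.
Local Notation pt := 'rV[R]_m.
Implicit Types (g h : pt -> R) (u w : pt) (i j : 'I_m) (P : pred 'I_m).

Lemma coord_padd P i u : coord_subspace (padd P i) u -> coord_subspace P (setc i 0 u).
Proof.
move=> h k Pk; rewrite mxE; case: eqP => // /eqP ki; apply: h.
by move: Pk; rewrite -!topredE /= /padd (negPf ki) orbF.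
Qed.

Lemma smooth_calculus (rho mu : R) : 0 <= rho -> 0 <= mu ->
  difference_calculus (fun=> cube rho) partial (fun _ g => g) (sm setT) rho mu.
Proof.
move=> rho0 mu0; have oT : open [set: pt] by exact: openT.
split.
- exact: rho0.
- exact: mu0.
- by move=> v w _ u.
- by move=> f i; exact: sm_partial.
- by [].
- by move=> f g; exact: sm_add.
- by move=> f g; exact: sm_mul.
- by move=> c; exact: sm_cst.
- move=> f g i hf hg; apply/funext => u.
  exact: deriveD (smT_derivable hf) (smT_derivable hg).
- move=> f g i hf hg; apply/funext => u.
  transitivity (f u *: partial i g u + g u *: partial i f u).
    exact: deriveM (smT_derivable hf) (smT_derivable hg).
  by rewrite addrC [g u *: _]mulrC.
- by move=> c i; apply/funext => u; exact: derive_cst.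
- by move=> f i j hf; apply/funext => u; exact: (partialC i j oT hf).
- by [].
- by move=> f v P i M _.
- move=> f v P i M M' hf Pi hM M'0 hM' u uc uP.
  have e0 : u = setc i 0 u + u 0 i *: unitv i.
    by apply/rowP => k; rewrite addu_coord mxE; case: eqP => [->|]; rewrite ?add0r ?addr0.
  have c0 : cube rho (setc i 0 u).
    by apply/cubeP => k; rewrite mxE; case: ifP; rewrite ?normr0 //; move/cubeP : uc.
  have h0 := hM _ c0 (coord_padd uP).
  rewrite -(subrK (f (setc i 0 u)) (f u)) addrC.
  apply: le_trans (ler_normD _ _) _; apply: lerD => //.
  apply: (@le_trans _ _ (M' * `|u 0 i|)); last first.
    by rewrite mulrC; apply: ler_wpM2r => //; move/cubeP : uc.
  rewrite {1}e0; apply: mvt_bound => s su; split; first exact: smT_derivable.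
  apply: hM'; first by apply: box_segment su => //; rewrite -e0.
  move=> k; rewrite -topredE /= /padd negb_or => /andP[Pk ki].
  rewrite addu_coord mxE (negPf ki) addr0; apply: uP.
  by rewrite -topredE /= /padd negb_or Pk.
Qed.

Lemma sm_sum (I : Type) (r : seq I) (Q : pred I) (F : I -> pt -> R) :
  (forall x, sm setT (F x)) -> sm setT (fun u => \sum_(x <- r | Q x) F x u).
Proof.
move=> hF; elim: r => [|x r IH].
  apply: sm_eq (sm_cst 0 openT); [exact: openT|by move=> u _; rewrite big_nil].
have [Qx|Qx] := boolP (Q x).
  apply: sm_eq (sm_add openT (hF x) IH); [exact: openT|].
  by move=> u _; rewrite big_cons Qx.
by apply: sm_eq IH; [exact: openT|move=> u _; rewrite big_cons (negPf Qx)].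
Qed.

Lemma partial_sum (I : Type) (r : seq I) (Q : pred I) (F : I -> pt -> R) k u :
  (forall x, sm setT (F x)) ->
  partial k (fun u => \sum_(x <- r | Q x) F x u) u = \sum_(x <- r | Q x) partial k (F x) u.
Proof.
move=> hF; elim: r => [|x r IH].
  have -> : (fun u => \sum_(x <- [::] | Q x) F x u) = (fun=> 0).
    by apply/funext => w; rewrite big_nil.
  by rewrite big_nil; exact: derive_cst.
rewrite big_cons; have [Qx|Qx] := boolP (Q x).
  have -> : (fun u => \sum_(x <- x :: r | Q x) F x u) = (fun u => F x u + \sum_(x <- r | Q x) F x u).
    by apply/funext => w; rewrite big_cons Qx.
  rewrite -IH; exact: (deriveD (smT_derivable (hF x)) (smT_derivable (sm_sum r Q hF))).
have -> : (fun u => \sum_(x <- x :: r | Q x) F x u) = (fun u => \sum_(x <- r | Q x) F x u).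
  by apply/funext => w; rewrite big_cons (negPf Qx).
exact: IH.
Qed.

(** A derivative in a direction of P at a point of B_P uses only values on B_P. This allows
    equations that hold merely on a subspace to enter the estimates. *)
Lemma smooth_Bd_congr (rho mu : R) n v P f g M :
  (forall u, coord_subspace P u -> f u = g u) ->
  Bd (fun=> cube rho) partial mu n v P f M -> Bd (fun=> cube rho) partial mu n v P g M.
Proof.
move=> fg; apply: (@Bd_congr _ _ _ _ (fun=> setT)) => //; last by move=> u _; exact: fg.
move=> w i f' g' Pi e u _ uP; rewrite /partial /derive.
have ew (h : R) : f' (h *: unitv i + u) = g' (h *: unitv i + u).
  apply: e => // k Pk; rewrite addrC addu_coord uP // add0r; case: eqP => // ki.
  by move: Pk; rewrite ki -topredE /= Pi.
have e2 : (fun h : R => h^-1 *: ((f' \o shift u) (h *: unitv i) - f' u)) =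
          (fun h : R => h^-1 *: ((g' \o shift u) (h *: unitv i) - g' u)).
  by apply/funext => h /=; rewrite ew (e u).
by rewrite e2.
Qed.

Lemma bound_sm_words (rho : R) g n : sm setT g -> exists2 M, 0 <= M &
  forall v P, Bd (fun=> cube rho) partial 1 n v P g M.
Proof.
move=> hg.
have [M M0 hM] : exists2 M, 0 <= M & forall s u, (size s <= n)%N -> cube rho u -> `|partials s g u| <= M.
  elim: n => [|n [M M0 IH]].
    have [M M0 hM] := smT_bounded rho hg; exists M => // s u.
    by rewrite leqn0 => /nilP ->; exact: hM.
  have [F hF] : exists F : (n.+1).-tuple 'I_m -> R, forall s, 0 <= F s /\ forall u, cube rho u -> `|partials s g u| <= F s.
    have /boolp.choice[F hF] : forall s : (n.+1).-tuple 'I_m, exists N, 0 <= N /\ forall u, cube rho u -> `|partials s g u| <= N.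
      by move=> s; have [N N0 hN] := smT_bounded rho (sm_partials s hg); exists N.
    by exists F.
  exists (M + \sum_s F s); first by rewrite addr_ge0 // sumr_ge0 // => s _; have [] := hF s.
  have S0 : 0 <= \sum_s F s by rewrite sumr_ge0 // => s _; have [] := hF s.
  move=> s u; rewrite leq_eqVlt => /orP[/eqP ss|ss] uc; last first.
    by apply: le_trans (IH s u ss uc) _; rewrite lerDl.
  have ss' : size s == n.+1 by rewrite ss.
  have [F0 /(_ u uc)] := hF (Tuple ss'); rewrite /= => h; apply: le_trans h _.
  rewrite (bigD1 (Tuple ss')) //= addrCA lerDl addr_ge0 // sumr_ge0 // => t _; by have [] := hF t.
exists (M * m.+1%:R ^+ n); first by rewrite mulr_ge0 // exprn_ge0.
by move=> v P; apply: Bd_of_words => // s u ss _ uc _; exact: hM.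
Qed.

End SmoothCalculus.

(** * The smooth Darboux system *)

Section Auxiliary.
Context {R : realType}.

Lemma fin_bound (K : finType) (Q : K -> R -> Prop) :
  (forall k M M', M <= M' -> Q k M -> Q k M') ->
  (forall k, exists2 M, 0 <= M & Q k M) -> exists2 M, 0 <= M & forall k, Q k M.
Proof.
move=> Qle hQ; have /boolp.choice[F hF] : forall k, exists M, 0 <= M /\ Q k M.
  by move=> k; have [M ? ?] := hQ k; exists M.
have F0 k : 0 <= F k by have [] := hF k.
exists (\sum_k F k); first exact: sumr_ge0.
move=> k; have [_] := hF k; apply: Qle.
by rewrite (bigD1 k) //= lerDl sumr_ge0.
Qed.

Lemma small_weight (A c : R) : 0 <= A -> 0 < c -> exists2 mu : R, 0 < mu <= 1 & mu * A <= c.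
Proof.
move=> A0 c0; have A1 : 0 < A + 1 by rewrite ltr_wpDl.
exists (Num.min 1 (c / (A + 1))).
  by rewrite lt_min ltr01 divr_gt0 // ge_min lexx.
apply: (@le_trans _ _ (c / (A + 1) * (A + 1))); last by rewrite divfK // gt_eqF.
apply: ler_pM => //; last by rewrite lerDl.
- by rewrite le_min ler01 divr_ge0 // ltW.
- by rewrite ge_min lexx orbT.
Qed.

(** The intervals with centre [a p] and radius 2C/2^p are nested, and the supremum of their lower
    ends lies in all of them. *)
Lemma geometric_cauchy (a : nat -> R) (C : R) : 0 <= C ->
  (forall p, `|a p.+1 - a p| <= C / 2 ^+ p) ->
  exists l, forall p, `|a p - l| <= 2 * C / 2 ^+ p.
Proof.
move=> C0 ha; pose b p := 2 * C / 2 ^+ p.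
have bS p : b p = 2 * b p.+1.
  by rewrite /b exprS; field; rewrite expf_neq0 // pnatr_eq0.
have bC p : C / 2 ^+ p = b p.+1.
  by rewrite /b exprS; field; rewrite expf_neq0 // pnatr_eq0.
have inc p k : a p - b p <= a (p + k)%N - b (p + k)%N.
  elim: k => [|k IH]; first by rewrite addn0.
  apply: le_trans IH _; rewrite addnS; have := ha (p + k)%N.
  by rewrite bC ler_norml => /andP[h1 h2]; have := bS (p + k)%N; lra.
have dec p k : a (p + k)%N + b (p + k)%N <= a p + b p.
  elim: k => [|k IH]; first by rewrite addn0.
  apply: le_trans IH; rewrite addnS; have := ha (p + k)%N.
  by rewrite bC ler_norml => /andP[h1 h2]; have := bS (p + k)%N; lra.
have b0 p : 0 <= b p by rewrite divr_ge0 // ?exprn_ge0 // mulr_ge0.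
pose E : set R := [set x | exists p, x = a p - b p].
have ub p : ubound E (a p + b p).
  move=> x [q ->]; have [pq|/ltnW qp] := leqP p q.
    by have := dec p (q - p)%N; rewrite subnKC //; have := b0 q; lra.
  by have := inc q (p - q)%N; rewrite subnKC //; have := b0 p; lra.
have hE : has_sup E by split; [exists (a 0%N - b 0%N), 0%N|exists (a 0%N + b 0%N)].
exists (sup E) => p; rewrite ler_distl -/(b p); apply/andP; split.
  by have := ge_sup hE.1 (ub p); lra.
have : a p - b p <= sup E by apply: sup_upper_bound => //; exists p.
by lra.
Qed.

Lemma le0_of_geometric (x C : R) : (forall p : nat, x <= C / 2 ^+ p) -> x <= 0.
Proof.
move=> h; rewrite leNgt; apply/negP => x0.
have [k hk] : exists k, C / 2 ^+ k < x.
  exists (Num.trunc (C / x)).+1; rewrite ltr_pdivrMr ?exprn_gt0 // mulrC -ltr_pdivrMr //.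
  apply: lt_le_trans (truncnS_gt _) _; rewrite -natrX ler_nat; exact: ltnW (ltn_expl _ _).
by have := h k; rewrite leNgt hk.
Qed.

End Auxiliary.

Section SmoothLimit.
Context {R : realType} {m : nat}.
Local Notation pt := 'rV[R]_m.
Implicit Types (g : pt -> R) (u w : pt) (i j : 'I_m).

Definition ocube (a : R) : set pt := [set u | forall k, `|u 0 k| < a].

Lemma ocube_open a : open (ocube a).
Proof.
move=> u hu; pose d := \big[Num.min/1]_k (a - `|u 0 k|).
have d0 : 0 < d.
  by rewrite /d; elim/big_ind : _ => // [x y ? ?|k _]; [rewrite lt_min; apply/andP|rewrite subr_gt0].
apply/nbhs_boxP; exists d => // w hw k.
have dk : d <= a - `|u 0 k| by rewrite /d (bigD1 k) //= ge_min lexx.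
rewrite -(subrK (u 0 k) (w 0 k)); apply: le_lt_trans (ler_normD _ _) _.
by have := hw k; lra.
Qed.

Lemma ocube_cube a : ocube a `<=` cube a.
Proof. by move=> u hu; apply/cubeP => k; exact: ltW. Qed.

Lemma ocube_nbhs a u : ocube a u -> exists2 d : R, 0 < d &
  forall w, (forall k, `|w 0 k - u 0 k| <= d) -> ocube a w.
Proof.
move=> /(@ocube_open a) /nbhs_boxP[d d0 h]; exists (d / 2); first by rewrite divr_gt0.
by move=> w hw; apply: h => k; apply: le_lt_trans (hw k) _; lra.
Qed.

(** All derivatives converge at a geometric rate, so the Taylor bounds of the approximations pass to
    the limit. The quadratic remainder then identifies the limit of the derivatives along [i :: s]
    as the i-th derivative of the limit along [s]. The open cube leaves room for small
    increments. *)
Lemma smooth_limit (a : R) (g : nat -> pt -> R) :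
  (forall p, sm setT (g p)) ->
  (forall s, exists2 C, 0 <= C & forall p u, cube a u ->
     `|partials s (g p.+1) u - partials s (g p) u| <= C / 2 ^+ p) ->
  exists f, sm (ocube a) f /\ forall s, exists2 C, 0 <= C & forall p u, ocube a u ->
     `|partials s (g p) u - partials s f u| <= C / 2 ^+ p.
Proof.
move=> hg hC.
have /boolp.choice[C hC'] : forall s, exists C, 0 <= C /\ forall p u, cube a u ->
     `|partials s (g p.+1) u - partials s (g p) u| <= C / 2 ^+ p.
  by move=> s; have [C ? ?] := hC s; exists C.
have C0 s : 0 <= C s by have [] := hC' s.
have /boolp.choice[G hG] : forall su : seq 'I_m * pt, exists l, cube a su.2 -> forall p,
     `|partials su.1 (g p) su.2 - l| <= 2 * C su.1 / 2 ^+ p.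
  move=> [s u] /=; have [uc|nuc] := pselect (cube a u); last by exists 0.
  have [l hl] := geometric_cauchy (C0 s) (fun p => (hC' s).2 p u uc).
  by exists l.
have {}hG s u p : cube a u -> `|partials s (g p) u - G (s, u)| <= 2 * C s / 2 ^+ p.
  by move=> uc; exact: (hG (s, u) uc p).
have hpos p (A : R) : 0 <= A -> A / 2 ^+ p <= A.
  by move=> A0; rewrite ler_pdivrMr ?exprn_gt0 // ler_peMr // exprn_ege1 // ler1n.
have bnd s : exists2 M, 0 <= M & forall p u, cube a u -> `|partials s (g p) u| <= M.
  have [M M0 hM] := smT_bounded a (sm_partials s (hg 0%N)).
  have C20 : 0 <= 2 * C s by rewrite mulr_ge0.
  exists (M + 2 * C s + 2 * C s); first by rewrite !addr_ge0.
  move=> p u uc; have h0 := hG s u 0%N uc; have hp := hG s u p uc.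
  have -> : partials s (g p) u = partials s (g 0%N) u - (partials s (g 0%N) u - G (s, u))
      + (partials s (g p) u - G (s, u)) by ring.
  apply: le_trans (ler_normD _ _) _; apply: lerD; last exact: le_trans hp (hpos p _ C20).
  apply: le_trans (ler_normB _ _) _; apply: lerD; first exact: hM.
  exact: le_trans h0 (hpos _ _ C20).
have derG s i u : ocube a u -> derivable (fun w => G (s, w)) u (unitv i) /\
     partial i (fun w => G (s, w)) u = G (i :: s, u).
  move=> ua; have [d d0 hd] := ocube_nbhs ua.
  have [M M0 hM] := bnd [:: i, i & s].
  apply: (@partial_of_quadratic _ _ _ _ _ _ M d) => // t td.
  have seg x : `|x| <= `|t| -> ocube a (u + x *: unitv i).
    move=> xt; apply: hd => k; rewrite addu_coord addrC addKr.
    by case: ifP => _; [exact: le_trans xt (ltW td)|rewrite normr0 ltW].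
  have taylor p : `|partials s (g p) (u + t *: unitv i) - partials s (g p) u -
       t * partials (i :: s) (g p) u| <= M * t ^+ 2.
    apply: taylor_bound => x /btw_norm xt; split.
    - exact: smT_derivable (sm_partials s (hg p)).
    - exact: smT_derivable (sm_partials (i :: s) (hg p)).
    - by apply: hM; apply: ocube_cube; exact: seg.
  have ct : cube a (u + t *: unitv i) by apply: ocube_cube; exact: seg.
  have cu := ocube_cube ua.
  rewrite -subr_le0.
  pose B := C s + C s + `|t| * C (i :: s).
  have Bp (p : nat) : `|G (s, u + t *: unitv i) - G (s, u) - t * G (i :: s, u)| - M * t ^+ 2 <= 2 * B / 2 ^+ p.
    rewrite lerBlDl.
    have -> : G (s, u + t *: unitv i) - G (s, u) - t * G (i :: s, u) =
      (partials s (g p) (u + t *: unitv i) - partials s (g p) u - t * partials (i :: s) (g p) u)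
      - ((partials s (g p) (u + t *: unitv i) - G (s, u + t *: unitv i)) - (partials s (g p) u - G (s, u))
         - t * (partials (i :: s) (g p) u - G (i :: s, u))) by ring.
    apply: le_trans (ler_normB _ _) _; apply: lerD; first exact: taylor.
    have -> : 2 * B / 2 ^+ p = 2 * C s / 2 ^+ p + 2 * C s / 2 ^+ p + `|t| * (2 * C (i :: s) / 2 ^+ p).
      by rewrite /B !mulrDr !mulrDl; ring.
    apply: le_trans (ler_normB _ _) _; apply: lerD.
      by apply: le_trans (ler_normB _ _) _; apply: lerD; exact: hG.
    by rewrite normrM ler_wpM2l //; exact: hG.
  exact: le0_of_geometric Bp.
have smG s : sm (ocube a) (fun w => G (s, w)).
  apply: (@sm_coind _ _ _ (fun f => exists s, f = fun w => G (s, w))); [exact: ocube_open| |by exists s].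
  move=> f [{}s ->]; split; last first.
    by move=> i; exists (fun w => G (i :: s, w)); [exists (i :: s)|move=> u ua; exact: (derG s i u ua).2].
  move=> u ua; split; last by move=> i; exact: (derG s i u ua).1.
  apply: continuous_of_bounded_partials; have [d d0 hd] := ocube_nbhs ua; exists d => //.
  have /fin_bound[] : forall i, exists2 M, 0 <= M & forall w, ocube a w -> `|G (i :: s, w)| <= M.
    move=> i; have [M M0 hM] := bnd (i :: s); exists (M + 2 * C (i :: s)).
      by rewrite addr_ge0 // mulr_ge0.
    move=> w wa; have wc := ocube_cube wa.
    rewrite -[G _](subKr (partials (i :: s) (g 0%N) w)).
    apply: le_trans (ler_normB _ _) _; apply: lerD; first exact: hM.
    by have := hG (i :: s) w 0%N wc; rewrite expr0 divr1.
  - by move=> i M M' MM' h w wa; exact: le_trans (h w wa) MM'.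
  - move=> M M0 hM; exists M => w hw k; have wa := hd w hw.
    by have [dd ->] := derG s k w wa; split=> //; exact: hM.
have parG s u : ocube a u -> partials s (fun w => G ([::], w)) u = G (s, u).
  elim: s u => [//|i s IH] u ua.
  rewrite -(derG s i u ua).2.
  exact: (@partial_eq_on _ _ R^o (ocube a) _ _ i (@ocube_open a) IH u ua).
exists (fun w => G ([::], w)); split; first exact: smG.
move=> s; exists (2 * C s); first by rewrite mulr_ge0.
by move=> p u ua; rewrite parG //; apply: hG; exact: ocube_cube.
Qed.

End SmoothLimit.

Section Picard.
Context {R : realType} {m : nat} {T : finType}.
Local Notation pt := 'rV[R]_m.
Local Notation J := ('I_m + T)%type.
Implicit Types (u w : pt) (i l : 'I_m) (j k : J) (x y : J -> J -> pt -> R).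
Context (kap : J -> R) (phi : J -> J -> pt -> R).

Definition static j k : pred 'I_m := fun l => (inl l == j) || (inl l == k).

Definition darboux i x j k : pt -> R :=
  darboux_rhs (kap k) (x j (inl i)) (x (inl i) k) (x k (inl i)) (x j k).

(* A solution of the Darboux system in which component (j,k), prescribed on
   the subspace [static j k], is transported along the coordinate directions in
   increasing order. Only the equations used on the way are asserted. *)
Fixpoint picard p : J -> J -> pt -> R :=
  match p with
  | 0 => phi
  | p'.+1 => fun j k u => phi j k u + \sum_(i | ~~ static j k i)
      prim_dir i (darboux i (picard p') j k) (proj (ppath (static j k) i.+1) u)
  end.

Hypothesis kap1 : forall k, `|kap k| <= 1.
Hypothesis phi_sm : forall j k, sm setT (phi j k).
Hypothesis phi_static : forall j k u, phi j k (proj (static j k) u) = phi j k u.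

Lemma sm_darboux i x j k : (forall j k, sm setT (x j k)) -> sm setT (darboux i x j k).
Proof.
move=> hx; have oT : open [set: pt] by exact: openT.
apply: sm_add => //; first exact: sm_mul.
by apply: sm_mul => //; [exact: sm_cst|apply: sm_mul => //; exact: sm_mul].
Qed.

Lemma sm_comp_proj (P : pred 'I_m) g : sm setT g -> sm setT (fun u : pt => g (proj P u)).
Proof.
move=> hg; apply: sm_proj => s _; split.
  by apply: continuous_subspaceT => u; exact: (sm_continuous (sm_partials s hg)).
by move=> u i _ _; exact: smT_derivable (sm_partials s hg).
Qed.

Lemma sm_picard p j k : sm setT (picard p j k).
Proof.
elim: p j k => [|p IH] j k /=; first exact: phi_sm.
apply: sm_add; [exact: openT|exact: phi_sm|].
apply: (@sm_sum _ _ _ _ _ (fun i u => prim_dir i (darboux i (picard p) j k) (proj (ppath (static j k) i.+1) u))).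
by move=> i; apply: sm_comp_proj; apply: sm_prim_dir; exact: sm_darboux.
Qed.

Lemma partials_sub s (f g : pt -> R) : sm setT f -> sm setT g ->
  partials s (fun u => f u - g u) = fun u => partials s f u - partials s g u.
Proof.
move=> hf hg; elim: s => [//|i s IH]; apply/funext => u.
rewrite [partials (i :: s) _]/= -/(partials s _) IH.
exact: (deriveB (smT_derivable (sm_partials s hf)) (smT_derivable (sm_partials s hg))).
Qed.

Lemma cvg_of_geometric (a : nat -> R) (l C : R) : (forall p, `|a p - l| <= C / 2 ^+ p) -> a @ \oo --> l.
Proof.
move=> h; have C0 : 0 <= C by have := h 0%N; rewrite expr0 divr1; exact: le_trans.
apply/cvgrPdist_le => e e0; exists (Num.trunc (C / e)).+1 => // p /= hp.
rewrite distrC; apply: le_trans (h p) _; rewrite ler_pdivrMr ?exprn_gt0 // mulrC -ler_pdivrMr //.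
apply: le_trans (ltW (truncnS_gt _)) _; rewrite -natrX ler_nat.
exact: leq_trans hp (ltnW (ltn_expl _ _)).
Qed.

Lemma picard_data p j k u : coord_subspace (static j k) u -> picard p j k u = phi j k u.
Proof.
case: p => //= p us; rewrite big1 ?addr0 // => i Si.
apply: prim_dir0; first by move=> w; apply: smT_derivable; apply: sm_darboux; exact: sm_picard.
by rewrite mxE; case: ifP => // _; apply: us; rewrite -topredE.
Qed.

Lemma phi_partial j k i u : ~~ static j k i -> partial i (phi j k) u = 0.
Proof.
move=> Si; have -> : phi j k = fun u => phi j k (proj (static j k) u).
  by apply/funext => w; rewrite phi_static.
by rewrite (partial_proj _).2 (negPf Si).
Qed.

(** On this subspace only the summand i contributes: a summand l < i does not depend on u_i because
    of its projection, and a summand l > i vanishes together with its i-th derivative, since u_l = 0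
    there. *)
Lemma picard_eq p j k i u : ~~ static j k i -> coord_subspace (ppath (static j k) i.+1) u ->
  partial i (picard p.+1 j k) u = darboux i (picard p) j k u.
Proof.
move=> Si uP; have smd l : sm setT (darboux l (picard p) j k).
  by apply: sm_darboux; exact: sm_picard.
have smF l : sm setT (fun u => prim_dir l (darboux l (picard p) j k) (proj (ppath (static j k) l.+1) u)).
  by apply: sm_comp_proj; exact: sm_prim_dir.
have smS := sm_sum (index_enum _) (fun i => ~~ static j k i) smF.
transitivity (partial i (phi j k) u + partial i (fun u => \sum_(i | ~~ static j k i)
      prim_dir i (darboux i (picard p) j k) (proj (ppath (static j k) i.+1) u)) u).
  exact: (deriveD (smT_derivable (phi_sm j k)) (smT_derivable smS)).
rewrite phi_partial // add0r (partial_sum _ _ _ _ smF) (bigD1 i) //=.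
rewrite big1 ?addr0 => [|l /andP[Sl li]].
  rewrite (partial_proj _).2 /ppath ltnS leqnn orbT; last by move=> _; exact: smT_derivable (sm_prim_dir i (smd i)).
  rewrite -/(ppath _ _) proj_id //; apply: (prim_dir_derivable u _).2.
  by move=> w; exact: smT_derivable (smd i).
rewrite (partial_proj _).2; last by move=> _; exact: smT_derivable (sm_prim_dir l (smd l)).
case: ifP => // il.
rewrite (prim_dir_partial _ li (smd l)).2.
apply: prim_dir0; first by move=> w; exact: smT_derivable (sm_partial i (smd l)).
rewrite mxE; case: ifP => // _; apply: uP; rewrite -topredE /= /ppath negb_or Sl /= -leqNgt ltn_neqAle eq_sym.
move: il; rewrite /ppath (negPf Si) /= ltnS => ->; rewrite andbT.
by apply: contra li => /eqP e; apply/eqP/val_inj.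
Qed.

Context (rho K : R).
Hypotheses (rho0 : 0 < rho) (K0 : 0 < K).
Hypothesis phi_bound : forall j k u, cube rho u -> `|phi j k u| <= K.
Local Notation L := (3 * K).
Hypothesis small_growth : m%:R * rho * (L ^+ 2 + L ^+ 3) <= K / 2.
Hypothesis small_contraction : m%:R * rho * (2 * L + 3 * L ^+ 2) <= 4^-1.

(** The conditions on [rho] use half of the allowed amounts, which leaves room for the terms with
    mu. The ball has radius L = 3K: 2K for the data in the weighted norm and K for the growth along
    the path. *)
Lemma picard_weight n : exists2 mu, 0 < mu <= 1 &
  [/\ forall v P j k, Bd (fun=> cube rho) partial mu n v P (phi j k) (2 * K),
      m%:R * ((rho + n%:R * mu) * (L ^+ 2 + L ^+ 3)) <= K
    & m%:R * ((rho + n%:R * mu) * (2 * L + 3 * L ^+ 2)) <= 2^-1].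
Proof.
have [C C0 hC] : exists2 C, 0 <= C & forall jk : J * J, forall v P,
    Bd (fun=> cube rho) partial 1 n v P (phi jk.1 jk.2) C.
  apply: fin_bound => [jk M M' MM' h v P|[j k]]; first exact: Bd_le (h v P).
  have [M M0 hM] := bound_sm_words rho n (phi_sm j k); by exists M.
have L0 : 0 < L by rewrite mulr_gt0.
have sg := small_growth; have sc := small_contraction.
set A1 := L ^+ 2 + L ^+ 3 in sg *; set A2 := 2 * L + 3 * L ^+ 2 in sc *.
have A10 : 0 <= A1 by rewrite addr_ge0 // exprn_ge0 // ltW.
have A20 : 0 <= A2 by rewrite addr_ge0 // mulr_ge0 // ?exprn_ge0 // ltW.
have c0 : 0 < Num.min (K / 2) (4^-1 : R) by rewrite lt_min divr_gt0 //= invr_gt0.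
have A0 : 0 <= C + m%:R * n%:R * A1 + m%:R * n%:R * A2.
  by rewrite !addr_ge0 // !mulr_ge0.
have [mu mu1 hmu] := small_weight A0 c0.
exists mu => //; have /andP[mu0 mule1] := mu1.
move: hmu; rewrite le_min => /andP[h1 h2].
have p1 : 0 <= mu * (m%:R * n%:R * A1) by rewrite !mulr_ge0 // ltW.
have p2 : 0 <= mu * (m%:R * n%:R * A2) by rewrite !mulr_ge0 // ltW.
have p3 : 0 <= mu * C by rewrite mulr_ge0 // ltW.
clearbody A1 A2.
have e : mu * (C + m%:R * n%:R * A1 + m%:R * n%:R * A2) =
  mu * C + mu * (m%:R * n%:R * A1) + mu * (m%:R * n%:R * A2) by ring.
rewrite e in h1 h2.
split.
- move=> v P j k; apply: (@Bd_le _ _ _ _ _ _ _ _ _ (K + mu * C)); first by lra.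
  apply: Bd_small_weight; [by rewrite (ltW mu0)| |exact: (hC (j, k))].
  by split; [exact: ltW|move=> u uc _; exact: phi_bound].
- have -> : m%:R * ((rho + n%:R * mu) * A1) = m%:R * rho * A1 + mu * (m%:R * n%:R * A1) by ring.
  by lra.
- have -> : m%:R * ((rho + n%:R * mu) * A2) = m%:R * rho * A2 + mu * (m%:R * n%:R * A2) by ring.
  by lra.
Qed.

(** The iterates stay in the ball of radius L, on which the right-hand side is Lipschitz. Since they
    all agree on the data subspaces, [Bd_path] halves the distance of consecutive iterates. *)
Lemma picard_bounds n mu : 0 < mu <= 1 ->
  (forall v P j k, Bd (fun=> cube rho) partial mu n v P (phi j k) (2 * K)) ->
  m%:R * ((rho + n%:R * mu) * (L ^+ 2 + L ^+ 3)) <= K ->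
  m%:R * ((rho + n%:R * mu) * (2 * L + 3 * L ^+ 2)) <= 2^-1 ->
  forall p v j k,
    Bd (fun=> cube rho) partial mu n v predT (picard p j k) L /\
    Bd (fun=> cube rho) partial mu n v predT
      (fun u => picard p.+1 j k u - picard p j k u) (2 * L / 2 ^+ p).
Proof.
move=> /andP[mu0 mu1] hphi h1 h2.
have dc := smooth_calculus (ltW rho0) (ltW mu0) : difference_calculus (m := m) _ _ _ _ _ _.
have L0 : 0 < L by rewrite mulr_gt0.
have A1 : 0 <= L ^+ 2 + L ^+ 3 by rewrite addr_ge0 // exprn_ge0 // ltW.
have A2 : 0 <= 2 * L + 3 * L ^+ 2 by rewrite addr_ge0 // mulr_ge0 // ?exprn_ge0 // ltW.
have ball p v j k : Bd (fun=> cube rho) partial mu n v predT (picard p j k) L.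
  elim: p v j k => [|p IH] v j k; first by apply: Bd_le (hphi v predT j k); lra.
  apply: (@Bd_le _ _ _ _ _ _ _ _ _ (2 * K + m%:R * ((rho + n%:R * mu) * (L ^+ 2 + L ^+ 3)))); first by lra.
  apply: (Bd_path dc (sm_picard p.+1 j k) A1).
    apply: (smooth_Bd_congr _ (hphi v (static j k) j k)) => u us; apply/esym; exact: (@picard_data p.+1).
  move=> i Si; apply: (@smooth_Bd_congr _ _ _ _ _ _ _ (darboux i (picard p) j k)).
    by move=> u uP; apply/esym; exact: picard_eq.
  apply: (Bd_rhs dc (kap1 k)); try exact: sm_picard;
  by apply: (Bd_subP dc) (IH _ _ _).
move=> p v j k; split; first exact: ball.
elim: p v j k => [|p IH] v j k.
  rewrite expr0 divr1 mulrDl mul1r; apply: (Bd_sub2 dc); [exact: sm_picard|exact: sm_picard|exact: ball|exact: ball].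
have sB q j' k' : sm setT (fun u => picard q.+1 j' k' u - picard q j' k' u).
  by apply: sm_sub2; [exact: openT|exact: sm_picard|exact: sm_picard].
have Z0 : 0 <= 2 * L / 2 ^+ p by rewrite divr_ge0 ?exprn_ge0 // mulr_ge0 // ltW.
apply: (@Bd_le _ _ _ _ _ _ _ _ _ (0 + m%:R * ((rho + n%:R * mu) *
   ((2 * L + 3 * L ^+ 2) * (2 * L / 2 ^+ p) + 0 * L ^+ 3)))).
  have -> : 2 * L / 2 ^+ p.+1 = 2^-1 * (2 * L / 2 ^+ p).
    by rewrite exprS; field; rewrite expf_neq0 // pnatr_eq0.
  have := ler_wpM2r Z0 h2; rewrite add0r mul0r addr0 !mulrA; exact.
apply: (Bd_path (S := static j k) dc (sB p.+1 j k)).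
- by rewrite mul0r addr0 mulr_ge0.
- apply: (@smooth_Bd_congr _ _ _ _ _ _ _ (fun=> 0)); last by have := Bd_const dc n v (static j k) 0; rewrite normr0.
  by move=> u us; rewrite (@picard_data p.+2) // (@picard_data p.+1) // subrr.
- move=> i Si; apply: (@smooth_Bd_congr _ _ _ _ _ _ _ (fun u => darboux i (picard p.+1) j k u - darboux i (picard p) j k u)).
    move=> u uP; rewrite -!picard_eq //; apply/esym.
    exact: (deriveB (smT_derivable (sm_picard p.+2 j k)) (smT_derivable (sm_picard p.+1 j k))).
  apply: (Bd_rhs_diff dc (kap1 k) (kap1 k)); try exact: sm_picard; rewrite ?subrr ?normr0 //;
  by apply: (Bd_subP dc) => //; first [exact: ball|exact: IH].
Qed.

Theorem darboux_path_solution : exists gam : J -> J -> pt -> R,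
  [/\ forall j k, sm (ocube rho) (gam j k),
      forall j k u, ocube rho u -> coord_subspace (static j k) u -> gam j k u = phi j k u,
      forall j k i u, ocube rho u -> ~~ static j k i ->
        coord_subspace (ppath (static j k) i.+1) u ->
        partial i (gam j k) u = darboux i gam j k u
    & forall j k u, ocube rho u ->
        `|gam j k u - phi j k u| <= m%:R * rho * (L ^+ 2 + L ^+ 3)].
Proof.
have /boolp.choice[gam hgam] : forall jk : J * J, exists gam : pt -> R, sm (ocube rho) gam /\
   forall s, exists2 C, 0 <= C & forall p u, ocube rho u ->
     `|partials s (picard p jk.1 jk.2) u - partials s gam u| <= C / 2 ^+ p.
  move=> -[j k] /=; apply: smooth_limit; first by move=> p; exact: sm_picard.
  (* The weight depends on the length of s, the cube does not, so all derivatives converge on the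
     same cube. *)
  move=> s; have [mu mu1 [b1 b2 b3]] := picard_weight (size s).
  have h := picard_bounds mu1 b1 b2 b3; have /andP[mu0 _] := mu1.
  exists (2 * L / mu ^+ size s); first by rewrite divr_ge0 ?exprn_ge0 ?mulr_ge0 // ltW.
  move=> p u uc; have [_ hp] := h p (fun=> 0%N) j k.
  have hw := Bd_word (Bd_unit_weight mu1 hp) (leqnn (size s)) (all_predT s) uc.
  have -> : partials s (picard p.+1 j k) u - partials s (picard p j k) u =
     partials s (fun u => picard p.+1 j k u - picard p j k u) u.
    by rewrite partials_sub //; exact: sm_picard.
  by rewrite mulrAC; apply: hw => k'.
exists (fun j k => gam (j, k)).
have cv s j k u : ocube rho u -> (fun p => partials s (picard p j k) u) @ \oo --> partials s (gam (j, k)) u.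
  by move=> uc; have [_ /(_ s) [C C0 hC]] := hgam (j, k); apply: cvg_of_geometric => p; exact: hC.
split.
- by move=> j k; have [] := hgam (j, k).
- move=> j k u uc us; have := cv [::] j k u uc => /=.
  have -> : (fun p => picard p j k u) = fun=> phi j k u by apply/funext => p; exact: picard_data.
  by move=> /cvg_lim <- //; rewrite lim_cst.
- move=> j k i u uc Si uP.
  have c1 := cv [:: i] j k u uc; rewrite -cvg_shiftS /= in c1.
  have c2 : (fun p => darboux i (picard p) j k u) @ \oo --> darboux i (fun j k => gam (j, k)) j k u.
    apply: cvgD; first by apply: cvgM; [exact: (cv [::] j (inl i) u uc)|exact: (cv [::] (inl i) k u uc)].
    apply: cvgM; first exact: cvg_cst.
    apply: cvgM; first exact: (cv [::] (inl i) k u uc).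
    by apply: cvgM; [exact: (cv [::] k (inl i) u uc)|exact: (cv [::] j k u uc)].
  apply: (cvg_unique _ c1); first exact: Rhausdorff.
  have -> : (fun n => partial i (picard n.+1 j k) u) = (fun p => darboux i (picard p) j k u).
    by apply/funext => p; exact: picard_eq.
  exact: c2.
- move=> j k u uc; have c1 := cv [::] j k u uc; rewrite -cvg_shiftS /= in c1.
  have [mu mu1 [b1 b2 b3]] := picard_weight 0; have h := picard_bounds mu1 b1 b2 b3.
  have bound p : `|picard p.+1 j k u - phi j k u| <= m%:R * rho * (L ^+ 2 + L ^+ 3).
    have /andP[mu0 _] := mu1.
    have dc := smooth_calculus (ltW rho0) (ltW mu0) : difference_calculus (m := m) _ _ _ _ _ _.
    have A1 : 0 <= L ^+ 2 + L ^+ 3 by rewrite addr_ge0 // exprn_ge0 // mulr_ge0 // ltW.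
    have sB : sm setT (fun u => picard p.+1 j k u - phi j k u).
      by apply: sm_sub2; [exact: openT|exact: sm_picard|exact: phi_sm].
    have uT : coord_subspace (predT : pred 'I_m) u by move=> l; rewrite -topredE.
    have [||_ /(_ u (ocube_cube uc) uT)] := Bd_path dc (n := 0) (v := fun=> 0%N) (S := static j k) sB A1 (M := 0).
    + apply: (@smooth_Bd_congr _ _ _ _ 0 _ _ (fun=> 0)); last by have := Bd_const dc 0 (fun=> 0%N) (static j k) 0; rewrite normr0.
      by move=> w ws; rewrite (@picard_data p.+1) // subrr.
    + move=> i Si; apply: (@smooth_Bd_congr _ _ _ _ _ _ _ (darboux i (picard p) j k)).
        move=> w wP; rewrite -picard_eq // -[LHS]subr0 -(phi_partial w Si); apply/esym.
        exact: (deriveB (smT_derivable (sm_picard p.+1 j k)) (smT_derivable (phi_sm j k))).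
      apply: (Bd_rhs dc (kap1 k)); try exact: sm_picard;
      by apply: (Bd_subP dc) => //; exact: (h _ _ _ _).1.
    + by rewrite add0r mul0r addr0 mulrA.
  have c2 : (fun p => `|picard p.+1 j k u - phi j k u|) @ \oo --> `|gam (j, k) u - phi j k u|.
    by apply: cvg_norm; apply: cvgB => //; exact: cvg_cst.
  rewrite -(cvg_lim (@Rhausdorff R) c2); apply: limr_le; first exact: cvgP c2.
  exact: nearW.
Qed.


End Picard.

(** * Difference calculus on lattices *)

Section DiscreteCalculus.
Context {R : realType} {m : nat}.
Local Notation pt := 'rV[R]_m.
Implicit Types (g h : pt -> R) (u w : pt) (i j : 'I_m) (P : pred 'I_m) (v nu : 'I_m -> nat).

Definition latt (eps : R) nu : pt := \row_k (eps * (nu k)%:R).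

Definition Ldom (eps r : R) v : set pt :=
  [set u | exists nu, u = latt eps nu /\ forall k, eps * (nu k + v k)%:R <= r].

Definition dl (eps : R) i g : pt -> R := fun u => eps^-1 * (g (u + eps *: unitv i) - g u).

Lemma latt_vadd eps nu i : latt eps (vadd nu i) = latt eps nu + eps *: unitv i.
Proof.
apply/rowP => k; rewrite addu_coord !mxE /vadd natrD mulrDr.
by case: (k == i); rewrite ?mulr1 ?mulr0.
Qed.

Lemma Ldom_shift eps r v i u : Ldom eps r (vadd v i) u -> Ldom eps r v (u + eps *: unitv i).
Proof.
move=> [nu [-> h]]; exists (vadd nu i); rewrite latt_vadd; split => // k.
by rewrite /vadd -addnA [((k == i) + _)%N]addnC; exact: h.
Qed.

Lemma Ldom_le eps r v v' : 0 < eps -> (forall k, v k <= v' k)%N -> Ldom eps r v' `<=` Ldom eps r v.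
Proof.
move=> e0 vw u [nu [-> h]]; exists nu; split=> // k; apply: le_trans (h k).
by rewrite ler_pM2l // ler_nat leq_add2l.
Qed.

Lemma Ldom_box eps r v u : 0 < eps -> Ldom eps r v u -> box r u.
Proof.
move=> e0 [nu [-> h]] k; rewrite mxE mulr_ge0 ?(ltW e0) //=.
by apply: le_trans (h k); rewrite ler_pM2l // ler_nat leq_addr.
Qed.

Lemma coord_shift P i u (t : R) : P i -> coord_subspace P u -> coord_subspace P (u + t *: unitv i).
Proof.
move=> Pi uP k Pk; rewrite addu_coord uP // add0r; case: eqP => // ki.
by move: Pk; rewrite ki -topredE /= Pi.
Qed.

Lemma dlC eps i j g : dl eps i (dl eps j g) = dl eps j (dl eps i g).
Proof. by apply/funext => u; rewrite /dl [u + _ + _ *: unitv j]addrAC; ring. Qed.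

Lemma discrete_calculus (eps r mu : R) : 0 < eps -> 0 <= r -> 0 <= mu ->
  difference_calculus (Ldom eps r) (dl eps) (fun i g => tau eps i g) (fun=> True) r mu.
Proof.
move=> e0 r0 mu0; split => //.
- by move=> v v'; exact: Ldom_le.
- by move=> f g i _ _; apply/funext => u; rewrite /dl; ring.
- by move=> f g i _ _; apply/funext => u; rewrite /dl /tau; ring.
- by move=> c i; apply/funext => u; rewrite /dl subrr mulr0.
- by move=> f i j _; exact: dlC.
- by move=> f i j; apply/funext => u; rewrite /dl /tau [u + _ + _ *: unitv j]addrAC.
- move=> f v P i M Pi h u du uP; apply: h; first exact: Ldom_shift.
  exact: coord_shift.
- move=> f v P i M M' _ nPi hM M'0 hM' u [nu [-> hnu]] uP.
  (* [up n] moves the lattice point to height n in direction i. At height 0 it lies in B_P, and the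
     steps up to height [nu i] form a path of length at most r. *)
  pose up n : 'I_m -> nat := fun k => if k == i then n else nu k.
  have up_nu : up (nu i) = nu by apply/funext => k; rewrite /up; case: eqP => [->|].
  have upS n : up n.+1 = vadd (up n) i.
    by apply/funext => k; rewrite /up /vadd; case: eqP => _; rewrite ?addn1 ?addn0.
  have nu0 k : ~~ padd P i k -> (nu k)%:R = 0 :> R.
    move=> nPk; have := uP k; rewrite -topredE /= => /(_ nPk); rewrite mxE => /eqP.
    by rewrite mulf_eq0 (gt_eqF e0) /= => /eqP.
  have inP n : coord_subspace (padd P i) (latt eps (up n)).
    move=> k; rewrite -topredE /= => nPk; rewrite mxE /up.
    have /negPf -> : k != i by apply: contra nPk => /eqP ->; rewrite /padd eqxx orbT.
    by rewrite nu0 // mulr0.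
  have dn n k : (n <= nu i)%N -> eps * (up n k + v k)%:R <= r.
    move=> nn; apply: le_trans (hnu k); rewrite ler_pM2l // ler_nat leq_add2r /up.
    by case: eqP => [->|].
  have claim n : (n <= nu i)%N -> `|f (latt eps (up n))| <= M + (eps * n%:R) * M'.
    elim: n => [_|n IH nn].
      rewrite mulr0 mul0r addr0; apply: hM; first by exists (up 0%N); split => // k; exact: dn.
      move=> k; rewrite -topredE /= => nPk; rewrite mxE /up; case: eqP => [_|/eqP ki]; first by rewrite mulr0.
      by rewrite nu0 ?mulr0 // /padd negb_or nPk.
    have h := IH (ltnW nn).
    have hd : `|dl eps i f (latt eps (up n))| <= M'.
      apply: hM'; last exact: inP.
      exists (up n); split => // k; have := dn n.+1 k nn; rewrite upS /vadd.
      by rewrite -addnA [((k == i) + _)%N]addnC.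
    rewrite upS latt_vadd.
    have -> : f (latt eps (up n) + eps *: unitv i) = f (latt eps (up n)) + eps * dl eps i f (latt eps (up n)).
      by rewrite /dl mulVKf ?gt_eqF //; ring.
    apply: le_trans (ler_normD _ _) _; rewrite normrM gtr0_norm //.
    have : eps * `|dl eps i f (latt eps (up n))| <= eps * M' by rewrite ler_pM2l.
    by rewrite -natr1; lra.
  have := claim _ (leqnn _); rewrite up_nu => h; apply: le_trans h _.
  rewrite lerD2l; apply: ler_wpM2r => //; apply: le_trans (hnu i).
  by rewrite ler_pM2l // ler_nat leq_addr.
Qed.

Lemma discrete_Bd_congr eps r mu n v P f g M :
  (forall u, Ldom eps r v u -> coord_subspace P u -> f u = g u) -> 0 < eps ->
  Bd (Ldom eps r) (dl eps) mu n v P f M -> Bd (Ldom eps r) (dl eps) mu n v P g M.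
Proof.
move=> fg e0; apply: (@Bd_congr _ _ _ _ (Ldom eps r)) => [v' u //|w i f' g' Pi e u du uP|//].
rewrite /dl !e //; first by apply: Ldom_le du => // k; exact: le_vadd.
- exact: Ldom_shift.
- exact: coord_shift.
Qed.

(* crude bound at a fixed mesh size; it only serves to start an iteration *)
Lemma discrete_crude eps r mu n v P g M : 0 < eps -> 0 <= mu ->
  Bd (Ldom eps r) (dl eps) mu 0 v P g M -> exists2 M', 0 <= M' & Bd (Ldom eps r) (dl eps) mu n v P g M'.
Proof.
move=> e0 mu0; elim: n v g M => [|n IH] v g M; first by move=> h; exists M => //; case: h.
move=> h; have [M1 M10 h1] := IH _ _ _ h; have M0 := Bd_nneg mu0 h.
have hd i : P i -> Bd (Ldom eps r) (dl eps) mu 0 (vadd v i) P (dl eps i g) (eps^-1 * (M + M)).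
  move=> Pi; split; first by apply: mulr_ge0; [rewrite invr_ge0 ltW|exact: addr_ge0].
  case: h => _ h u du uP; rewrite /dl normrM gtr0_norm ?invr_gt0 //.
  rewrite ler_pM2l ?invr_gt0 //; apply: le_trans (ler_normB _ _) _; apply: lerD; apply: h => //.
  - exact: Ldom_shift.
  - exact: coord_shift.
  - by apply: Ldom_le du => // k; exact: le_vadd.
have [A hA] : exists A : 'I_m -> R, forall i, 0 <= A i /\ (P i -> Bd (Ldom eps r) (dl eps) mu n (vadd v i) P (dl eps i g) (A i)).
  have /boolp.choice[A hA] : forall i, exists a, 0 <= a /\ (P i -> Bd (Ldom eps r) (dl eps) mu n (vadd v i) P (dl eps i g) a).
    move=> i; have [Pi|Pi] := boolP (P i); last by exists 0.
    by have [a a0 ha] := IH _ _ _ (hd i Pi); exists a.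
  by exists A.
have A0 i : 0 <= A i by have [] := hA i.
exists (M1 + mu * \sum_i A i); first by rewrite addr_ge0 // mulr_ge0 // sumr_ge0.
by exists M1, A; split => // i; exact: (hA i).2.
Qed.

End DiscreteCalculus.

Section Orders.
Context {R : realType} {m : nat} (r : R).
Local Notation pt := 'rV[R]_m.
Implicit Types (f g h : R -> pt -> R) (u w : pt) (i j : 'I_m) (v : 'I_m -> nat).
Local Notation N eps n v g M := (Bd (Ldom eps r) (dl eps) 1 n v predT g M).
Hypothesis r0 : 0 < r.

(* All iterated difference quotients are bounded, resp. O(eps), as eps -> 0. *)
Definition OB v g := forall n, exists2 C, 0 <= C & \forall eps \near 0^'+, N eps n v (g eps) C.
Definition OE v g := forall n, exists2 C, 0 <= C & \forall eps \near 0^'+, N eps n v (g eps) (C * eps).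

Lemma near_pos : \forall eps \near (0 : R)^'+, 0 < eps.
Proof. exact: nbhs_right_gt. Qed.

Lemma near_lt (a : R) : 0 < a -> \forall eps \near (0 : R)^'+, eps < a.
Proof. by move=> a0; exact: nbhs_right_lt. Qed.

Let dc (eps : R) (e0 : 0 < eps) :=
  @discrete_calculus R m eps r 1 e0 (ltW r0) ler01.

Lemma OE_OB v g : OE v g -> OB v g.
Proof.
move=> h n; have [C C0 hC] := h n; exists C => //; near=> eps.
apply: (@Bd_le _ _ _ _ _ _ _ _ _ (C * eps)); last by near: eps.
by rewrite ler_piMr //; near: eps; apply: filterS (near_lt ltr01) => e /ltW.
Unshelve. all: by end_near. Qed.

Lemma OB_cst v (c : R) : OB v (fun _ _ => c).
Proof.
move=> n; exists `|c| => //; near=> eps.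
have e0 : 0 < eps by near: eps; exact: near_pos.
exact: (Bd_const (dc e0)).
Unshelve. all: by end_near. Qed.

Lemma OE_eps v (c : R) : OE v (fun eps _ => c * eps).
Proof.
move=> n; exists `|c| => //; near=> eps.
have e0 : 0 < eps by near: eps; exact: near_pos.
have := Bd_const (dc e0) n v predT (c * eps); by rewrite normrM (gtr0_norm e0).
Unshelve. all: by end_near. Qed.

Lemma OB_add v f g : OB v f -> OB v g -> OB v (fun eps u => f eps u + g eps u).
Proof.
move=> hf hg n; have [A A0 hA] := hf n; have [B B0 hB] := hg n.
exists (A + B); first exact: addr_ge0.
near=> eps; have e0 : 0 < eps by near: eps; exact: near_pos.
by apply: (Bd_add (dc e0)) => //; near: eps.
Unshelve. all: by end_near. Qed.

Lemma OE_add v f g : OE v f -> OE v g -> OE v (fun eps u => f eps u + g eps u).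
Proof.
move=> hf hg n; have [A A0 hA] := hf n; have [B B0 hB] := hg n.
exists (A + B); first exact: addr_ge0.
near=> eps; have e0 : 0 < eps by near: eps; exact: near_pos.
by rewrite mulrDl; apply: (Bd_add (dc e0)) => //; near: eps.
Unshelve. all: by end_near. Qed.

Lemma OB_mul v f g : OB v f -> OB v g -> OB v (fun eps u => f eps u * g eps u).
Proof.
move=> hf hg n; have [A A0 hA] := hf n; have [B B0 hB] := hg n.
exists (A * B); first exact: mulr_ge0.
near=> eps; have e0 : 0 < eps by near: eps; exact: near_pos.
by apply: (Bd_mul (dc e0)) => //; near: eps.
Unshelve. all: by end_near. Qed.

Lemma OE_mul v f g : OB v f -> OE v g -> OE v (fun eps u => f eps u * g eps u).
Proof.
move=> hf hg n; have [A A0 hA] := hf n; have [B B0 hB] := hg n.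
exists (A * B); first exact: mulr_ge0.
near=> eps; have e0 : 0 < eps by near: eps; exact: near_pos.
by rewrite -mulrA; apply: (Bd_mul (dc e0)) => //; near: eps.
Unshelve. all: by end_near. Qed.

Lemma OE_mulr v f g : OE v f -> OB v g -> OE v (fun eps u => f eps u * g eps u).
Proof.
move=> hf hg; have := OE_mul hg hf.
by congr OE; apply/funext => eps; apply/funext => u; rewrite mulrC.
Qed.

Lemma OE_le v v' g : (forall k, v k <= v' k)%N -> OE v g -> OE v' g.
Proof.
move=> vv h n; have [C C0 hC] := h n; exists C => //.
near=> eps; have e0 : 0 < eps by near: eps; exact: near_pos.
by apply: (Bd_subv (dc e0) vv); near: eps.
Unshelve. all: by end_near. Qed.

Lemma OE_tau v g i : OE v g -> OE (vadd v i) (fun eps => tau eps i (g eps)).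
Proof.
move=> h n; have [C C0 hC] := h n; exists C => //.
near=> eps; have e0 : 0 < eps by near: eps; exact: near_pos.
by apply: (Bd_shift (dc e0)) => //; near: eps.
Unshelve. all: by end_near. Qed.

Lemma Bd_dl eps n v (g : pt -> R) M i : N eps n.+1 v g M -> N eps n (vadd v i) (dl eps i g) M.
Proof.
move=> [M0 [Mi [h0 h1 h2 h3]]]; apply: Bd_le (h1 i isT).
have M00 := Bd_nneg ler01 h0; apply: le_trans h3; rewrite mul1r (bigD1 i) //=.
by rewrite addrCA lerDl addr_ge0 // sumr_ge0.
Qed.

Lemma OB_dl v g i : OB v g -> OB (vadd v i) (fun eps => dl eps i (g eps)).
Proof.
move=> h n; have [C C0 hC] := h n.+1; exists C => //.
by apply: filterS hC => eps; exact: Bd_dl.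
Qed.

Lemma OE_dl v g i : OE v g -> OE (vadd v i) (fun eps => dl eps i (g eps)).
Proof.
move=> h n; have [C C0 hC] := h n.+1; exists C => //.
by apply: filterS hC => eps; exact: Bd_dl.
Qed.

Lemma OE_congr v f g : (\forall eps \near 0^'+, forall u, Ldom eps r v u -> f eps u = g eps u) ->
  OE v f -> OE v g.
Proof.
move=> fg h n; have [C C0 hC] := h n; exists C => //.
near=> eps; have e0 : 0 < eps by near: eps; exact: near_pos.
apply: (@discrete_Bd_congr _ _ _ _ _ _ _ _ (f eps)) => //; last by near: eps.
by move=> u du _; move: u du; near: eps.
Unshelve. all: by end_near. Qed.

Lemma OB_congr v f g : (\forall eps \near 0^'+, forall u, Ldom eps r v u -> f eps u = g eps u) ->
  OB v f -> OB v g.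
Proof.
move=> fg h n; have [C C0 hC] := h n; exists C => //.
near=> eps; have e0 : 0 < eps by near: eps; exact: near_pos.
apply: (@discrete_Bd_congr _ _ _ _ _ _ _ _ (f eps)) => //; last by near: eps.
by move=> u du _; move: u du; near: eps.
Unshelve. all: by end_near. Qed.

(** The difference quotient of 1/g is minus that of g, times 1/g, times the shifted 1/g. Hence order
    n + 1 of 1/g needs order n of 1/g and order n + 1 of g, on a domain with one step less. *)
Lemma OB_inv v g (eta : R) : 0 < eta ->
  (\forall eps \near 0^'+, forall u, Ldom eps r v u -> eta <= `|g eps u|) ->
  OB v g -> OB v (fun eps u => (g eps u)^-1).
Proof.
move=> eta0 hg h.
have lower v' : (forall k, v k <= v' k)%N -> \forall eps \near 0^'+, forall u, Ldom eps r v' u -> eta <= `|g eps u|.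
  move=> vv; near=> eps; have e0 : 0 < eps by near: eps; exact: near_pos.
  by move=> u /(Ldom_le e0 vv); move: u; near: eps.
suff H n v' : (forall k, v k <= v' k)%N -> exists2 C, 0 <= C &
    \forall eps \near 0^'+, N eps n v' (fun u => (g eps u)^-1) C by move=> n; exact: H.
elim: n v' => [|n IH] v' vv.
  exists eta^-1; first by rewrite invr_ge0 ltW.
  have := lower _ vv; apply: filterS => eps he; split; first by rewrite invr_ge0 ltW.
  move=> u du _; rewrite normfV; have gu := he u du.
  by rewrite lef_pV2 // posrE; exact: lt_le_trans gu.
have [A A0 hA] := IH _ vv; have [B B0 hB] := h n.+1.
exists (A + \sum_(i < m) (B * (A * A))).
  by rewrite addr_ge0 // sumr_ge0 // => i _; rewrite !mulr_ge0.
have hl := lower _ vv; near=> eps; have e0 : 0 < eps by near: eps; exact: near_pos.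
have hAe : N eps n v' (fun u => (g eps u)^-1) A by near: eps.
have hle : forall u, Ldom eps r v' u -> eta <= `|g eps u| by near: eps.
have hBe : N eps n.+1 v' (g eps) B by apply: (Bd_subv (dc e0) vv); near: eps.
exists A, (fun=> B * (A * A)); split => //; last by rewrite mul1r.
  move=> i _; apply: (@discrete_Bd_congr _ _ _ _ _ _ _ _
    (fun u => dl eps i (g eps) u * (-1 * (g eps u)^-1 * tau eps i (fun u => (g eps u)^-1) u))) => //.
    move=> u du _; rewrite /dl /tau.
    have g1 : g eps u != 0.
      rewrite -normr_gt0; apply: lt_le_trans eta0 (hle _ _).
      by apply: (Ldom_le e0 _ du) => k; exact: le_vadd.
    have g2 : g eps (u + eps *: unitv i) != 0.
      by rewrite -normr_gt0; apply: lt_le_trans eta0 (hle _ (Ldom_shift du)).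
    by field; rewrite g1 g2 gt_eqF.
  apply: (Bd_mul (dc e0)) => //; first exact: Bd_dl hBe.
  apply: (Bd_mul (dc e0)) => //; last exact: (Bd_shift (dc e0)).
  have := Bd_scale (dc e0) (-1) (Logic.I : True) (Bd_vadd (dc e0) i hAe).
  by rewrite normrN normr1 mul1r.
by move=> i; rewrite !mulr_ge0.
Unshelve. all: by end_near. Qed.

End Orders.

(** * Difference quotients of smooth functions *)

Section SmoothDifferences.
Context {R : realType} {m : nat}.
Local Notation pt := 'rV[R]_m.
Implicit Types (g : pt -> R) (u w : pt) (i j : 'I_m) (v : 'I_m -> nat) (s : seq 'I_m).
Context (U : set pt) (oU : open U) (lo hi : 'I_m -> R).
Local Notation Q := (itvbox lo hi).
Hypothesis QU : Q `<=` U.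

(** Unlike in [Ldom], the base points are arbitrary, because the mean value theorem slides a point
    along an edge of its cell. *)
Definition cellpts (eps : R) v : set pt :=
  [set u | Q u /\ forall k, lo k <= u 0 k + eps * (v k)%:R <= hi k].

Lemma cellpts_shift eps v i u t : 0 < eps -> 0 <= t <= eps ->
  cellpts eps (vadd v i) u -> cellpts eps v (u + t *: unitv i).
Proof.
move=> e0 /andP[t0 te] [uQ uv]; split => k; rewrite addu_coord; have := uv k; have /andP[a b] := uQ k;
  rewrite /vadd natrD mulrDr; case: (k == i) => /andP[c d]; rewrite ?mulr1 ?mulr0 ?addr0 in c d *.
- have p : 0 <= eps * (v k)%:R by rewrite mulr_ge0 // ltW.
  by apply/andP; split; lra.
- by rewrite a b.
- by have p : 0 <= eps * (v k)%:R; [rewrite mulr_ge0 // ltW|apply/andP; split; lra].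
- by rewrite c d.
Qed.

Lemma cellpts_le eps v i u : 0 < eps -> cellpts eps (vadd v i) u -> cellpts eps v u.
Proof.
move=> e0 h; rewrite -[u]addr0 -(scale0r (unitv i : pt)).
by apply: cellpts_shift h => //; rewrite lexx ltW.
Qed.

Lemma vword0_cons i s : vword (fun=> 0%N) (i :: s) = vadd (vword (fun=> 0%N) s) i :> ('I_m -> nat).
Proof. by apply/funext => k; rewrite /vword /vadd /= !add0n addnC eq_sym. Qed.

Lemma partial_dl eps g i j u : derivable g (u + eps *: unitv j) (unitv i) -> derivable g u (unitv i) ->
  derivable (dl eps j g) u (unitv i) /\
  partial i (dl eps j g) u = eps^-1 * (partial i g (u + eps *: unitv j) - partial i g u).
Proof.
move=> d1 d2; have d1' := derivable_shift d1.
have dB := derivableB d1' d2.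
split; first exact: (derivableZ (k := eps^-1) dB).
rewrite -partial_shift.
exact: (etrans (deriveZ eps^-1 dB) (congr1 (fun x => eps^-1 * x) (deriveB d1' d2))).
Qed.

Lemma words_derivable eps s g i u : 0 < eps -> sm U g -> cellpts eps (vword (fun=> 0%N) s) u ->
  derivable (foldr (dl eps) g s) u (unitv i) /\
  partial i (foldr (dl eps) g s) u = foldr (dl eps) (partial i g) s u.
Proof.
move=> e0 hg; elim: s u => [|j s IH] u.
  by move=> [uQ _]; split => //=; apply: (sm_derivable hg); exact: QU.
rewrite vword0_cons => uc.
have [d1 e1] := IH _ (cellpts_shift e0 (introT andP (conj (ltW e0) (lexx eps))) uc).
have [d2 e2] := IH _ (cellpts_le e0 uc).
have [d3 e3] := partial_dl d1 d2.
by split; [exact: d3|rewrite /= e3 e1 e2].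
Qed.

(** The mean value theorem turns each letter of the word into a partial derivative, which commutes
    with the remaining differences. *)
Lemma words_bound eps n M s g u : 0 < eps -> sm U g ->
  (forall s w, size s = n -> Q w -> `|partials s g w| <= M) -> size s = n ->
  cellpts eps (vword (fun=> 0%N) s) u -> `|foldr (dl eps) g s u| <= M.
Proof.
move=> e0; elim: s n g u => [|j s IH] n g u hg hM.
  by move=> n0 [uQ _]; exact: (hM [::]).
case: n hM => // n hM [ss]; rewrite vword0_cons => uc.
have := @mvt_bound _ _ (foldr (dl eps) g s) u j eps M.
have H x : (0 <= x <= eps) || (eps <= x <= 0) -> derivable (foldr (dl eps) g s) (u + x *: unitv j) (unitv j) /\
    `|partial j (foldr (dl eps) g s) (u + x *: unitv j)| <= M.
  move=> hx; have xe : 0 <= x <= eps by case/orP: hx => // /andP[a b]; apply/andP; split; lra.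
  have uc' := cellpts_shift e0 xe uc.
  have [d ->] := words_derivable j e0 hg uc'; split=> //.
  apply: (IH n _ _ (sm_partial j hg) _ ss uc').
  move=> s' w ss' wQ; have := hM (rcons s' j) w; rewrite /partials foldr_rcons size_rcons ss'; exact.
move=> /(_ H) h; rewrite /= {1}/dl normrM gtr0_norm ?invr_gt0 // mulrC ler_pdivrMr //.
by rewrite -[X in _ <= _ * X](gtr0_norm e0).
Qed.

Lemma smooth_words_bounded g n : sm U g -> exists2 M, 0 <= M &
  forall s u, (size s <= n)%N -> Q u -> `|partials s g u| <= M.
Proof.
move=> hg.
have hb s : exists2 M, 0 <= M & forall u, Q u -> `|partials s g u| <= M.
  by apply: bounded_on_box => u /QU; exact: (sm_continuous (sm_partials s hg)).
have := @fin_bound R 'I_n.+1 (fun k M => forall s u, size s = k -> Q u -> `|partials s g u| <= M).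
case.
- by move=> k M M' MM' h s u ss uQ; exact: le_trans (h s u ss uQ) MM'.
- move=> k; have := @fin_bound R (k.-tuple 'I_m) (fun t M => forall u, Q u -> `|partials t g u| <= M).
  case; [by move=> t M M' MM' h u uQ; exact: le_trans (h u uQ) MM'|by move=> t; exact: hb|].
  by move=> M M0 hM; exists M => // s u ss uQ; move/eqP: ss => ss; exact: (hM (Tuple ss)).
- move=> M M0 hM; exists M => // s u ss uQ.
  have ss' : (size s < n.+1)%N by [].
  exact: (hM (Ordinal ss')).
Qed.

Lemma words_diff eps s (f g : pt -> R) : foldr (dl eps) (fun u => f u - g u) s =
  (fun u => foldr (dl eps) f s u - foldr (dl eps) g s u).
Proof. by elim: s => //= i s ->; apply/funext => u; rewrite /dl; ring. Qed.

Lemma words_comm eps s i g : foldr (dl eps) (dl eps i g) s = dl eps i (foldr (dl eps) g s).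
Proof. by elim: s => //= j s ->; rewrite dlC. Qed.

(** After one mean value theorem the error is the increment of a first derivative over at most one
    edge; a second one bounds it by eps times a derivative of order n + 2. *)
Lemma words_taylor eps n M s g i u : 0 < eps -> sm U g ->
  (forall s w, size s = n.+2 -> Q w -> `|partials s g w| <= M) -> size s = n ->
  cellpts eps (vadd (vword (fun=> 0%N) s) i) u ->
  `|foldr (dl eps) (fun u => dl eps i g u - partial i g u) s u| <= M * eps.
Proof.
move=> e0 hg hM ss uc; rewrite words_diff words_comm.
have H x : (0 <= x <= eps) || (eps <= x <= 0) -> cellpts eps (vword (fun=> 0%N) s) (u + x *: unitv i).
  move=> hx; have xe : 0 <= x <= eps by case/orP: hx => // /andP[a b]; apply/andP; split; lra.
  exact: cellpts_shift e0 xe uc.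
have D0 x hx := (words_derivable i e0 hg (H x hx)).1.
have [x hx ex] := mvt_dir D0.
have [_ e1] := words_derivable i e0 hg (H x hx).
have hx0 y : (0 <= y <= x) || (x <= y <= 0) -> (0 <= y <= eps) || (eps <= y <= 0).
  by case/orP: hx => /andP[a b] /orP[] /andP[c d]; apply/orP; lra.
have h := @mvt_bound _ _ (foldr (dl eps) (partial i g) s) u i x M.
have {}h : `|foldr (dl eps) (partial i g) s (u + x *: unitv i) - foldr (dl eps) (partial i g) s u| <= M * `|x|.
  apply: h => y /hx0 hy; have [d ->] := words_derivable i e0 (sm_partial i hg) (H y hy); split => //.
  apply: (words_bound (n := n) e0 (sm_partial i (sm_partial i hg)) _ ss (H y hy)).
  move=> s' w ss' wQ; have := hM (rcons (rcons s' i) i) w; rewrite /partials !foldr_rcons !size_rcons ss'; exact.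
rewrite {1}/dl ex e1 mulKf ?gt_eqF //; apply: le_trans h _.
have M0 : 0 <= M.
  have [uQ _] := uc; have := hM (nseq n.+2 i) u; rewrite size_nseq => /(_ erefl uQ).
  exact: le_trans.
apply: ler_wpM2l => //; rewrite -[X in _ <= X](gtr0_norm e0); exact: btw_norm.
Qed.

End SmoothDifferences.

(** * Convergence of order eps and passage to the limit *)

Section Convergence.
Context {R : realType} {m : nat} (r : R).
Local Notation pt := 'rV[R]_m.
Implicit Types (f g h : R -> pt -> R) (u w : pt) (i j : 'I_m) (v : 'I_m -> nat).
Hypothesis r0 : 0 < r.

Definition snear (g : pt -> R) := exists U, [/\ open U, box r `<=` U & sm U g].

Lemma Ldom_cellpts (eps r' : R) v s u : 0 < eps -> r <= r' -> Ldom eps r (vword v s) u ->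
  cellpts (fun=> 0) (fun=> r') eps (vword (fun=> 0%N) s) u.
Proof.
move=> e0 rr [nu [-> h]]; split=> k; rewrite mxE.
  rewrite mulr_ge0 ?(ltW e0) //=; apply: le_trans rr; apply: le_trans (h k).
  by rewrite ler_pM2l // ler_nat leq_addr.
rewrite -mulrDr -natrD mulr_ge0 ?(ltW e0) //=; apply: le_trans rr; apply: le_trans (h k).
by rewrite ler_pM2l // ler_nat leq_add2l /vword add0n leq_addl.
Qed.

Lemma snear_OB v (g : pt -> R) : snear g -> OB r v (fun=> g).
Proof.
move=> [U [oU bU hg]] n; have [M M0 hM] := @smooth_words_bounded _ _ U (fun=> 0) (fun=> r) bU g n hg.
exists (M * m.+1%:R ^+ n); first by rewrite mulr_ge0 // exprn_ge0.
near=> eps; have e0 : 0 < eps by near: eps; exact: near_pos.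
apply: Bd_of_words => // s u ss _ uc _.
apply: (words_bound bU (n := size s) e0 hg _ erefl (Ldom_cellpts e0 (lexx r) uc)).
by move=> s' w ss' wQ; apply: hM => //; rewrite ss'.
Unshelve. all: by end_near. Qed.

Lemma snear_dl v i (g : pt -> R) : snear g ->
  OE r (vadd v i) (fun eps u => dl eps i g u - partial i g u).
Proof.
move=> [U [oU bU hg]] n; have [M M0 hM] := @smooth_words_bounded _ _ U (fun=> 0) (fun=> r) bU g n.+2 hg.
exists (M * m.+1%:R ^+ n); first by rewrite mulr_ge0 // exprn_ge0.
near=> eps; have e0 : 0 < eps by near: eps; exact: near_pos.
rewrite mulrAC; apply: Bd_of_words => [|s u ss _ uc _]; first by rewrite mulr_ge0 // ltW.
apply: (words_taylor bU (n := size s) e0 hg _ erefl).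
  by move=> s' w ss' wQ; apply: hM => //; rewrite ss' !ltnS.
rewrite -vword0_cons; apply: (@Ldom_cellpts eps r v (i :: s)) => //.
have -> // : vword v (i :: s) = vword (vadd v i) s.
by apply/funext => k; rewrite /vword /vadd /= addnA eq_sym.
Unshelve. all: by end_near. Qed.

Lemma snear_tau v i (g : pt -> R) : snear g ->
  OE r (vadd v i) (fun eps u => tau eps i g u - g u).
Proof.
move=> hg.
have h := OE_mulr r0 (OE_eps r0 (vadd v i) 1) (OB_dl i (snear_OB v hg)).
apply: (OE_congr _ h); near=> eps; have e0 : 0 < eps by near: eps; exact: near_pos.
by move=> u _; rewrite mul1r /dl /tau mulVKf // gt_eqF.
Unshelve. all: by end_near. Qed.

Lemma words_offset eps s (g : pt -> R) w u :
  foldr (dl eps) (fun x => g (x + w)) s u = foldr (dl eps) g s (u + w).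
Proof. by elim: s u => //= i s IH u; rewrite /dl !IH addrAC. Qed.

(** This covers the midpoint variant of the initial data: a displacement by at most one mesh size
    changes every difference quotient by O(eps). The box is enlarged by 1 because displaced points
    may leave it. *)
Lemma offset_OE v (g : pt -> R) (w : R -> pt) : sm setT g ->
  (forall eps k, 0 < eps -> 0 <= w eps 0 k <= eps) ->
  OE r v (fun eps u => g (u + w eps) - g u).
Proof.
move=> hg hw n.
have QT : itvbox (fun=> 0) (fun=> r + 1) `<=` [set: pt] by [].
have [M M0 hM] := @smooth_words_bounded _ _ setT (fun=> 0) (fun=> r + 1) QT g n.+1 hg.
exists (m%:R * M * m.+1%:R ^+ n); first by rewrite !mulr_ge0 // exprn_ge0.
near=> eps; have e0 : 0 < eps by near: eps; exact: near_pos.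
have e1 : eps < 1 by near: eps; exact: near_lt.
rewrite mulrAC; apply: Bd_of_words => [|s u ss _ uc _]; first by rewrite !mulr_ge0 // ltW.
rewrite words_diff words_offset -mulrA.
have uc' := Ldom_cellpts e0 (lexx r) uc.
apply: (@lip_box _ _ (foldr (dl eps) g s) (fun k => u 0 k) (fun k => u 0 k + eps)) => //.
- move=> z hz k.
  have zc : cellpts (fun=> 0) (fun=> r + 1) eps (vword (fun=> 0%N) s) z.
    case: uc' => uQ uv; split=> l; have := hz l; have := uQ l; have := uv l;
    by move=> /andP[? ?] /andP[? ?] /andP[? ?]; apply/andP; split; lra.
  have [d ->] := words_derivable QT k e0 hg zc; split => //.
  apply: (words_bound QT (n := size s) e0 (sm_partial k hg) _ erefl zc).
  move=> s' x ss' xQ; have := hM (rcons s' k) x; rewrite /partials foldr_rcons size_rcons ss'; exact.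
- by move=> k; rewrite lexx lerDl ltW.
- by move=> k; rewrite mxE lerDl lerD2l; exact: hw.
- by move=> k; rewrite mxE [u 0 k + _]addrC addrK; have /andP[a b] := hw eps k e0; rewrite ger0_norm.
Unshelve. all: by end_near. Qed.

(** Convergence of order O(eps) of all difference quotients, with a smooth limit. The notion is
    compatible with sums, products, nonzero inverses, shifts and differences, so a discrete equation
    passes to the limit term by term. *)
Definition Cv v g (g0 : pt -> R) := OE r v (fun eps u => g eps u - g0 u) /\ snear g0.

Lemma snear2 (g h : pt -> R) : snear g -> snear h -> exists U, [/\ open U, box r `<=` U, sm U g & sm U h].
Proof.
move=> [U [oU bU hU]] [V [oV bV hV]]; exists (U `&` V); split.
- exact: openI.
- by move=> u ub; split; [exact: bU|exact: bV].
- by apply: sm_sub hU => u [].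
- by apply: sm_sub hV => u [].
Qed.

Lemma snear_add (g h : pt -> R) : snear g -> snear h -> snear (fun u => g u + h u).
Proof. by move=> hg hh; have [U [oU bU a b]] := snear2 hg hh; exists U; split; [exact: oU|exact: bU|exact: sm_add oU a b]. Qed.

Lemma snear_mul (g h : pt -> R) : snear g -> snear h -> snear (fun u => g u * h u).
Proof. by move=> hg hh; have [U [oU bU a b]] := snear2 hg hh; exists U; split; [exact: oU|exact: bU|exact: sm_mul oU a b]. Qed.

Lemma snear_partial i (g : pt -> R) : snear g -> snear (partial i g).
Proof. by move=> [U [oU bU hg]]; exists U; split; [exact: oU|exact: bU|exact: sm_partial]. Qed.

Lemma snear_smT (g : pt -> R) : sm setT g -> snear g.
Proof. by move=> hg; exists setT; split => //; exact: openT. Qed.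

Lemma snear_cst (c : R) : snear (fun=> c).
Proof. by apply: snear_smT; apply: sm_cst; exact: openT. Qed.

Lemma snear_continuous (g : pt -> R) u : snear g -> box r u -> {for u, continuous g}.
Proof. by move=> [U [oU bU hg]] ub; apply: (sm_continuous hg); exact: bU. Qed.

Lemma snear_inv (g : pt -> R) : snear g -> (forall u, box r u -> g u != 0) -> snear (fun u => (g u)^-1).
Proof.
move=> [U [oU bU hg]] g0; exists (U `&` [set u | g u != 0]).
have oV : open (U `&` [set u | g u != 0]).
  move=> u [uU gu]; have cg := sm_continuous hg uU.
  have n1 : nbhs u (g @^-1` [set x | x != 0]).
    apply: cg; apply: open_nbhs_nbhs; split => //; exact: open_neq.
  exact: (@filterI _ _ (nbhs_filter u) _ _ (oU u uU) n1).
split => //; first by move=> u ub; split; [exact: bU|exact: g0].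
apply: sm_inv => //; last by move=> u [].
by apply: sm_sub hg => u [].
Qed.

Lemma Cv_OB v g (g0 : pt -> R) : Cv v g g0 -> OB r v g.
Proof.
move=> [h1 h2]; apply: (OB_congr _ (OB_add r0 (OE_OB h1) (snear_OB v h2))).
by apply: nearW => eps u _ /=; rewrite subrK.
Qed.

Lemma Cv_const v (g0 : pt -> R) : snear g0 -> Cv v (fun=> g0) g0.
Proof.
move=> h; split => //; apply: (OE_congr _ (OE_eps r0 v 0)).
by apply: nearW => eps u _; rewrite mul0r subrr.
Qed.

Lemma Cv_eps v (c : R) : Cv v (fun eps _ => c * eps) (fun=> 0).
Proof.
split; last exact: snear_cst; apply: (OE_congr _ (OE_eps r0 v c)).
by apply: nearW => eps u _; rewrite subr0.
Qed.

Lemma Cv_add v f g (f0 g0 : pt -> R) : Cv v f f0 -> Cv v g g0 ->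
  Cv v (fun eps u => f eps u + g eps u) (fun u => f0 u + g0 u).
Proof.
move=> [hf sf] [hg sg]; split; last exact: snear_add.
apply: (OE_congr _ (OE_add r0 hf hg)); apply: nearW => eps u _ /=; ring.
Qed.

Lemma Cv_mul v f g (f0 g0 : pt -> R) : Cv v f f0 -> Cv v g g0 ->
  Cv v (fun eps u => f eps u * g eps u) (fun u => f0 u * g0 u).
Proof.
move=> hf hg; have [of_ sf] := hf; have [og sg] := hg; split; last exact: snear_mul.
have h := OE_add r0 (OE_mulr r0 of_ (Cv_OB hg)) (OE_mul r0 (snear_OB v sf) og).
apply: (OE_congr _ h); apply: nearW => eps u _ /=; ring.
Qed.

Lemma Cv_le v v' g (g0 : pt -> R) : (forall k, v k <= v' k)%N -> Cv v g g0 -> Cv v' g g0.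
Proof. by move=> vv [h s]; split => //; exact: (OE_le r0 vv h). Qed.

Lemma Cv_vadd v i g (g0 : pt -> R) : Cv v g g0 -> Cv (vadd v i) g g0.
Proof. by apply: Cv_le => k; exact: le_vadd. Qed.

Lemma Cv_tau v i g (g0 : pt -> R) : Cv v g g0 -> Cv (vadd v i) (fun eps => tau eps i (g eps)) g0.
Proof.
move=> [h s]; split => //.
have h' := OE_add r0 (OE_tau r0 i h) (snear_tau v i s).
apply: (OE_congr _ h'); apply: nearW => eps u _ /=; rewrite /tau; ring.
Qed.

Lemma Cv_dl v i g (g0 : pt -> R) : Cv v g g0 -> Cv (vadd v i) (fun eps => dl eps i (g eps)) (partial i g0).
Proof.
move=> [h s]; split; last exact: snear_partial.
have h' := OE_add r0 (OE_dl i h) (snear_dl v i s).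
apply: (OE_congr _ h'); apply: nearW => eps u _ /=; rewrite /dl; ring.
Qed.

Lemma Cv_congr v f g (g0 : pt -> R) :
  (\forall eps \near 0^'+, forall u, Ldom eps r v u -> f eps u = g eps u) -> Cv v f g0 -> Cv v g g0.
Proof.
move=> fg [h s]; split => //; apply: (OE_congr _ h).
by apply: filterS fg => eps e u /e ->.
Qed.

Lemma OE_value v g : OE r v g -> exists2 C, 0 <= C &
  \forall eps \near 0^'+, forall u, Ldom eps r v u -> `|g eps u| <= C * eps.
Proof.
move=> /(_ 0%N)[C C0 hC]; exists C => //; apply: filterS hC => eps [_ h] u du.
by apply: h => // k; rewrite -topredE.
Qed.

Lemma snear_lower (g : pt -> R) : snear g -> (forall u, box r u -> g u != 0) ->
  exists2 eta, 0 < eta & forall u, box r u -> eta <= `|g u|.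
Proof.
move=> sg g0; have := snear_inv sg g0; move=> sgi.
have [M M0 hM] := @bounded_on_box _ _ (fun u => (g u)^-1) (fun=> 0) (fun=> r) (fun u ub => snear_continuous sgi ub).
exists (M + 1)^-1; first by rewrite invr_gt0 ltr_wpDl.
move=> u ub; have := hM u ub; rewrite normfV => h.
have gp : 0 < `|g u| by rewrite normr_gt0 g0.
rewrite -[X in _ <= X]invrK lef_pV2 ?posrE ?invr_gt0 // ?ltr_wpDl //.
by apply: le_trans h _; rewrite lerDl.
Qed.

Lemma Cv_lower v g (g0 : pt -> R) : Cv v g g0 -> (forall u, box r u -> g0 u != 0) ->
  exists2 eta, 0 < eta & \forall eps \near 0^'+, forall u, Ldom eps r v u -> eta <= `|g eps u|.
Proof.
move=> [h s] g00; have [eta eta0 he] := snear_lower s g00.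
have [C C0 hC] := OE_value h; exists (eta / 2); first by rewrite divr_gt0.
near=> eps; have e0 : 0 < eps by near: eps; exact: near_pos.
have e1 : eps < eta / 2 / (C + 1) by near: eps; apply: near_lt; rewrite !divr_gt0 // ltr_wpDl.
have hCe : forall u, Ldom eps r v u -> `|g eps u - g0 u| <= C * eps by near: eps.
move=> u du; have h1 := hCe u du; have h2 := he u (Ldom_box e0 du).
have h3 : C * eps <= eta / 2.
  have : eps * (C + 1) < eta / 2 by rewrite -ltr_pdivlMr // ltr_wpDl.
  by rewrite mulrDr mulr1; lra.
have := ler_normB (g0 u - g eps u) (- g eps u); rewrite opprK subrK normrN distrC; lra.
Unshelve. all: by end_near. Qed.

Lemma Cv_inv v g (g0 : pt -> R) : Cv v g g0 -> (forall u, box r u -> g0 u != 0) ->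
  Cv v (fun eps u => (g eps u)^-1) (fun u => (g0 u)^-1).
Proof.
move=> hg g00; have [h s] := hg; have si := snear_inv s g00; split => //.
have [eta eta0 he] := Cv_lower hg g00.
have hi := OB_inv r0 eta0 he (Cv_OB hg).
have h' := OE_mulr r0 (OE_mul r0 (OB_cst r0 v (-1)) h) (OB_mul r0 hi (snear_OB v si)).
apply: (OE_congr _ h'); near=> eps; have e0 : 0 < eps by near: eps; exact: near_pos.
have hle : forall u, Ldom eps r v u -> eta <= `|g eps u| by near: eps.
move=> u du.
have g1 : g eps u != 0 by rewrite -normr_gt0; apply: lt_le_trans (hle u du).
have g2 : g0 u != 0 by apply: g00; exact: Ldom_box du.
by field; rewrite g1 g2.
Unshelve. all: by end_near. Qed.

Lemma lattice_dense v u (d : R) : box r u -> 0 < d ->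
  \forall eps \near 0^'+, exists w, [/\ Ldom eps r v w, forall k, `|w 0 k - u 0 k| < d
    & forall P, coord_subspace P u -> coord_subspace P w].
Proof.
move=> ub d0; pose V := (\sum_k v k)%N.
have vV k : (v k <= V)%N by rewrite /V (bigD1 k) //= leq_addr.
have V0 : 0 < (V%:R + 1 : R) by rewrite ltr_wpDl.
near=> eps; have e0 : 0 < eps by near: eps; exact: near_pos.
have e1 : eps < r / (V%:R + 1) by near: eps; apply: near_lt; rewrite divr_gt0.
have e2 : eps < d / (V%:R + 1) by near: eps; apply: near_lt; rewrite divr_gt0.
rewrite ltr_pdivlMr // in e1; rewrite ltr_pdivlMr // in e2.
(* Rounding down and going back v_k further steps leaves room for v steps inside the box.
   Subtraction of naturals stops at 0, so points near the lower faces stay in the box and vanishing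
   coordinates remain 0. *)
pose q k : nat := Num.trunc (u 0 k / eps).
exists (latt eps (fun k : 'I_m => (q k - v k)%N)); split; last first.
- by move=> P uP k Pk; rewrite mxE /q (uP k Pk) mul0r truncn0 mulr0.
- move=> k; rewrite mxE; have /andP[uk0 ukr] := ub k.
  have ue0 : 0 <= u 0 k / eps by rewrite divr_ge0 // ltW.
  have /andP[t1 t2] := truncn_itv ue0; rewrite -/(q k) in t1 t2.
  rewrite ler_pdivlMr // in t1; rewrite ltr_pdivrMr // -natr1 in t2.
  have vVR : (v k)%:R <= V%:R :> R by rewrite ler_nat.
  have evV : eps * (v k)%:R <= eps * V%:R by rewrite ler_pM2l.
  have ev0 : 0 <= eps * (v k)%:R by rewrite mulr_ge0 // ltW.
  have [h|h] := leqP (v k) (q k).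
    rewrite natrB // mulrBr ltr_norml; apply/andP; split; lra.
  have /eqP -> : (q k - v k == 0)%N by rewrite subn_eq0 ltnW.
  have tv : (q k)%:R * eps <= eps * (v k)%:R.
    by rewrite mulrC ler_pM2l // ler_nat ltnW.
  by rewrite mulr0 sub0r normrN ger0_norm //; lra.
- exists (fun k : 'I_m => (q k - v k)%N); split=> // k.
  have /andP[uk0 ukr] := ub k.
  have ue0 : 0 <= u 0 k / eps by rewrite divr_ge0 // ltW.
  have /andP[t1 t2] := truncn_itv ue0; rewrite -/(q k) in t1 t2.
  have [h|/ltnW h] := leqP (v k) (q k).
    by rewrite subnK //; apply: le_trans ukr; rewrite mulrC -ler_pdivlMr.
  have /eqP -> : (q k - v k == 0)%N by rewrite subn_eq0.
  rewrite add0n; apply: le_trans (ltW e1); rewrite ler_pM2l //.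
  by apply: (@le_trans _ _ V%:R); [rewrite ler_nat|rewrite lerDl].
Unshelve. all: by end_near. Qed.

(** By density: the lattice points approximating u inside its coordinate subspace carry values that
    tend to 0, while d is continuous and does not depend on eps. *)
Lemma vanish_on P v (d : pt -> R) (C : R) : snear d -> 0 <= C ->
  (\forall eps \near 0^'+, forall u, Ldom eps r v u -> coord_subspace P u -> `|d u| <= C * eps) ->
  forall u, box r u -> coord_subspace P u -> d u = 0.
Proof.
move=> sd C0 hC u ub uP; apply/eqP; apply/negPn/negP => du.
have e0 : 0 < `|d u| / 2 by rewrite divr_gt0 // normr_gt0.
have cd := snear_continuous sd ub.
have : \forall w \near u, `|d u - d w| < `|d u| / 2 by move/cvgrPdist_lt: cd => /(_ _ e0).
move=> /nbhs_boxP[dd dd0 hd].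
have hl := @lattice_dense v u dd ub dd0.
have [eps [ep h1 h2 [w [wL wd wP]]]] : exists eps : R, [/\ 0 < eps, eps < `|d u| / 2 / (C + 1),
   forall u, Ldom eps r v u -> coord_subspace P u -> `|d u| <= C * eps &
   exists w, [/\ Ldom eps r v w, forall k, `|w 0 k - u 0 k| < dd
    & forall P, coord_subspace P u -> coord_subspace P w]].
  apply: (@filter_ex _ (0 : R)^'+).
  near=> eps; split; near: eps => //; [exact: near_pos|].
  by apply: near_lt; rewrite !divr_gt0 // ?normr_gt0 // ltr_wpDl.
have a1 := hd w wd; have a2 := h2 w wL (wP P uP).
rewrite ltr_pdivlMr ?ltr_wpDl // mulrDr mulr1 in h1.
have := ler_normD (d u - d w) (d w); rewrite subrK => a3.
have : C * eps <= eps * C + eps by rewrite mulrC lerDl ltW.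
lra.
Unshelve. all: by end_near. Qed.

(** The way in which the equations and initial conditions of the smooth nets are obtained from their
    discrete counterparts; P is the subspace on which a condition is prescribed. *)
Lemma Cv_eq_on P v g h (g0 h0 : pt -> R) : Cv v g g0 -> Cv v h h0 ->
  (\forall eps \near 0^'+, forall u, Ldom eps r v u -> coord_subspace P u -> g eps u = h eps u) ->
  forall u, box r u -> coord_subspace P u -> g0 u = h0 u.
Proof.
move=> [hg sg] [hh sh] gh u ub uP; apply/eqP; rewrite -subr_eq0; apply/eqP.
have sd := snear_add sg (snear_mul (snear_cst (-1)) sh).
have [C C0 hC] := OE_value (OE_add r0 hh (OE_mul r0 (OB_cst r0 v (-1)) hg)).
have := @vanish_on P v _ C sd C0 _ u ub uP; rewrite mulN1r; apply.
near=> eps => w wL wP; have -> : g0 w + -1 * h0 w = h eps w - h0 w + -1 * (g eps w - g0 w).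
  have -> : g eps w = h eps w by move: w wL wP; near: eps.
  ring.
by move: w wL {wP}; near: eps.
Unshelve. all: by end_near. Qed.

Lemma Cv_eq v g h (g0 h0 : pt -> R) : Cv v g g0 -> Cv v h h0 ->
  (\forall eps \near 0^'+, forall u, Ldom eps r v u -> g eps u = h eps u) ->
  forall u, box r u -> g0 u = h0 u.
Proof.
move=> hg hh gh u ub; apply: (@Cv_eq_on predT _ _ _ _ _ hg hh) => //.
by apply: filterS gh => eps e w /e.
Qed.

End Convergence.

(** * The discrete Darboux system *)

Section Elimination.
Context {F : fieldType}.
Implicit Types (hi hj hk hl : F).

(* One step in direction i of the discrete Darboux system, solved for the new
   value: [el hi hk g_jk g_ji g_ik g_ki] is tau_i g_jk. *)
Definition el hi hk gjk gji gik gki : F := (gjk + hi * gji * gik) / (1 - hi * hk * gik * gki).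

(** Consistency of the discrete Darboux system around a cube, as a rational identity in the values
    at one corner. It is used for two lattice directions and again for a lattice direction with the
    Jonas direction. *)
Lemma el_comm hi hl hk jk ji jl ik il ki kl li lk :
  1 - hi * hk * ik * ki != 0 -> 1 - hl * hk * lk * kl != 0 -> 1 - hi * hl * il * li != 0 ->
  1 - hl * hk * el hi hk lk li ik ki * el hi hl kl ki il li != 0 ->
  el hi hk (el hl hk jk jl lk kl) (el hl hi ji jl li il) (el hl hk ik il lk kl) (el hl hi ki kl li il)
  = el hl hk (el hi hk jk ji ik ki) (el hi hl jl ji il li) (el hi hk lk li ik ki) (el hi hl kl ki il li).
Proof.
rewrite /el => h1 h2 h3 h4; field; rewrite h1 h2 h3 /= andbT.
(* The remaining side condition of [field] is that the product of the denominators in h1, h3 and h4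
   does not vanish. *)
have := mulf_neq0 (mulf_neq0 h1 h3) h4; congr (_ != 0); field.
by rewrite h1 h3.
Qed.

End Elimination.

Section DiscreteDarboux.
Context {R : realType} {m : nat} {T : finType}.
Local Notation pt := 'rV[R]_m.
Local Notation J := ('I_m + T)%type.
Implicit Types (i l : 'I_m) (j k : J) (nu : 'I_m -> nat).
Context (eps : R) (hh : J -> R) (phi : J -> J -> pt -> R).

Definition vsub nu i : 'I_m -> nat := fun l => (nu l - (l == i))%N.
Definition vsize nu := (\sum_l nu l)%N.

Lemma vadd_sub nu i : (0 < nu i)%N -> vadd (vsub nu i) i = nu.
Proof.
move=> h; apply/funext => k; rewrite /vadd /vsub; case: eqP => [->|_]; last by rewrite subn0 addn0.
by rewrite subn1 addn1 prednK.
Qed.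

Lemma vsub_add nu i : vsub (vadd nu i) i = nu.
Proof. by apply/funext => k; rewrite /vadd /vsub addnK. Qed.

Lemma vsubC nu i l : vsub (vsub nu i) l = vsub (vsub nu l) i.
Proof. by apply/funext => k; rewrite /vsub subnAC. Qed.

Lemma vsize_add nu i : vsize (vadd nu i) = (vsize nu).+1.
Proof.
rewrite /vsize big_split /= -addn1; congr addn.
by rewrite -big_mkcond big_pred1_eq.
Qed.

(** The value is computed by descending in whichever transversal direction is picked;
    [gauge_step_down] shows that the choice is harmless. If there is none, the point lies in the
    subspace carrying the data. *)
Fixpoint gauge_rec n j k nu : R :=
  match n with
  | 0 => phi j k (latt eps nu)
  | n'.+1 =>
    match [pick i | ~~ static j k i && (0 < nu i)%N] with
    | None => phi j k (latt eps nu)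
    | Some i => let w := vsub nu i in
        el eps (hh k) (gauge_rec n' j k w) (gauge_rec n' j (inl i) w)
          (gauge_rec n' (inl i) k w) (gauge_rec n' k (inl i) w)
    end
  end.

Definition gauge j k nu := gauge_rec (vsize nu) j k nu.

Lemma gauge_data j k nu : (forall i, ~~ static j k i -> nu i = 0%N) ->
  gauge j k nu = phi j k (latt eps nu).
Proof.
move=> h; rewrite /gauge; case: (vsize nu) => //= n; case: pickP => // i /andP[Si].
by rewrite h.
Qed.

Context (K : R).
Local Notation A := (2 * K).
Local Notation c := (2 * (A ^+ 2 + A ^+ 3)).
Hypotheses (eps0 : 0 < eps) (K0 : 0 < K) (hh1 : forall k, `|hh k| <= 1) (hhi : forall i, hh (inl i) = eps).
Hypothesis epsA : eps * A ^+ 2 <= 2^-1.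
Hypothesis phi_bound : forall j k nu, (vsize nu)%:R * (eps * c) <= K -> `|phi j k (latt eps nu)| <= K.

Lemma denominator_bound hk x y : `|hk| <= 1 -> `|x| <= A -> `|y| <= A ->
  2^-1 <= `|1 - eps * hk * x * y|.
Proof.
move=> hk1 xA yA.
have h : `|eps * hk * x * y| <= 2^-1.
  apply: le_trans epsA; rewrite !normrM (gtr0_norm eps0) -!mulrA ler_pM2l //.
  apply: (@le_trans _ _ (`|x| * `|y|)); first by rewrite ler_piMl // mulr_ge0.
  by rewrite expr2; exact: ler_pM.
have := ler_normB 1 (eps * hk * x * y); have := lerB_dist 1 (eps * hk * x * y).
rewrite normr1; lra.
Qed.

Lemma denominator_neq0 hk x y : `|hk| <= 1 -> `|x| <= A -> `|y| <= A -> 1 - eps * hk * x * y != 0.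
Proof.
move=> a b d; rewrite -normr_gt0; apply: lt_le_trans (denominator_bound a b d).
by rewrite invr_gt0.
Qed.

(** The increment is eps times a Darboux right-hand side, at most A^2 + A^3, over a denominator of
    absolute value at least 1/2; this is the origin of c. *)
Lemma el_bound hk a b d e : `|hk| <= 1 -> `|a| <= A -> `|b| <= A -> `|d| <= A -> `|e| <= A ->
  `|el eps hk a b d e - a| <= eps * c.
Proof.
move=> h1 aA bA dA eA; have dn := denominator_bound h1 dA eA; have d0 := denominator_neq0 h1 dA eA.
have -> : el eps hk a b d e - a = eps * (b * d + hk * (a * (d * e))) / (1 - eps * hk * d * e).
  by rewrite /el; field.
rewrite normrM normfV ler_pdivrMr; last by rewrite normr_gt0.
rewrite normrM (gtr0_norm eps0) -[X in _ <= X]mulrA ler_pM2l //.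
have A0 : 0 <= A by rewrite mulr_ge0 // ltW.
have s0 : 0 <= A ^+ 2 + A ^+ 3 by rewrite addr_ge0 // exprn_ge0.
apply: (@le_trans _ _ (A ^+ 2 + A ^+ 3)).
  apply: le_trans (ler_normD _ _) _; apply: lerD.
    by rewrite normrM expr2; apply: ler_pM.
  rewrite !normrM; apply: (@le_trans _ _ (`|a| * (`|d| * `|e|))).
    by rewrite ler_piMl // !mulr_ge0.
  have -> : A ^+ 3 = A * (A * A) by ring.
  by apply: ler_pM => //; exact: ler_pM.
have : 2^-1 * (A ^+ 2 + A ^+ 3) <= `|1 - eps * hk * d * e| * (A ^+ 2 + A ^+ 3) by exact: ler_wpM2r.
lra.
Qed.

(** Each step adds at most eps c, so in the range considered data bounded by K grow to at most A =
    2K, and this bound in turn keeps the denominator of the next step away from 0. *)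
Lemma gauge_rec_bound n j k nu : (n <= vsize nu)%N -> (vsize nu)%:R * (eps * c) <= K ->
  `|gauge_rec n j k nu| <= K + n%:R * (eps * c).
Proof.
have A0 : 0 <= A by rewrite mulr_ge0 // ltW.
have c0 : 0 <= eps * c by rewrite mulr_ge0 ?(ltW eps0) // mulr_ge0 // addr_ge0 // exprn_ge0.
elim: n j k nu => [|n IH] j k nu nn hK /=; first by rewrite mul0r addr0; exact: phi_bound.
have nK : n.+1%:R * (eps * c) <= K.
  by apply: le_trans hK; apply: ler_wpM2r => //; rewrite ler_nat.
case: pickP => [i /andP[Si nui]|_]; last first.
  by apply: le_trans (phi_bound _ _ hK) _; rewrite lerDl mulr_ge0.
set w := vsub nu i; have ew : vsize nu = (vsize w).+1 by rewrite -(vsize_add w i) /w vadd_sub.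
rewrite ew in nn hK.
have wK : (vsize w)%:R * (eps * c) <= K.
  by apply: le_trans hK; apply: ler_wpM2r => //; rewrite ler_nat.
have b j' k' : `|gauge_rec n j' k' w| <= K + n%:R * (eps * c) by exact: IH.
have bA j' k' : `|gauge_rec n j' k' w| <= A.
  apply: le_trans (b j' k') _; rewrite -natr1 mulrDl mul1r in nK; lra.
have := el_bound (hh1 k) (bA j k) (bA j (inl i)) (bA (inl i) k) (bA k (inl i)).
have := b j k; set x := gauge_rec n j k w; set y := el _ _ _ _ _ _ => h1 h2.
rewrite -natr1 mulrDl mul1r addrA -(subrK x y) addrC.
by apply: le_trans (ler_normD _ _) _; exact: lerD.
Qed.

Lemma gauge_bound j k nu : (vsize nu)%:R * (eps * c) <= K -> `|gauge j k nu| <= A.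
Proof.
by move=> h; apply: le_trans (gauge_rec_bound _ _ (leqnn _) h) _; rewrite mulr_natl; lra.
Qed.

(** By induction on the size of the index. If the recursion descended along some l different from i,
    both descents are expanded at the point z below in both directions, where [el_comm] identifies
    them. *)
Lemma gauge_step_down nu i j k : ~~ static j k i -> (0 < nu i)%N -> (vsize nu)%:R * (eps * c) <= K ->
  let w := vsub nu i in
  gauge j k nu = el eps (hh k) (gauge j k w) (gauge j (inl i) w) (gauge (inl i) k w) (gauge k (inl i) w).
Proof.
have A0 : 0 <= A by rewrite mulr_ge0 // ltW.
have c0 : 0 <= eps * c by rewrite mulr_ge0 ?(ltW eps0) // mulr_ge0 // addr_ge0 // exprn_ge0.
move: {2}(vsize nu) (erefl (vsize nu)) => n; elim: n nu i j k => [|n IH] nu i j k en Si nui hK w.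
  by have := vsize_add w i; rewrite vadd_sub // en.
have size_sub l : (0 < nu l)%N -> vsize (vsub nu l) = n.
  by move=> nul; apply: succn_inj; rewrite -(vsize_add _ l) vadd_sub.
have boundS l : (0 < nu l)%N -> (vsize (vsub nu l))%:R * (eps * c) <= K.
  by move=> nul; apply: le_trans hK; rewrite size_sub // en; apply: ler_wpM2r => //; rewrite ler_nat.
rewrite {1}/gauge en /=; case: pickP => [l /andP[Sl nul]|/(_ i)]; last by rewrite Si nui.
rewrite -(size_sub l nul) -/(gauge j k _) -/(gauge j (inl l) _) -/(gauge (inl l) k _) -/(gauge k (inl l) _).
have [->//|li] := eqVneq l i.
have nuil : (0 < vsub nu i l)%N by rewrite /vsub (negPf li) subn0.
have nuli : (0 < vsub nu l i)%N by rewrite /vsub eq_sym (negPf li) subn0.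
set z := vsub (vsub nu l) i.
have zK : (vsize z)%:R * (eps * c) <= K.
  apply: le_trans (boundS l nul); apply: ler_wpM2r => //; rewrite ler_nat.
  by rewrite -[X in (_ <= vsize X)%N](vadd_sub nuli) vsize_add.
have st_il j' : ~~ (inl i == j') -> ~~ static j' (inl l) i.
  by move=> h; rewrite /static negb_or h /=; apply: contra li => /eqP[->].
have st_li j' : ~~ (inl l == j') -> ~~ static j' (inl i) l.
  by move=> h; rewrite /static negb_or h /=; apply: contra li => /eqP[->].
have stC j' k' l' : static j' k' l' = static k' j' l' by rewrite /static orbC.
have /norP[ij ik] := Si; have /norP[lj lk] := Sl.
have G1 j' k' : ~~ static j' k' i -> gauge j' k' (vsub nu l) =
    el eps (hh k') (gauge j' k' z) (gauge j' (inl i) z) (gauge (inl i) k' z) (gauge k' (inl i) z).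
  by move=> h; apply: IH => //; [exact: size_sub|exact: boundS].
have G2 j' k' : ~~ static j' k' l -> gauge j' k' (vsub nu i) =
    el eps (hh k') (gauge j' k' z) (gauge j' (inl l) z) (gauge (inl l) k' z) (gauge k' (inl l) z).
  by move=> h; rewrite /z -vsubC; apply: IH => //; [exact: size_sub|exact: boundS].
have gz j' k' : `|gauge j' k' z| <= A by exact: gauge_bound.
rewrite (G1 j k) // (G1 j (inl l)) ?st_il // (G1 (inl l) k) ?(G1 k (inl l)) ?st_il //; last by rewrite stC st_il.
rewrite /w (G2 j k) // (G2 j (inl i)) ?st_li // (G2 (inl i) k) ?(G2 k (inl i)) ?st_li //; last by rewrite stC st_li.
rewrite hhi hhi; symmetry; apply: el_comm.
- exact: denominator_neq0.
- exact: denominator_neq0.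
- by apply: denominator_neq0; rewrite // -(hhi l).
- have := G1 (inl l) k; rewrite stC => <-; last exact: st_il.
  have := G1 k (inl l) (st_il _ ik); rewrite hhi => <-.
  by apply: denominator_neq0 => //; apply: gauge_bound; exact: boundS.
Qed.

Lemma gauge_step nu i j k : ~~ static j k i -> (vsize nu).+1%:R * (eps * c) <= K ->
  gauge j k (vadd nu i) = el eps (hh k) (gauge j k nu) (gauge j (inl i) nu) (gauge (inl i) k nu) (gauge k (inl i) nu).
Proof.
move=> Si h; rewrite (gauge_step_down Si) ?vsub_add ?vsize_add //.
by rewrite /vadd eqxx addn1.
Qed.

End DiscreteDarboux.

Section LatticeIndex.
Context {R : realType} {m : nat}.
Local Notation pt := 'rV[R]_m.

(** Recovers the multi-index of a lattice point, where the quotient is an integer and the truncation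
    does nothing. *)
Definition idx (eps : R) (u : pt) : 'I_m -> nat := fun l => Num.trunc (u 0 l / eps).

Lemma idx_latt (eps : R) nu : 0 < eps -> idx eps (latt eps nu) = nu.
Proof.
by move=> e0; apply/funext => l; rewrite /idx mxE mulrC mulKf ?gt_eqF // natrK.
Qed.

Lemma latt_coord (eps : R) (P : pred 'I_m) nu : 0 < eps -> coord_subspace P (latt eps nu) ->
  forall l, ~~ P l -> nu l = 0%N.
Proof.
move=> e0 h l Pl; have := h l; rewrite -topredE /= => /(_ Pl); rewrite mxE => /eqP.
by rewrite mulf_eq0 (gt_eqF e0) /= pnatr_eq0 => /eqP.
Qed.

Lemma vsize_box (eps r : R) (nu : 'I_m -> nat) : (forall l, eps * (nu l)%:R <= r) -> eps * (vsize nu)%:R <= m%:R * r.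
Proof.
move=> h; rewrite /vsize natr_sum mulr_sumr.
apply: le_trans (ler_sum _ (fun l _ => h l)) _; by rewrite sumr_const card_ord mulr_natl.
Qed.

Lemma vsize_coord (nu : 'I_m -> nat) l : (nu l <= vsize nu)%N.
Proof. by rewrite /vsize (bigD1 l) //= leq_addr. Qed.

End LatticeIndex.

Section NearFinite.
Context {R : realType}.

Lemma near_fin (K : finType) (Q : K -> R -> Prop) :
  (forall k, \forall eps \near (0 : R)^'+, Q k eps) -> \forall eps \near (0 : R)^'+, forall k, Q k eps.
Proof.
move=> h; have : \forall eps \near (0 : R)^'+, forall k, k \in enum K -> Q k eps.
  elim: (enum K) => [|k s IH]; first by apply: nearW => eps k; rewrite in_nil.
  near=> eps => k'; rewrite inE => /orP[/eqP ->|]; first by near: eps.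
  by move: k'; near: eps.
by apply: filterS => eps hk k; apply: hk; rewrite mem_enum.
Unshelve. all: by end_near. Qed.

Lemma fin_near (K : finType) (Q : K -> R -> R -> Prop) :
  (forall k M M' eps, 0 < eps -> M <= M' -> Q k M eps -> Q k M' eps) ->
  (forall k, exists2 C : R, 0 <= C & \forall eps \near (0 : R)^'+, Q k C eps) ->
  exists2 C : R, 0 <= C & \forall eps \near (0 : R)^'+, forall k, Q k C eps.
Proof.
move=> Qle hQ.
have [|C C0 hC] := @fin_bound R K (fun k M => \forall eps \near (0 : R)^'+, Q k M eps) _ hQ.
  move=> k M M' MM' h; near=> eps; have e0 : 0 < eps by near: eps; exact: near_pos.
  by apply: (Qle k M) => //; near: eps.
by exists C => //; exact: near_fin.
Unshelve. all: by end_near. Qed.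

End NearFinite.

(** * Convergence of the discrete Darboux solutions *)

Section DarbouxConvergence.
Context {R : realType} {m : nat} {T : finType}.
Local Notation pt := 'rV[R]_m.
Local Notation J := ('I_m + T)%type.
Implicit Types (i l : 'I_m) (j k : J) (nu v : 'I_m -> nat) (u : pt).
Context (kap : J -> R) (phi : J -> J -> pt -> R) (phie : R -> J -> J -> pt -> R).
Hypothesis kap_lat : forall i, kap (inl i) = 0.
Hypothesis kap1 : forall k, `|kap k| <= 1.

(** Only lattice directions have the step eps; the Jonas direction and the formal indices keep their
    fixed steps. *)
Definition mesh (eps : R) (k : J) : R := if k is inl _ then eps else kap k.

Definition gaugef eps j k u : R := gauge eps (mesh eps) (phie eps) j k (idx eps u).

Lemma mesh1 eps k : 0 < eps <= 1 -> `|mesh eps k| <= 1.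
Proof. by case: k => [i|t] /andP[e0 e1]; rewrite /mesh ?kap1 // gtr0_norm. Qed.

Context (r K rho : R) (gam : J -> J -> pt -> R).
Hypotheses (r0 : 0 < r) (K1 : 1 <= K) (rrho : r < rho).
Local Notation A := (2 * K).
Local Notation c := (2 * (A ^+ 2 + A ^+ 3)).
Local Notation L := (4 * K).
Hypothesis phi_sm : forall j k, sm setT (phi j k).
Hypothesis phi_box : forall j k u, box r u -> `|phi j k u| <= K.
Hypothesis phie_phi : forall j k, OE r (fun=> 0%N) (fun eps u => phie eps j k u - phi j k u).
Hypothesis phie_bound : \forall eps \near (0 : R)^'+, forall j k nu,
  (vsize nu)%:R * (eps * c) <= K -> `|phie eps j k (latt eps nu)| <= K.
Hypothesis gam_sm : forall j k, sm (ocube rho) (gam j k).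
Hypothesis gam_data : forall j k u, ocube rho u -> coord_subspace (static j k) u -> gam j k u = phi j k u.
Hypothesis gam_path : forall j k i u, ocube rho u -> ~~ static j k i ->
  coord_subspace (ppath (static j k) i.+1) u -> partial i (gam j k) u = darboux kap i gam j k u.
Hypothesis gam_bound : forall j k u, ocube rho u -> `|gam j k u| <= A.
Hypothesis small_r : m%:R * r * c <= K / 2.
Hypothesis small_contraction : m%:R * r * (2 * L + 4 * L ^+ 3) <= 4^-1.

Lemma box_ocube : (box r : set pt) `<=` ocube rho.
Proof.
by move=> u ub l; have /andP[a b] := ub l; rewrite ger0_norm //; exact: le_lt_trans rrho.
Qed.

Lemma gam_snear j k : snear r (gam j k).
Proof. by exists (ocube rho); split; [exact: ocube_open|exact: box_ocube|exact: gam_sm]. Qed.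

(** What a small eps guarantees at the lattice points of the box: the system in every transversal
    direction, not only along the paths, with bounded values and nonzero denominators. *)
Definition gauge_regular (eps : R) := [/\ 0 < eps, eps <= 1,
  forall nu i j k, (forall l, eps * (nu l)%:R <= r) -> ~~ static j k i ->
    let G j k := gauge eps (mesh eps) (phie eps) j k nu in
    gauge eps (mesh eps) (phie eps) j k (vadd nu i) =
      el eps (mesh eps k) (G j k) (G j (inl i)) (G (inl i) k) (G k (inl i)) &
  forall nu, (forall l, eps * (nu l)%:R <= r) ->
    let G j k := gauge eps (mesh eps) (phie eps) j k nu in
    (forall j k, `|G j k| <= A) /\
    forall i j k, 1 - eps * mesh eps k * G (inl i) k * G k (inl i) != 0].

Lemma near_regular : \forall eps \near (0 : R)^'+, gauge_regular eps.
Proof.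
have K0 : 0 < K by exact: lt_le_trans ltr01 K1.
have A0 : 0 <= A by lra.
have c0 : 0 < c by rewrite mulr_gt0 // addr_gt0 // exprn_gt0 //; lra.
near=> eps; have e0 : 0 < eps by near: eps; exact: near_pos.
have e1 : eps <= 1 by near: eps; apply: filterS (near_lt ltr01) => e /ltW.
have eA : eps * A ^+ 2 <= 2^-1.
  have h : eps < 2^-1 / (A ^+ 2 + 1) by near: eps; apply: near_lt; rewrite divr_gt0 // ltr_wpDl // exprn_ge0.
  rewrite ltr_pdivlMr ?ltr_wpDl ?exprn_ge0 // mulrDr mulr1 in h; lra.
have ec : eps * c <= K / 2.
  have h : eps < K / 2 / c by near: eps; apply: near_lt; rewrite !divr_gt0.
  by rewrite ltr_pdivlMr // in h; exact: ltW.
have pb : forall j k nu, (vsize nu)%:R * (eps * c) <= K -> `|phie eps j k (latt eps nu)| <= K.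
  by near: eps.
have hK nu : (forall l, eps * (nu l)%:R <= r) -> (vsize nu)%:R * (eps * c) <= K / 2.
  move=> /vsize_box h; apply: le_trans small_r; rewrite mulrA; apply: ler_wpM2r; first exact: ltW.
  by rewrite mulrC.
have h1 k : `|mesh eps k| <= 1 by apply: mesh1; rewrite e0.
have hl i : mesh eps (inl i) = eps by [].
split => //.
- move=> nu i j k hnu Si G; apply: (gauge_step (K := K)) => //.
  by rewrite -natr1 mulrDl mul1r; have := hK nu hnu; lra.
- move=> nu hnu G; have b j k : `|G j k| <= A.
    by apply: (gauge_bound (K := K)) => //; have := hK nu hnu; lra.
  split => // i j k; exact: (denominator_neq0 (K := K)).
Unshelve. all: by end_near. Qed.

Lemma gaugef_latt eps j k nu : 0 < eps ->
  gaugef eps j k (latt eps nu) = gauge eps (mesh eps) (phie eps) j k nu.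
Proof. by move=> e0; rewrite /gaugef idx_latt. Qed.

Lemma gaugef_data eps j k u v : 0 < eps -> Ldom eps r v u -> coord_subspace (static j k) u ->
  gaugef eps j k u = phie eps j k u.
Proof.
move=> e0 [nu [-> h]] us; rewrite gaugef_latt // gauge_data //.
exact: (latt_coord e0 us).
Qed.

Lemma gaugef_dl eps i j k v u : gauge_regular eps -> ~~ static j k i -> Ldom eps r (vadd v i) u ->
  dl eps i (gaugef eps j k) u = darboux_rhs (mesh eps k) (gaugef eps j (inl i)) (gaugef eps (inl i) k)
    (gaugef eps k (inl i)) (tau eps i (gaugef eps j k)) u.
Proof.
move=> [e0 e1 hs hb] Si [nu [-> h]].
have hnu l : eps * (nu l)%:R <= r.
  by apply: le_trans (h l); rewrite ler_pM2l // ler_nat leq_addr.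
rewrite /dl /darboux_rhs /tau -latt_vadd !gaugef_latt // hs // /el.
have [_ /(_ i j k) d] := hb nu hnu.
by field; rewrite d gt_eqF.
Qed.

Local Notation v0 := (fun _ : 'I_m => 0%N).
Local Notation N eps mu n v P g M := (Bd (Ldom eps r) (dl eps) mu n v P g M).

Lemma discrete_constants n : exists2 C : R, 0 <= C & \forall eps \near (0 : R)^'+,
  (forall j k, N eps 1 n v0 predT (phi j k) C /\ N eps 1 n v0 predT (gam j k) C) /\
  (forall j k, N eps 1 n v0 predT (fun u => phie eps j k u - phi j k u) (C * eps)) /\
  (forall j k i, N eps 1 n (vadd v0 i) predT (fun u => dl eps i (gam j k) u - partial i (gam j k) u) (C * eps) /\
     N eps 1 n (vadd v0 i) predT (fun u => tau eps i (gam j k) u - gam j k u) (C * eps)).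
Proof.
have mono eps v (g : pt -> R) M M' : 0 < eps -> M <= M' -> N eps 1 n v predT g (M * eps) -> N eps 1 n v predT g (M' * eps).
  by move=> e0 MM'; apply: Bd_le; apply: ler_wpM2r => //; exact: ltW.
have [C1 C10 h1] : exists2 C : R, 0 <= C & \forall eps \near (0 : R)^'+, forall jk : J * J, N eps 1 n v0 predT (phi jk.1 jk.2) C.
  apply: fin_near => [jk M M' eps _ MM'|[j k]]; first exact: Bd_le.
  exact: (snear_OB v0 (snear_smT r (phi_sm j k)) n).
have [C2 C20 h2] : exists2 C : R, 0 <= C & \forall eps \near (0 : R)^'+, forall jk : J * J, N eps 1 n v0 predT (gam jk.1 jk.2) C.
  apply: fin_near => [jk M M' eps _ MM'|[j k]]; first exact: Bd_le.
  exact: (snear_OB v0 (gam_snear j k) n).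
have [C3 C30 h3] : exists2 C : R, 0 <= C & \forall eps \near (0 : R)^'+, forall jk : J * J,
    N eps 1 n v0 predT (fun u => phie eps jk.1 jk.2 u - phi jk.1 jk.2 u) (C * eps).
  apply: fin_near => [jk M M' eps|[j k]]; first exact: mono.
  exact: (phie_phi j k n).
have [C4 C40 h4] : exists2 C : R, 0 <= C & \forall eps \near (0 : R)^'+, forall jk : J * J * 'I_m,
    N eps 1 n (vadd v0 jk.2) predT (fun u => dl eps jk.2 (gam jk.1.1 jk.1.2) u - partial jk.2 (gam jk.1.1 jk.1.2) u) (C * eps).
  apply: fin_near => [jk M M' eps|[[j k] i]]; first exact: mono.
  exact: (snear_dl v0 i (gam_snear j k) n).
have [C5 C50 h5] : exists2 C : R, 0 <= C & \forall eps \near (0 : R)^'+, forall jk : J * J * 'I_m,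
    N eps 1 n (vadd v0 jk.2) predT (fun u => tau eps jk.2 (gam jk.1.1 jk.1.2) u - gam jk.1.1 jk.1.2 u) (C * eps).
  apply: fin_near => [jk M M' eps|[[j k] i]]; first exact: mono.
  exact: (snear_tau r0 v0 i (gam_snear j k) n).
exists (C1 + C2 + C3 + C4 + C5); first by rewrite !addr_ge0.
near=> eps; have e0 : 0 < eps by near: eps; exact: near_pos.
have g1 : forall jk : J * J, N eps 1 n v0 predT (phi jk.1 jk.2) C1 by near: eps.
have g2 : forall jk : J * J, N eps 1 n v0 predT (gam jk.1 jk.2) C2 by near: eps.
have g3 : forall jk : J * J,
    N eps 1 n v0 predT (fun u => phie eps jk.1 jk.2 u - phi jk.1 jk.2 u) (C3 * eps) by near: eps.
have g4 : forall jk : J * J * 'I_m,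
    N eps 1 n (vadd v0 jk.2) predT (fun u => dl eps jk.2 (gam jk.1.1 jk.1.2) u - partial jk.2 (gam jk.1.1 jk.1.2) u) (C4 * eps) by near: eps.
have g5 : forall jk : J * J * 'I_m,
    N eps 1 n (vadd v0 jk.2) predT (fun u => tau eps jk.2 (gam jk.1.1 jk.1.2) u - gam jk.1.1 jk.1.2 u) (C5 * eps) by near: eps.
split; [|split] => j k; [split| |move=> i; split].
- by apply: Bd_le (g1 (j, k)); lra.
- by apply: Bd_le (g2 (j, k)); lra.
- by apply: mono (g3 (j, k)) => //; lra.
- by apply: mono (g4 (j, k, i)) => //; lra.
- by apply: mono (g5 (j, k, i)) => //; lra.
Unshelve. all: by end_near. Qed.

(** Two bootstraps with [Bd_contraction]. The first bounds the discrete solution uniformly in eps,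
    order by order, from the sup bound A; the second bounds its distance to [gam], whose path
    equations it satisfies up to O(eps). L = 4K because the contraction triples the bound of the
    data, which is at most 4K/3. *)
Theorem gaugef_Cv j k : Cv r v0 (fun eps => gaugef eps j k) (gam j k).
Proof.
split; last exact: gam_snear.
move=> n; have [C C0 hC] := discrete_constants n.
have K0 : 0 < K by exact: lt_le_trans ltr01 K1.
have K1' := K1; have L1 : 1 <= L by lra.
have L0 : 0 < L by lra.
have sc := small_contraction; set X := 2 * L + 4 * L ^+ 3 in sc.
have X0 : 0 <= X by rewrite /X addr_ge0 // mulr_ge0 // ?exprn_ge0 // ltW.
have [mu mu1 hmu] : exists2 mu : R, 0 < mu <= 1 & mu * (C + m%:R * n%:R * X) <= Num.min (K / 6) 4^-1.
  apply: small_weight; first by rewrite addr_ge0 // !mulr_ge0.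
  by rewrite lt_min divr_gt0 //= invr_gt0.
have /andP[mu0 mule1] := mu1.
have mu01 : 0 <= mu <= 1 by rewrite ltW.
have muC : mu * C <= K / 6 /\ m%:R * ((r + n%:R * mu) * X) <= 2^-1.
  move: hmu; rewrite le_min mulrDr => /andP[a b].
  have p1 : 0 <= mu * C by rewrite mulr_ge0 // ltW.
  have p2 : 0 <= mu * (m%:R * n%:R * X) by rewrite !mulr_ge0 // ltW.
  split; first by lra.
  have -> : m%:R * ((r + n%:R * mu) * X) = m%:R * r * X + mu * (m%:R * n%:R * X) by ring.
  lra.
case: muC => muC small.
have smallp p : (p <= n)%N -> m%:R * ((r + p%:R * mu) * X) <= 2^-1.
  move=> pn; apply: le_trans small; apply: ler_wpM2l => //; apply: ler_wpM2r => //.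
  by rewrite lerD2l; apply: ler_wpM2r; [exact: ltW|rewrite ler_nat].
pose Y := 2 * L + 3 * L ^+ 2.
have YX : Y <= X.
  rewrite /X /Y lerD2l; have : L ^+ 2 <= L ^+ 3 by rewrite (exprS L 2) ler_peMl // exprn_ge0 // ltW.
  have : 0 <= L ^+ 2 by rewrite exprn_ge0 // ltW.
  lra.
have Y0 : 0 <= Y by rewrite /Y addr_ge0 // mulr_ge0 // ?exprn_ge0 // ltW.
(* The three parts of the consistency error: the shift in the right-hand side, the step eps in place
   of [kap] in the cubic term, and the difference quotient of [gam] in place of its derivative. *)
pose B := Y * C + L ^+ 3 + C.
have L30 : 0 <= L ^+ 3 by rewrite exprn_ge0 // ltW.
have B0 : 0 <= B by rewrite /B addr_ge0 // addr_ge0 // mulr_ge0.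
exists (3 * (C + 1 + m%:R * ((r + n%:R * mu) * B)) / mu ^+ n).
  rewrite divr_ge0 ?exprn_ge0 ?(ltW mu0) // mulr_ge0 // addr_ge0 ?addr_ge0 //.
  by rewrite mulr_ge0 // mulr_ge0 // addr_ge0 ?(ltW r0) // mulr_ge0 // ltW.
have num1 x : x <= K / 6 -> K + mu * C + x <= L / 3 by move=> hx; lra.
have num2 : A + mu * C <= L by lra.
have num3 : A <= L by lra.
have num4 : L = 3 * (L / 3) by rewrite [RHS]mulrC divfK.
near=> eps.
have [e0 e1 hs hb] : gauge_regular eps by near: eps; exact: near_regular.
have reg : gauge_regular eps by split.
have [hpg [hd hg]] : (forall j k, N eps 1 n v0 predT (phi j k) C /\ N eps 1 n v0 predT (gam j k) C) /\
  (forall j k, N eps 1 n v0 predT (fun u => phie eps j k u - phi j k u) (C * eps)) /\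
  (forall j k i, N eps 1 n (vadd v0 i) predT (fun u => dl eps i (gam j k) u - partial i (gam j k) u) (C * eps) /\
     N eps 1 n (vadd v0 i) predT (fun u => tau eps i (gam j k) u - gam j k u) (C * eps)) by near: eps.
have eC : C * eps <= K / 6.
  have h : eps < K / 6 / (C + 1) by near: eps; apply: near_lt; rewrite !divr_gt0 // ltr_wpDl.
  by rewrite ltr_pdivlMr ?ltr_wpDl // mulrDr mulr1 mulrC in h; apply: le_trans (ltW h); rewrite lerDl ltW.
have D0 := discrete_calculus (m := m) e0 (ltW r0) (ltW mu0).
have h1 k' : `|mesh eps k'| <= 1 by apply: mesh1; rewrite e0.
have phie_L p j' k' : (p <= n)%N -> N eps mu p v0 (static j' k') (phie eps j' k') (L / 3).
  move=> pn; apply: (Bd_subP D0) (Bd_leqn D0 pn _) => //.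
  have -> : phie eps j' k' = (fun u => phi j' k' u + (phie eps j' k' u - phi j' k' u)).
    by apply/funext => u; ring.
  apply: (@Bd_le _ _ _ _ _ _ _ _ _ ((K + mu * C) + C * eps)); first exact: num1.
  apply: (Bd_add D0) => //; last by apply: Bd_weight_le => //; exact: hd.
  apply: Bd_small_weight => //; last exact: (hpg j' k').1.
  by split; [exact: ltW|move=> u du _; apply: phi_box; exact: Ldom_box du].
have gam_L j' k' : N eps mu n v0 predT (gam j' k') L.
  apply: (@Bd_le _ _ _ _ _ _ _ _ _ (A + mu * C)); first exact: num2.
  apply: Bd_small_weight => //; last exact: (hpg j' k').2.
  by split; [by rewrite mulr_ge0 // ltW|move=> u du _; apply: gam_bound; apply: box_ocube; exact: Ldom_box du].
have gf0 j' k' : N eps mu 0 v0 predT (gaugef eps j' k') A.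
  split; first by rewrite mulr_ge0 // ltW.
  move=> u [nu [-> hnu]] _; rewrite gaugef_latt //.
  by apply: (hb nu _).1 => l; have := hnu l; rewrite addn0.
have step_eq j' k' i : ~~ static j' k' i -> forall u, Ldom eps r (vadd v0 i) u ->
   darboux_rhs (mesh eps k') (gaugef eps j' (inl i)) (gaugef eps (inl i) k')
    (gaugef eps k' (inl i)) (tau eps i (gaugef eps j' k')) u = dl eps i (gaugef eps j' k') u.
  by move=> Si u du; rewrite (gaugef_dl reg Si du).
(* Given the bound of order p, order p + 1 enters the right-hand side only linearly ([Bd_rhsS]), so
   the step is a contraction. The mesh dependent bound [Z0] merely starts it. *)
have gf_L p : (p <= n)%N -> forall j' k', N eps mu p v0 predT (gaugef eps j' k') L.
  elim: p => [_|p IH pn] j' k'; first by apply: Bd_le (gf0 j' k'); exact: num3.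
  have {}IH := IH (ltnW pn).
  have [Z0 Z00 hZ0] : exists2 Z, 0 <= Z & forall jk : J * J, N eps mu p.+1 v0 predT (gaugef eps jk.1 jk.2) Z.
    apply: fin_bound => [jk M M' MM'|[j1 k1]]; first exact: Bd_le.
    exact: discrete_crude e0 (ltW mu0) (gf0 j1 k1).
  have := @Bd_contraction _ _ _ _ _ _ _ _ D0 (J * J)%type p.+1 v0 (fun jk => static jk.1 jk.2)
    (fun jk => gaugef eps jk.1 jk.2) X (L / 3) 0 Z0 (fun=> I) X0 _ (lexx 0) (smallp _ pn).
  rewrite !mulr0 addr0 => H.
  rewrite num4.
  apply: (H _ _ _ Z00 hZ0 (j', k')).
  - by rewrite divr_gt0.
  - move=> [j1 k1] /=; apply: (discrete_Bd_congr _ e0 (phie_L _ j1 k1 pn)).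
    by move=> u du us; rewrite (gaugef_data e0 du us).
  - move=> M M0 hM [j1 k1] i Si; apply: (@Bd_le _ _ _ _ _ _ _ _ _ (X * M)); first by rewrite addr0.
    apply: discrete_Bd_congr; [move=> u du _; exact: (step_eq j1 k1 i Si u du)|exact: e0|].
    apply: (Bd_subP D0 (S := predT)) => //.
    have hv q (f : pt -> R) Z : N eps mu q v0 predT f Z -> N eps mu q (vadd v0 i) predT f Z by exact: (Bd_vadd D0).
    have ht q (f : pt -> R) Z : N eps mu q v0 predT f Z -> N eps mu q (vadd v0 i) predT (tau eps i f) Z by exact: (Bd_shift D0).
    exact: (Bd_rhsS D0 (h1 k1) I I I I L1 (hv _ _ _ (IH _ _)) (hv _ _ _ (IH _ _)) (hv _ _ _ (IH _ _)) (ht _ _ _ (IH _ _))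
      (hv _ _ _ (hM (_, _))) (hv _ _ _ (hM (_, _))) (hv _ _ _ (hM (_, _))) (ht _ _ _ (hM (_, _)))).
apply: (@Bd_le _ _ _ _ _ _ _ _ _ ((3 * ((C + 1) * eps + m%:R * ((r + n%:R * mu) * (B * eps)))) / mu ^+ n)).
  rewrite le_eqVlt; apply/orP; left; apply/eqP; field; by rewrite expf_neq0 // gt_eqF.
apply: Bd_unit_weight => //.
have [Z0 Z00 hZ0] : exists2 Z, 0 <= Z & forall jk : J * J,
   N eps mu n v0 predT (fun u => gaugef eps jk.1 jk.2 u - gam jk.1 jk.2 u) Z.
  exists (L + L); first by rewrite addr_ge0 // ltW.
  by move=> [j1 k1] /=; apply: (Bd_sub2 D0) => //; exact: gf_L.
have := @Bd_contraction _ _ _ _ _ _ _ _ D0 (J * J)%type n v0 (fun jk => static jk.1 jk.2)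
    (fun jk u => gaugef eps jk.1 jk.2 u - gam jk.1 jk.2 u) Y ((C + 1) * eps) (B * eps) Z0 (fun=> I) Y0.
move=> H; apply: (H _ _ _ _ _ Z00 hZ0 (j, k)).
- by rewrite mulr_gt0 // ltr_wpDl.
- by rewrite mulr_ge0 // ltW.
- apply: le_trans (smallp n (leqnn n)); apply: ler_wpM2l => //; apply: ler_wpM2l => //.
  by rewrite addr_ge0 ?mulr_ge0 // ltW.
- move=> [j1 k1] /=; apply: (@Bd_le _ _ _ _ _ _ _ _ _ (C * eps)); first by apply: ler_wpM2r; [exact: ltW|rewrite lerDl].
  apply: (discrete_Bd_congr _ e0 (Bd_subP D0 (S := predT) _ (Bd_weight_le mu01 (hd j1 k1)))) => //.
  move=> u du us; rewrite (gaugef_data e0 du us) gam_data //.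
  by apply: box_ocube; exact: Ldom_box du.
move=> M M0 hM [j1 k1] i /= Si.
pose q := darboux_rhs (mesh eps k1) (gaugef eps j1 (inl i)) (gaugef eps (inl i) k1)
    (gaugef eps k1 (inl i)) (tau eps i (gaugef eps j1 k1)).
pose q' := darboux_rhs (kap k1) (gam j1 (inl i)) (gam (inl i) k1) (gam k1 (inl i)) (gam j1 k1).
have [hg1 hg2] := hg j1 k1 i.
apply: (@discrete_Bd_congr _ _ _ _ _ _ _ _ (fun u => (q u - q' u) + -1 * (dl eps i (gam j1 k1) u - partial i (gam j1 k1) u))) => //.
  move=> u du uP; rewrite /q step_eq //.
  have -> : partial i (gam j1 k1) u = q' u.
    by rewrite gam_path //; apply: box_ocube; exact: Ldom_box du.
  by rewrite /dl; ring.
have hq : N eps mu n (vadd v0 i) predT (fun u => q u - q' u) (Y * (M + C * eps) + eps * L ^+ 3).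
  have hv (f : pt -> R) Z : N eps mu n v0 predT f Z -> N eps mu n (vadd v0 i) predT f Z by exact: (Bd_vadd D0).
  have ht (f : pt -> R) Z : N eps mu n v0 predT f Z -> N eps mu n (vadd v0 i) predT (tau eps i f) Z by exact: (Bd_shift D0).
  have hMC (f : pt -> R) : N eps mu n v0 predT f M -> N eps mu n (vadd v0 i) predT f (M + C * eps).
    by move=> hf; apply: Bd_le (hv _ _ hf); rewrite lerDl mulr_ge0 // ltW.
  have kd : `|mesh eps k1 - kap k1| <= eps.
    by case: (k1) => [l|t]; rewrite /mesh ?kap_lat ?subr0 ?subrr ?normr0 ?gtr0_norm // ltW.
  have gn := gf_L n (leqnn n).
  apply: (Bd_rhs_diff D0 (h1 k1) (kap1 k1) kd I I I I I I I I (hv _ _ (gn _ _)) (hv _ _ (gn _ _)) (hv _ _ (gn _ _)) (ht _ _ (gn _ _))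
    (hv _ _ (gam_L _ _)) (hv _ _ (gam_L _ _)) (hv _ _ (gam_L _ _)) (hv _ _ (gam_L _ _))
    (hMC _ (hM (_, _))) (hMC _ (hM (_, _))) (hMC _ (hM (_, _)))).
  have -> : (fun u => tau eps i (gaugef eps j1 k1) u - gam j1 k1 u) =
    (fun u => tau eps i (fun w => gaugef eps j1 k1 w - gam j1 k1 w) u + (tau eps i (gam j1 k1) u - gam j1 k1 u)).
    by apply/funext => u; rewrite /tau; ring.
  exact: (Bd_add D0 I I (ht _ _ (hM (j1, k1))) (Bd_weight_le mu01 hg2)).
apply: (Bd_subP D0 (S := predT)) => //.
apply: (@Bd_le _ _ _ _ _ _ _ _ _ (Y * (M + C * eps) + eps * L ^+ 3 + C * eps)).
  by rewrite le_eqVlt; apply/orP; left; apply/eqP; rewrite /B; ring.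
apply: (Bd_add D0) => //.
have := Bd_scale D0 (-1) I (Bd_weight_le mu01 hg1); by rewrite normrN normr1 mul1r.
Unshelve. all: by end_near. Qed.

End DarbouxConvergence.

(** * Nets and Jonas transforms in terms of rotation coefficients *)

Section Identities.
Context {F : fieldType}.
Implicit Types hi hj hk : F.

(** Since the denominator is symmetric in i and k, the step also has the form delta_i gamma_jk =
    (tau_k gamma_ji) gamma_ik. The net equations are derived from this form. *)
Lemma el_key hi hk jk ji ik ki : 1 - hi * hk * ik * ki != 0 ->
  el hi hk jk ji ik ki = jk + hi * el hk hi ji jk ki ik * ik.
Proof.
move=> d; rewrite /el; have -> : 1 - hk * hi * ki * ik = 1 - hi * hk * ik * ki by ring.
by field.
Qed.

(** The common source of the cube equation of c and of the equations for a, b and c^+: in these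
    cases none, the second, the third or the first of the directions i, j, k is the Jonas direction.
    An index after the underscore denotes a shift. *)
Lemma qnet_identity hi jk jk_i ik ij_k ji_k Hk Hk_i Hj_k Hj_ik Hi_k Hi_jk :
  hi != 0 -> Hk != 0 -> Hk_i != 0 -> Hj_k != 0 -> Hi_k != 0 ->
  jk_i = jk + hi * ji_k * ik -> Hj_ik = Hj_k + hi * Hi_jk * ij_k -> Hk_i = Hk + hi * Hi_k * ik ->
  hi^-1 * (jk_i * Hj_ik / Hk_i - jk * Hj_k / Hk) =
  (ij_k * Hi_jk / Hj_k) * (jk * Hj_k / Hk) + (ji_k * Hj_ik / Hi_k) * (ik * Hi_k / Hk)
  - (jk_i * Hj_ik / Hk_i) * (ik * Hi_k / Hk).
Proof.
move=> h0 k0 ki0 jk0 ik0 e1 e2 e3.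
have e4 : jk_i * Hj_ik = jk * Hj_k + hi * (ij_k * jk * Hi_jk + ji_k * ik * Hj_ik).
  by rewrite e1 mulrDl e2; ring.
apply: (mulfI h0); rewrite mulVKf //.
have -> : hi * (ij_k * Hi_jk / Hj_k * (jk * Hj_k / Hk) + ji_k * Hj_ik / Hi_k * (ik * Hi_k / Hk) - jk_i * Hj_ik / Hk_i * (ik * Hi_k / Hk))
  = hi * (ij_k * jk * Hi_jk + ji_k * ik * Hj_ik) / Hk - jk_i * Hj_ik / Hk_i * ((hi * Hi_k * ik) / Hk).
  by field; rewrite k0 ki0 jk0 ik0.
have -> : hi * Hi_k * ik = Hk_i - Hk by rewrite e3; ring.
have -> : hi * (ij_k * jk * Hi_jk + ji_k * ik * Hj_ik) = jk_i * Hj_ik - jk * Hj_k by rewrite e4; ring.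
by field; rewrite k0 ki0.
Qed.

Lemma second_difference_identity hi ij ji Hi Hj Hi_j Hj_i Xi Xj Xj_i :
  hi != 0 -> Hi != 0 -> Hj != 0 ->
  Hi_j = Hi + hi * Hj_i * ji -> Hj_i = Hj + hi * Hi_j * ij -> Xj_i = Xj + hi * ji * Xi ->
  hi^-1 * (Hj_i * Xj_i - Hj * Xj) = (ji * Hj_i / Hi) * (Hi * Xi) + (ij * Hi_j / Hj) * (Hj * Xj).
Proof.
move=> h0 i0 j0 e1 e2 e3; rewrite e3; apply: (mulfI h0); rewrite mulVKf //.
have -> : Hj = Hj_i - hi * Hi_j * ij by rewrite e2; ring.
field; apply/andP; split => //; suff -> : Hj_i - hi * Hi_j * ij = Hj by []; rewrite e2; ring.
Qed.

End Identities.

Section GaugeNets.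
Context {R : realType} {m N : nat}.
Local Notation pt := 'rV[R]_m.
Local Notation T := (option (option 'I_N)).
Local Notation J := ('I_m + T)%type.
Implicit Types (eps r : R) (hh : J -> R) (G : J -> J -> pt -> R) (i j k : 'I_m) (u : pt).

(* The nets are encoded by rotation coefficients gamma_jk whose indices are the
   m lattice directions (inl i), the direction jo of the Jonas transformation,
   which has step 1, and formal indices of step 0: gamma_(st,k) is the Lame
   coefficient H_k, gamma_(j, sh n) the n-th coordinate of the tangent direction
   X_j, where delta_j f = H_j X_j, and gamma_(st, sh n) that of f itself. *)
Definition jo : J := inr None.
Definition st : J := inr (Some None).
Definition sh (n : 'I_N) : J := inr (Some (Some n)).

(** The transformation as one step of length 1 in the Jonas direction. *)
Definition transf hh G (j k : J) u := el 1 (hh k) (G j k u) (G j jo u) (G jo k u) (G k jo u).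
(** By the symmetric form of the Darboux equations this is c_ij = delta_i H_j / H_j, and [neta],
    [netb] are a_j = H_j^+ / H_j and b_j = delta_j H_jo / H_jo, all written without division by eps.
    For eps = 0 the shift is the identity and the formulas are those of the smooth nets. *)
Definition netc eps G i j u := G (inl i) (inl j) u * tau eps j (G st (inl i)) u / G st (inl j) u.
Definition neta eps G j u := 1 + G jo (inl j) u * tau eps j (G st jo) u / G st (inl j) u.
Definition netb hh G j u := G (inl j) jo u * transf hh G st (inl j) u / G st jo u.
Definition net G u : 'rV[R]_N := \row_n G st (sh n) u.

Section Laws.
Context (eps r : R) (hh : J -> R).
Hypotheses (eps0 : 0 < eps) (hh_lat : forall i, hh (inl i) = eps) (hh_jo : hh jo = 1).
Hypotheses (hh_st : hh st = 0) (hh_sh : forall n, hh (sh n) = 0).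
Local Notation v0 := (fun _ : 'I_m => 0%N).
Local Notation V := (Ldom eps r v0).

(** [P] selects the indices for which the law is claimed: the transformed coefficients satisfy it
    only away from the index [jo], along which the step was taken. *)
Definition gauge_law (P : pred J) G := forall u i (j k : J), V u -> V (u + eps *: unitv i) -> P j -> P k ->
  ~~ static j k i -> G j k (u + eps *: unitv i) =
    el eps (hh k) (G j k u) (G j (inl i) u) (G (inl i) k u) (G k (inl i) u).

Lemma Ldom_vadd v i u : Ldom eps r (vadd v i) u -> Ldom eps r v u.
Proof. by apply: Ldom_le => // k; exact: le_vadd. Qed.

Lemma Ldom_tau i u : Ldom eps r (vadd v0 i) u -> V u /\ V (u + eps *: unitv i).
Proof. by move=> h; split; [exact: Ldom_vadd h|exact: Ldom_shift]. Qed.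

Section Law.
Context (P : pred J) (G : J -> J -> pt -> R).
Hypotheses (G_law : gauge_law P G) (P_lat : forall i, P (inl i)) (P_st : P st) (P_sh : forall n, P (sh n)).
Hypothesis den : forall u i k, V u -> 1 - eps * eps * G (inl i) (inl k) u * G (inl k) (inl i) u != 0.

Lemma gauge_key u i (j : J) k : V u -> V (u + eps *: unitv i) -> V (u + eps *: unitv k) -> P j ->
  i != k -> j != inl i -> j != inl k ->
  G j (inl k) (u + eps *: unitv i) =
    G j (inl k) u + eps * G j (inl i) (u + eps *: unitv k) * G (inl i) (inl k) u.
Proof.
move=> vu vi vk Pj ik ji jk.
rewrite (G_law vu vi Pj (P_lat k)); last by rewrite /static negb_or eq_sym ji.
rewrite (G_law vu vk Pj (P_lat i)); last by rewrite /static negb_or eq_sym jk eq_sym.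
by rewrite !hh_lat; apply: el_key; exact: den.
Qed.

Hypothesis H0 : forall u j, V u -> G st (inl j) u != 0.

Lemma net_qnet u i j k : i != j -> j != k -> i != k -> Ldom eps r (vadd (vadd (vadd v0 k) j) i) u ->
  dl eps i (netc eps G j k) u = tau eps k (netc eps G i j) u * netc eps G j k u +
    tau eps k (netc eps G j i) u * netc eps G i k u - tau eps i (netc eps G j k) u * netc eps G i k u.
Proof.
move=> ij jk ik d; have e0 : eps != 0 by rewrite gt_eqF.
have dkj := Ldom_vadd d.
have dki : Ldom eps r (vadd (vadd v0 k) i) u by apply: (@Ldom_vadd _ j); rewrite vaddC.
have [vu vk] := Ldom_tau (Ldom_vadd dkj).
have vi : V (u + eps *: unitv i) by apply: (@Ldom_vadd _ k); exact: Ldom_shift.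
have vki : V (u + eps *: unitv k + eps *: unitv i) by do 2!apply: Ldom_shift; rewrite vaddC.
have vkj : V (u + eps *: unitv k + eps *: unitv j) by do 2!apply: Ldom_shift; rewrite vaddC.
have Sl l : st != inl l by [].
have := @qnet_identity _ eps (G (inl j) (inl k) u) (G (inl j) (inl k) (u + eps *: unitv i))
 (G (inl i) (inl k) u) (G (inl i) (inl j) (u + eps *: unitv k)) (G (inl j) (inl i) (u + eps *: unitv k))
 (G st (inl k) u) (G st (inl k) (u + eps *: unitv i)) (G st (inl j) (u + eps *: unitv k))
 (G st (inl j) (u + eps *: unitv k + eps *: unitv i)) (G st (inl i) (u + eps *: unitv k))
 (G st (inl i) (u + eps *: unitv k + eps *: unitv j)) e0 (H0 _ vu) (H0 _ vi) (H0 _ vk) (H0 _ vk).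
rewrite /dl /tau /netc /tau [u + eps *: unitv i + eps *: unitv k]addrAC; apply.
- by apply: gauge_key => //; rewrite eq_sym.
- exact: gauge_key.
- exact: gauge_key.
Qed.

Lemma gauge_sh (j : J) n u i : V u -> V (u + eps *: unitv i) -> P j -> j != inl i ->
  G j (sh n) (u + eps *: unitv i) = G j (sh n) u + eps * G j (inl i) u * G (inl i) (sh n) u.
Proof.
move=> vu vi Pj ji; rewrite (G_law vu vi Pj (P_sh n)); last by rewrite /static negb_or eq_sym ji.
by rewrite hh_sh /el mulr0 !mul0r subr0 divr1.
Qed.

Lemma net_step n u i : V u -> V (u + eps *: unitv i) ->
  dl eps i (G st (sh n)) u = G st (inl i) u * G (inl i) (sh n) u.
Proof.
by move=> vu vi; rewrite /dl gauge_sh // [_ + _ - _]addrAC subrr add0r -mulrA mulKf ?gt_eqF.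
Qed.

Lemma net_second n u i j : i != j -> Ldom eps r (vadd (vadd v0 j) i) u ->
  dl eps i (dl eps j (G st (sh n))) u =
   netc eps G j i u * dl eps i (G st (sh n)) u + netc eps G i j u * dl eps j (G st (sh n)) u.
Proof.
move=> ij d; have [vu vj] := Ldom_tau (Ldom_vadd d).
have vi : V (u + eps *: unitv i) by apply: (@Ldom_vadd _ j); exact: Ldom_shift.
have vij : V (u + eps *: unitv i + eps *: unitv j) by do 2!apply: Ldom_shift.
have -> : dl eps i (dl eps j (G st (sh n))) u = eps^-1 * (dl eps j (G st (sh n)) (u + eps *: unitv i) - dl eps j (G st (sh n)) u) by [].
rewrite !net_step //; have e0 : eps != 0 by rewrite gt_eqF.
have ji : j != i by rewrite eq_sym.
rewrite /netc /tau; apply: second_difference_identity => //; try exact: H0.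
- exact: gauge_key.
- exact: gauge_key.
- exact: gauge_sh.
Qed.

End Law.

Section Transform.
Context (G : J -> J -> pt -> R).
Local Notation G0 := (transf hh G).
Hypothesis G_law : gauge_law predT G.
Hypothesis den : forall u i (k : J), V u -> 1 - eps * hh k * G (inl i) k u * G k (inl i) u != 0.

Let den_lat u i k : V u -> 1 - eps * eps * G (inl i) (inl k) u * G (inl k) (inl i) u != 0.
Proof. by move=> vu; rewrite -{2}(hh_lat k); exact: den. Qed.

Let den_jo u k : V u -> 1 - eps * 1 * G (inl k) jo u * G jo (inl k) u != 0.
Proof. by move=> vu; have := den k jo vu; rewrite hh_jo. Qed.

Let den_jo' u k : V u -> 1 - 1 * eps * G jo (inl k) u * G (inl k) jo u != 0.
Proof.
move=> vu; have -> : 1 - 1 * eps * G jo (inl k) u * G (inl k) jo u = 1 - eps * 1 * G (inl k) jo u * G jo (inl k) u by ring.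
exact: den_jo.
Qed.

(** A lattice step in direction i commutes with the step in direction [jo], by [el_comm]. The formal
    indices have step 0, so their denominators are 1. *)
Lemma transf_law : gauge_law (predC1 jo) G0.
Proof.
move=> u i j k vu vi jZ kZ S.
have st_jo (j' : J) : ~~ (inl i == j') -> ~~ static j' jo i by move=> h; rewrite /static negb_or h.
have stC (j' k' : J) : static j' k' i = static k' j' i by rewrite /static orbC.
have /norP[ij ik] := S.
have lw (j' k' : J) : ~~ static j' k' i -> G j' k' (u + eps *: unitv i) =
    el eps (hh k') (G j' k' u) (G j' (inl i) u) (G (inl i) k' u) (G k' (inl i) u) by exact: G_law.
have S1 := st_jo j ij; have S3 := st_jo k ik; have S2 : ~~ static jo k i by rewrite stC.
rewrite /transf (lw j k S) (lw j jo S1) (lw jo k S2) (lw k jo S3).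
rewrite hh_jo hh_lat; symmetry; apply: el_comm; [exact: den| |exact: den_jo|].
  by case: (k) kZ => [l _|[[n|]|//] _]; rewrite ?hh_lat ?hh_st ?hh_sh ?mulr0 ?mul0r ?subr0 ?oner_neq0 //; exact: den_jo'.
have -> : el eps (hh k) (G jo k u) (G jo (inl i) u) (G (inl i) k u) (G k (inl i) u) = G jo k (u + eps *: unitv i).
  by rewrite -lw.
have -> : el eps 1 (G k jo u) (G k (inl i) u) (G (inl i) jo u) (G jo (inl i) u) = G k jo (u + eps *: unitv i).
  by rewrite lw // hh_jo.
by case: (k) kZ => [l _|[[n|]|//] _]; rewrite ?hh_lat ?hh_st ?hh_sh ?mulr0 ?mul0r ?subr0 ?oner_neq0 //; exact: den_jo'.
Qed.

Lemma key_to_jo u i (j : J) : V u -> j != inl i -> j != jo -> V (u + eps *: unitv i) ->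
  G j jo (u + eps *: unitv i) = G j jo u + eps * G0 j (inl i) u * G (inl i) jo u.
Proof.
move=> vu ji jZ vi; rewrite (G_law vu vi) //; last by rewrite /static negb_or eq_sym ji.
by rewrite hh_jo el_key ?den_jo // /transf hh_lat.
Qed.

(** The symmetric form on the face spanned by k and [jo], as in [key_to_jo] but with the roles of
    the two directions exchanged. *)
Lemma key_by_jo u (j : J) k : V u -> j != inl k -> j != jo -> V (u + eps *: unitv k) ->
  G0 j (inl k) u = G j (inl k) u + G j jo (u + eps *: unitv k) * G jo (inl k) u.
Proof.
move=> vu jk jZ vk; rewrite (G_law (k := jo) vu vk) //; last by rewrite /static negb_or eq_sym jk.
by rewrite hh_jo /transf hh_lat el_key ?den_jo' // mul1r.
Qed.

Hypothesis den0 : forall u i k, V u -> 1 - eps * eps * G0 (inl i) (inl k) u * G0 (inl k) (inl i) u != 0.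
Hypothesis H_neq0 : forall u j, V u -> G st (inl j) u != 0.
Hypothesis Hjo_neq0 : forall u, V u -> G st jo u != 0.
Hypothesis Hp_neq0 : forall u j, V u -> G0 st (inl j) u != 0.
Local Notation c := (netc eps G).
Local Notation cp := (netc eps G0).
Local Notation a := (neta eps G).
Local Notation b := (netb hh G).

Lemma jonas_f n u i : V u -> V (u + eps *: unitv i) ->
  dl eps i (G0 st (sh n)) u = a i u * dl eps i (G st (sh n)) u + b i u * (G0 st (sh n) u - G st (sh n) u).
Proof.
move=> vu vi; rewrite (net_step transf_law) // (net_step G_law) //.
(* A formal index has step 0, so the denominator is 1. For j = [st] this reads f^+ - f = H_jo
   X_jo. *)
have X (j : J) : G0 j (sh n) u = G j (sh n) u + G j jo u * G jo (sh n) u.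
  by rewrite /transf hh_sh /el mulr0 !mul0r subr0 divr1 mul1r.
have aE : a i u = G0 st (inl i) u / G st (inl i) u.
  by rewrite /neta key_by_jo // mulrDl divff ?H_neq0 // /tau [G jo _ _ * _]mulrC.
rewrite aE /netb !X; field.
by rewrite H_neq0 // Hjo_neq0.
Qed.

Lemma jonas_a u i j : i != j -> Ldom eps r (vadd (vadd v0 j) i) u ->
  dl eps i (a j) u = tau eps j (b i) u * (a j u - 1) + (tau eps j (a i) u - tau eps i (a j) u) * c i j u.
Proof.
move=> ij d; have e0 : eps != 0 by rewrite gt_eqF.
have [vu vj] := Ldom_tau (Ldom_vadd d).
have vi : V (u + eps *: unitv i) by apply: (@Ldom_vadd _ j); exact: Ldom_shift.
have vji : V (u + eps *: unitv j + eps *: unitv i) by do 2!apply: Ldom_shift; rewrite vaddC.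
have := @qnet_identity _ eps (G jo (inl j) u) (G jo (inl j) (u + eps *: unitv i))
 (G (inl i) (inl j) u) (G (inl i) jo (u + eps *: unitv j)) (G jo (inl i) (u + eps *: unitv j))
 (G st (inl j) u) (G st (inl j) (u + eps *: unitv i)) (G st jo (u + eps *: unitv j))
 (G st jo (u + eps *: unitv j + eps *: unitv i)) (G st (inl i) (u + eps *: unitv j))
 (G0 st (inl i) (u + eps *: unitv j)) e0 (H_neq0 _ vu) (H_neq0 _ vi) (Hjo_neq0 vj) (H_neq0 _ vj).
move=> /(_ _ _ _)H; rewrite /dl /tau /neta /netb /netc /tau [u + eps *: unitv i + eps *: unitv j]addrAC.
transitivity (eps^-1 * (G jo (inl j) (u + eps *: unitv i) * G st jo (u + eps *: unitv j + eps *: unitv i) / G st (inl j) (u + eps *: unitv i)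
  - G jo (inl j) u * G st jo (u + eps *: unitv j) / G st (inl j) u)); first by congr (_ * _); ring.
rewrite H; first by ring.
- exact: (gauge_key G_law).
- exact: key_to_jo.
- exact: (gauge_key G_law).
Qed.

Lemma jonas_b u i j : i != j -> Ldom eps r (vadd (vadd v0 j) i) u ->
  dl eps i (b j) u = cp i j u * b j u + cp j i u * b i u - tau eps i (b j) u * b i u.
Proof.
move=> ij d; have e0 : eps != 0 by rewrite gt_eqF.
have [vu vj] := Ldom_tau (Ldom_vadd d).
have vi : V (u + eps *: unitv i) by apply: (@Ldom_vadd _ j); exact: Ldom_shift.
have := @qnet_identity _ eps (G (inl j) jo u) (G (inl j) jo (u + eps *: unitv i))
 (G (inl i) jo u) (G0 (inl i) (inl j) u) (G0 (inl j) (inl i) u)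
 (G st jo u) (G st jo (u + eps *: unitv i)) (G0 st (inl j) u)
 (G0 st (inl j) (u + eps *: unitv i)) (G0 st (inl i) u)
 (G0 st (inl i) (u + eps *: unitv j)) e0 (Hjo_neq0 vu) (Hjo_neq0 vi) (Hp_neq0 _ vu) (Hp_neq0 _ vu).
rewrite /dl /tau /netb /netc /tau; apply.
- by apply: key_to_jo; rewrite // eq_sym.
- exact: (gauge_key transf_law).
- exact: key_to_jo.
Qed.

Lemma jonas_c u i j : i != j -> Ldom eps r (vadd (vadd v0 j) i) u ->
  a j u * cp i j u = tau eps j (a i) u * c i j u + tau eps j (b i) u * (a j u - 1).
Proof.
move=> ij d.
have [vu vj] := Ldom_tau (Ldom_vadd d).
have vji : V (u + eps *: unitv j + eps *: unitv i) by do 2!apply: Ldom_shift; rewrite vaddC.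
have := @qnet_identity _ 1 (G (inl i) (inl j) u) (G0 (inl i) (inl j) u)
 (G jo (inl j) u) (G jo (inl i) (u + eps *: unitv j)) (G (inl i) jo (u + eps *: unitv j))
 (G st (inl j) u) (G0 st (inl j) u) (G st (inl i) (u + eps *: unitv j))
 (G0 st (inl i) (u + eps *: unitv j)) (G st jo (u + eps *: unitv j))
 (G st jo (u + eps *: unitv j + eps *: unitv i)) (oner_neq0 _) (H_neq0 _ vu) (Hp_neq0 _ vu) (H_neq0 _ vj) (Hjo_neq0 vj).
rewrite invr1 !mul1r => K; have {K} := K (key_by_jo vu _ _ vj) (key_by_jo vj _ _ vji) (key_by_jo vu _ _ vj).
move=> /(_ ij isT isT isT isT isT) H.
have E (y z p q s : R) : y - z = p * z + s * q - y * q -> (1 + q) * y = (1 + p) * z + s * (1 + q - 1).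
  by move=> h; apply/eqP; rewrite -subr_eq0; apply/eqP; rewrite -(subrr (y - z)) {2}h; ring.
exact: E.
Qed.

End Transform.
End Laws.
End GaugeNets.

Section ShrinkDomain.
Context {R : realType} {m : nat}.
Local Notation pt := 'rV[R]_m.
Implicit Types (g : pt -> R) (i : 'I_m) (v : 'I_m -> nat) (eps r : R).

Lemma Bd_domain (D1 D2 : ('I_m -> nat) -> set pt) (s : ('I_m -> nat) -> 'I_m -> nat) D mu n v P g M :
  (forall v i, s (vadd v i) = vadd (s v) i) -> (forall v, D1 v `<=` D2 (s v)) ->
  Bd D2 D mu n (s v) P g M -> Bd D1 D mu n v P g M.
Proof.
move=> hs hD; elim: n v g M => [|n IH] v g M /=; first by move=> [M0 h]; split => // u du; apply: h; exact: hD.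
move=> [M0 [Mi [h0 h1 h2 h3]]]; exists M0, Mi; split => //; first exact: IH.
by move=> i Pi; apply: IH; rewrite hs; exact: h1.
Qed.

Lemma OE_shrink r r' v i (g : R -> pt -> R) : r < r' -> OE r' (vadd v i) g -> OE r v g.
Proof.
move=> rr h n; have [C C0 hC] := h n; exists C => //.
near=> eps; apply: (@Bd_domain _ (Ldom eps r') (fun w => vadd w i)); last by near: eps.
  by move=> w j; exact: vaddC.
have e0 : 0 < eps by near: eps; exact: near_pos.
have er : eps < r' - r by near: eps; apply: near_lt; rewrite subr_gt0.
move=> w u [nu [-> hu]]; exists nu; split => // k.
rewrite /vadd addnA natrD mulrDr; have := hu k.
have : eps * (k == i)%:R <= eps by rewrite ler_piMr ?(ltW e0) // lern1; case: (k == i).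
lra.
Unshelve. all: by end_near. Qed.

(** For a function smooth on the whole space no step is lost: the estimate is taken on the box r +
    1, where one more step is possible for every small eps. *)
Lemma smT_dl r v i g : 0 < r -> sm setT g -> Cv r v (fun eps => dl eps i g) (partial i g).
Proof.
move=> r0 hg; have r1 : 0 < r + 1 by rewrite addr_gt0.
split; last by apply: snear_partial; exact: snear_smT.
apply: (@OE_shrink _ (r + 1) _ i); first by rewrite ltrDl.
exact: (snear_dl v i (snear_smT (r + 1) hg)).
Qed.

End ShrinkDomain.

(** * Convergence for a linear difference equation *)

Section LinearEquation.
Context {R : realType} {m : nat} (r : R) (i : 'I_m).
Local Notation pt := 'rV[R]_m.
Local Notation v0 := (fun _ : 'I_m => 0%N).
Context (g : R -> pt -> R) (g0 : pt -> R) (E : R -> pt -> R) (E0 : pt -> R) (K : R).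
Hypotheses (r0 : 0 < r) (gC : Cv r v0 g g0) (g0K : forall u, box r u -> `|g0 u| <= K) (K1 : 0 <= K).
Hypothesis small : m%:R * (r * (K + 1)) <= 4^-1.
Hypothesis E_step : \forall eps \near (0 : R)^'+, forall u, Ldom eps r (vadd v0 i) u ->
  E eps (u + eps *: unitv i) = E eps u * (1 + eps * g eps u).
Hypothesis E_start : \forall eps \near (0 : R)^'+, forall u, Ldom eps r v0 u -> u 0 i = 0 -> E eps u = 1.
Hypotheses (E0_snear : snear r E0) (E0_step : forall u, box r u -> partial i E0 u = g0 u * E0 u).
Hypothesis E0_start : forall u, box r u -> u 0 i = 0 -> E0 u = 1.

(** A discrete Gronwall bound at fixed eps, which starts the contraction in [linear_Cv]. *)
Lemma linear_bounded eps X : 0 < eps -> 0 <= X -> (forall u, Ldom eps r v0 u -> `|g eps u| <= X) ->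
  (forall u, Ldom eps r (vadd v0 i) u -> E eps (u + eps *: unitv i) = E eps u * (1 + eps * g eps u)) ->
  (forall u, Ldom eps r v0 u -> u 0 i = 0 -> E eps u = 1) ->
  exists2 M, 0 <= M & forall u, Ldom eps r v0 u -> `|E eps u| <= M.
Proof.
move=> e0 X0 hg hs h1; pose q := 1 + eps * X.
have q1 : 1 <= q by rewrite lerDl mulr_ge0 // ltW.
exists (q ^+ Num.trunc (r / eps)); first by rewrite exprn_ge0 // (le_trans ler01).
have claim n nu : nu i = n -> (forall k, eps * (nu k)%:R <= r) -> `|E eps (latt eps nu)| <= q ^+ n.
  elim: n nu => [|n IH] nu nun hnu.
    rewrite h1 ?normr1 //; first by exists nu; split => // k; rewrite addn0.
    by rewrite mxE nun mulr0.
  have nu0 : (0 < nu i)%N by rewrite nun.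
  have ws k : eps * (vsub nu i k)%:R <= r.
    by apply: le_trans (hnu k); rewrite ler_pM2l // ler_nat /vsub leq_subr.
  rewrite -(vadd_sub nu0) latt_vadd hs; last first.
    exists (vsub nu i); split => // k; have := hnu k; rewrite -[nu in _ * (nu k)%:R <= _ -> _](vadd_sub nu0).
    by rewrite /vadd add0n.
  rewrite normrM exprSr; apply: ler_pM => //; first by apply: IH; rewrite // /vsub eqxx nun subn1.
  apply: le_trans (ler_normD _ _) _; rewrite normr1 lerD2l normrM gtr0_norm // ler_pM2l //.
  by apply: hg; exists (vsub nu i); split => // k; rewrite addn0.
move=> u [nu [-> hnu]]; apply: le_trans (claim _ _ (erefl _) _) _.
  by move=> k; have := hnu k; rewrite addn0.
apply: ler_weXn2l => //; rewrite truncn_ge_nat; last by rewrite divr_ge0 // ltW.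
by rewrite ler_pdivlMr // mulrC; have := hnu i; rewrite addn0.
Qed.

(** The contraction scheme for a family with one member and a path in the single direction i: the
    error vanishes on the hyperplane u_i = 0 and solves the linear equation up to O(eps). *)
Lemma linear_Cv : Cv r v0 E E0.
Proof.
split => // n; have [s1 s2] := gC.
have [C1 C10 h1] := s1 n; have [C2 C20 h2] := snear_OB v0 s2 n; have [C3 C30 h3] := snear_OB v0 E0_snear n.
have [C4 C40 h4] := snear_dl v0 i E0_snear n.
pose X := K + 1; have X0 : 0 <= X by rewrite addr_ge0.
have [mu mu1 hmu] : exists2 mu : R, 0 < mu <= 1 & mu * (C2 + m%:R * n%:R * X) <= 4^-1.
  by apply: small_weight; rewrite ?invr_gt0 // addr_ge0 // !mulr_ge0.
have /andP[mu0 mule1] := mu1; have mu01 : 0 <= mu <= 1 by rewrite ltW.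
have muC : mu * C2 <= 4^-1 /\ m%:R * ((r + n%:R * mu) * X) <= 2^-1.
  move: hmu; rewrite mulrDr => a.
  have p1 : 0 <= mu * C2 by rewrite mulr_ge0 // ltW.
  have p2 : 0 <= mu * (m%:R * n%:R * X) by rewrite !mulr_ge0 // ltW.
  split; first by lra.
  have -> : m%:R * ((r + n%:R * mu) * X) = m%:R * (r * X) + mu * (m%:R * n%:R * X) by ring.
  have := small; rewrite -/X; lra.
case: muC => muC sm2.
have num1 x : x <= 2^-1 -> K + mu * C2 + x <= X by rewrite /X => hx; lra.
pose B := C1 * C3 + C4; have B0 : 0 <= B by rewrite addr_ge0 // mulr_ge0.
have th0 : 0 <= m%:R * ((r + n%:R * mu) * B).
  by rewrite mulr_ge0 // mulr_ge0 // addr_ge0 ?(ltW r0) // mulr_ge0 // ltW.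
exists (3 * (1 + m%:R * ((r + n%:R * mu) * B)) / mu ^+ n).
  by rewrite divr_ge0 ?exprn_ge0 ?(ltW mu0) // mulr_ge0 // addr_ge0.
near=> eps.
have e0 : 0 < eps by near: eps; exact: near_pos.
have e1 : eps <= 1 by near: eps; apply: filterS (near_lt ltr01) => e /ltW.
have g1 : Bd (Ldom eps r) (dl eps) 1 n v0 predT (fun u => g eps u - g0 u) (C1 * eps) by near: eps.
have g2 : Bd (Ldom eps r) (dl eps) 1 n v0 predT g0 C2 by near: eps.
have g3 : Bd (Ldom eps r) (dl eps) 1 n v0 predT E0 C3 by near: eps.
have g4 : Bd (Ldom eps r) (dl eps) 1 n (vadd v0 i) predT (fun u => dl eps i E0 u - partial i E0 u) (C4 * eps) by near: eps.
have st1 : forall u, Ldom eps r (vadd v0 i) u -> E eps (u + eps *: unitv i) = E eps u * (1 + eps * g eps u) by near: eps.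
have st2 : forall u, Ldom eps r v0 u -> u 0 i = 0 -> E eps u = 1 by near: eps.
have eC : C1 * eps <= 2^-1.
  have h : eps < 2^-1 / (C1 + 1) by near: eps; apply: near_lt; rewrite divr_gt0 // ltr_wpDl.
  rewrite ltr_pdivlMr ?ltr_wpDl // mulrDr mulr1 mulrC in h; apply: le_trans (ltW h); rewrite lerDl; exact: ltW.
have D0 := discrete_calculus (m := m) e0 (ltW r0) (ltW mu0).
have gX : Bd (Ldom eps r) (dl eps) mu n v0 predT (g eps) X.
  have -> : g eps = (fun u => g0 u + (g eps u - g0 u)) by apply/funext => u; ring.
  apply: (Bd_le (num1 _ eC)).
  apply: (Bd_add D0 I I _ (Bd_weight_le mu01 g1)); apply: (Bd_small_weight mu01 _ g2).
  by split => // u du _; apply: g0K; exact: Ldom_box du.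
have gX0 u : Ldom eps r v0 u -> `|g eps u| <= X.
  have [_ h] : Bd (Ldom eps r) (dl eps) mu 0 v0 predT (g eps) X := Bd_leqn D0 (leq0n n) gX.
  by move=> du; apply: h => // k; rewrite -topredE.
have [M M0 hM] := linear_bounded e0 X0 gX0 st1 st2.
have [Z0 Z00 hZ0] : exists2 Z, 0 <= Z & Bd (Ldom eps r) (dl eps) mu n v0 predT (fun u => E eps u - E0 u) Z.
  have [Z1 Z10 hZ1] : exists2 Z, 0 <= Z & Bd (Ldom eps r) (dl eps) mu n v0 predT (E eps) Z.
    have hM0 : Bd (Ldom eps r) (dl eps) mu 0 v0 predT (E eps) M by split => // u du _; exact: hM.
    exact: (discrete_crude n e0 (ltW mu0) hM0).
  exists (Z1 + C3); first exact: addr_ge0.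
  exact: (Bd_sub2 D0 I I hZ1 (Bd_weight_le mu01 g3)).
apply: (@Bd_le _ _ _ _ _ _ _ _ _ ((3 * (1 * eps + m%:R * ((r + n%:R * mu) * (B * eps)))) / mu ^+ n)).
  rewrite le_eqVlt; apply/orP; left; apply/eqP; field; by rewrite expf_neq0 // gt_eqF.
apply: Bd_unit_weight => //.
have H := @Bd_contraction _ _ _ _ _ _ _ _ D0 unit n v0 (fun _ => predC1 i)
    (fun _ u => E eps u - E0 u) X (1 * eps) (B * eps) Z0 (fun=> I) X0.
apply: (H _ _ sm2 _ _ Z00 (fun=> hZ0) tt).
- by rewrite mul1r.
- by rewrite mulr_ge0 // ltW.
- move=> _; apply: (@discrete_Bd_congr _ _ _ _ _ _ _ _ (fun=> 0)); [|exact: e0|].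
    move=> u du us; have ui : u 0 i = 0 by apply: us; rewrite -topredE /= eqxx.
    by rewrite st2 // E0_start ?subrr //; exact: Ldom_box du.
  apply: (Bd_le _ (Bd_const D0 _ _ _ 0)); rewrite normr0 mul1r; exact: ltW.
move=> M' M'0 hM' _ k /=; rewrite negbK => /eqP ->.
apply: (@discrete_Bd_congr _ _ _ _ _ _ _ _
  (fun u => (g eps u * (E eps u - E0 u) + (g eps u - g0 u) * E0 u) + -1 * (dl eps i E0 u - partial i E0 u))); [|exact: e0|].
  move=> u du _; rewrite /dl st1 // E0_step; last by exact: Ldom_box du.
  by field; rewrite gt_eqF.
apply: (Bd_subP D0 (S := predT)) => //.
apply: (@Bd_le _ _ _ _ _ _ _ _ _ (X * M' + (C1 * eps) * C3 + `|-1| * (C4 * eps))).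
  by rewrite normrN normr1 mul1r /B le_eqVlt; apply/orP; left; apply/eqP; ring.
have hv (f : pt -> R) Z : Bd (Ldom eps r) (dl eps) mu n v0 predT f Z -> Bd (Ldom eps r) (dl eps) mu n (vadd v0 i) predT f Z.
  exact: (Bd_vadd D0).
apply: (Bd_add D0 I I _ (Bd_scale D0 (-1) I (Bd_weight_le mu01 g4))).
apply: (Bd_add D0 I I (Bd_mul D0 I I (hv _ _ gX) (hv _ _ (hM' tt)))).
exact: (Bd_mul D0 I I (hv _ _ (Bd_weight_le mu01 g1)) (hv _ _ (Bd_weight_le mu01 g3))).
Unshelve. all: by end_near. Qed.

End LinearEquation.

(** * Initial data *)

Section Products.
Context {R : realType} {m : nat}.
Local Notation pt := 'rV[R]_m.
Implicit Types (g h : pt -> R) (u w : pt) (i j : 'I_m) (P Q : pred 'I_m) (eps r : R).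

Definition primexp i g : pt -> R := fun u => expR (prim_dir i g u).

(** The discrete counterpart of [primexp]: the solution of delta_i E = g E with E = 1 where u_i =
    0. *)
Definition latprod eps i g : pt -> R :=
  fun u => \prod_(s < idx eps u i) (1 + eps * g (setc i (eps * s%:R) u)).

Lemma latprod0 eps i g u : u 0 i = 0 -> latprod eps i g u = 1.
Proof. by move=> u0; rewrite /latprod /idx u0 mul0r truncn0 big_ord0. Qed.

Lemma latprod_step eps i g r v u : 0 < eps -> Ldom eps r v u ->
  latprod eps i g (u + eps *: unitv i) = latprod eps i g u * (1 + eps * g u).
Proof.
move=> e0 [nu [-> _]]; rewrite -latt_vadd /latprod !idx_latt //.
have -> : vadd nu i i = (nu i).+1 by rewrite /vadd eqxx addn1.
rewrite big_ord_recr /=.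
congr (_ * (1 + eps * g _)).
  apply: eq_bigr => s _; congr (1 + eps * g _); apply/rowP => k; rewrite !mxE /vadd.
  by case: eqP => //; rewrite addn0.
by apply/rowP => k; rewrite !mxE /vadd; case: eqP => [->|_] //; rewrite addn0.
Qed.

Lemma sm_primexp i g : sm setT g -> sm setT (primexp i g).
Proof. by move=> hg; apply: sm_exp; [exact: openT|exact: sm_prim_dir]. Qed.

Lemma primexp_neq0 i g u : primexp i g u != 0.
Proof. by rewrite gt_eqF // expR_gt0. Qed.

Lemma primexp0 i g u : sm setT g -> u 0 i = 0 -> primexp i g u = 1.
Proof. by move=> hg u0; rewrite /primexp prim_dir0 ?expR0 // => w; exact: smT_derivable hg. Qed.

Lemma partial_primexp i g u : sm setT g -> partial i (primexp i g) u = g u * primexp i g u.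
Proof.
move=> hg; have dg w : derivable g w (unitv i) by exact: smT_derivable hg.
have [d e] := @prim_dir_derivable _ _ i g u dg.
by rewrite (partial_expR d).2 e mulrC.
Qed.

Lemma latprod_Cv i (g : R -> pt -> R) (g0 : pt -> R) r K : 0 < r -> sm setT g0 -> 0 <= K ->
  Cv r (fun=> 0%N) g g0 -> (forall u, box r u -> `|g0 u| <= K) -> m%:R * (r * (K + 1)) <= 4^-1 ->
  Cv r (fun=> 0%N) (fun eps => latprod eps i (g eps)) (primexp i g0).
Proof.
move=> r0 sg K0 gC gK small.
apply: (linear_Cv (i := i) r0 gC gK K0 small).
- near=> eps => u; apply: latprod_step; near: eps; exact: near_pos.
- by apply: nearW => eps u _; exact: latprod0.
- by apply: snear_smT; exact: sm_primexp.
- by move=> u _; exact: partial_primexp.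
- by move=> u _; exact: primexp0.
Unshelve. all: by end_near. Qed.

Definition depends_on P g := forall u, g (proj P u) = g u.

Lemma proj_sub P Q u : (forall k, P k -> Q k) -> proj P (proj Q u) = proj P u.
Proof. by move=> PQ; apply/rowP => k; rewrite !mxE; case: ifP => // /PQ ->. Qed.

Lemma depends_proj P Q (T : Type) (f : pt -> T) : (forall k, P k -> Q k) ->
  forall u, f (proj P (proj Q u)) = f (proj P u).
Proof. by move=> PQ u; rewrite proj_sub. Qed.

Lemma depends_primexp P i g : P i -> depends_on P g -> depends_on P (primexp i g).
Proof.
move=> Pi dg u.
have e s : g (setc i s (proj P u)) = g (setc i s u).
  rewrite -(dg (setc i s (proj P u))) -(dg (setc i s u)).
  have -> // : proj P (setc i s (proj P u)) = proj P (setc i s u).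
  by apply/rowP => k; rewrite !mxE; case: (k == i) => //; case: (P k).
by rewrite /primexp /prim_dir (funext e) mxE Pi.
Qed.

Lemma depends_partial P i g : P i -> depends_on P g -> depends_on P (partial i g).
Proof.
move=> Pi dg u; rewrite /partial /derive.
suff -> : (fun h : R => h^-1 *: ((g \o shift (proj P u)) (h *: unitv i) - g (proj P u))) =
   (fun h : R => h^-1 *: ((g \o shift u) (h *: unitv i) - g u)) by [].
apply/funext => h /=; rewrite dg; congr (_ *: (_ - _)).
by rewrite -[RHS]dg [in RHS]addrC proj_add Pi addrC.
Qed.

Lemma partial_along P (V : normedModType R) (f g : pt -> V) i u : P i -> coord_subspace P u ->
  (forall w, coord_subspace P w -> f w = g w) ->
  (fun h : R => h^-1 *: ((f \o shift u) (h *: unitv i) - f u)) =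
  (fun h : R => h^-1 *: ((g \o shift u) (h *: unitv i) - g u)).
Proof.
move=> Pi Pu fg; apply/funext => h /=; rewrite (fg u Pu) (fg (h *: unitv i + u)) //.
by rewrite addrC; exact: coord_shift.
Qed.

Lemma smooth_along_coord N P (f : pt -> 'rV[R]_N) n : smooth_along P (coord_subspace P) f ->
  smooth_along P (coord_subspace P) (fun u => f u 0 n : R^o).
Proof.
move=> hf; have partialsE s : {subset s <= P} -> forall u, coord_subspace P u ->
    partials s (fun u => f u 0 n : R^o) u = partials s f u 0 n.
  elim: s => [//|i s IH] sP u uP; have Pi : P i by apply: sP; rewrite mem_head.
  have sP' : {subset s <= P} by move=> k ks; apply: sP; rewrite inE ks orbT.
  have := (hf s sP').2 u i uP Pi => d /=; rewrite /partial (derive_mx d) mxE /derive.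
  by rewrite (partial_along Pi uP (IH sP')).
move=> s sP; have [ch dh] := hf s sP; split; last first.
  move=> u i uP Pi; rewrite /derivable (partial_along Pi uP (partialsE s sP)).
  by have /derivable_mxP := dh u i uP Pi; apply.
apply/subspace_continuousP => u uP.
have /subspace_continuousP/(_ u uP) c := ch.
have := cvg_comp _ _ c (@coord_continuous R 1 N 0 n (partials s f u)).
rewrite -(partialsE s sP u uP); apply: cvg_trans => V hV.
have uf : Filter (nbhs u) by exact: nbhs_filter.
have {}hV : nbhs u [set w | coord_subspace P w -> V (partials s f w 0 n)] by exact: hV.
suff : nbhs u [set w | coord_subspace P w -> V (partials s (fun u => f u 0 n : R^o) w)] by [].
by apply: filterS hV => w h wP; rewrite partialsE //; exact: h.
Qed.

End Products.

Section InitialData.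
Context {R : realType} {m N : nat}.
Local Notation pt := 'rV[R]_m.
Local Notation T := (option (option 'I_N)).
Local Notation J := ('I_m + T)%type.
Local Notation v0 := (fun _ : 'I_m => 0%N).
Implicit Types (eps r : R) (i j : 'I_m) (u : pt).
Context (midQ midJ : bool) (fQ : pt -> 'rV[R]_N) (cQ : 'I_m -> 'I_m -> pt -> R)
        (p : 'rV[R]_N) (aJ bJ : 'I_m -> pt -> R).
Hypotheses (dataQ : smooth_data_Q fQ cQ) (dataJ : smooth_data_J aJ bJ)
           (aJ_neq0 : forall i u, axis i u -> aJ i u != 0).

(** The data are extended by projection from their axis or plane, so that they become smooth
    functions on the whole space. *)
Definition fP i n u := fQ (proj (pred1 i) u) 0 n.
Definition cP i j u := cQ i j (proj (pred2 i j) u).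
Definition aP i u := aJ i (proj (pred1 i) u).
Definition bP i u := bJ i (proj (pred1 i) u).
Definition offQ eps i j : pt := if midQ then (eps / 2) *: unitv i + (eps / 2) *: unitv j else 0.
Definition offJ eps i : pt := if midJ then (eps / 2) *: unitv i else 0.
Definition cD eps i j u := cP i j (u + offQ eps i j).
Definition aD eps i u := aP i (u + offJ eps i).
Definition bD eps i u := bP i (u + offJ eps i).

Lemma fP_sm i n : sm setT (fP i n).
Proof. exact: (sm_proj (smooth_along_coord n (dataQ.1 i))). Qed.

Lemma cP_sm i j : i != j -> sm setT (cP i j).
Proof. by move=> ij; exact: (sm_proj (dataQ.2 i j ij)). Qed.

Lemma aP_sm i : sm setT (aP i). Proof. exact: (sm_proj (dataJ i).1). Qed.
Lemma bP_sm i : sm setT (bP i). Proof. exact: (sm_proj (dataJ i).2). Qed.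

Lemma aP_neq0 i u : aP i u != 0.
Proof. exact: (aJ_neq0 (@proj_in _ _ (pred1 i) u)). Qed.

(* Normalizing H_i = 1 on the i-th axis and H_jo(0) = 1, the equations
   c_ji = delta_j H_i / H_i and b_j = delta_j H_jo / H_jo determine H_i on the
   coordinate planes and H_jo on the axes; this gives the data of all gamma_jk. *)
Definition phi (j k : J) : pt -> R :=
  match j, k with
  | inl j, inl i => if j == i then fun=> 0
      else fun u => cP j i u * primexp j (cP j i) u / primexp i (cP i j) u
  | inr (Some None), inl _ => fun=> 1
  | inr (Some None), inr None => fun=> 1
  | inr (Some None), inr (Some (Some n)) => fun=> fQ 0 0 n
  | inr None, inl j => fun u => (aP j u - 1) / primexp j (bP j) u
  | inl j, inr None => fun u => bP j u * primexp j (bP j) u / aP j u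
  | inr None, inr (Some (Some n)) => fun=> p 0 n - fQ 0 0 n
  | inl i, inr (Some (Some n)) => partial i (fP i n)
  | _, _ => fun=> 0
  end.

(** Obtained from gamma_ji = c_ji H_i / tau_i H_j with tau_i H_j = (1 + eps c_ij) H_j, and likewise
    from gamma_(jo,j) = (a_j - 1) H_j / tau_j H_jo and gamma_(j,jo) = b_j H_jo / H_j^+, where H_j^+
    = a_j on the axis. The last quotient is where the data a_j must not vanish. *)
Definition phie eps (j k : J) : pt -> R :=
  match j, k with
  | inl j, inl i => if j == i then fun=> 0
      else fun u => cD eps j i u * latprod eps j (cD eps j i) u /
                    ((1 + eps * cD eps i j u) * latprod eps i (cD eps i j) u)
  | inr None, inl j => fun u => (aD eps j u - 1) / ((1 + eps * bD eps j u) * latprod eps j (bD eps j) u)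
  | inl j, inr None => fun u => bD eps j u * latprod eps j (bD eps j) u / aD eps j u
  | inl i, inr (Some (Some n)) => dl eps i (fP i n)
  | _, _ => phi j k
  end.

Lemma sm_div (g h : pt -> R) : sm setT g -> sm setT h -> (forall u, h u != 0) -> sm setT (fun u => g u / h u).
Proof.
by move=> hg hh h0; apply: sm_mul; [exact: openT|exact: hg|apply: sm_inv; [exact: openT|exact: hh|move=> u _; exact: h0]].
Qed.

Lemma smT_mul (g h : pt -> R) : sm setT g -> sm setT h -> sm setT (fun u => g u * h u).
Proof. by move=> hg hh; apply: sm_mul; [exact: openT|exact: hg|exact: hh]. Qed.

Lemma smT_cst (c : R) : sm setT (fun _ : pt => c).
Proof. by apply: sm_cst; exact: openT. Qed.

Lemma phi_sm (j k : J) : sm setT (phi j k).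
Proof.
case: j => [j|[[n|]|]]; case: k => [k|[[n'|]|]] /=; try exact: smT_cst.
- case: eqP => [_|/eqP jk]; first exact: smT_cst.
  have kj : k != j by rewrite eq_sym.
  apply: sm_div; [|exact: (sm_primexp k (cP_sm kj))|move=> u; exact: primexp_neq0].
  exact: (smT_mul (cP_sm jk) (sm_primexp j (cP_sm jk))).
- by apply: sm_partial; exact: fP_sm.
- apply: sm_div; [|exact: aP_sm|exact: aP_neq0].
  exact: (smT_mul (bP_sm j) (sm_primexp j (bP_sm j))).
- apply: sm_div; [|exact: (sm_primexp k (bP_sm k))|move=> u; exact: primexp_neq0].
  exact: (sm_add (@openT _) (aP_sm k) (smT_cst (-1))).
Qed.

Lemma phi_static (j k : J) u : phi j k (proj (static j k) u) = phi j k u.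
Proof.
have s1 i (P : pred 'I_m) (f : pt -> R) : P i -> (fun w => f (proj (pred1 i) (proj P w))) = (fun w => f (proj (pred1 i) w)).
  by move=> Pi; apply/funext => w; apply: depends_proj => k' /eqP ->.
have s2 i i' (P : pred 'I_m) (f : pt -> R) : P i -> P i' -> (fun w => f (proj (pred2 i i') (proj P w))) = (fun w => f (proj (pred2 i i') w)).
  by move=> Pi Pi'; apply/funext => w; apply: depends_proj => k' /orP[] /eqP ->.
have dc i i' (P : pred 'I_m) : P i -> P i' -> depends_on P (cP i i').
  by move=> Pi Pi' w; have := congr1 (fun f => f w) (s2 i i' P (cQ i i') Pi Pi').
have da i (P : pred 'I_m) : P i -> depends_on P (aP i).
  by move=> Pi w; have := congr1 (fun f => f w) (s1 i P (aJ i) Pi).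
have db i (P : pred 'I_m) : P i -> depends_on P (bP i).
  by move=> Pi w; have := congr1 (fun f => f w) (s1 i P (bJ i) Pi).
have stl i (k' : J) : static (inl i) k' i by rewrite /static eqxx.
have str i (j' : J) : static j' (inl i) i by rewrite /static eqxx orbT.
case: j => [j|[[n|]|]]; case: k => [k|[[n'|]|]] //=.
- case: (j == k) => //.
  by rewrite dc // (depends_primexp _ (dc _ _ _ _ _)) // (depends_primexp _ (dc _ _ _ _ _)).
- apply: depends_partial => // w.
  by have := congr1 (fun f => f w) (s1 j (static (inl j) (sh n')) (fun w => fQ w 0 n') (stl _ _)).
- by rewrite db // da // (depends_primexp _ (db _ _ _)).
- by rewrite da // (depends_primexp _ (db _ _ _)).
Qed.

Section Limits.
Context (r K : R).
Hypotheses (r0 : 0 < r) (K0 : 0 <= K) (small : m%:R * (r * (K + 1)) <= 4^-1).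
Hypothesis cPK : forall i j u, i != j -> box r u -> `|cP i j u| <= K.
Hypothesis bPK : forall i u, box r u -> `|bP i u| <= K.

Lemma offQ_bound eps i j k : i != j -> 0 < eps -> 0 <= offQ eps i j 0 k <= eps.
Proof.
move=> ij e0; rewrite /offQ; case: midQ; last by rewrite mxE lexx ltW.
rewrite !mxE /=; have [->|ki] := eqVneq k i; last by case: eqP => _; rewrite /= ?mulr1 ?mulr0; lra.
by rewrite (negPf ij) /= mulr1 mulr0; lra.
Qed.

Lemma offJ_bound eps i k : 0 < eps -> 0 <= offJ eps i 0 k <= eps.
Proof.
move=> e0; rewrite /offJ; case: midJ; last by rewrite mxE lexx ltW.
by rewrite !mxE /=; case: eqP => _; rewrite /= ?mulr1 ?mulr0; lra.
Qed.

Lemma cD_Cv i j : i != j -> Cv r v0 (fun eps => cD eps i j) (cP i j).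
Proof.
move=> ij; split; last by apply: snear_smT; exact: cP_sm.
by apply: offset_OE; [exact: cP_sm|move=> eps k; exact: offQ_bound].
Qed.

Lemma aD_Cv i : Cv r v0 (fun eps => aD eps i) (aP i).
Proof.
split; last by apply: snear_smT; exact: aP_sm.
by apply: offset_OE; [exact: aP_sm|move=> eps k; exact: offJ_bound].
Qed.

Lemma bD_Cv i : Cv r v0 (fun eps => bD eps i) (bP i).
Proof.
split; last by apply: snear_smT; exact: bP_sm.
by apply: offset_OE; [exact: bP_sm|move=> eps k; exact: offJ_bound].
Qed.

Lemma factor_Cv (g : R -> pt -> R) (g0 : pt -> R) : Cv r v0 g g0 ->
  Cv r v0 (fun eps u => 1 + eps * g eps u) (fun=> 1).
Proof.
move=> hg; have h := Cv_add r0 (Cv_const r0 v0 (snear_cst r 1)) (Cv_mul r0 (Cv_eps r0 v0 1) hg).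
have e : (fun u : pt => 1 + 0 * g0 u) = (fun=> 1) by apply/funext => u; rewrite mul0r addr0.
rewrite e in h; apply: Cv_congr h; apply: nearW => eps u _; by rewrite mul1r.
Qed.

Lemma div_Cv (g h : R -> pt -> R) (g0 h0 : pt -> R) : Cv r v0 g g0 -> Cv r v0 h h0 ->
  (forall u, h0 u != 0) -> Cv r v0 (fun eps u => g eps u / h eps u) (fun u => g0 u / h0 u).
Proof. by move=> hg hh n0; apply: (Cv_mul r0 hg); apply: (Cv_inv r0 hh) => u _; exact: n0. Qed.

Lemma phie_Cv (j k : J) : Cv r v0 (fun eps => phie eps j k) (phi j k).
Proof.
have c (f : pt -> R) : sm setT f -> Cv r v0 (fun _ => f) f by move=> hf; apply: Cv_const => //; exact: snear_smT.
have P (g : R -> pt -> R) (g0 : pt -> R) i : sm setT g0 -> Cv r v0 g g0 -> (forall u, box r u -> `|g0 u| <= K) ->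
    Cv r v0 (fun eps => latprod eps i (g eps)) (primexp i g0).
  by move=> hs hg hb; exact: (latprod_Cv i r0 hs K0 hg hb small).
have F (g : R -> pt -> R) (g0 : pt -> R) i : sm setT g0 -> Cv r v0 g g0 -> (forall u, box r u -> `|g0 u| <= K) ->
    Cv r v0 (fun eps u => (1 + eps * g eps u) * latprod eps i (g eps) u) (primexp i g0).
  move=> hs hg hb; have := Cv_mul r0 (factor_Cv hg) (P _ _ i hs hg hb).
  by have -> : (fun u => 1 * primexp i g0 u) = primexp i g0 by apply/funext => u; rewrite mul1r.
case: j => [j|[[n|]|]]; case: k => [k|[[n'|]|]] /=; try exact: (c _ (smT_cst _)).
- case: eqP => [_|/eqP jk]; first exact: (c _ (smT_cst _)).
  have kj : k != j by rewrite eq_sym.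
  apply: div_Cv; [|exact: (F _ _ k (cP_sm kj) (cD_Cv kj) (fun u => cPK kj))|move=> u; exact: primexp_neq0].
  exact: (Cv_mul r0 (cD_Cv jk) (P _ _ j (cP_sm jk) (cD_Cv jk) (fun u => cPK jk))).
- exact: (smT_dl _ _ r0 (fP_sm j n')).
- apply: div_Cv; [|exact: aD_Cv|exact: aP_neq0].
  exact: (Cv_mul r0 (bD_Cv j) (P _ _ j (bP_sm j) (bD_Cv j) (@bPK j))).
- apply: div_Cv; [|exact: (F _ _ k (bP_sm k) (bD_Cv k) (@bPK k))|move=> u; exact: primexp_neq0].
  exact: (Cv_add r0 (aD_Cv k) (c _ (smT_cst (-1)))).
Qed.

End Limits.
End InitialData.

Section GaugeExists.
Context {R : realType} {m N : nat}.
Local Notation pt := 'rV[R]_m.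
Local Notation T := (option (option 'I_N)).
Local Notation J := ('I_m + T)%type.
Local Notation v0 := (fun _ : 'I_m => 0%N).
Implicit Types (eps : R) (i j : 'I_m) (u : pt).
Context (midQ midJ : bool) (fQ : pt -> 'rV[R]_N) (cQ : 'I_m -> 'I_m -> pt -> R)
        (p : 'rV[R]_N) (aJ bJ : 'I_m -> pt -> R).
Hypotheses (dataQ : smooth_data_Q fQ cQ) (dataJ : smooth_data_J aJ bJ)
           (aJ_neq0 : forall i u, axis i u -> aJ i u != 0).

Definition kap (k : J) : R := if k is inr None then 1 else 0.

Lemma kap_norm k : `|kap k| <= 1.
Proof. by case: k => [i|[t|]]; rewrite /kap ?normr0 ?normr1. Qed.

Local Notation phi := (phi fQ cQ p aJ bJ).
Local Notation phie := (phie midQ midJ fQ cQ p aJ bJ).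

Lemma box_cube (r : R) : r <= 1 -> (box r : set pt) `<=` cube 1.
Proof.
move=> r1 u ub; apply/cubeP => k; have /andP[a b] := ub k.
by rewrite ger0_norm //; exact: le_trans r1.
Qed.

(** The margin in K - 1 makes room for the discrete data, which will differ from the smooth ones by
    at most 1; m <= K enters the choice of the radius. *)
Lemma data_bound : exists K : R, [/\ 1 <= K, m%:R <= K,
  forall (j k : J) u, cube 1 u -> `|phi j k u| <= K - 1,
  forall i j u, i != j -> cube 1 u -> `|cP cQ i j u| <= K & forall i u, cube 1 u -> `|bP bJ i u| <= K].
Proof.
have [K1 K10 h1] : exists2 M : R, 0 <= M & forall jk : J * J, forall u, cube 1 u -> `|phi jk.1 jk.2 u| <= M.
  apply: fin_bound => [jk M M' MM' h u uc|[j k]]; first exact: le_trans (h u uc) MM'.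
  exact: (smT_bounded 1 (phi_sm p dataQ dataJ aJ_neq0 j k)).
have [K2 K20 h2] : exists2 M : R, 0 <= M & forall ij : 'I_m * 'I_m, forall u, ij.1 != ij.2 -> cube 1 u -> `|cP cQ ij.1 ij.2 u| <= M.
  apply: fin_bound => [ij M M' MM' h u ne uc|[i j]] /=; first exact: le_trans (h u ne uc) MM'.
  have [->|ij] := eqVneq i j; first by exists 0.
  by have [M M0 hM] := smT_bounded 1 (cP_sm dataQ ij); exists M => // u _; exact: hM.
have [K3 K30 h3] : exists2 M : R, 0 <= M & forall i : 'I_m, forall u, cube 1 u -> `|bP bJ i u| <= M.
  apply: fin_bound => [i M M' MM' h u uc|i]; first exact: le_trans (h u uc) MM'.
  exact: (smT_bounded 1 (bP_sm dataJ i)).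
have m0 : 0 <= m%:R :> R by [].
exists (K1 + K2 + K3 + m%:R + 1); split; try lra.
- by move=> j k u uc; apply: le_trans (h1 (j, k) u uc) _; lra.
- by move=> i j u ij uc; apply: le_trans (h2 (i, j) u ij uc) _; lra.
- by move=> i u uc; apply: le_trans (h3 i u uc) _; lra.
Qed.

Lemma positive_near (g : pt -> R) (rho : R) : 0 < rho -> sm (ocube rho) g -> g 0 != 0 ->
  \forall r \near (0 : R)^'+, forall u, box r u -> g u != 0.
Proof.
move=> rho0 sg g0; have o0 : ocube rho (0 : pt) by move=> k; rewrite mxE normr0.
have e0 : 0 < `|g 0| by rewrite normr_gt0.
have : \forall w \near (0 : pt), `|g 0 - g w| < `|g 0| by move/cvgrPdist_lt: (sm_continuous sg o0) => /(_ _ e0).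
move=> /nbhs_boxP[d d0 hd]; near=> r => u ub.
have rd : r < d by near: r; exact: near_lt.
have /hd : forall k, `|u 0 k - (0 : pt) 0 k| < d.
  by move=> k; rewrite mxE subr0; have /andP[a b] := ub k; rewrite ger0_norm //; exact: le_lt_trans rd.
by apply: contraTneq => ->; rewrite subr0 ltxx.
Unshelve. all: by end_near. Qed.

Theorem gauge_exists : exists (r K : R) (gam : J -> J -> pt -> R), [/\ 0 < r, 1 <= K,
  forall (j k : J), Cv r v0 (fun eps => gaugef kap phie eps j k) (gam j k),
  \forall eps \near (0 : R)^'+, gauge_regular kap phie r K eps &
  forall u, box r u -> [/\ forall j, gam st (inl j) u != 0, gam st jo u != 0 &
    forall j, transf kap gam st (inl j) u != 0]].
Proof.
have [K [K1 mK hphi hc hb]] := data_bound.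
have K0 : 0 < K by exact: lt_le_trans ltr01 K1.
have m0 : 0 <= m%:R :> R by [].
pose A := 2 * K; pose c := 2 * (A ^+ 2 + A ^+ 3); pose L := 3 * K; pose L4 := 4 * K.
have c0 : 0 < c by rewrite mulr_gt0 // addr_gt0 // exprn_gt0 // mulr_gt0.
(* A multi-index whose size times eps c is at most K has all coordinates at most r1 = K / c, so
   [phie_bound] concerns only the box r1, on which the discrete data are close to the smooth
   ones. *)
pose r1 := K / c; have r10 : 0 < r1 by rewrite divr_gt0.
have cE : c = K * (8 * K + 16 * K ^+ 2) by rewrite /c /A; ring.
have q0 : 0 < 8 * K + 16 * K ^+ 2 by rewrite addr_gt0 // mulr_gt0 // exprn_gt0.
have r1E : r1 = (8 * K + 16 * K ^+ 2)^-1 by rewrite /r1 cE; field; rewrite !gt_eqF.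
have KK : K <= K ^+ 2 by rewrite expr2 ler_peMl // ltW.
have r11 : r1 <= 1 by rewrite r1E invf_le1 //; lra.
have mK2 : m%:R * (K + 1) <= K ^+ 2 + K.
  have -> : K ^+ 2 + K = K * (K + 1) by ring.
  by rewrite ler_wpM2r // addr_ge0 // ltW.
have small1 : m%:R * (r1 * (K + 1)) <= 4^-1.
  by rewrite r1E mulrCA mulrC ler_pdivrMr //; lra.
have K00 : 0 <= K by exact: ltW.
have hcb r : r <= 1 -> forall i j u, i != j -> box r u -> `|cP cQ i j u| <= K.
  by move=> rl i j u ij ub; apply: hc => //; exact: (box_cube rl).
have hbb r : r <= 1 -> forall i u, box r u -> `|bP bJ i u| <= K.
  by move=> rl i u ub; apply: hb; exact: (box_cube rl).
have phie_bound : \forall eps \near (0 : R)^'+, forall (j k : J) nu,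
    (vsize nu)%:R * (eps * c) <= K -> `|phie eps j k (latt eps nu)| <= K.
  have : \forall eps \near (0 : R)^'+, forall jk : J * J, forall u, Ldom eps r1 v0 u -> `|phie eps jk.1 jk.2 u - phi jk.1 jk.2 u| <= 1.
    apply: near_fin => -[j k] /=.
    have [h _] := phie_Cv midQ midJ p dataQ dataJ aJ_neq0 r10 K00 small1 (hcb _ r11) (hbb _ r11) j k.
    have [C C0 hC] := OE_value h; near=> eps => u uL.
    apply: (@le_trans _ _ (C * eps)); first by move: u uL; near: eps.
    have e0 : 0 < eps by near: eps; exact: near_pos.
    have : eps < 1 / (C + 1) by near: eps; apply: near_lt; rewrite divr_gt0 // ltr_wpDl.
    rewrite ltr_pdivlMr ?ltr_wpDl // mulrDr mulr1 mulrC => hh; apply: le_trans (ltW hh); rewrite lerDl; exact: ltW.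
  move=> hn; near=> eps => j k nu hnu.
  have e0 : 0 < eps by near: eps; exact: near_pos.
  have h1 : forall jk : J * J, forall u, Ldom eps r1 v0 u -> `|phie eps jk.1 jk.2 u - phi jk.1 jk.2 u| <= 1 by near: eps.
  have uL : Ldom eps r1 v0 (latt eps nu).
    exists nu; split => // l; rewrite addn0 /r1 ler_pdivlMr //; apply: le_trans hnu.
    rewrite mulrAC mulrC; apply: ler_wpM2r; first by rewrite mulr_ge0 // ltW.
    by rewrite ler_nat vsize_coord.
  have h2 := h1 (j, k) _ uL; have h3 := hphi j k _ (box_cube r11 (Ldom_box e0 uL)).
  have := ler_normD (phie eps j k (latt eps nu) - phi j k (latt eps nu)) (phi j k (latt eps nu)).
  by rewrite subrK /= in h2 h3 * => h4; lra.
pose S1 := m%:R * (L ^+ 2 + L ^+ 3); pose S2 := m%:R * (2 * L + 3 * L ^+ 2).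
have L0 : 0 <= L by rewrite mulr_ge0.
have S10 : 0 <= S1 by rewrite mulr_ge0 // addr_ge0 // exprn_ge0.
have S20 : 0 <= S2 by rewrite mulr_ge0 // addr_ge0 ?mulr_ge0 // exprn_ge0.
(* One bound yields both smallness conditions of the Picard iteration, because 1/4 is also at most
   K/2. *)
have [rho /andP[rho0 rho1] hrho] : exists2 rho : R, 0 < rho <= 1 & rho * (S1 + S2) <= 4^-1.
  by apply: small_weight; rewrite ?invr_gt0 // addr_ge0.
have p1 : 0 <= rho * S1 by rewrite mulr_ge0 // ltW.
have p2 : 0 <= rho * S2 by rewrite mulr_ge0 // ltW.
have sm1 : m%:R * rho * (L ^+ 2 + L ^+ 3) <= K / 2.
  have -> : m%:R * rho * (L ^+ 2 + L ^+ 3) = rho * S1 by rewrite /S1; ring.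
  rewrite mulrDr in hrho; lra.
have sm2 : m%:R * rho * (2 * L + 3 * L ^+ 2) <= 4^-1.
  have -> : m%:R * rho * (2 * L + 3 * L ^+ 2) = rho * S2 by rewrite /S2; ring.
  rewrite mulrDr in hrho; lra.
have ocube_cube1 u : ocube rho u -> cube 1 u.
  by move=> h; apply/cubeP => k; exact: le_trans (ltW (h k)) rho1.
have phiK (j k : J) u : cube 1 u -> `|phi j k u| <= K by move=> /(hphi j k); lra.
have phi_cube (j k : J) u : cube rho u -> `|phi j k u| <= K.
  by move=> /cubeP h; apply: phiK; apply/cubeP => l; exact: le_trans (h l) rho1.
have [gam [gam_sm gam_data gam_path gam_phi]] := darboux_path_solution kap_norm (phi_sm p dataQ dataJ aJ_neq0)
  (phi_static fQ cQ p aJ bJ) rho0 K0 phi_cube sm1 sm2.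
have gam_bound (j k : J) u : ocube rho u -> `|gam j k u| <= 2 * K.
  move=> uo; have h1 := le_trans (gam_phi j k u uo) sm1; have h2 := phiK j k u (ocube_cube1 u uo).
  have := ler_normD (gam j k u - phi j k u) (phi j k u); rewrite subrK; lra.
have o0 : ocube rho (0 : pt) by move=> k; rewrite mxE normr0.
have s0 P : coord_subspace P (0 : pt) by move=> k _; rewrite mxE.
have H0 j : gam st (inl j) 0 = 1 by exact: (gam_data st (inl j) 0 o0 (s0 _)).
have Hjo : gam st jo 0 = 1 by exact: (gam_data st jo 0 o0 (s0 _)).
have gj j : gam jo (inl j) 0 = aP aJ j 0 - 1.
  rewrite (gam_data jo (inl j) 0 o0 (s0 _)) /=.
  by rewrite (primexp0 (bP_sm dataJ j) (mxE _ _ _ _)) divr1.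
have Hp_sm j : sm (ocube rho) (transf kap gam st (inl j)).
  have oo := @ocube_open R m rho.
  apply: (@sm_eq _ _ _ (fun u => gam st (inl j) u + gam st jo u * gam jo (inl j) u)) => //.
    by move=> u _; rewrite /transf /el /= mul1r mulr0 !mul0r subr0 divr1.
  exact: (sm_add oo (gam_sm _ _) (sm_mul oo (gam_sm _ _) (gam_sm _ _))).
have nz1 : \forall r \near (0 : R)^'+, forall j u, box r u -> gam st (inl j) u != 0.
  by apply: near_fin => j; apply: (positive_near rho0 (gam_sm _ _)); rewrite H0 oner_neq0.
have nz2 : \forall r \near (0 : R)^'+, forall u, box r u -> gam st jo u != 0.
  by apply: (positive_near rho0 (gam_sm _ _)); rewrite Hjo oner_neq0.
have nz3 : \forall r \near (0 : R)^'+, forall j u, box r u -> transf kap gam st (inl j) u != 0.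
  apply: near_fin => j; apply: (positive_near rho0 (Hp_sm j)).
  rewrite /transf /el /= mul1r mulr0 !mul0r subr0 divr1 H0 Hjo gj mul1r addrC subrK.
  exact: aP_neq0.
have le_near (X a : R) : 0 < a -> 0 <= X -> \forall r \near (0 : R)^'+, r * X <= a.
  move=> a0 X0; near=> r; have r0 : 0 < r by near: r; exact: near_pos.
  have : r < a / (X + 1) by near: r; apply: near_lt; rewrite divr_gt0 // ltr_wpDl.
  rewrite ltr_pdivlMr ?ltr_wpDl // mulrDr mulr1; lra.
(* The final radius also keeps H_j, H_jo and H_j^+ away from 0; at the origin they are 1, 1 and
   a_j(0). *)
have [r [[r0 rr] r1' sr1 [sr2 sr3] [n1 n2 n3]]] : exists r : R, [/\ 0 < r /\ r < rho, r < 1, r * (m%:R * c) <= K / 2,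
   r * (m%:R * (2 * L4 + 4 * L4 ^+ 3)) <= 4^-1 /\ r * (m%:R * (K + 1)) <= 4^-1 &
   [/\ forall j u, box r u -> gam st (inl j) u != 0, forall u, box r u -> gam st jo u != 0 &
    forall j u, box r u -> transf kap gam st (inl j) u != 0]].
  apply: (@filter_ex _ (0 : R)^'+); near=> r; split; last by split; near: r.
  - by split; near: r; [exact: near_pos|exact: near_lt].
  - by near: r; exact: near_lt.
  - by near: r; apply: le_near; [rewrite divr_gt0|rewrite mulr_ge0 // ltW].
  - split; near: r; apply: le_near; rewrite ?invr_gt0 // mulr_ge0 //.
      by rewrite addr_ge0 // mulr_ge0 // ?exprn_ge0 // mulr_ge0.
    by rewrite addr_ge0.
have r1le : r <= 1 by exact: ltW.
have kap_lat i : kap (inl i) = 0 by [].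
have phi_box (j k : J) u : box r u -> `|phi j k u| <= K by move=> ub; apply: phiK; exact: (box_cube r1le).
have phie_phi (j k : J) : OE r v0 (fun eps u => phie eps j k u - phi j k u).
  have [] // := phie_Cv midQ midJ p dataQ dataJ aJ_neq0 r0 K00 _ (hcb _ r1le) (hbb _ r1le) j k.
  by rewrite mulrCA.
have small_r : m%:R * r * c <= K / 2 by rewrite -mulrA mulrCA.
have small_c : m%:R * r * (2 * L4 + 4 * L4 ^+ 3) <= 4^-1 by rewrite -mulrA mulrCA.
exists r, K, gam; split => //.
- exact: (gaugef_Cv kap_lat kap_norm r0 K1 rr (phi_sm p dataQ dataJ aJ_neq0) phi_box phie_phi phie_bound
    gam_sm gam_data gam_path gam_bound small_r small_c).
- exact: (near_regular kap_norm K1 phie_bound small_r).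
- by move=> u ub; split => [j||j]; [exact: n1|exact: n2|exact: n3].
Unshelve. all: by end_near. Qed.

End GaugeExists.

(** * The canonical discrete nets *)

Section Cells.
Context {R : realType} {m : nat}.
Local Notation pt := 'rV[R]_m.
Local Notation v0 := (fun _ : 'I_m => 0%N).
Implicit Types (eps r : R) (i j k : 'I_m) (u : pt) (v : 'I_m -> nat).

Lemma lattice_Ldom eps r v u : 0 < eps -> lattice_box eps r u -> (forall k, u 0 k + eps * (v k)%:R <= r) ->
  Ldom eps r v u.
Proof.
move=> e0 [ub ul] h.
have /boolp.choice[nu hnu] : forall k, exists n : nat, u 0 k = eps * n%:R.
  move=> k; have [z hz] := ul k; have /andP[uk _] := ub k.
  have z0 : 0 <= z by rewrite hz pmulr_rge0 // ler0z in uk.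
  by exists `|z|%N; rewrite hz -[in LHS](gez0_abs z0).
exists nu; split; first by apply/rowP => k; rewrite mxE.
by move=> k; rewrite natrD mulrDr -hnu.
Qed.

Lemma lattice_boxP eps r u : 0 < eps -> lattice_box eps r u <-> Ldom eps r v0 u.
Proof.
move=> e0; split=> [h|[nu [-> h]]].
  by apply: lattice_Ldom => // k; rewrite mulr0 addr0; case: h => /(_ k)/andP[].
split=> k; rewrite mxE; last by exists (nu k)%:Z.
by rewrite mulr_ge0 ?(ltW e0) //=; have := h k; rewrite addn0.
Qed.

Lemma vwordE v s k : vword v s k = (v k + \sum_(i <- s) (k == i))%N.
Proof.
rewrite /vword -sum1_count big_mkcond /=; congr (_ + _)%N; apply: eq_bigr => i _.
by rewrite eq_sym; case: eqP.
Qed.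

Lemma cell_Ldom eps r s u : 0 < eps -> cell eps r s u -> Ldom eps r (vword v0 s) u.
Proof.
move=> e0 [ul [ub _]]; apply: lattice_Ldom => // k.
have /andP[_] := ub k; congr (_ <= _); rewrite !mxE summxE vwordE add0n; congr (_ + _ * _).
by rewrite natr_sum; apply: eq_bigr => i _; rewrite mxE eqxx.
Qed.

Lemma cell_edge eps r i u : 0 < eps -> cell eps r [:: i] u -> Ldom eps r (vadd v0 i) u.
Proof.
move=> e0 /(cell_Ldom e0); congr (Ldom _ _ _ _); apply/funext => k.
by rewrite /vword /vadd /= addn0 eq_sym.
Qed.

Lemma cell_square eps r i j u : 0 < eps -> cell eps r [:: i; j] u -> Ldom eps r (vadd (vadd v0 j) i) u.
Proof.
move=> e0 /(cell_Ldom e0); congr (Ldom _ _ _ _); apply/funext => k.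
by rewrite /vword /vadd /= addn0 !add0n addnC (eq_sym i) (eq_sym j).
Qed.

Lemma cell_cube eps r i j k u : 0 < eps -> cell eps r [:: i; j; k] u ->
  Ldom eps r (vadd (vadd (vadd v0 k) j) i) u.
Proof.
move=> e0 /(cell_Ldom e0); congr (Ldom _ _ _ _); apply/funext => l.
by rewrite /vword /vadd /= addn0 !add0n addnC (eq_sym i) (eq_sym j) (eq_sym k) [(_ + (l == k))%N]addnC.
Qed.

Lemma deltaE eps i (g : pt -> R) : delta eps i (g : pt -> R^o) = dl eps i g.
Proof. by []. Qed.

Lemma comb_coord N (a b : R) (x y : 'rV[R]_N) n : (a *: x + b *: y) 0 n = a * x 0 n + b * y 0 n.
Proof. by rewrite !mxE. Qed.

Lemma net_coord N (F : ('I_m + option (option 'I_N)) -> ('I_m + option (option 'I_N)) -> pt -> R) n :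
  (fun w => net F w 0 n) = F st (sh n).
Proof. by apply/funext => w; rewrite mxE. Qed.

Lemma delta_coord N eps i (f : pt -> 'rV[R]_N) u n : delta eps i f u 0 n = dl eps i (fun w => f w 0 n) u.
Proof. by rewrite /delta /dl /tau !mxE. Qed.

End Cells.

Section PlaneIdentities.
Context {F : fieldType}.
Implicit Types (e : F).

(** For the prescribed rotation coefficients the Darboux step of H_i on a coordinate plane reduces
    to delta_j H_i = c_ji H_i, so the recursion reproduces the products built into the data. *)
Lemma plane_step e Hi Hj cij cji gij gji : Hi != 0 -> Hj != 0 -> 1 + e * cij != 0 -> 1 + e * cji != 0 ->
  gji = cji * Hi / ((1 + e * cij) * Hj) -> gij = cij * Hj / ((1 + e * cji) * Hi) ->
  1 - e * e * gji * gij != 0 -> el e e Hi Hj gji gij = Hi * (1 + e * cji).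
Proof.
move=> i0 j0 p q -> -> d; rewrite /el; set D := (X in _ / X); apply: (mulIf d); rewrite divfK // /D.
by field; rewrite i0 j0 p q.
Qed.

(** Likewise delta_j H_jo = b_j H_jo on the axis j, where H_j = 1. *)
Lemma axis_step e H0 a b gj0 g0j : H0 != 0 -> a != 0 -> 1 + e * b != 0 ->
  gj0 = b * H0 / a -> g0j = (a - 1) / ((1 + e * b) * H0) -> 1 - e * 1 * gj0 * g0j != 0 ->
  el e 1 H0 1 gj0 g0j = H0 * (1 + e * b).
Proof.
move=> h a0 p -> -> d; rewrite /el; set D := (X in _ / X); apply: (mulIf d); rewrite divfK // /D.
by field; rewrite h a0 p.
Qed.

Lemma axis_transform e H0 a b gj0 g0j : H0 != 0 -> a != 0 -> 1 + e * b != 0 ->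
  gj0 = b * H0 / a -> g0j = (a - 1) / ((1 + e * b) * H0) -> 1 - 1 * e * g0j * gj0 != 0 ->
  el 1 e 1 H0 g0j gj0 = a.
Proof.
move=> h a0 p -> -> d; rewrite /el; set D := (X in _ / X); apply: (mulIf d); rewrite divfK // /D.
by field; rewrite h a0 p.
Qed.

End PlaneIdentities.

Section DiscreteSolution.
Context {R : realType} {m N : nat}.
Local Notation pt := 'rV[R]_m.
Local Notation T := (option (option 'I_N)).
Local Notation J := ('I_m + T)%type.
Local Notation v0 := (fun _ : 'I_m => 0%N).
Implicit Types (i j : 'I_m) (u : pt).
Context (midQ midJ : bool) (fQ : pt -> 'rV[R]_N) (cQ : 'I_m -> 'I_m -> pt -> R)
        (p : 'rV[R]_N) (aJ bJ : 'I_m -> pt -> R) (r K eps : R).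
Local Notation phie := (phie midQ midJ fQ cQ p aJ bJ).
Local Notation G := (gaugef kap phie eps).
Local Notation hh := (@mesh R m T (@kap R m N) eps).
Local Notation G0 := (transf hh G).
Local Notation V := (Ldom eps r v0).
Local Notation cD := (cD midQ cQ eps).
Local Notation aD := (aD midJ aJ eps).
Local Notation bD := (bD midJ bJ eps).

Definition nondegenerate := [/\ forall u i k, V u -> 1 - eps * eps * G0 (inl i) (inl k) u * G0 (inl k) (inl i) u != 0,
  forall u j, V u -> G st (inl j) u != 0, forall u, V u -> G st jo u != 0, forall u j, V u -> G0 st (inl j) u != 0 &
  [/\ forall i j u, i != j -> V u -> 1 + eps * cD i j u != 0, forall i u, V u -> 1 + eps * bD i u != 0
    & forall i u, aD i u != 0]].

Hypotheses (r0 : 0 < r) (reg : gauge_regular kap phie r K eps) (nd : nondegenerate).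

Let e0 : 0 < eps. Proof. by case: reg. Qed.
Let hh_jo : hh jo = 1. Proof. by []. Qed.
Let hl k : hh (inl k) = eps. Proof. by []. Qed.
Let hst : hh st = 0. Proof. by []. Qed.
Let hs n : hh (sh n) = 0. Proof. by []. Qed.

Let Glaw u i (j k : J) : V u -> ~~ static j k i -> G j k (u + eps *: unitv i) =
    el eps (hh k) (G j k u) (G j (inl i) u) (G (inl i) k u) (G k (inl i) u).
Proof.
move=> [nu [-> hnu]] S; have [_ _ hstep _] := reg.
rewrite -latt_vadd !gaugef_latt // hstep // => l; by have := hnu l; rewrite addn0.
Qed.

Let Gden u i (k : J) : V u -> 1 - eps * hh k * G (inl i) k u * G k (inl i) u != 0.
Proof.
move=> [nu [-> hnu]]; have [_ _ _ hb] := reg; rewrite !gaugef_latt //.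
by have [|_] := hb nu; [move=> l; have := hnu l; rewrite addn0|move=> /(_ i k k)].
Qed.

Let Gdata (j k : J) u : V u -> coord_subspace (static j k) u -> G j k u = phie eps j k u.
Proof. by move=> vu us; exact: (gaugef_data kap phie e0 vu us). Qed.

Let coord_sub (P Q : pred 'I_m) u : (forall k, P k -> Q k) -> coord_subspace P u -> coord_subspace Q u.
Proof. by move=> PQ uP k Qk; apply: uP; apply: contra Qk => Pk; exact: PQ. Qed.

Let H_axis j u : V u -> axis j u -> G st (inl j) u = 1.
Proof.
by move=> vu uj; rewrite Gdata.
Qed.

Let sub_box nu i : (forall k, eps * (nu k)%:R <= r) -> V (latt eps (vsub nu i)).
Proof.
move=> h; exists (vsub nu i); split => // k; apply: le_trans (h k).
by rewrite addn0 ler_pM2l // ler_nat /vsub leq_subr.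
Qed.

(** The step of H_i involves gamma_ij and gamma_ji, whose data contain both H_i and H_j; the
    induction therefore treats the pairs (i, j) and (j, i) together. *)
Let H_plane i j u : i != j -> V u -> plane i j u -> G st (inl i) u = latprod eps j (cD j i) u.
Proof.
move=> ij [nu [-> hnu]] up.
move: {2}(vsize nu) (erefl (vsize nu)) => n; elim: n nu i j ij up hnu => [|n IH] nu i j ij up hnu en.
  have n0 k : nu k = 0%N by apply/eqP; rewrite -leqn0 -en vsize_coord.
  rewrite latprod0; last by rewrite mxE n0 mulr0.
  by apply: H_axis; [exists nu|move=> k _; rewrite mxE n0 mulr0].
have hn k : eps * (nu k)%:R <= r by have := hnu k; rewrite addn0.
have [nj|nj] := posnP (nu j).
  rewrite latprod0; last by rewrite mxE nj mulr0.
  apply: H_axis; first by exists nu.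
  move=> k; rewrite -topredE /= => ki; have [->|kj] := eqVneq k j; first by rewrite mxE nj mulr0.
  by apply: up; rewrite -topredE /= negb_or ki.
have vw := sub_box j hn; set w := vsub nu j in vw *.
have hw k : eps * (w k + 0)%:R <= r.
  by apply: le_trans (hn k); rewrite addn0 ler_pM2l // ler_nat /w /vsub leq_subr.
have ew : vsize w = n by apply: succn_inj; rewrite -(vsize_add _ j) /w vadd_sub.
have wp : plane i j (latt eps w).
  by move=> k kp; have := up k kp; rewrite !mxE /w /vsub => /eqP; rewrite mulf_eq0 gt_eqF //= pnatr_eq0 => /eqP ->; rewrite sub0n mulr0.
have wp' : plane j i (latt eps w) by move=> k kp; apply: wp; move: kp; rewrite -!topredE /= orbC.
have ji : j != i by rewrite eq_sym.
have h1 := IH w i j ij wp hw ew; have h2 := IH w j i ji wp' hw ew.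
rewrite -(vadd_sub nj) -/w latt_vadd Glaw //.
rewrite (latprod_step _ _ e0 vw) -h1.
have [_ n1 _ _ [nc _ _]] := nd.
have sij : coord_subspace (static (inl i) (inl j : J)) (latt eps w).
  by apply: coord_sub wp => k /orP[] /eqP ->; rewrite /static eqxx ?orbT.
have sji : coord_subspace (static (inl j) (inl i : J)) (latt eps w).
  by apply: coord_sub wp => k /orP[] /eqP ->; rewrite /static eqxx ?orbT.
apply: (plane_step (Hj := G st (inl j) (latt eps w)) (cij := cD i j (latt eps w))); try exact: n1.
- exact: nc.
- exact: nc.
- by rewrite (Gdata vw sji) /= (negPf ji) h1 h2.
- by rewrite (Gdata vw sij) /= (negPf ij) h1 h2.
- exact: (Gden j (inl i) vw).
Qed.

Let Hjo_axis j u : V u -> axis j u -> G st jo u = latprod eps j (bD j) u.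
Proof.
move=> [nu [-> hnu]] ua.
move: {2}(nu j) (erefl (nu j)) => n; elim: n nu ua hnu => [|n IH] nu ua hnu en.
  rewrite latprod0; last by rewrite mxE en mulr0.
  have n0 k : nu k = 0%N.
    have [->//|kj] := eqVneq k j; have := ua k; rewrite -topredE /= => /(_ kj) /eqP.
    by rewrite mxE mulf_eq0 gt_eqF //= pnatr_eq0 => /eqP.
  by rewrite Gdata //; [exists nu|move=> k _; rewrite mxE n0 mulr0].
have hn k : eps * (nu k)%:R <= r by have := hnu k; rewrite addn0.
have nj : (0 < nu j)%N by rewrite en.
have vw := sub_box j hn; set w := vsub nu j in vw *.
have hw k : eps * (w k + 0)%:R <= r.
  by apply: le_trans (hn k); rewrite addn0 ler_pM2l // ler_nat /w /vsub leq_subr.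
have wa : axis j (latt eps w).
  by move=> k kp; have := ua k kp; rewrite !mxE /w /vsub => /eqP; rewrite mulf_eq0 gt_eqF //= pnatr_eq0 => /eqP ->; rewrite sub0n mulr0.
have h1 : G st jo (latt eps w) = latprod eps j (bD j) (latt eps w).
  by apply: IH => //; rewrite /w /vsub eqxx en subn1.
rewrite -(vadd_sub nj) -/w latt_vadd Glaw //.
rewrite (latprod_step _ _ e0 vw) -h1 (H_axis vw wa) hh_jo.
have [_ _ n2 _ [_ nb na]] := nd.
have s1 : coord_subspace (static (inl j) (jo : J)) (latt eps w).
  by apply: coord_sub wa => k /eqP ->; rewrite /static eqxx.
have s2 : coord_subspace (static (jo : J) (inl j)) (latt eps w).
  by apply: coord_sub wa => k /eqP ->; rewrite /static eqxx orbT.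
apply: (axis_step (a := aD j (latt eps w))); [exact: n2|exact: na|exact: nb| | |].
- by rewrite (Gdata vw s1) /= h1.
- by rewrite (Gdata vw s2) /= h1.
- exact: (Gden j jo vw).
Qed.

(** As H_i = 1 on the axis, a step adds eps times the difference quotient of the given curve, and
    the sum telescopes. *)
Let f_axis n i u : V u -> axis i u -> G st (sh n) u = fQ u 0 n.
Proof.
move=> [nu [-> hnu]] ua.
move: {2}(nu i) (erefl (nu i)) => q; elim: q nu ua hnu => [|q IH] nu ua hnu en.
  have n0 k : nu k = 0%N.
    have [->//|ki] := eqVneq k i; have := ua k; rewrite -topredE /= => /(_ ki) /eqP.
    by rewrite mxE mulf_eq0 gt_eqF //= pnatr_eq0 => /eqP.
  have u0 : latt eps nu = 0 by apply/rowP => k; rewrite !mxE n0 mulr0.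
  by rewrite Gdata ?u0 //; [rewrite -u0; exists nu|move=> k _; rewrite mxE].
have hn k : eps * (nu k)%:R <= r by have := hnu k; rewrite addn0.
have ni : (0 < nu i)%N by rewrite en.
have vw := sub_box i hn; set w := vsub nu i in vw *.
have hw k : eps * (w k + 0)%:R <= r.
  by apply: le_trans (hn k); rewrite addn0 ler_pM2l // ler_nat /w /vsub leq_subr.
have wa : axis i (latt eps w).
  by move=> k kp; have := ua k kp; rewrite !mxE /w /vsub => /eqP; rewrite mulf_eq0 gt_eqF //= pnatr_eq0 => /eqP ->; rewrite sub0n mulr0.
have h1 : G st (sh n) (latt eps w) = fQ (latt eps w) 0 n.
  by apply: IH => //; rewrite /w /vsub eqxx en subn1.
have s1 : coord_subspace (static (inl i) (sh n : J)) (latt eps w).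
  by apply: coord_sub wa => k /eqP ->; rewrite /static eqxx.
have ua' : axis i (latt eps w + eps *: unitv i) by apply: coord_shift => //; exact: eqxx.
rewrite -(vadd_sub ni) -/w latt_vadd Glaw // (H_axis vw wa) h1 (Gdata vw s1) /= /el mulr0 !mul0r subr0 divr1 mulr1.
by rewrite /dl /fP (proj_id wa) (proj_id ua') mulVKf ?gt_eqF // addrC subrK.
Qed.

Let law : gauge_law eps r hh predT G.
Proof. by move=> u i j k vu _ _ _; exact: Glaw. Qed.

Let den_lat u i k : V u -> 1 - eps * eps * G (inl i) (inl k) u * G (inl k) (inl i) u != 0.
Proof. by move=> vu; exact: (Gden i (inl k) vu). Qed.

Let tlaw : gauge_law eps r hh (predC1 jo) G0.
Proof. exact: (transf_law hl hh_jo hst hs law Gden). Qed.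

Lemma net_is_qnet P (F : J -> J -> pt -> R) : gauge_law eps r hh P F -> (forall i, P (inl i)) -> P st -> (forall n, P (sh n)) ->
  (forall u i k, V u -> 1 - eps * eps * F (inl i) (inl k) u * F (inl k) (inl i) u != 0) ->
  (forall u j, V u -> F st (inl j) u != 0) -> qnet eps r (net F) (netc eps F).
Proof.
move=> lw P1 P2 P3 dF HF; split.
  move=> u i j ij /(cell_square e0) d; apply/rowP => n; rewrite comb_coord !delta_coord net_coord.
  have -> : (fun w => delta eps j (net F) w 0 n) = dl eps j (F st (sh n)).
    by apply/funext => w; rewrite delta_coord net_coord.
  exact: (net_second e0 hl hs lw P1 P2 P3 dF HF n ij d).
move=> u i j k ij jk ik /(cell_cube e0) d; rewrite deltaE.
exact: (net_qnet e0 hl lw P1 P2 dF HF ij jk ik d).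
Qed.

Lemma discrete_c_data i j u : i != j -> V u -> plane i j u -> netc eps G i j u = cD i j u.
Proof.
move=> ij vu up; have [_ n1 _ _ [nc _ _]] := nd.
have ji : j != i by rewrite eq_sym.
have up' : plane j i u by move=> k kp; apply: up; move: kp; rewrite -!topredE /= orbC.
have s1 : coord_subspace (static (inl i) (inl j : J)) u.
  by apply: coord_sub up => k /orP[] /eqP ->; rewrite /static eqxx ?orbT.
have s2 : coord_subspace (static (inl j) (inl i : J)) u.
  by apply: coord_sub up => k /orP[] /eqP ->; rewrite /static eqxx ?orbT.
have n1i := n1 u i vu; have n1j := n1 u j vu; have ni := nc i j u ij vu; have nj := nc j i u ji vu.
have h1 := H_plane ij vu up; have h2 := H_plane ji vu up'.
rewrite /netc /tau Glaw //.
rewrite (plane_step (cij := cD i j u) (cji := cD j i u)) //; last 3 first.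
- by rewrite (Gdata vu s2) /= (negPf ji) h1 h2.
- by rewrite (Gdata vu s1) /= (negPf ij) h1 h2.
- exact: (Gden j (inl i) vu).
rewrite (Gdata vu s1) /= (negPf ij) -h1 -h2.
by field; rewrite n1i n1j nj.
Qed.

Lemma cD_data i j u : i != j -> plane i j u ->
  cD i j u = cQ i j (if midQ then u + (eps / 2) *: unitv i + (eps / 2) *: unitv j else u).
Proof.
move=> ij up.
rewrite /cD /cP /offQ; case: midQ; last by rewrite addr0 proj_id.
  rewrite addrA proj_id //; apply: coord_shift; last apply: coord_shift; rewrite //= ?eqxx ?orbT //.
Qed.

Theorem discrete_qnet : canonical_qnet midQ eps r fQ cQ (net G) (netc eps G).
Proof.
have [_ n1 _ _ _] := nd; split.
- by apply: (net_is_qnet law).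
- by move=> u i /(lattice_boxP _ _ e0) vu ua; apply/rowP => n; rewrite mxE (f_axis n vu ua).
by move=> u i j ij /(lattice_boxP _ _ e0) vu up; rewrite discrete_c_data // cD_data.
Qed.

Lemma discrete_ab_data j u : V u -> axis j u ->
  neta eps G j u = aD j u /\ netb hh G j u = bD j u.
Proof.
move=> vu ua; have [_ _ n2 _ [_ nb na]] := nd.
have s1 : coord_subspace (static (inl j) (jo : J)) u.
  by apply: coord_sub ua => k /eqP ->; rewrite /static eqxx.
have s2 : coord_subspace (static (jo : J) (inl j)) u.
  by apply: coord_sub ua => k /eqP ->; rewrite /static eqxx orbT.
have h1 := Hjo_axis vu ua; have H1 := H_axis vu ua.
have q1 := n2 u vu; have q2 := na j u; have q3 := nb j u vu.
have g1 : G (inl j) jo u = bD j u * G st jo u / aD j u by rewrite (Gdata vu s1) /= h1.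
have g2 : G jo (inl j) u = (aD j u - 1) / ((1 + eps * bD j u) * G st jo u) by rewrite (Gdata vu s2) /= h1.
have d1 : 1 - eps * 1 * G (inl j) jo u * G jo (inl j) u != 0 by rewrite -hh_jo; exact: (Gden j jo vu).
have d2 : 1 - 1 * eps * G jo (inl j) u * G (inl j) jo u != 0.
  by have -> : 1 - 1 * eps * G jo (inl j) u * G (inl j) jo u = 1 - eps * 1 * G (inl j) jo u * G jo (inl j) u by ring.
split.
  rewrite /neta /tau (Glaw (k := jo) vu) // H1 divr1 hh_jo (axis_step q1 q2 q3 g1 g2 d1) g2.
  by field; rewrite q1 q3.
rewrite /netb /transf H1 hl (axis_transform q1 q2 q3 g1 g2 d2) g1.
by field; rewrite q1 q2.
Qed.

Lemma discrete_fp0 : net G0 0 = p.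
Proof.
apply/rowP => n; have v00 : V 0.
    exists (fun=> 0%N); split; first by apply/rowP => k; rewrite !mxE mulr0.
    by move=> k; rewrite mulr0 ltW.
  have s0 P : coord_subspace P (0 : pt) by move=> k _; rewrite mxE.
  rewrite mxE /transf /el hs mulr0 !mul0r subr0 divr1 mul1r.
  by rewrite (Gdata v00 (s0 _)) (Gdata v00 (s0 _)) (Gdata v00 (s0 _)) /= mul1r addrC subrK.
Qed.

Lemma aD_data j u : axis j u -> let v := if midJ then u + (eps / 2) *: unitv j else u in
  aD j u = aJ j v /\ bD j u = bJ j v.
Proof.
move=> ua v.
have vE : v = proj (pred1 j) (u + offJ midJ eps j).
  rewrite /v /offJ; case: midJ; last by rewrite addr0 proj_id.
  by rewrite proj_id //; apply: coord_shift => //; exact: eqxx.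
by rewrite vE.
Qed.

Theorem discrete_jonas_transform :
  discrete_jonas eps r (net G) (netc eps G) (net G0) (neta eps G) (netb hh G) (netc eps G0).
Proof.
have [n0 n1 n2 n3 _] := nd.
split.
- by apply: (net_is_qnet tlaw).
- move=> u i /(cell_edge e0) /(Ldom_tau e0) [vu vi]; apply/rowP => n; rewrite comb_coord !delta_coord !net_coord.
    have -> : (net G0 u - net G u) 0 n = G0 st (sh n) u - G st (sh n) u by rewrite !mxE.
    exact: (jonas_f e0 hl hh_jo hst hs law).
- move=> u i j ij /(cell_square e0) d; rewrite !deltaE.
    split.
    * by apply: (jonas_a e0 hl hh_jo law).
    * by apply: (jonas_b e0 hl hh_jo hst hs law).
    * by apply: (jonas_c e0 hl hh_jo law).
Qed.

End DiscreteSolution.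

(** * The limit nets *)

Section VectorSmooth.
Context {R : realType} {m : nat}.
Local Notation pt := 'rV[R]_m.
Implicit Types (u w : pt) (i : 'I_m).

Lemma snear_smooth_near (r : R) (g : pt -> R) : snear r g -> smooth_near (box r) (g : pt -> R^o).
Proof.
move=> [U [oU bU hg]]; exists U => // s _; split.
  by apply: continuous_in_subspaceT => u /set_mem Uu; exact: (sm_continuous (sm_partials s hg) Uu).
by move=> u i Uu _; exact: (sm_derivable (sm_partials s hg) Uu).
Qed.

Lemma smooth_near_snear (r : R) (g : pt -> R) : smooth_near (box r) (g : pt -> R^o) -> snear r g.
Proof.
move=> [U [oU bU] hg]; exists U; split => // s u Uu.
have [c d] : {within U, continuous (partials s g)} /\ forall u i, U u -> i \in predT -> derivable (partials s g) u (unitv i).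
  exact: (hg s (fun _ _ => isT)).
split; last by move=> i; exact: d.
by move: c; rewrite continuous_open_subspace // => /(_ u (mem_set Uu)).
Qed.

Lemma snear_fin (I : finType) (r : R) (g : I -> pt -> R) : (forall n, snear r (g n)) ->
  exists U, [/\ open U, box r `<=` U & forall n, sm U (g n)].
Proof.
move=> /boolp.choice[U hU]; exists [set u | forall n, U n u]; split.
- rewrite openE => u Uu; have nU n : nbhs u (U n) by have [+ _ _] := hU n; rewrite openE; apply; exact: Uu.
  exact: (@filter_forall _ I U (nbhs u) (nbhs_filter u) nU).
- by move=> u ub i; have [_ bU _] := hU i; exact: bU.
by move=> i s u Uu; have [_ _ h] := hU i; exact: h.
Qed.

Lemma vector_partials N (U : set pt) (f : pt -> 'rV[R]_N) : open U -> (forall n, sm U (fun u => f u 0 n)) ->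
  forall s u, U u -> [/\ forall n, partials s f u 0 n = partials s (fun w => f w 0 n) u,
    {for u, continuous (partials s f)} & forall i, derivable (partials s f) u (unitv i)].
Proof.
move=> oU hf; have nU u : U u -> nbhs u U by move: oU; rewrite openE; apply.
(* Equality of components along s yields continuity and differentiability of that derivative, which
   in turn allows the components of the next one to be compared. *)
have step s u : U u -> (forall w, U w -> forall n, partials s f w 0 n = partials s (fun w => f w 0 n) w) ->
   {for u, continuous (partials s f)} /\ forall i, derivable (partials s f) u (unitv i).
  move=> Uu E; pose h w : 'rV[R]_N := \row_n partials s (fun w => f w 0 n) w.
  have near_h : {near u, partials s f =1 h}.
    by apply: filterS (nU u Uu) => w Uw; apply/rowP => n; rewrite mxE E.
  have near_h' : {near u, h =1 partials s f} by apply: filterS near_h => w ->.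
  split; last first.
    move=> i; apply: (near_eq_derivable near_h'); apply/derivable_mxP => a n; rewrite (ord1 a).
    have -> : (fun x => h x 0 n) = partials s (fun w => f w 0 n) by apply/funext => w; rewrite mxE.
    exact: (sm_derivable (sm_partials s (hf n)) Uu).
  have hu : partials s f u = h u by exact: nbhs_singleton near_h.
  move=> V; rewrite /= hu => hV; suff : nbhs u [set w | V (h w)].
    by move=> hh; apply: filterS2 hh near_h => w /= Vw e; rewrite /= e.
  have [e e0 he] : exists2 e : R, 0 < e & forall x : 'rV[R]_N, (forall n, `|x 0 n - h u 0 n| < e) -> V x.
    by have /nbhs_boxP[e e0 he] := hV; exists e.
  have : nbhs u [set w | forall n, `|h u 0 n - h w 0 n| < e].
    apply: (@filter_forall _ 'I_N (fun n => [set w | `|h u 0 n - h w 0 n| < e]) (nbhs u) (nbhs_filter u)) => n.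
    have c := sm_continuous (sm_partials s (hf n)) Uu.
    have /cvgrPdist_lt/(_ e e0) c' := c.
    by apply: filterS c' => w; rewrite /= !mxE.
  by apply: filterS => w hw; apply: he => n; rewrite distrC; exact: hw.
have E s : forall u, U u -> forall n, partials s f u 0 n = partials s (fun w => f w 0 n) u.
  elim: s => [//|i s IH] u Uu n /=; have [_ d] := step s u Uu IH.
  rewrite /partial (derive_mx (d i)) mxE; apply: near_eq_derive.
  by apply: filterS (nU u Uu) => w Uw; exact: IH.
by move=> s u Uu; have [c d] := step s u Uu (E s); split; [exact: E|exact: c|exact: d].
Qed.

Lemma vector_smooth_near N (r : R) (f : pt -> 'rV[R]_N) : (forall n, snear r (fun u => f u 0 n)) ->
  smooth_near (box r) f /\
  forall s u, box r u -> forall n, partials s f u 0 n = partials s (fun w => f w 0 n) u.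
Proof.
move=> /snear_fin[U [oU bU hU]]; have V := vector_partials oU hU; split.
  exists U => // s _; split.
    by apply: continuous_in_subspaceT => u /set_mem Uu; have [] := V s u Uu.
  by move=> u i Uu _; have [] := V s u Uu.
by move=> s u ub; have [] := V s u (bU u ub).
Qed.

End VectorSmooth.

Section Limits.
Context {R : realType} {m N : nat}.
Local Notation pt := 'rV[R]_m.
Local Notation T := (option (option 'I_N)).
Local Notation J := ('I_m + T)%type.
Local Notation v0 := (fun _ : 'I_m => 0%N).
Local Notation v3 := (fun _ : 'I_m => 3%N).
Implicit Types (i j : 'I_m) (u : pt).
Context (r : R) (r0 : 0 < r).

Lemma Cv_neq0 v (g : R -> pt -> R) (g0 : pt -> R) : Cv r v g g0 -> (forall u, box r u -> g0 u != 0) ->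
  \forall eps \near (0 : R)^'+, forall u, Ldom eps r v u -> g eps u != 0.
Proof.
move=> hg h0; have [eta eta0 h] := Cv_lower hg h0; apply: filterS h => eps h u uL.
by rewrite -normr_gt0; apply: lt_le_trans eta0 _; exact: h.
Qed.

Lemma tau0 i (g : pt -> R) : tau 0 i g = g.
Proof. by apply/funext => u; rewrite /tau scale0r addr0. Qed.

Section Fields.
Context (F : R -> J -> J -> pt -> R) (F0 : J -> J -> pt -> R).
Hypothesis FC : forall j k : J, k != jo -> Cv r v0 (fun eps => F eps j k) (F0 j k).
Hypothesis H0 : forall u j, box r u -> F0 st (inl j) u != 0.

Lemma netc_Cv i j : Cv r (vadd v0 j) (fun eps => netc eps (F eps) i j) (netc 0 F0 i j).
Proof.
rewrite /netc tau0.
apply: (Cv_mul r0); last by apply: (Cv_inv r0); [apply: (Cv_vadd r0); exact: FC|move=> u; exact: H0].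
apply: (Cv_mul r0); first by apply: (Cv_vadd r0); exact: FC.
exact: (Cv_tau r0 j (@FC st (inl i) isT)).
Qed.

Lemma net_snear n : snear r (fun u => net F0 u 0 n).
Proof. by rewrite net_coord; have [] := @FC st (sh n) isT. Qed.

Hypothesis dq : \forall eps \near (0 : R)^'+, qnet eps r (net (F eps)) (netc eps (F eps)).

Lemma Ldom_cell eps s u : 0 < eps -> (forall k, count_mem k s <= 3)%N -> Ldom eps r v3 u -> cell eps r s u.
Proof.
move=> e0 hs [nu [-> h]]; have hw k : eps * (vword nu s k)%:R <= r.
  by apply: le_trans (h k); rewrite ler_pM2l // ler_nat leq_add2l.
have e : latt eps nu + eps *: \sum_(i <- s) unitv i = latt eps (vword nu s).
  apply/rowP => k; rewrite !mxE vwordE natrD mulrDr summxE natr_sum; congr (_ + _ * _).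
  by apply: eq_bigr => i _; rewrite mxE eqxx.
split; rewrite ?e; apply/(lattice_boxP _ _ e0).
  by exists nu; split => // k; apply: le_trans (h k); rewrite ler_pM2l // ler_nat leq_add2l.
by exists (vword nu s); split => // k; rewrite addn0.
Qed.

(** Three steps in every direction contain any cell on which an equation lives, so all equations are
    compared on the domain of [v3] and pass to the limit by [Cv_eq]. *)
Lemma limit_conjugate_net : conjugate_net r (net F0) (netc 0 F0).
Proof.
have [sf pf] := vector_smooth_near net_snear.
have le3 i j : forall k, (vadd (vadd v0 i) j k <= v3 k)%N.
  by move=> k; rewrite /vadd; case: (k == i); case: (k == j).
have le3' i : forall k, (vadd v0 i k <= v3 k)%N by move=> k; rewrite /vadd; case: (k == i).
have cC i j := Cv_le r0 (le3' j) (netc_Cv i j).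
have small3 (s : seq 'I_m) : (size s <= 3)%N -> forall k, (count_mem k s <= 3)%N.
  by move=> hs k; apply: leq_trans hs; exact: count_size.
split.
- exact: sf.
- by move=> i j _; apply: snear_smooth_near; have [] := netc_Cv i j.
- move=> u i j ub ij; apply/rowP => n; rewrite comb_coord.
  rewrite (pf [:: i; j] u ub n) (pf [:: i] u ub n) (pf [:: j] u ub n) /= net_coord.
  have fC := @FC st (sh n) isT.
  have dC k := Cv_le r0 (le3' k) (Cv_dl r0 k fC).
  apply: (Cv_eq r0 (Cv_le r0 (le3 j i) (Cv_dl r0 i (Cv_dl r0 j fC)))
    (Cv_add r0 (Cv_mul r0 (cC j i) (dC i)) (Cv_mul r0 (cC i j) (dC j)))) => //.
  near=> eps => w wL; have e0 : 0 < eps by near: eps; exact: near_pos.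
  have [h _] : qnet eps r (net (F eps)) (netc eps (F eps)) by near: eps.
  have := congr1 (fun x : 'rV[R]_N => x 0 n) (h w i j ij (Ldom_cell e0 (small3 [:: i; j] isT) wL)).
  rewrite comb_coord !delta_coord !net_coord => <-; congr (dl eps i _ w).
  by apply/funext => x; rewrite delta_coord net_coord.
- move=> u i j k ub ij jk ik.
  rewrite (Cv_eq r0 (Cv_le r0 (le3 k i) (Cv_dl r0 i (netc_Cv j k)))
    (Cv_add r0 (Cv_add r0 (Cv_mul r0 (Cv_le r0 (le3 j k) (Cv_tau r0 k (netc_Cv i j))) (cC j k))
       (Cv_mul r0 (Cv_le r0 (le3 i k) (Cv_tau r0 k (netc_Cv j i))) (cC i k)))
       (Cv_mul r0 (Cv_const r0 v3 (snear_cst r (-1))) (Cv_mul r0 (Cv_le r0 (le3 k i) (Cv_tau r0 i (netc_Cv j k))) (cC i k)))) _ ub); first by ring.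
  near=> eps => w wL; have e0 : 0 < eps by near: eps; exact: near_pos.
  have [_ h] : qnet eps r (net (F eps)) (netc eps (F eps)) by near: eps.
  have := h w i j k ij jk ik (Ldom_cell e0 (small3 [:: i; j; k] isT) wL).
  by rewrite deltaE => ->; rewrite mulN1r.
Unshelve. all: by end_near. Qed.

End Fields.
End Limits.

Section LimitNets.
Context {R : realType} {m N : nat}.
Local Notation pt := 'rV[R]_m.
Local Notation T := (option (option 'I_N)).
Local Notation J := ('I_m + T)%type.
Local Notation v0 := (fun _ : 'I_m => 0%N).
Local Notation v3 := (fun _ : 'I_m => 3%N).
Local Notation kp := (@kap R m N).
Implicit Types (i j : 'I_m) (u : pt).
Context (r : R) (r0 : 0 < r) (F : R -> J -> J -> pt -> R) (F0 : J -> J -> pt -> R).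
Hypothesis FC : forall j k : J, Cv r v0 (fun eps => F eps j k) (F0 j k).
Hypothesis H0 : forall u j, box r u -> F0 st (inl j) u != 0.
Hypothesis Hjo : forall u, box r u -> F0 st jo u != 0.
Hypothesis Hp0 : forall u j, box r u -> transf kp F0 st (inl j) u != 0.
Local Notation mh eps := (@mesh R m T kp eps).
Local Notation F' eps := (transf (mh eps) (F eps)).
Local Notation F0' := (transf kp F0).

Lemma mesh_Cv v (k : J) : Cv r v (fun eps (_ : pt) => mh eps k) (fun=> kp k).
Proof.
case: k => [i|t]; last by apply: (Cv_const r0); exact: snear_cst.
have h := Cv_eps r0 v 1; apply: (Cv_congr _ h); apply: nearW => eps u _; exact: mul1r.
Qed.

Lemma transf_Cv (j k : J) : k != jo -> Cv r v0 (fun eps => F' eps j k) (F0' j k).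
Proof.
move=> kZ; have c (x : R) : Cv r v0 (fun (_ : R) (_ : pt) => x) (fun=> x) by apply: (Cv_const r0); exact: snear_cst.
have kk : kp k = 0 by case: (k) kZ => [i|[t|]].
rewrite /transf /el.
apply: (Cv_mul r0 (Cv_add r0 (FC _ _) (Cv_mul r0 (Cv_mul r0 (c 1) (FC _ _)) (FC _ _)))).
apply: (Cv_inv r0); last by move=> u _; rewrite kk mulr0 !mul0r subr0 oner_neq0.
have h := Cv_add r0 (c 1) (Cv_mul r0 (c (-1)) (Cv_mul r0 (Cv_mul r0 (Cv_mul r0 (c 1) (mesh_Cv v0 k)) (FC jo k)) (FC k jo))).
have e : (fun u => 1 + -1 * (1 * kp k * F0 jo k u * F0 k jo u)) = (fun u => 1 - 1 * kp k * F0 jo k u * F0 k jo u).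
  by apply/funext => u; rewrite mulN1r.
by rewrite -e; apply: (Cv_congr _ h); apply: nearW => eps u _; rewrite mulN1r.
Qed.

Lemma neta_Cv j : Cv r (vadd v0 j) (fun eps => neta eps (F eps) j) (neta 0 F0 j).
Proof.
rewrite /neta tau0; apply: (Cv_add r0); first by apply: (Cv_const r0); exact: snear_cst.
apply: (Cv_mul r0); last by apply: (Cv_inv r0); [apply: (Cv_vadd r0); exact: FC|move=> u; exact: H0].
apply: (Cv_mul r0); first by apply: (Cv_vadd r0); exact: FC.
exact: (Cv_tau r0 j (FC st jo)).
Qed.

Lemma netb_Cv j : Cv r (vadd v0 j) (fun eps => netb (mh eps) (F eps) j) (netb kp F0 j).
Proof.
apply: (Cv_vadd r0); rewrite /netb.
apply: (Cv_mul r0); last by apply: (Cv_inv r0); [exact: FC|exact: Hjo].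
by apply: (Cv_mul r0); [exact: FC|exact: transf_Cv].
Qed.

Lemma neta0E j u : box r u -> neta 0 F0 j u = F0' st (inl j) u / F0 st (inl j) u.
Proof.
move=> ub; rewrite /neta tau0 /transf /el /= mulr0 !mul0r subr0 divr1 mul1r mulrDl divff ?H0 //.
by rewrite [F0 jo _ _ * _]mulrC.
Qed.

Lemma neta0_neq0 j u : box r u -> neta 0 F0 j u != 0.
Proof. by move=> ub; rewrite neta0E // mulf_neq0 ?Hp0 // invr_neq0 // H0. Qed.

Lemma near_nonresonant : \forall eps \near (0 : R)^'+, forall i k u, Ldom eps r v0 u ->
  1 - eps * eps * F' eps (inl i) (inl k) u * F' eps (inl k) (inl i) u != 0.
Proof.
apply: near_fin => i; apply: near_fin => k.
have c (x : R) : Cv r v0 (fun (_ : R) (_ : pt) => x) (fun=> x) by apply: (Cv_const r0); exact: snear_cst.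
have e1 := Cv_eps r0 v0 1.
have h := Cv_add r0 (c 1) (Cv_mul r0 (c (-1)) (Cv_mul r0 (Cv_mul r0 (Cv_mul r0 e1 e1) (@transf_Cv (inl i) (inl k) isT)) (@transf_Cv (inl k) (inl i) isT))).
have h' := Cv_neq0 h; have : forall u, box r u -> 1 + -1 * (0 * 0 * F0' (inl i) (inl k) u * F0' (inl k) (inl i) u) != 0.
  by move=> u _; rewrite mulr0 !mul0r mulr0 addr0 oner_neq0.
move=> /h'; apply: filterS => eps h1 u uL; have := h1 u uL.
by rewrite mulN1r !mul1r.
Qed.

Hypothesis dq : \forall eps \near (0 : R)^'+, qnet eps r (net (F eps)) (netc eps (F eps)).
Hypothesis dj : \forall eps \near (0 : R)^'+, discrete_jonas eps r (net (F eps)) (netc eps (F eps))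
  (net (F' eps)) (neta eps (F eps)) (netb (mh eps) (F eps)) (netc eps (F' eps)).

Lemma limit_jonas : jonas r (net F0) (netc 0 F0) (net F0') (neta 0 F0) (netb kp F0) (netc 0 F0').
Proof.
have dq' : \forall eps \near (0 : R)^'+, qnet eps r (net (F' eps)) (netc eps (F' eps)).
  by apply: filterS dj => eps [].
have FC' (j k : J) : k != jo -> Cv r v0 (fun eps => F eps j k) (F0 j k) by move=> _; exact: FC.
have le3 i j : forall k, (vadd (vadd v0 i) j k <= v3 k)%N.
  by move=> k; rewrite /vadd; case: (k == i); case: (k == j).
have le3' i : forall k, (vadd v0 i k <= v3 k)%N by move=> k; rewrite /vadd; case: (k == i).
have le30 : forall k : 'I_m, (v0 k <= v3 k)%N by [].
have aC j := Cv_le r0 (le3' j) (neta_Cv j); have bC j := Cv_le r0 (le3' j) (netb_Cv j).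
have cC i j := Cv_le r0 (le3' j) (netc_Cv r0 FC' H0 i j).
have cpC i j := Cv_le r0 (le3' j) (netc_Cv r0 transf_Cv Hp0 i j).
have small3 (s : seq 'I_m) : (size s <= 3)%N -> forall k, (count_mem k s <= 3)%N.
  by move=> hs k; apply: leq_trans hs; exact: count_size.
have m1 := Cv_const r0 v3 (snear_cst r (-1)).
split.
- exact: (limit_conjugate_net r0 transf_Cv Hp0 dq').
- move=> i; split; apply: snear_smooth_near; [by have [] := neta_Cv i|by have [] := netb_Cv i].
- move=> u i ub; apply/rowP => n; rewrite comb_coord.
  have [_ p1] := vector_smooth_near (net_snear transf_Cv); have [_ p2] := vector_smooth_near (net_snear FC').
  rewrite (p1 [:: i] u ub n) (p2 [:: i] u ub n) /= !net_coord.
  have -> : (net F0' u - net F0 u) 0 n = F0' st (sh n) u + -1 * F0 st (sh n) u by rewrite !mxE mulN1r.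
  have fp := @transf_Cv st (sh n) isT; have fC := FC st (sh n).
  apply: (Cv_eq r0 (Cv_le r0 (le3' i) (Cv_dl r0 i fp)) (Cv_add r0 (Cv_mul r0 (aC i) (Cv_le r0 (le3' i) (Cv_dl r0 i fC)))
    (Cv_mul r0 (bC i) (Cv_add r0 (Cv_le r0 le30 fp) (Cv_mul r0 m1 (Cv_le r0 le30 fC)))))) => //.
  near=> eps => w wL; have e0 : 0 < eps by near: eps; exact: near_pos.
  have [_ h _] : discrete_jonas eps r (net (F eps)) (netc eps (F eps))
    (net (F' eps)) (neta eps (F eps)) (netb (mh eps) (F eps)) (netc eps (F' eps)) by near: eps.
  have := congr1 (fun x : 'rV[R]_N => x 0 n) (h w i (Ldom_cell e0 (small3 [:: i] isT) wL)).
  by rewrite comb_coord !delta_coord !net_coord => ->; rewrite mulN1r !mxE.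
(* Differences are written as sums with a factor -1, the form that the rules for sums and products
   of convergent families produce. *)
have D : \forall eps \near (0 : R)^'+, forall u i j, i != j -> Ldom eps r v3 u ->
   [/\ dl eps i (neta eps (F eps) j) u = tau eps j (netb (mh eps) (F eps) i) u * (neta eps (F eps) j u + -1)
       + (tau eps j (neta eps (F eps) i) u + -1 * tau eps i (neta eps (F eps) j) u) * netc eps (F eps) i j u,
     dl eps i (netb (mh eps) (F eps) j) u = netc eps (F' eps) i j u * netb (mh eps) (F eps) j u
       + netc eps (F' eps) j i u * netb (mh eps) (F eps) i u
       + -1 * (tau eps i (netb (mh eps) (F eps) j) u * netb (mh eps) (F eps) i u)
   & neta eps (F eps) j u * netc eps (F' eps) i j u = tau eps j (neta eps (F eps) i) u * netc eps (F eps) i j u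
       + tau eps j (netb (mh eps) (F eps) i) u * (neta eps (F eps) j u + -1)].
  near=> eps => w i j ij wL; have e0 : 0 < eps by near: eps; exact: near_pos.
  have [_ _ h] : discrete_jonas eps r (net (F eps)) (netc eps (F eps))
    (net (F' eps)) (neta eps (F eps)) (netb (mh eps) (F eps)) (netc eps (F' eps)) by near: eps.
  have [h1 h2 h3] := h w i j ij (Ldom_cell e0 (small3 [:: i; j] isT) wL).
  by rewrite !deltaE in h1 h2; rewrite !mulN1r; split.
move=> u i j ub ij.
have ta x y := Cv_le r0 (le3 x y) (Cv_tau r0 y (neta_Cv x)).
have tb x y := Cv_le r0 (le3 x y) (Cv_tau r0 y (netb_Cv x)).
split.
- rewrite (Cv_eq r0 (Cv_le r0 (le3 j i) (Cv_dl r0 i (neta_Cv j)))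
    (Cv_add r0 (Cv_mul r0 (tb i j) (Cv_add r0 (aC j) m1)) (Cv_mul r0 (Cv_add r0 (ta i j) (Cv_mul r0 m1 (ta j i))) (cC i j))) _ ub).
    by ring.
  by apply: filterS D => eps h w wL; have [] := h w i j ij wL.
- rewrite (Cv_eq r0 (Cv_le r0 (le3 j i) (Cv_dl r0 i (netb_Cv j)))
    (Cv_add r0 (Cv_add r0 (Cv_mul r0 (cpC i j) (bC j)) (Cv_mul r0 (cpC j i) (bC i))) (Cv_mul r0 m1 (Cv_mul r0 (tb j i) (bC i)))) _ ub).
    by ring.
  by apply: filterS D => eps h w wL; have [] := h w i j ij wL.
- rewrite (Cv_eq r0 (Cv_mul r0 (aC j) (cpC i j)) (Cv_add r0 (Cv_mul r0 (ta i j) (cC i j)) (Cv_mul r0 (tb i j) (Cv_add r0 (aC j) m1))) _ ub).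
    by ring.
  by apply: filterS D => eps h w wL; have [] := h w i j ij wL.
Unshelve. all: by end_near. Qed.

End LimitNets.

Section NetsExist.
Context {R : realType} {m N : nat}.
Local Notation pt := 'rV[R]_m.
Local Notation T := (option (option 'I_N)).
Local Notation J := ('I_m + T)%type.
Local Notation v0 := (fun _ : 'I_m => 0%N).
Local Notation kp := (@kap R m N).
Implicit Types (i j : 'I_m) (u : pt).
Context (midQ midJ : bool) (fQ : pt -> 'rV[R]_N) (cQ : 'I_m -> 'I_m -> pt -> R)
        (p : 'rV[R]_N) (aJ bJ : 'I_m -> pt -> R).
Hypotheses (dataQ : smooth_data_Q fQ cQ) (dataJ : smooth_data_J aJ bJ)
           (aJ_neq0 : forall i u, axis i u -> aJ i u != 0).

Definition data_J (eps r : R) (a b : 'I_m -> pt -> R) := forall u i, lattice_box eps r u -> axis i u ->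
  let v := if midJ then u + (eps / 2) *: unitv i else u in a i u = aJ i v /\ b i u = bJ i v.

(** The uniqueness proofs need eps small against [M], so one [M] has to serve all small eps. The
    inverse of a_j is included because c^+ is eliminated by dividing by a_j. *)
Definition net_bounds (eps r M : R) (c : 'I_m -> 'I_m -> pt -> R) (a b : 'I_m -> pt -> R) :=
  (forall i j u, i != j -> cell eps r [:: i; j] u -> `|c i j u| <= M) /\
  forall j u, cell eps r [:: j] u -> [/\ `|a j u| <= M, `|b j u| <= M, a j u != 0 & `|(a j u)^-1| <= M].

Lemma OB_value r v (g : R -> pt -> R) : OB r v g -> exists2 C : R, 0 <= C &
  \forall eps \near (0 : R)^'+, forall u, Ldom eps r v u -> `|g eps u| <= C.
Proof.
move=> /(_ 0%N)[C C0 hC]; exists C => //; apply: filterS hC => eps [_ h] u du.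
by apply: h => // k; rewrite -topredE.
Qed.

Theorem nets_exist : exists (r M : R) (f fp : pt -> 'rV[R]_N) (c cp : 'I_m -> 'I_m -> pt -> R)
  (a b : 'I_m -> pt -> R) (fe fpe : R -> pt -> 'rV[R]_N) (ce cpe : R -> 'I_m -> 'I_m -> pt -> R)
  (ae be : R -> 'I_m -> pt -> R),
  [/\ 0 < r, conjugate_net_for r fQ cQ f c,
   [/\ jonas r f c fp a b cp, fp 0 = p, forall u i, box r u -> axis i u -> a i u = aJ i u /\ b i u = bJ i u
     & forall i u, box r u -> a i u != 0],
   \forall eps \near (0 : R)^'+, [/\ canonical_qnet midQ eps r fQ cQ (fe eps) (ce eps),
     discrete_jonas eps r (fe eps) (ce eps) (fpe eps) (ae eps) (be eps) (cpe eps), fpe eps 0 = p,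
     data_J eps r (ae eps) (be eps) & net_bounds eps r M (ce eps) (ae eps) (be eps)]
   & forall n, OE r v0 (fun eps u => fpe eps u 0 n - fp u 0 n)].
Proof.
have [r [K [gam [r0 K1 gC hreg nz]]]] := gauge_exists midQ midJ p dataQ dataJ aJ_neq0.
pose phe := phie midQ midJ fQ cQ p aJ bJ.
pose G eps := gaugef kp phe eps; pose mh eps := @mesh R m T kp eps.
have H0 u j : box r u -> gam st (inl j) u != 0 by move=> /nz[h _ _]; exact: h.
have Hjo u : box r u -> gam st jo u != 0 by move=> /nz[].
have Hp u j : box r u -> transf kp gam st (inl j) u != 0 by move=> /nz[_ _ h]; exact: h.
have GC (j k : J) : Cv r v0 (fun eps => G eps j k) (gam j k) := gC j k.
have GC' (j k : J) (_ : k != jo) := GC j k.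
have tC := transf_Cv r0 GC.
have ndg : \forall eps \near (0 : R)^'+, nondegenerate midQ midJ fQ cQ p aJ bJ r eps.
  have a1 := near_nonresonant r0 GC.
  have a2 : \forall eps \near (0 : R)^'+, forall j u, Ldom eps r v0 u -> G eps st (inl j) u != 0.
    by apply: near_fin => j; apply: (Cv_neq0 (GC _ _)) => u; exact: H0.
  have a3 := Cv_neq0 (GC st jo) Hjo.
  have a4 : \forall eps \near (0 : R)^'+, forall j u, Ldom eps r v0 u -> transf (mh eps) (G eps) st (inl j) u != 0.
    by apply: near_fin => j; apply: (Cv_neq0 (tC st (inl j) isT)) => u; exact: Hp.
  have one (u : pt) : box r u -> (1 : R) != 0 by move=> _; exact: oner_neq0.
  have a5 : \forall eps \near (0 : R)^'+, forall i j u, i != j -> Ldom eps r v0 u -> 1 + eps * cD midQ cQ eps i j u != 0.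
    apply: near_fin => i; apply: near_fin => j; have [->|ij] := eqVneq i j; first by apply: nearW => eps u /eqP.
    have := Cv_neq0 (factor_Cv r0 (cD_Cv midQ dataQ r ij)) one.
    by apply: filterS => eps h u _; exact: h.
  have a6 : \forall eps \near (0 : R)^'+, forall i u, Ldom eps r v0 u -> 1 + eps * bD midJ bJ eps i u != 0.
    by apply: near_fin => i; exact: (Cv_neq0 (factor_Cv r0 (bD_Cv midJ dataJ r i)) one).
  near=> eps; split.
  - by move=> u i k; move: i k u; near: eps.
  - by move=> u j; move: j u; near: eps.
  - by near: eps.
  - by move=> u j; move: j u; near: eps.
  split; [by near: eps|by near: eps|move=> i u; exact: aP_neq0].
have hq : \forall eps \near (0 : R)^'+, canonical_qnet midQ eps r fQ cQ (net (G eps)) (netc eps (G eps)).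
  by apply: filterS2 hreg ndg => eps; exact: discrete_qnet.
have hj : \forall eps \near (0 : R)^'+, discrete_jonas eps r (net (G eps)) (netc eps (G eps))
   (net (transf (mh eps) (G eps))) (neta eps (G eps)) (netb (mh eps) (G eps)) (netc eps (transf (mh eps) (G eps))).
  by apply: filterS2 hreg ndg => eps; exact: discrete_jonas_transform.
have hq' : \forall eps \near (0 : R)^'+, qnet eps r (net (G eps)) (netc eps (G eps)) by apply: filterS hq => eps [].
have cC i j := netc_Cv r0 GC' H0 i j; have aC j := neta_Cv r0 GC H0 j; have bC j := netb_Cv r0 GC Hjo j.
have an j (u : pt) (ub : box r u) : neta 0 gam j u != 0 by exact: (neta0_neq0 H0 Hp j ub).
have aiC j := Cv_inv r0 (aC j) (@an j).
have [M M0 hM] : exists2 M : R, 0 <= M & \forall eps \near (0 : R)^'+, forall ij : 'I_m * 'I_m, forall u,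
   Ldom eps r (vadd v0 ij.2) u -> [/\ `|netc eps (G eps) ij.1 ij.2 u| <= M, `|neta eps (G eps) ij.2 u| <= M,
      `|netb (mh eps) (G eps) ij.2 u| <= M & `|(neta eps (G eps) ij.2 u)^-1| <= M].
  apply: fin_near => [ij M M' eps _ MM' h u uL|[i j]] /=.
    by have [x1 x2 x3 x4] := h u uL; split; exact: le_trans MM'.
  have [C1 C10 h1] := OB_value (Cv_OB r0 (cC i j)); have [C2 C20 h2] := OB_value (Cv_OB r0 (aC j)).
  have [C3 C30 h3] := OB_value (Cv_OB r0 (bC j)); have [C4 C40 h4] := OB_value (Cv_OB r0 (aiC j)).
  exists (C1 + C2 + C3 + C4); first by rewrite !addr_ge0.
  near=> eps => u uL.
  have g1 : forall u, Ldom eps r (vadd v0 j) u -> `|netc eps (G eps) i j u| <= C1 by near: eps.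
  have g2 : forall u, Ldom eps r (vadd v0 j) u -> `|neta eps (G eps) j u| <= C2 by near: eps.
  have g3 : forall u, Ldom eps r (vadd v0 j) u -> `|netb (mh eps) (G eps) j u| <= C3 by near: eps.
  have g4 : forall u, Ldom eps r (vadd v0 j) u -> `|(neta eps (G eps) j u)^-1| <= C4 by near: eps.
  split; [apply: le_trans (g1 u uL) _|apply: le_trans (g2 u uL) _|apply: le_trans (g3 u uL) _|apply: le_trans (g4 u uL) _]; lra.
have an0 : \forall eps \near (0 : R)^'+, forall j u, Ldom eps r (vadd v0 j) u -> neta eps (G eps) j u != 0.
  by apply: near_fin => j; exact: (Cv_neq0 (aC j) (@an j)).
exists r, M, (net gam), (net (transf kp gam)), (netc 0 gam), (netc 0 (transf kp gam)), (neta 0 gam), (netb kp gam).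
exists (fun eps => net (G eps)), (fun eps => net (transf (mh eps) (G eps))), (fun eps => netc eps (G eps)),
  (fun eps => netc eps (transf (mh eps) (G eps))), (fun eps => neta eps (G eps)), (fun eps => netb (mh eps) (G eps)).
have le1 i : forall k, (vadd v0 i k <= 1)%N by move=> k; rewrite /vadd; case: (k == i).
split.
- exact: r0.
- split.
  + exact: (limit_conjugate_net r0 GC' H0 hq').
  + move=> u i ub ua; apply/rowP => n; rewrite mxE.
    rewrite (Cv_eq_on (P := pred1 i) r0 (GC st (sh n)) (Cv_const r0 v0 (snear_smT r (fP_sm dataQ i n))) _ ub ua).
      by rewrite /fP proj_id.
    apply: filterS2 hq (@near_pos R) => eps [_ h _] e0 w wL wP; rewrite /fP proj_id //.
    by rewrite -(h w i) ?mxE //; apply/(lattice_boxP _ _ e0).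
  + move=> u i j ub ij up.
    have le v := Cv_vadd r0 (v := v0) j.
    rewrite (Cv_eq_on (P := pred2 i j) r0 (cC i j) (Cv_vadd r0 j (cD_Cv midQ dataQ r ij)) _ ub up).
      by rewrite /cP proj_id.
    apply: filterS2 hq (@near_pos R) => eps [_ _ h] e0 w wL wP; rewrite cD_data // -(h w i j) //.
    by apply/(lattice_boxP _ _ e0); exact: (Ldom_vadd e0 wL).
- split.
  + exact: (limit_jonas r0 GC H0 Hjo Hp hj).
  + apply/rowP => n; rewrite mxE.
    have u0 : box r (0 : pt) by move=> k; rewrite mxE lexx ltW.
    (* The condition at the origin is treated as a condition on the coordinate subspace without
       directions. *)
    have s0 : coord_subspace pred0 (0 : pt) by move=> k _; rewrite mxE.
    rewrite (Cv_eq_on (P := pred0) r0 (tC st (sh n) isT) (Cv_const r0 v0 (snear_cst r (p 0 n))) _ u0 s0) //.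
    near=> eps => w wL wP; have w0 : w = 0 by apply/rowP => k; rewrite mxE; apply: wP.
    have rg : gauge_regular kp phe r K eps by near: eps.
    have nd : nondegenerate midQ midJ fQ cQ p aJ bJ r eps by near: eps.
    by have := congr1 (fun x : 'rV[R]_N => x 0 n) (discrete_fp0 r0 rg); rewrite mxE w0.
  + move=> u i ub ua.
    have D : \forall eps \near (0 : R)^'+, forall w, Ldom eps r (vadd v0 i) w -> coord_subspace (pred1 i) w ->
       neta eps (G eps) i w = aD midJ aJ eps i w /\ netb (mh eps) (G eps) i w = bD midJ bJ eps i w.
      near=> eps => w wL wP; have e0 : 0 < eps by near: eps; exact: near_pos.
      have rg : gauge_regular kp phe r K eps by near: eps.
      have nd : nondegenerate midQ midJ fQ cQ p aJ bJ r eps by near: eps.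
      exact: (discrete_ab_data rg nd (Ldom_vadd e0 wL) wP).
    split.
      rewrite (Cv_eq_on (P := pred1 i) r0 (aC i) (Cv_vadd r0 i (aD_Cv midJ dataJ r i)) _ ub ua).
        by rewrite /aP proj_id.
      by apply: filterS D => eps h w wL wP; have [] := h w wL wP.
    rewrite (Cv_eq_on (P := pred1 i) r0 (bC i) (Cv_vadd r0 i (bD_Cv midJ dataJ r i)) _ ub ua).
      by rewrite /bP proj_id.
    by apply: filterS D => eps h w wL wP; have [] := h w wL wP.
  + exact: an.
- near=> eps; have e0 : 0 < eps by near: eps; exact: near_pos.
  have rg : gauge_regular kp phe r K eps by near: eps.
  have nd : nondegenerate midQ midJ fQ cQ p aJ bJ r eps by near: eps.
  have hMe : forall ij : 'I_m * 'I_m, forall u,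
   Ldom eps r (vadd v0 ij.2) u -> [/\ `|netc eps (G eps) ij.1 ij.2 u| <= M, `|neta eps (G eps) ij.2 u| <= M,
      `|netb (mh eps) (G eps) ij.2 u| <= M & `|(neta eps (G eps) ij.2 u)^-1| <= M] by near: eps.
  have ane : forall j u, Ldom eps r (vadd v0 j) u -> neta eps (G eps) j u != 0 by near: eps.
  split; [by near: eps|by near: eps|exact: (discrete_fp0 r0 rg)| |split].
  + move=> u i /(lattice_boxP _ _ e0) vu ua v; have [-> ->] := discrete_ab_data rg nd vu ua.
    exact: aD_data.
  + move=> i j u ij /(cell_square e0) /(Ldom_vadd e0) d.
    by have [] := hMe (i, j) u d.
  + move=> j u /(cell_edge e0) d; have [_ x1 x2 x3] := hMe (j, j) u d.
    by split => //; exact: ane.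
- move=> n; have [h _] := tC st (sh n) isT.
  by apply: (OE_congr _ h); apply: nearW => eps u _; rewrite !mxE.
Unshelve. all: by end_near. Qed.

End NetsExist.

(** * Uniqueness *)

Section DiscreteUniqueness.
Context {R : realType} {m N : nat} (eps r M : R).
Local Notation pt := 'rV[R]_m.
Local Notation v0 := (fun _ : 'I_m => 0%N).
Implicit Types (i j k : 'I_m) (u w : pt) (c : 'I_m -> 'I_m -> pt -> R) (a b : 'I_m -> pt -> R).
Hypotheses (e0 : 0 < eps) (M1 : 1 <= M) (small : 7 * (eps * M ^+ 3) < 1).

Lemma Ldom_cell_sub s s' u : (forall k, count_mem k s' <= count_mem k s)%N ->
  Ldom eps r (vword v0 s) u -> cell eps r s' u.
Proof.
move=> hs [nu [-> h]]; have hw k : eps * (vword nu s' k)%:R <= r.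
  by apply: le_trans (h k); rewrite ler_pM2l // ler_nat /vword leq_add2l add0n.
have e : latt eps nu + eps *: \sum_(i <- s') unitv i = latt eps (vword nu s').
  apply/rowP => k; rewrite !mxE vwordE natrD mulrDr summxE natr_sum; congr (_ + _ * _).
  by apply: eq_bigr => i _; rewrite mxE eqxx.
split; rewrite ?e; apply/(lattice_boxP _ _ e0).
  by exists nu; split => // k; apply: le_trans (h k); rewrite ler_pM2l // ler_nat leq_add2l.
by exists (vword nu s'); split => // k; rewrite addn0.
Qed.

Lemma latt_inj nu nu' : latt eps nu = latt eps nu' :> pt -> nu = nu'.
Proof.
move=> e; apply/funext => k; have := congr1 (fun x : pt => x 0 k) e.
by rewrite !mxE => /(mulfI (lt0r_neq0 e0)) /eqP; rewrite eqr_nat => /eqP.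
Qed.

Lemma count_mid (x y z l : 'I_m) : (count_mem l [:: x; z] <= count_mem l [:: x; y; z])%N.
Proof. by rewrite /= leq_add2l leq_addl. Qed.

Lemma count_tail (x y z l : 'I_m) : (count_mem l [:: y; z] <= count_mem l [:: x; y; z])%N.
Proof. by rewrite /= leq_addl. Qed.

Lemma perms3 (x y z : 'I_m) l : [/\ count_mem l [:: x; z; y] = count_mem l [:: x; y; z],
  count_mem l [:: y; x; z] = count_mem l [:: x; y; z], count_mem l [:: y; z; x] = count_mem l [:: x; y; z],
  count_mem l [:: z; x; y] = count_mem l [:: x; y; z] & count_mem l [:: z; y; x] = count_mem l [:: x; y; z]].
Proof.
rewrite /= !addn0; move: (nat_of_bool (x == l)) (nat_of_bool (y == l)) (nat_of_bool (z == l)) => A B C.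
by split; lia.
Qed.

Let p1 (x y z l : 'I_m) : (count_mem l [:: x; z; y] <= count_mem l [:: x; y; z])%N. Proof. by have [-> _ _ _ _] := perms3 x y z l. Qed.
Let p2 (x y z l : 'I_m) : (count_mem l [:: y; x; z] <= count_mem l [:: x; y; z])%N. Proof. by have [_ -> _ _ _] := perms3 x y z l. Qed.
Let p3 (x y z l : 'I_m) : (count_mem l [:: y; z; x] <= count_mem l [:: x; y; z])%N. Proof. by have [_ _ -> _ _] := perms3 x y z l. Qed.
Let p4 (x y z l : 'I_m) : (count_mem l [:: z; x; y] <= count_mem l [:: x; y; z])%N. Proof. by have [_ _ _ -> _] := perms3 x y z l. Qed.
Let p5 (x y z l : 'I_m) : (count_mem l [:: z; y; x] <= count_mem l [:: x; y; z])%N. Proof. by have [_ _ _ _ ->] := perms3 x y z l. Qed.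

Lemma cell_down i s nu : (0 < nu i)%N -> i \notin s -> (forall k, eps * (vword nu s k)%:R <= r) ->
  Ldom eps r (vword v0 (i :: s)) (latt eps (vsub nu i)).
Proof.
move=> ni si h; exists (vsub nu i); split => // k; apply: le_trans (h k); rewrite ler_pM2l // ler_nat.
rewrite /vword /vsub /= add0n addnA leq_add2r (eq_sym i k).
have [->|_] := eqVneq k i; last by rewrite subn0 addn0.
by rewrite subnK.
Qed.

Lemma delta_diff (x0 x x' A A' : R) : eps^-1 * (x - x0) = A -> eps^-1 * (x' - x0) = A' ->
  `|x' - x| = eps * `|A' - A|.
Proof.
move=> <- <-; rewrite -mulrBr normrM normfV (gtr0_norm e0) mulVKf ?gt_eqF //.
by congr (`| _ |); ring.
Qed.

Lemma normM_le (x y C : R) : `|y| <= C -> `|x * y| <= C * `|x|.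
Proof. by move=> h; rewrite normrM [C * _]mulrC ler_wpM2l. Qed.

Lemma qM : 0 <= eps * M /\ eps * M <= eps * M ^+ 3.
Proof.
have M0 : 0 <= M by exact: le_trans ler01 M1.
split; first by rewrite mulr_ge0 // ltW.
rewrite ler_pM2l // (exprS M 2) ler_peMr //.
by rewrite expr_ge1.
Qed.

(** The unknowns are the errors of the shifted coefficients on a 3-cube, one for each permutation of
    its directions. Each occurs on the right of three inequalities, so their sum S satisfies S <= 3
    q S. *)
Lemma coupled_zero (q x1 x2 x3 x4 x5 x6 : R) : 3 * q < 1 ->
  0 <= x1 -> 0 <= x2 -> 0 <= x3 -> 0 <= x4 -> 0 <= x5 -> 0 <= x6 ->
  x1 <= q * (x5 + x6 + x1) -> x2 <= q * (x3 + x4 + x2) -> x3 <= q * (x6 + x5 + x3) ->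
  x4 <= q * (x1 + x2 + x4) -> x5 <= q * (x4 + x3 + x5) -> x6 <= q * (x2 + x1 + x6) -> x1 <= 0.
Proof.
move=> q1 y1 y2 y3 y4 y5 y6 h1 h2 h3 h4 h5 h6.
pose S := x1 + x2 + x3 + x4 + x5 + x6.
have hS : S <= 3 * q * S by rewrite /S; lra.
have S0 : S <= 0.
  rewrite leNgt; apply/negP => Sp; have : 3 * q * S < 1 * S by rewrite ltr_pM2r.
  by rewrite mul1r; lra.
by move: S0; rewrite /S; lra.
Qed.

Definition cube_equations c := forall u i j k, i != j -> j != k -> i != k -> cell eps r [:: i; j; k] u ->
  dl eps i (c j k) u = tau eps k (c i j) u * c j k u + tau eps k (c j i) u * c i k u - tau eps i (c j k) u * c i k u.

(** The cube equations have shifted coefficients on both sides, so a new coefficient is determined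
    only jointly with the other five of its 3-cube. A bound of c alone suffices, because both nets
    agree at the lowest corner. *)
Lemma qnet_c_unique c c' : cube_equations c -> cube_equations c' ->
  (forall i j u, i != j -> cell eps r [:: i; j] u -> `|c i j u| <= M) ->
  (forall u i j, i != j -> lattice_box eps r u -> plane i j u -> c' i j u = c i j u) ->
  forall i j u, i != j -> cell eps r [:: i; j] u -> c' i j u = c i j u.
Proof.
move=> hc hc' cM hp j k u jk d.
have [nu [eu hnu]] := cell_Ldom e0 d; rewrite {}eu in d *.
move: {2}(vsize nu) (erefl (vsize nu)) => n; elim: n nu j k jk d hnu => [|n IH] nu j k jk d hnu en.
  apply: hp => //; first by case: d.
  move=> i _; rewrite mxE; have -> : nu i = 0%N by apply/eqP; rewrite -leqn0 -en vsize_coord.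
  by rewrite mulr0.
case: (pickP (fun i => [&& i != j, i != k & (0 < nu i)%N])) => [i /and3P[ij ik ni]|h0]; last first.
  apply: hp => //; first by case: d.
  move=> i; rewrite -topredE /= negb_or => /andP[ij ik]; rewrite mxE; have := h0 i.
  by rewrite ij ik /= lt0n => /negbFE/eqP ->; rewrite mulr0.
set w := vsub nu i; have ew : vsize w = n by apply: succn_inj; rewrite -(vsize_add _ i) /w vadd_sub.
have D : Ldom eps r (vword v0 [:: i; j; k]) (latt eps w).
  by apply: cell_down => //; rewrite !inE negb_or ij ik.
have nuw : nu = vadd w i by rewrite vadd_sub.
have IHw x y : x != y -> (forall l, count_mem l [:: x; y] <= count_mem l [:: i; j; k])%N ->
    c' x y (latt eps w) = c x y (latt eps w) /\ `|c x y (latt eps w)| <= M.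
  move=> xy hl; have cl := Ldom_cell_sub hl D; split; last exact: cM.
  have [nu' [/latt_inj eu h']] := cell_Ldom e0 cl; subst nu'; exact: IH.
have ji : j != i by rewrite eq_sym.
have ki : k != i by rewrite eq_sym.
have kj : k != j by rewrite eq_sym.
pose W := latt eps w.
have E x y z : x != y -> y != z -> x != z -> (forall l, count_mem l [:: x; y; z] <= count_mem l [:: i; j; k])%N ->
   `|tau eps x (c' y z) W - tau eps x (c y z) W| <= eps * M * (`|tau eps z (c' x y) W - tau eps z (c x y) W| +
     `|tau eps z (c' y x) W - tau eps z (c y x) W| + `|tau eps x (c' y z) W - tau eps x (c y z) W|).
  move=> xy yz xz hl; have cl := Ldom_cell_sub hl D.
  have [q1 b1] : c' y z W = c y z W /\ `|c y z W| <= M by apply: IHw => // l; apply: leq_trans (hl l); exact: count_tail.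
  have [q2 b2] : c' x z W = c x z W /\ `|c x z W| <= M by apply: IHw => // l; apply: leq_trans (hl l); exact: count_mid.
  have h := hc W x y z xy yz xz cl; have h' := hc' W x y z xy yz xz cl.
  rewrite /dl q1 in h'; rewrite /dl in h.
  rewrite [X in X <= _](delta_diff h h') q2 -mulrA ler_pM2l //.
  set t1 := tau eps z (c' x y) W; set t2 := tau eps z (c x y) W; set t3 := tau eps z (c' y x) W.
  set t4 := tau eps z (c y x) W; set t5 := tau eps x (c' y z) W; set t6 := tau eps x (c y z) W.
  have -> : t1 * c y z W + t3 * c x z W - t5 * c x z W - (t2 * c y z W + t4 * c x z W - t6 * c x z W) =
    (t1 - t2) * c y z W + (t3 - t4) * c x z W - (t5 - t6) * c x z W by ring.
  apply: le_trans (ler_normB _ _) _; rewrite mulrDr; apply: lerD; last exact: normM_le.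
  apply: le_trans (ler_normD _ _) _; rewrite mulrDr; apply: lerD; exact: normM_le.
have [E1 E2 E3 [E4 E5 E6]] := And4 (E i j k ij jk ik (fun l => leqnn _)) (E i k j ik kj ij (p1 i j k)) (E j i k ji ik jk (p2 i j k))
  (And3 (E j k i jk ki ji (p3 i j k)) (E k i j ki ij kj (p4 i j k)) (E k j i kj ji ki (p5 i j k))).
have [q0 qle] := qM; set q := eps * M in E1 E2 E3 E4 E5 E6 q0 qle.
have q3 : 3 * q < 1 by apply: le_lt_trans small; lra.
rewrite nuw latt_vadd; apply/eqP; rewrite -subr_eq0 -normr_eq0 eq_le normr_ge0 andbT.
rewrite -/W -/(tau eps i (c' j k) W) -/(tau eps i (c j k) W).
by apply: (coupled_zero q3 _ _ _ _ _ _ E1 E2 E3 E4 E5 E6).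
Qed.

Lemma second_delta (f : pt -> 'rV[R]_N) u i j X : delta eps i (delta eps j f) u = X ->
  f (u + eps *: unitv i + eps *: unitv j) =
  f (u + eps *: unitv i) + eps *: (eps^-1 *: (f (u + eps *: unitv j) - f u) + eps *: X).
Proof.
have K (Y : 'rV[R]_N) : eps *: (eps^-1 *: Y) = Y by rewrite scalerA divff ?gt_eqF // scale1r.
by move=> <-; rewrite /delta /tau K [_ + (_ - _)]addrC subrK K [_ + (_ - _)]addrC subrK.
Qed.

Lemma lattice_latt nu : (forall k, eps * (nu k)%:R <= r) -> lattice_box eps r (latt eps nu).
Proof. by move=> h; apply/(lattice_boxP _ _ e0); exists nu; split => // k; rewrite addn0. Qed.

Lemma sub_le nu i : (forall k, eps * (nu k)%:R <= r) -> forall k, eps * (vsub nu i k)%:R <= r.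
Proof. by move=> h k; apply: le_trans (h k); rewrite ler_pM2l // ler_nat leq_subr. Qed.

Definition square_equations c (f : pt -> 'rV[R]_N) := forall u i j, i != j -> cell eps r [:: i; j] u ->
  delta eps i (delta eps j f) u = c j i u *: delta eps i f u + c i j u *: delta eps j f u.

Lemma cell_swap i j u : cell eps r [:: i; j] u -> cell eps r [:: j; i] u.
Proof. by rewrite /cell !big_cons !big_nil !addr0 [unitv j + _]addrC. Qed.

Lemma cell_pair nu i j : i != j -> (0 < nu i)%N -> cell eps r [:: j] (latt eps nu) -> cell eps r [:: i; j] (latt eps (vsub nu i)).
Proof.
move=> ij ni /(cell_Ldom e0) [nu' [/latt_inj <- h]].
by apply: (Ldom_cell_sub (s := [:: i; j])) => //; apply: cell_down; rewrite // inE.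
Qed.

(** The square equation gives the highest vertex of a square from the other three. A point without
    two positive indices lies on an axis; for the origin this requires that there is an axis. *)
Lemma qnet_f_unique c c' f f' : square_equations c f -> square_equations c' f' ->
  (forall i j u, i != j -> cell eps r [:: i; j] u -> c' i j u = c i j u) ->
  (forall u i, lattice_box eps r u -> axis i u -> f' u = f u) -> (0 < m)%N ->
  forall u, lattice_box eps r u -> f' u = f u.
Proof.
move=> hf hf' cc hx m0 u /(lattice_boxP _ _ e0) [nu [-> h0]].
have {h0} hnu k : eps * (nu k)%:R <= r by have := h0 k; rewrite addn0.
move: {2}(vsize nu) (leqnn (vsize nu)) => n; elim: n nu hnu => [|n IH] nu hnu len.
  apply: (hx _ (Ordinal m0)); first exact: lattice_latt.
  move=> k _; rewrite mxE; have -> : nu k = 0%N by apply/eqP; rewrite -leqn0 (leq_trans _ len) // vsize_coord.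
  by rewrite mulr0.
case: (pickP (fun ij : 'I_m * 'I_m => [&& ij.1 != ij.2, (0 < nu ij.1)%N & (0 < nu ij.2)%N])) => [[i j] /and3P[/= ij ni nj]|hn]; last first.
  have [i hi] : exists i, axis i (latt eps nu).
    case: (pickP (fun i => (0 < nu i)%N)) => [i ni|n0]; last first.
      by exists (Ordinal m0) => k _; rewrite mxE; have := n0 k; rewrite lt0n => /negbFE/eqP ->; rewrite mulr0.
    exists i => k; rewrite -topredE /= => ki; rewrite mxE; have := hn (k, i); rewrite /= ki ni andbT /= lt0n => /negbFE/eqP ->.
    by rewrite mulr0.
  by apply: hx hi; exact: lattice_latt.
set w := vsub (vsub nu j) i.
have nji : (0 < vsub nu j i)%N by rewrite /vsub (negPf ij) subn0.
have e1 : vadd w i = vsub nu j by rewrite vadd_sub.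
have e2 : vadd (vadd w i) j = nu by rewrite e1 vadd_sub.
have cl : cell eps r [:: i; j] (latt eps w).
  apply: cell_pair => //; apply: (@Ldom_cell_sub [:: j]) => //.
  by apply: cell_down => // k; rewrite /vword addn0.
have szw : (vsize w < n)%N by move: len; rewrite -e2 !vsize_add; lia.
have hj := sub_le j hnu; have hw := sub_le i hj; have hi := sub_le i hnu.
have e3 : vadd w j = vsub nu i.
  by rewrite -[in RHS]e2 -[in RHS]vaddC; rewrite vsub_add.
have q0 : f' (latt eps w) = f (latt eps w) by apply: IH => //; lia.
have qj : f' (latt eps w + eps *: unitv i) = f (latt eps w + eps *: unitv i).
  by rewrite -latt_vadd e1; apply: IH; rewrite // -e1 vsize_add; lia.
have qi : f' (latt eps w + eps *: unitv j) = f (latt eps w + eps *: unitv j).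
  by rewrite -latt_vadd e3; apply: IH; rewrite // -e3 vsize_add; lia.
have ji : j != i by rewrite eq_sym.
rewrite -e2 !latt_vadd (second_delta (hf _ _ _ ij cl)) (second_delta (hf' _ _ _ ij cl)).
by rewrite /delta /tau q0 qj qi (cc _ _ _ ij cl) (cc _ _ _ ji (cell_swap cl)).
Qed.

(** The unknowns are the errors of the shifted a and b on a square. The errors y1, y2 of c^+ are
    expressed by them at the cost of M^2, whence the power M^3; after this substitution the largest
    total coefficient of an unknown is 7. *)
Lemma coupled_zero4 (q t x1 x2 x3 x4 y1 y2 : R) : 7 * q < 1 -> 0 <= q -> t * M ^+ 2 <= q -> 0 <= t -> t <= q ->
  0 <= x1 -> 0 <= x2 -> 0 <= x3 -> 0 <= x4 ->
  x1 <= t * (2 * x4 + x2 + x1) -> x2 <= t * (2 * x3 + x1 + x2) ->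
  x3 <= t * (y1 + y2 + x3) -> x4 <= t * (y2 + y1 + x4) ->
  y1 <= M ^+ 2 * (x2 + 2 * x4) -> y2 <= M ^+ 2 * (x1 + 2 * x3) -> x1 <= 0 /\ x3 <= 0.
Proof.
move=> q7 q0 tq t0 tq' z1 z2 z3 z4 h1 h2 h3 h4 h5 h6.
have up (z : R) : 0 <= z -> t * z <= q * z by move=> z0; exact: ler_wpM2r.
have hy1 : t * y1 <= q * (x2 + 2 * x4).
  apply: le_trans (ler_wpM2l t0 h5) _; rewrite mulrA; apply: ler_wpM2r => //; lra.
have hy2 : t * y2 <= q * (x1 + 2 * x3).
  apply: le_trans (ler_wpM2l t0 h6) _; rewrite mulrA; apply: ler_wpM2r => //; lra.
have k1 := up (2 * x4 + x2 + x1) ltac:(lra); have k2 := up (2 * x3 + x1 + x2) ltac:(lra).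
have k3 := up x3 z3; have k4 := up x4 z4.
pose S := x1 + x2 + x3 + x4.
have S0 : 0 <= S by rewrite /S; lra.
have g1 : 0 <= q * x1 by exact: mulr_ge0.
have g2 : 0 <= q * x2 by exact: mulr_ge0.
have hS : S <= 7 * q * S by rewrite /S; lra.
have Sn : S <= 0.
  rewrite leNgt; apply/negP => Sp; have : 7 * q * S < 1 * S by rewrite ltr_pM2r.
  by rewrite mul1r; lra.
by move: Sn; rewrite /S; split; lra.
Qed.

Definition jonas_equations c cp a b := forall u i j, i != j -> cell eps r [:: i; j] u ->
  [/\ dl eps i (a j) u = tau eps j (b i) u * (a j u - 1) + (tau eps j (a i) u - tau eps i (a j) u) * c i j u,
      dl eps i (b j) u = cp i j u * b j u + cp j i u * b i u - tau eps i (b j) u * b i u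
    & a j u * cp i j u = tau eps j (a i) u * c i j u + tau eps j (b i) u * (a j u - 1)].

(** The equations of a square are again implicit and couple both edges. No data are given for c^+,
    so it is eliminated by its algebraic equation, where the bound of 1/a_j enters. *)
Lemma jonas_ab_unique c cp cp' a b a' b' : jonas_equations c cp a b -> jonas_equations c cp' a' b' ->
  net_bounds eps r M c a b ->
  (forall u i, lattice_box eps r u -> axis i u -> a' i u = a i u /\ b' i u = b i u) ->
  forall j u, cell eps r [:: j] u -> a' j u = a j u /\ b' j u = b j u.
Proof.
move=> h h' [cM abM] hx j u d; have [nu [eu hnu]] := cell_Ldom e0 d; rewrite {}eu in d *.
move: {2}(vsize nu) (erefl (vsize nu)) => n; elim: n nu j d hnu => [|n IH] nu j d hnu en.
  apply: hx; first by case: d.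
  move=> i _; rewrite mxE; have -> : nu i = 0%N by apply/eqP; rewrite -leqn0 -en vsize_coord.
  by rewrite mulr0.
case: (pickP (fun i => (i != j) && (0 < nu i)%N)) => [i /andP[ij ni]|h0]; last first.
  apply: hx; first by case: d.
  move=> i; rewrite -topredE /= => ij; rewrite mxE; have := h0 i.
  by rewrite ij /= lt0n => /negbFE/eqP ->; rewrite mulr0.
set w := vsub nu i; have ew : vsize w = n by apply: succn_inj; rewrite -(vsize_add _ i) /w vadd_sub.
have cl : cell eps r [:: i; j] (latt eps w) by exact: cell_pair.
have ji : j != i by rewrite eq_sym.
have D := cell_Ldom e0 cl.
have ej : cell eps r [:: j] (latt eps w) by apply: (Ldom_cell_sub _ D) => l; rewrite /= leq_addl.
have ei : cell eps r [:: i] (latt eps w) by apply: (Ldom_cell_sub _ D) => l; rewrite /= leq_add2l.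
have IHw k : cell eps r [:: k] (latt eps w) -> a' k (latt eps w) = a k (latt eps w) /\ b' k (latt eps w) = b k (latt eps w).
  by move=> ck; have [nu' [/latt_inj eu hu]] := cell_Ldom e0 ck; subst nu'; exact: IH.
have nuw : nu = vadd w i by rewrite vadd_sub.
rewrite nuw latt_vadd; move: (latt eps w) cl ej ei IHw {D} => W cl ej ei IHw.
have [aj bj] := IHw j ej; have [ai bi] := IHw i ei.
have [A1 A2 A3 A4] := abM j W ej; have [B1 B2 B3 B4] := abM i W ei.
have C1 := cM i j W ij cl; have C2 := cM j i W ji (cell_swap cl).
have one (x : R) : `|x| <= M -> `|x - 1| <= 2 * M.
  by move=> hx1; apply: le_trans (ler_normB _ _) _; rewrite normr1 mulr2n mulrDl mul1r; exact: lerD.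
have M0 : 0 <= M by exact: le_trans ler01 M1.
have main x y : x != y -> cell eps r [:: x; y] W -> a' x W = a x W -> b' x W = b x W -> a' y W = a y W -> b' y W = b y W ->
   `|a y W| <= M -> `|b y W| <= M -> `|b x W| <= M -> a y W != 0 -> `|(a y W)^-1| <= M -> `|c x y W| <= M ->
   [/\ `|tau eps x (a' y) W - tau eps x (a y) W| <= eps * M * (2 * `|tau eps y (b' x) W - tau eps y (b x) W| +
        `|tau eps y (a' x) W - tau eps y (a x) W| + `|tau eps x (a' y) W - tau eps x (a y) W|),
      `|tau eps x (b' y) W - tau eps x (b y) W| <= eps * M * (`|cp' x y W - cp x y W| + `|cp' y x W - cp y x W| +
         `|tau eps x (b' y) W - tau eps x (b y) W|) &
      `|cp' x y W - cp x y W| <= M ^+ 2 * (`|tau eps y (a' x) W - tau eps y (a x) W| + 2 * `|tau eps y (b' x) W - tau eps y (b x) W|)].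
  move=> xy cxy ax bx ay by_ ayM byM bxM ay0 aiM cM'.
  have [h1 h2 h3] := h W x y xy cxy; have [h1' h2' h3'] := h' W x y xy cxy.
  rewrite /dl ay in h1'; rewrite /dl by_ bx in h2'; rewrite ay in h3'; rewrite /dl in h1 h2.
  split.
  - rewrite [X in X <= _](delta_diff h1 h1') -mulrA ler_pM2l //.
    set s1 := tau eps y (b' x) W; set s2 := tau eps y (b x) W; set s3 := tau eps y (a' x) W; set s4 := tau eps y (a x) W.
    set s5 := tau eps x (a' y) W; set s6 := tau eps x (a y) W.
    have -> : s1 * (a y W - 1) + (s3 - s5) * c x y W - (s2 * (a y W - 1) + (s4 - s6) * c x y W) =
      (s1 - s2) * (a y W - 1) + (s3 - s4) * c x y W - (s5 - s6) * c x y W by ring.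
    apply: le_trans (ler_normB _ _) _; rewrite [X in _ <= X]mulrDr; apply: lerD; last exact: normM_le.
    apply: le_trans (ler_normD _ _) _; rewrite [X in _ <= X]mulrDr; apply: lerD; last exact: normM_le.
    by rewrite mulrCA mulrA; apply: normM_le; exact: one.
  - rewrite [X in X <= _](delta_diff h2 h2') -mulrA ler_pM2l //.
    set s5 := tau eps x (b' y) W; set s6 := tau eps x (b y) W.
    have -> : cp' x y W * b y W + cp' y x W * b x W - s5 * b x W - (cp x y W * b y W + cp y x W * b x W - s6 * b x W) =
      (cp' x y W - cp x y W) * b y W + (cp' y x W - cp y x W) * b x W - (s5 - s6) * b x W by ring.
    apply: le_trans (ler_normB _ _) _; rewrite [X in _ <= X]mulrDr; apply: lerD; last exact: normM_le.
    by apply: le_trans (ler_normD _ _) _; rewrite [X in _ <= X]mulrDr; apply: lerD; exact: normM_le.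
  - set s1 := tau eps y (b' x) W in h3' *; set s2 := tau eps y (b x) W in h3 *; set s3 := tau eps y (a' x) W in h3' *; set s4 := tau eps y (a x) W in h3 *.
    have -> : cp' x y W - cp x y W = ((s3 - s4) * c x y W + (s1 - s2) * (a y W - 1)) * (a y W)^-1.
      have -> : (s3 - s4) * c x y W + (s1 - s2) * (a y W - 1) = a y W * (cp' x y W - cp x y W).
        transitivity (a y W * cp' x y W - a y W * cp x y W); last by ring.
        by rewrite h3 h3'; ring.
      by rewrite mulrAC divff // mul1r.
    apply: le_trans (normM_le _ aiM) _; rewrite expr2 -mulrA; apply: ler_wpM2l => //.
    apply: le_trans (ler_normD _ _) _; rewrite [X in _ <= X]mulrDr; apply: lerD; first exact: normM_le.
    by rewrite mulrCA mulrA; apply: normM_le; exact: one.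
have [E1 E3 F1] := main i j ij cl ai bi aj bj A1 A2 B2 A3 A4 C1.
have [E2 E4 F2] := main j i ji (cell_swap cl) aj bj ai bi B1 B2 A2 B3 B4 C2.
have [q0 qle] := qM; have tq : eps * M * M ^+ 2 <= eps * M ^+ 3 by rewrite (exprS M 2) mulrA.
have qq : 0 <= eps * M ^+ 3 by exact: le_trans qle.
have [z1 z2] := coupled_zero4 small qq tq q0 qle (normr_ge0 _) (normr_ge0 _) (normr_ge0 _) (normr_ge0 _) E1 E2 E3 E4 F1 F2.
by split; apply/eqP; rewrite -subr_eq0 -normr_eq0 eq_le normr_ge0 andbT.
Qed.

Lemma jonas_fp_unique (f fp fp' : pt -> 'rV[R]_N) a b a' b' :
  (forall u i, cell eps r [:: i] u -> delta eps i fp u = a i u *: delta eps i f u + b i u *: (fp u - f u)) ->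
  (forall u i, cell eps r [:: i] u -> delta eps i fp' u = a' i u *: delta eps i f u + b' i u *: (fp' u - f u)) ->
  (forall j u, cell eps r [:: j] u -> a' j u = a j u /\ b' j u = b j u) -> fp' 0 = fp 0 ->
  forall u, lattice_box eps r u -> fp' u = fp u.
Proof.
move=> h h' ab hp u /(lattice_boxP _ _ e0) [nu [-> h0]].
have {h0} hnu k : eps * (nu k)%:R <= r by have := h0 k; rewrite addn0.
move: {2}(vsize nu) (erefl (vsize nu)) => n; elim: n nu hnu => [|n IH] nu hnu en.
  have -> // : latt eps nu = 0; apply/rowP => k; rewrite !mxE.
  have -> : nu k = 0%N by apply/eqP; rewrite -leqn0 -en vsize_coord.
  by rewrite mulr0.
have [i ni] : exists i, (0 < nu i)%N.
  case: (pickP (fun i => (0 < nu i)%N)) => [i ni|n0]; first by exists i.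
  by move: en; rewrite /vsize big1 // => k _; have := n0 k; rewrite lt0n => /negbFE/eqP.
set w := vsub nu i; have ew : vsize w = n by apply: succn_inj; rewrite -(vsize_add _ i) /w vadd_sub.
have cl : cell eps r [:: i] (latt eps w).
  by apply: (Ldom_cell_sub (s := [:: i])) => //; apply: cell_down => // k; rewrite /vword addn0.
have q0 : fp' (latt eps w) = fp (latt eps w) by apply: IH => //; exact: sub_le.
have [ea eb] := ab i _ cl; have k := h _ _ cl; have k' := h' _ _ cl.
have step (g : pt -> 'rV[R]_N) x : g (x + eps *: unitv i) = g x + eps *: delta eps i g x.
  by rewrite /delta /tau scalerA divff ?gt_eqF // scale1r [_ + (_ - _)]addrC subrK.
by rewrite -(vadd_sub ni) -/w latt_vadd !step k k' q0 ea eb.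
Qed.


End DiscreteUniqueness.

(** * Maximum principle and uniqueness of the smooth nets *)

Section MaximumPrinciple.
Context {R : realType} {m : nat}.
Local Notation pt := 'rV[R]_m.
Implicit Types (g : pt -> R) (u w : pt) (i l : 'I_m).

Lemma derivative_quotient g u i (e : R) : derivable g u (unitv i) -> 0 < e ->
  exists2 d : R, 0 < d & forall h, h != 0 -> `|h| < d -> `|partial i g u - h^-1 * (g (u + h *: unitv i) - g u)| < e.
Proof.
move=> dg e0; have /cvgrPdist_lt/(_ e e0) := dg.
move=> /nbhs_ballP[d d0 hd]; exists d => // h h0 hh.
have := hd h; rewrite /ball /= sub0r normrN => /(_ hh h0).
by rewrite [h *: _ + u]addrC.
Qed.

Context (r : R) (I : finType) (d : I -> pt -> R) (S : I -> pred 'I_m) (C : R).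
Hypotheses (C0 : 0 <= C) (d_cont : forall k u, box r u -> {for u, continuous (d k)}).
Hypothesis d_der : forall k u i, box r u -> derivable (d k) u (unitv i).
Hypothesis d_start : forall k u, box r u -> coord_subspace (S k) u -> d k u = 0.
Hypothesis d_growth : forall k u i, box r u -> ~~ S k i -> `|partial i (d k) u| <= C * \sum_l `|d l u|.

(* At a maximum of |d_k| exp (- lam (u_1 + .. + u_m)) the function |d_k| must
   grow at least with rate lam along every coordinate that can be decreased. *)
Lemma maximum_principle k u : box r u -> d k u = 0.
Proof.
move=> ub; apply/eqP; apply/negPn/negP => dku.
(* The summand 1 makes [lam] exceed the growth rate: at the maximum all |d_l| are at most X, so the
   derivative is at most (lam - 1) X. *)
pose lam := C * #|I|%:R + 1; have lam0 : 0 < lam by rewrite ltr_wpDl // mulr_ge0.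
pose s (w : pt) : R := \sum_l w 0 l.
pose g j w := `|d j w| * expR (- (lam * s w)).
have cs : continuous s.
  have -> : s = (fun w => \sum_(l <- enum 'I_m) w 0 l) by apply/funext => w; rewrite /s big_enum.
  elim: (enum 'I_m) => [|l q IH].
    have -> : (fun w : pt => \sum_(l <- [::]) w 0 l) = (fun=> 0 : R) by apply/funext => w; rewrite big_nil.
    exact: cst_continuous.
  have -> : (fun w : pt => \sum_(k <- l :: q) w 0 k) = (fun w => w 0 l + \sum_(k <- q) w 0 k) by apply/funext => w; rewrite big_cons.
  by move=> w; apply: continuousD; [exact: coord_continuous|exact: IH].
have cg j w : box r w -> {for w, continuous (g j)}.
  move=> wb; apply: continuousM; first by apply: continuous_comp; [exact: d_cont|exact: norm_continuous].
  apply: continuous_comp; last exact: continuous_expR.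
  by apply: continuousN; apply: continuousM; [exact: cst_continuous|exact: cs].
have /boolp.choice[U hU] : forall j, exists w, box r w /\ forall w', box r w' -> g j w' <= g j w.
  move=> j; have [] := @compact_EVT_max _ R (g j) (box r).
  - by exists u.
  - exact: itvbox_compact.
  - by apply: continuous_in_subspaceT => w /set_mem wb; exact: cg.
  by move=> w /set_mem wb hw; exists w; split => // w' wb'; apply: hw; exact: mem_set.
pose k1 := [arg max_(j > k) g j (U j)]%O.
have hk1 j w : box r w -> g j w <= g k1 (U k1).
  move=> wb; apply: le_trans ((hU j).2 w wb) _; rewrite /k1.
  by case: arg_maxP => // j' _; apply.
set u1 := U k1 in hk1; have u1b : box r u1 by exact: (hU k1).1.
pose X : R := `|d k1 u1|.
have X0 : 0 < X.
  have := hk1 k u ub; rewrite /g => h; have : 0 < `|d k u| * expR (- (lam * s u)) by rewrite mulr_gt0 ?normr_gt0 ?expR_gt0.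
  by move=> /lt_le_trans/(_ h); rewrite pmulr_lgt0 ?expR_gt0.
have dl_le (l : I) : `|d l u1| <= X by have := hk1 l u1 u1b; rewrite /g ler_pM2r ?expR_gt0.
(* Otherwise u1 would lie in the starting subspace of k1, where d vanishes. *)
have [i Si ui] : exists2 i, ~~ S k1 i & 0 < u1 0 i.
  case: (pickP (fun i => ~~ S k1 i && (u1 0 i != 0))) => [i /andP[Si ui]|h0].
    by exists i; rewrite // lt_neqAle eq_sym ui; have /andP[] := u1b i.
  move: X0; rewrite /X d_start ?normr0 ?ltxx // => i; rewrite -topredE /= => Si.
  by have := h0 i; rewrite Si /= => /negbFE/eqP.
have sum_le : C * \sum_l `|d l u1| <= (lam - 1) * X.
  rewrite /lam addrK -mulrA; apply: ler_wpM2l => //.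
  have h : \sum_l `|d l u1| <= \sum_(l : I) X by apply: ler_sum => l _; exact: dl_le.
  by move: h; rewrite sumr_const mulr_natl.
have pX := le_trans (d_growth u1b Si) sum_le.
have X2 : 0 < X / 2 by rewrite divr_gt0.
have [e e0 he] := derivative_quotient (@d_der k1 u1 i u1b) X2.
(* One backward step of length h contradicts maximality: |d| drops by at most h (lam - 1/2) X, while
   the weight gains at least the factor 1 + lam h, and h < 1/(2 lam^2) controls the term of second
   order. *)
have [h [h0 he' hu hl]] : exists h : R, [/\ 0 < h, h < e, h < u1 0 i & h < (2 * lam ^+ 2)^-1].
  apply: (@filter_ex _ (0 : R)^'+); near=> h; split; near: h; [exact: near_pos|exact: near_lt|exact: near_lt|].
  by apply: near_lt; rewrite invr_gt0 mulr_gt0 // exprn_gt0.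
have hN : - h != 0 by rewrite oppr_eq0 gt_eqF.
have hb : box r (u1 + (- h) *: unitv i).
  move=> l; rewrite addu_coord; have /andP[a b] := u1b l; case: eqP => [->|_]; last by rewrite addr0 a b.
  have /andP[a' b'] := u1b i; apply/andP; split; lra.
have := he (- h) hN; rewrite normrN gtr0_norm // => /(_ he') h1.
have h2 := hk1 k1 _ hb; rewrite /g in h2.
have sE : s (u1 + (- h) *: unitv i) = s u1 - h.
  rewrite /s (bigD1 i) //= [in RHS](bigD1 i) //= addu_coord eqxx addrAC; congr (_ + _ - _).
  by apply: eq_bigr => l li; rewrite addu_coord (negPf li) addr0.
rewrite sE -/X in h2.
have eE : expR (- (lam * (s u1 - h))) = expR (- (lam * s u1)) * expR (lam * h).
  by rewrite -expRD; congr expR; ring.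
rewrite eE mulrA mulrAC ler_pM2r ?expR_gt0 // in h2.
set Y := `|d k1 _| in h2.
have lh : 1 + lam * h <= expR (lam * h) by exact: expR_ge1Dx.
have Y0 : 0 <= Y by exact: normr_ge0.
have h3 : Y * (1 + lam * h) <= X by apply: le_trans h2; exact: ler_wpM2l.
have h4 : X - Y <= h * ((lam - 1) * X + X / 2).
  apply: le_trans (lerB_dist _ _) _; rewrite distrC.
  have -> (x : R) : `|x| = h * `|(- h)^-1 * x| by rewrite invrN mulNr normrN normrM normfV (gtr0_norm h0) mulrA divff ?mul1r // gt_eqF.
  rewrite ler_pM2l //.
  set q := (- h)^-1 * _ in h1 *.
  have -> : q = partial i (d k1) u1 - (partial i (d k1) u1 - q) by ring.
  apply: le_trans (ler_normB _ _) _; apply: lerD => //; exact: ltW.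
have l1 : 1 <= lam by rewrite lerDr mulr_ge0.
have hl2 : lam ^+ 2 * h < 2^-1.
  by move: hl; rewrite invfM ltr_pdivlMr ?exprn_gt0 // mulrC.
have Z : (X - h * ((lam - 1) * X + X / 2)) * (1 + lam * h) <= X.
  by apply: le_trans h3; apply: ler_wpM2r; [rewrite addr_ge0 // mulr_ge0 // ltW|lra].
have E : (X - h * ((lam - 1) * X + X / 2)) * (1 + lam * h) = X + h * X * (2^-1 - lam ^+ 2 * h + lam * h / 2) by field.
rewrite E gerDl in Z; have : 0 < h * X * (2^-1 - lam ^+ 2 * h + lam * h / 2).
  apply: mulr_gt0; first exact: mulr_gt0.
  have : 0 < lam * h by exact: mulr_gt0.
  lra.
by rewrite ltNge Z.
Unshelve. all: by end_near. Qed.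

End MaximumPrinciple.

Section SmoothUniqueness.
Context {R : realType} {m N : nat} (r : R).
Local Notation pt := 'rV[R]_m.
Implicit Types (g : pt -> R) (u w : pt) (i j k l : 'I_m).
Hypothesis r0 : 0 < r.

Lemma snear_derivable g u i : snear r g -> box r u -> derivable g u (unitv i).
Proof. by move=> [U [oU bU hg]] ub; exact: (sm_derivable hg (bU u ub)). Qed.

Lemma snear_bounded g : snear r g -> exists2 M : R, 0 <= M & forall u, box r u -> `|g u| <= M.
Proof. by move=> hg; apply: bounded_on_box => u ub; exact: (snear_continuous hg ub). Qed.

Lemma snear_sub (g h : pt -> R) : snear r g -> snear r h -> snear r (fun u => g u - h u).
Proof.
move=> hg hh; have h1 := snear_add hg (snear_mul (snear_cst r (-1)) hh).
have <- // : (fun u => g u + -1 * h u) = (fun u => g u - h u) by apply/funext => u; rewrite mulN1r.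
Qed.

Lemma partial_sub (g h : pt -> R) u i : snear r g -> snear r h -> box r u ->
  partial i (fun u => g u - h u) u = partial i g u - partial i h u.
Proof. by move=> hg hh ub; rewrite /partial -deriveB //; exact: snear_derivable. Qed.

Lemma partial_zero_on (P : pred 'I_m) i g u : derivable g u (unitv i) -> box r u -> P i -> coord_subspace P u ->
  (forall w, box r w -> coord_subspace P w -> g w = 0) -> partial i g u = 0.
Proof.
move=> dg ub Pi uP g0; apply/eqP; apply/negPn/negP => n0.
have p0 : 0 < `|partial i g u| by rewrite normr_gt0.
have [d d0 hd] := derivative_quotient dg p0.
have [e [e0 ed er]] : exists e : R, [/\ 0 < e, e < d & e < r / 2].
  apply: (@filter_ex _ (0 : R)^'+); near=> e; split; near: e; [exact: near_pos|exact: near_lt|].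
  by apply: near_lt; rewrite divr_gt0.
(* The increment points away from the nearer face, so boundary points are covered too; a two-sided
   derivative is determined from either side. *)
have [h [h0 hh hb]] : exists h : R, [/\ h != 0, `|h| < d & box r (u + h *: unitv i)].
  have /andP[a b] := ub i; have [le|lt] := lerP (u 0 i) (r / 2).
    exists e; rewrite gt_eqF // gtr0_norm //; split => // l; rewrite addu_coord.
    case: eqP => [->|_]; last by rewrite addr0; exact: ub.
    by apply/andP; split; lra.
  exists (- e); rewrite oppr_eq0 gt_eqF // normrN gtr0_norm //; split => // l; rewrite addu_coord.
  case: eqP => [->|_]; last by rewrite addr0; exact: ub.
  by apply/andP; split; lra.
have := hd h h0 hh; rewrite (g0 u ub uP) (g0 _ hb (coord_shift _ Pi uP)).
by rewrite subrr mulr0 subr0 ltxx.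
Unshelve. all: by end_near. Qed.

Lemma vector_components (f : pt -> 'rV[R]_N) : smooth_near (box r) f ->
  forall n, snear r (fun u => f u 0 n) /\
    forall s u, box r u -> partials s f u 0 n = partials s (fun w => f w 0 n) u.
Proof.
move=> [U [oU bU] hf] n; have nU u : U u -> nbhs u U by move: oU; rewrite openE; apply.
have hs s : {within U, continuous (partials s f)} /\ forall u i, U u -> i \in predT -> derivable (partials s f) u (unitv i).
  exact: (hf s (fun _ _ => isT)).
have E s : forall u, U u -> partials s f u 0 n = partials s (fun w => f w 0 n) u.
  elim: s => [//|i s IH] u Uu /=; have [_ d] := hs s.
  rewrite /partial (derive_mx (d u i Uu isT)) mxE; apply: near_eq_derive.
  by apply: filterS (nU u Uu) => w Uw; exact: IH.
have E' s u : U u -> {near u, (fun w => partials s f w 0 n) =1 partials s (fun w => f w 0 n)}.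
  by move=> Uu; apply: filterS (nU u Uu) => w Uw; exact: E.
split; last by move=> s u ub; exact: E (bU u ub).
exists U; split => // s u Uu; have [c d] := hs s; split.
  have cu : {for u, continuous (partials s f)} by move: c; rewrite continuous_open_subspace // => /(_ u (mem_set Uu)).
  have c2 := cvg_comp _ _ cu (@coord_continuous R 1 N 0 n (partials s f u)).
  move=> V; rewrite /= -(E s u Uu) => /c2 hV.
  have {}hV : nbhs u [set w | V (partials s f w 0 n)] by exact: hV.
  suff : nbhs u [set w | V (partials s (fun w => f w 0 n) w)] by [].
  by apply: filterS2 hV (E' s u Uu) => w /= Vw e; rewrite -e.
by move=> i; apply: (near_eq_derivable (E' s u Uu)); have /derivable_mxP := d u i Uu isT; apply.
Qed.

Let nD (x y X Y : R) : `|x| <= X -> `|y| <= Y -> `|x + y| <= X + Y.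
Proof. by move=> h1 h2; apply: le_trans (ler_normD _ _) _; exact: lerD. Qed.
Let nB (x y X Y : R) : `|x| <= X -> `|y| <= Y -> `|x - y| <= X + Y.
Proof. by move=> h1 h2; apply: le_trans (ler_normB _ _) _; exact: lerD. Qed.
Let nM (x y X Y : R) : `|x| <= X -> `|y| <= Y -> `|x * y| <= X * Y.
Proof. by move=> h1 h2; rewrite normrM; apply: ler_pM. Qed.

Let le_sum (I : finType) (d : I -> pt -> R) (l : I) u : `|d l u| <= \sum_k `|d k u|.
Proof. by rewrite (bigD1 l) //= lerDl sumr_ge0. Qed.

Lemma snear_family_bounded (I : finType) (g : I -> pt -> R) : (forall x, snear r (g x)) ->
  exists2 B : R, 0 <= B & forall x u, box r u -> `|g x u| <= B.
Proof.
move=> hg; apply: fin_bound => [k M M' MM' h u ub|k]; first exact: le_trans (h u ub) MM'.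
exact: snear_bounded.
Qed.

(** The entries c_ii are arbitrary; replacing them by 0 gives a family of smooth functions indexed
    by all pairs, as the maximum principle requires. *)
Definition offdiag (c : 'I_m -> 'I_m -> pt -> R) (jk : 'I_m * 'I_m) : pt -> R :=
  if jk.1 == jk.2 then fun=> 0 else c jk.1 jk.2.

Lemma offdiag_snear c : (forall i j, i != j -> smooth_near (box r) (c i j : pt -> R^o)) ->
  forall jk, snear r (offdiag c jk).
Proof.
move=> h [j k]; rewrite /offdiag /=; case: eqVneq => [_|jk]; first exact: snear_cst.
by apply: smooth_near_snear; exact: h.
Qed.

Lemma offdiag_neq c j k : j != k -> offdiag c (j, k) = c j k.
Proof. by move=> jk; rewrite /offdiag /= (negPf jk). Qed.

Lemma conjugate_c_unique f c f' c' : conjugate_net (N := N) r f c -> conjugate_net (N := N) r f' c' ->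
  (forall u i j, box r u -> i != j -> plane i j u -> c' i j u = c i j u) ->
  forall u i j, box r u -> i != j -> c' i j u = c i j u.
Proof.
move=> [_ sc _ ec] [_ sc' _ ec'] hp.
have s1 := offdiag_snear sc; have s2 := offdiag_snear sc'.
have [B1 B10 hB1] := snear_family_bounded s1; have [B2 B20 hB2] := snear_family_bounded s2.
pose B := B1 + B2.
have b1 i j u : i != j -> box r u -> `|c i j u| <= B.
  by move=> ij ub; have := hB1 (i, j) u ub; rewrite offdiag_neq // => h; apply: le_trans h _; rewrite lerDl.
have b2 i j u : i != j -> box r u -> `|c' i j u| <= B.
  by move=> ij ub; have := hB2 (i, j) u ub; rewrite offdiag_neq // => h; apply: le_trans h _; rewrite lerDr.
pose d jk u := offdiag c' jk u - offdiag c jk u.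
have sd jk : snear r (d jk) by exact: snear_sub.
have B0 : 0 <= B by exact: addr_ge0.
(* The difference of the two right-hand sides telescopes into six products of an error with a
   coefficient. *)
have key := @maximum_principle R m r _ d (fun jk => pred2 jk.1 jk.2) (6 * B).
move=> u i j ub ij; apply/eqP; rewrite -subr_eq0; apply/eqP.
have -> : c' i j u - c i j u = d (i, j) u by rewrite /d !offdiag_neq.
apply: key => //.
- by rewrite mulr_ge0.
- by move=> k w wb; exact: snear_continuous (sd k) wb.
- by move=> k w l wb; exact: snear_derivable (sd k) wb.
- move=> [x y] w wb wp; rewrite /d; have [->|xy] := eqVneq x y; first by rewrite /offdiag eqxx subrr.
  by rewrite !offdiag_neq // hp // subrr.
move=> [y z] w x wb /norP[/= xy xz]; have [->|yz] := eqVneq y z.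
  have -> : d (z, z) = (fun=> 0) by apply/funext => v; rewrite /d /offdiag eqxx subrr.
  rewrite /partial derive_cst normr0 mulr_ge0 ?sumr_ge0 // mulr_ge0 //.
rewrite /d partial_sub // !offdiag_neq // ec // ec' //.
set Sg := \sum_l _; have D p q : p != q -> `|c' p q w - c p q w| <= Sg.
  move=> pq; have := le_sum d (p, q) w; rewrite /d !offdiag_neq //.
have yx : y != x by rewrite eq_sym.
have -> : c' x y w * c' y z w + c' y x w * c' x z w - c' y z w * c' x z w - (c x y w * c y z w + c y x w * c x z w - c y z w * c x z w)
  = (c' x y w - c x y w) * c' y z w + (c' y z w - c y z w) * c x y w + (c' y x w - c y x w) * c' x z w
    + (c' x z w - c x z w) * c y x w - (c' y z w - c y z w) * c' x z w - (c' x z w - c x z w) * c y z w by ring.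
apply: le_trans (nB (nB (nD (nD (nD (nM (D _ _ xy) (b2 _ _ _ yz wb)) (nM (D _ _ yz) (b1 _ _ _ xy wb))) (nM (D _ _ yx) (b2 _ _ _ xz wb)))
  (nM (D _ _ xz) (b1 _ _ _ yx wb))) (nM (D _ _ yz) (b2 _ _ _ xz wb))) (nM (D _ _ xz) (b1 _ _ _ yz wb))) _.
by rewrite le_eqVlt; apply/orP; left; apply/eqP; ring.
Qed.

Lemma conjugate_f_unique f c f' c' : (0 < m)%N -> conjugate_net (N := N) r f c -> conjugate_net (N := N) r f' c' ->
  (forall u i, box r u -> axis i u -> f' u = f u) ->
  (forall u i j, box r u -> i != j -> c' i j u = c i j u) -> forall u, box r u -> f' u = f u.
Proof.
move=> m0 [sf sc ef _] [sf' _ ef' _] hx hc u ub; apply/rowP => n.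
have [B B0 hB] := snear_family_bounded (offdiag_snear sc).
have b1 i j w : i != j -> box r w -> `|c i j w| <= B.
  by move=> ij wb; have := hB (i, j) w wb; rewrite offdiag_neq.
have [g1 p1] := vector_components sf n; have [g2 p2] := vector_components sf' n.
pose F := fun w => f' w 0 n - f w 0 n.
have sF : snear r F by exact: snear_sub.
(* The equations of second order become a first order system for F and its partial derivatives: F
   starts at the origin, its i-th derivative on axis i, along which F vanishes. *)
pose d (k : option 'I_m) : pt -> R := if k is Some i then partial i F else F.
have sd (k : option 'I_m) : snear r (d k) by case: k => [i|]; [exact: (snear_partial i sF)|exact: sF].
pose S (k : option 'I_m) : pred 'I_m := if k is Some i then pred1 i else pred0.
have key := @maximum_principle R m r _ d S (2 * B + 1).
have pF i w : box r w -> partial i F w = partial i (fun w => f' w 0 n) w - partial i (fun w => f w 0 n) w.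
  by move=> wb; exact: partial_sub.
apply/eqP; rewrite -subr_eq0; apply/eqP; apply: (key _ _ _ _ _ None) => //.
- by rewrite addr_ge0 // mulr_ge0.
- by move=> k w wb; exact: snear_continuous (sd k) wb.
- by move=> k w i wb; exact: snear_derivable (sd k) wb.
- move=> [i|] w wb wp /=.
    apply: (@partial_zero_on (pred1 i)) => //; [exact: snear_derivable|exact: eqxx|].
    by move=> v vb va; rewrite /F (hx v i) // subrr.
  by rewrite /F (hx w (Ordinal m0)) ?subrr // => k _; exact: wp.
move=> k w i wb Si; set Sg := \sum_l _.
have D (l : option 'I_m) : `|d l w| <= Sg by exact: le_sum.
have S0 : 0 <= Sg by exact: sumr_ge0.
case: k Si => [j|] Si.
  have ij : i != j by [].
  have ji : j != i by rewrite eq_sym.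
  have -> : partial i (d (Some j)) w = c j i w * d (Some i) w + c i j w * d (Some j) w.
    have [U [oU bU hU]] := sd (Some j); have nU : nbhs w U by move: oU; rewrite openE; apply; exact: bU.
    have [V1 [oV1 bV1 hV1]] := g1; have [V2 [oV2 bV2 hV2]] := g2.
    have e : {near w, d (Some j) =1 (fun v => partial j (fun w => f' w 0 n) v - partial j (fun w => f w 0 n) v)}.
      have n1 : nbhs w V1 by move: oV1; rewrite openE; apply; exact: bV1.
      have n2 : nbhs w V2 by move: oV2; rewrite openE; apply; exact: bV2.
      apply: filterS2 n1 n2 => v v1 v2; rewrite /d /partial /F -deriveB //.
        exact: (sm_derivable hV2 v2).
      exact: (sm_derivable hV1 v1).
    have -> : partial i (d (Some j)) w = partial i (partial j (fun w => f' w 0 n)) w - partial i (partial j (fun w => f w 0 n)) w.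
      transitivity (partial i (fun v => partial j (fun w => f' w 0 n) v - partial j (fun w => f w 0 n) v) w).
        exact: near_eq_derive e.
      exact: (partial_sub i (snear_partial j g2) (snear_partial j g1) wb).
    have -> : partial i (partial j (fun w => f w 0 n)) w =
        c j i w * partial i (fun w => f w 0 n) w + c i j w * partial j (fun w => f w 0 n) w.
      apply: etrans (esym (p1 [:: i; j] w wb)) _; apply: etrans (congr1 (fun x : 'rV[R]_N => x 0 n) (ef w i j wb ij)) _.
      by rewrite comb_coord; congr (_ * _ + _ * _); [exact: (p1 [:: i] w wb)|exact: (p1 [:: j] w wb)].
    have -> : partial i (partial j (fun w => f' w 0 n)) w =
        c' j i w * partial i (fun w => f' w 0 n) w + c' i j w * partial j (fun w => f' w 0 n) w.
      apply: etrans (esym (p2 [:: i; j] w wb)) _; apply: etrans (congr1 (fun x : 'rV[R]_N => x 0 n) (ef' w i j wb ij)) _.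
      by rewrite comb_coord; congr (_ * _ + _ * _); [exact: (p2 [:: i] w wb)|exact: (p2 [:: j] w wb)].
    rewrite (hc w j i wb ji) (hc w i j wb ij) /d (pF i w wb) (pF j w wb); ring.
  apply: le_trans (nD (nM (b1 _ _ _ ji wb) (D (Some i))) (nM (b1 _ _ _ ij wb) (D (Some j)))) _.
  by rewrite -mulrDl; apply: ler_wpM2r => //; lra.
apply: le_trans (D (Some i)) _; rewrite ler_peMl //; lra.
Qed.

(** The coefficients c^+ have no data of their own: their error is a combination of the errors of a
    and b divided by a_j, whose inverse is bounded on the box. This closes the system for a and
    b. *)
Lemma jonas_ab_unique_smooth (f fp fp' : pt -> 'rV[R]_N) c cp cp' (a b a' b' : 'I_m -> pt -> R) :
  conjugate_net r f c -> jonas r f c fp a b cp -> jonas r f c fp' a' b' cp' ->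
  (forall i u, box r u -> a i u != 0) ->
  (forall u i, box r u -> axis i u -> a' i u = a i u /\ b' i u = b i u) ->
  forall u i, box r u -> a' i u = a i u /\ b' i u = b i u.
Proof.
move=> [_ sc _ _] [[_ scp _ _] sab _ e] [[_ scp' _ _] sab' _ e'] a0 hx.
have sa i : snear r (a i) by apply: smooth_near_snear; exact: (sab i).1.
have sb i : snear r (b i) by apply: smooth_near_snear; exact: (sab i).2.
have sa' i : snear r (a' i) by apply: smooth_near_snear; exact: (sab' i).1.
have sb' i : snear r (b' i) by apply: smooth_near_snear; exact: (sab' i).2.
have [B1 B10 hB1] := snear_family_bounded (offdiag_snear sc).
have [B2 B20 hB2] := snear_family_bounded (offdiag_snear scp).
have [B3 B30 hB3] := snear_family_bounded (offdiag_snear scp').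
have [B4 B40 hB4] := snear_family_bounded sa'; have [B5 B50 hB5] := snear_family_bounded sb.
have [B6 B60 hB6] := snear_family_bounded sb'.
have [B7 B70 hB7] := snear_family_bounded (fun i => snear_inv (sa i) (@a0 i)).
pose B := B1 + B2 + B3 + B4 + B5 + B6 + B7.
have B0 : 0 <= B by rewrite !addr_ge0.
have b1 i j u : i != j -> box r u -> `|c i j u| <= B.
  by move=> ij ub; have := hB1 (i, j) u ub; rewrite offdiag_neq // => h; apply: le_trans h _; rewrite /B; lra.
have b2 i j u : i != j -> box r u -> `|cp i j u| <= B.
  by move=> ij ub; have := hB2 (i, j) u ub; rewrite offdiag_neq // => h; apply: le_trans h _; rewrite /B; lra.
have b3 i j u : i != j -> box r u -> `|cp' i j u| <= B.
  by move=> ij ub; have := hB3 (i, j) u ub; rewrite offdiag_neq // => h; apply: le_trans h _; rewrite /B; lra.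
have b4 i u : box r u -> `|a' i u| <= B by move=> ub; apply: le_trans (hB4 i u ub) _; rewrite /B; lra.
have b5 i u : box r u -> `|b i u| <= B by move=> ub; apply: le_trans (hB5 i u ub) _; rewrite /B; lra.
have b6 i u : box r u -> `|b' i u| <= B by move=> ub; apply: le_trans (hB6 i u ub) _; rewrite /B; lra.
have b7 i u : box r u -> `|(a i u)^-1| <= B by move=> ub; apply: le_trans (hB7 i u ub) _; rewrite /B; lra.
clearbody B; clear hB1 hB2 hB3 hB4 hB5 hB6 hB7.
have b4' i u : box r u -> `|a' i u - 1| <= B + 1.
  by move=> ub; apply: nB; [exact: b4|rewrite normr1].
pose d (k : 'I_m * bool) : pt -> R := if k.2 then fun u => b' k.1 u - b k.1 u else fun u => a' k.1 u - a k.1 u.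
have sd (k : 'I_m * bool) : snear r (d k) by case: k => i [] /=; exact: snear_sub.
(* The first term comes from the two errors of c^+ in the equation for b, each at most B (4 B + 1)
   times the sum; 4 B comes from four further products, and 1 from the bound B + 1 of a' - 1. *)
pose C := 2 * B * (B * (4 * B + 1)) + 4 * B + 1.
have BB : 0 <= 2 * B * (B * (4 * B + 1)) by rewrite !mulr_ge0 // addr_ge0 // mulr_ge0.
have C0 : 0 <= C by rewrite /C; lra.
have key := @maximum_principle R m r _ d (fun k : 'I_m * bool => pred1 k.1 : pred 'I_m) C C0.
have dz (k : 'I_m * bool) u : box r u -> d k u = 0.
  apply: key.
  - by move=> l w wb; exact: snear_continuous (sd l) wb.
  - by move=> l w i wb; exact: snear_derivable (sd l) wb.
  - by move=> [i q] w wb wa; have [ha hb] := hx w i wb wa; case: q wa => _; rewrite /d /= ?ha ?hb subrr.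
  move=> [j q] w i wb ij; set Sg := \sum_l _.
  have D (l : 'I_m * bool) : `|d l w| <= Sg by exact: le_sum.
  have S0 : 0 <= Sg by exact: sumr_ge0.
  have Da l : `|a' l w - a l w| <= Sg by exact: (D (l, false)).
  have Db l : `|b' l w - b l w| <= Sg by exact: (D (l, true)).
  have ijn : i != j by [].
  have ji : j != i by rewrite eq_sym.
  have [e1 e2 _] := e w i j wb ijn; have [e1' e2' _] := e' w i j wb ijn.
  have Dc x y : x != y -> `|cp' x y w - cp x y w| <= B * (4 * B + 1) * Sg.
    move=> xy; have [_ _ h] := e w x y wb xy; have [_ _ h'] := e' w x y wb xy.
    have -> : cp' x y w - cp x y w = (a y w)^-1 * ((a' x w - a x w) * c x y w + (b' x w - b x w) * (a' y w - 1)
       + (a' y w - a y w) * b x w - (a' y w - a y w) * cp' x y w).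
      have -> : (a' x w - a x w) * c x y w + (b' x w - b x w) * (a' y w - 1) + (a' y w - a y w) * b x w - (a' y w - a y w) * cp' x y w
        = (a' x w * c x y w + b' x w * (a' y w - 1)) - (a x w * c x y w + b x w * (a y w - 1)) - a' y w * cp' x y w + a y w * cp' x y w by ring.
      rewrite -h -h'; have -> : a' y w * cp' x y w - a y w * cp x y w - a' y w * cp' x y w + a y w * cp' x y w = a y w * (cp' x y w - cp x y w) by ring.
      by rewrite mulKf // a0.
    apply: le_trans (nM (b7 y w wb) (nB (nD (nD (nM (Da x) (b1 _ _ _ xy wb)) (nM (Db x) (b4' y w wb))) (nM (Da y) (b5 x w wb))) (nM (Da y) (b3 _ _ _ xy wb)))) _.
    by rewrite le_eqVlt; apply/orP; left; apply/eqP; ring.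
  case: q ij => _; rewrite /d /= ?(partial_sub i (sb' j) (sb j) wb) ?(partial_sub i (sa' j) (sa j) wb).
    rewrite e2 e2'; have -> : cp' i j w * b' j w + cp' j i w * b' i w - b' j w * b' i w - (cp i j w * b j w + cp j i w * b i w - b j w * b i w)
      = (cp' i j w - cp i j w) * b' j w + (b' j w - b j w) * cp i j w + (cp' j i w - cp j i w) * b' i w + (b' i w - b i w) * cp j i w
        - (b' j w - b j w) * b' i w - (b' i w - b i w) * b j w by ring.
    apply: le_trans (nB (nB (nD (nD (nD (nM (Dc _ _ ijn) (b6 j w wb)) (nM (Db j) (b2 _ _ _ ijn wb))) (nM (Dc _ _ ji) (b6 i w wb))) (nM (Db i) (b2 _ _ _ ji wb)))
       (nM (Db j) (b6 i w wb))) (nM (Db i) (b5 j w wb))) _.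
    have -> : C * Sg = 2 * B * (B * (4 * B + 1)) * Sg + 4 * B * Sg + Sg by rewrite /C; ring.
    rewrite -[X in X <= _]addr0; apply: lerD => //.
    by rewrite le_eqVlt; apply/orP; left; apply/eqP; ring.
  rewrite e1 e1'; have -> : (a' i w - a' j w) * c i j w + b' i w * (a' j w - 1) - ((a i w - a j w) * c i j w + b i w * (a j w - 1))
    = (a' i w - a i w) * c i j w - (a' j w - a j w) * c i j w + (b' i w - b i w) * (a' j w - 1) + (a' j w - a j w) * b i w by ring.
  apply: le_trans (nD (nD (nB (nM (Da i) (b1 _ _ _ ijn wb)) (nM (Da j) (b1 _ _ _ ijn wb))) (nM (Db i) (b4' j w wb))) (nM (Da j) (b5 i w wb))) _.
  have -> : C * Sg = 2 * B * (B * (4 * B + 1)) * Sg + (4 * B * Sg + Sg) by rewrite /C; ring.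
  rewrite -[X in X <= _]add0r; apply: lerD; first exact: mulr_ge0.
  by rewrite le_eqVlt; apply/orP; left; apply/eqP; ring.
move=> u i ub; split; apply/eqP; rewrite -subr_eq0; apply/eqP; [exact: (dz (i, false) u ub)|exact: (dz (i, true) u ub)].
Qed.

Lemma jonas_fp_unique_smooth (f fp fp' : pt -> 'rV[R]_N) c cp cp' (a b a' b' : 'I_m -> pt -> R) :
  conjugate_net r f c -> jonas r f c fp a b cp -> jonas r f c fp' a' b' cp' -> fp' 0 = fp 0 ->
  (forall u i, box r u -> a' i u = a i u /\ b' i u = b i u) -> forall u, box r u -> fp' u = fp u.
Proof.
move=> [sf _ _ _] [[sp _ _ _] sab ep _] [[sp' _ _ _] _ ep' _] h0 hab.
have [B B0 hB] := snear_family_bounded (fun i => smooth_near_snear (sab i).2).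
have cf n := vector_components sf n; have cp1 n := vector_components sp n; have cp2 n := vector_components sp' n.
pose d (n : 'I_N) : pt -> R := fun u => fp' u 0 n - fp u 0 n.
have sd (n : 'I_N) : snear r (d n) by exact: (snear_sub (cp2 n).1 (cp1 n).1).
have key := @maximum_principle R m r _ d (fun _ : 'I_N => pred0 : pred 'I_m) B B0.
move=> u ub; apply/rowP => n; apply/eqP; rewrite -subr_eq0; apply/eqP; apply: (key _ _ _ _ n) => //.
- by move=> k w wb; exact: snear_continuous (sd k) wb.
- by move=> k w i wb; exact: snear_derivable (sd k) wb.
- move=> k w _ wp; have -> : w = 0 by apply/rowP => l; rewrite mxE; exact: wp.
  by rewrite /d h0 subrr.
move=> k w i wb _; rewrite /d (partial_sub i (cp2 k).1 (cp1 k).1 wb).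
have e1 : partial i (fun x => fp x 0 k) w = a i w * partial i (fun x => f x 0 k) w + b i w * (fp w - f w) 0 k.
  apply: etrans (esym ((cp1 k).2 [:: i] w wb)) _; apply: etrans (congr1 (fun x : 'rV[R]_N => x 0 k) (ep w i wb)) _.
  by rewrite comb_coord; congr (_ * _ + _); exact: ((cf k).2 [:: i] w wb).
have e2 : partial i (fun x => fp' x 0 k) w = a' i w * partial i (fun x => f x 0 k) w + b' i w * (fp' w - f w) 0 k.
  apply: etrans (esym ((cp2 k).2 [:: i] w wb)) _; apply: etrans (congr1 (fun x : 'rV[R]_N => x 0 k) (ep' w i wb)) _.
  by rewrite comb_coord; congr (_ * _ + _); exact: ((cf k).2 [:: i] w wb).
have [ea eb] := hab w i wb; rewrite e1 e2 ea eb.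
have -> : a i w * partial i (fun x => f x 0 k) w + b i w * (fp' w - f w) 0 k - (a i w * partial i (fun x => f x 0 k) w + b i w * (fp w - f w) 0 k)
   = b i w * d k w by rewrite /d !mxE; ring.
by apply: nM; [exact: hB|exact: le_sum].
Qed.

End SmoothUniqueness.

(** * Convergence *)

Section SmoothConvergence.
Context {R : realType} {m N : nat} (r : R).
Local Notation pt := 'rV[R]_m.
Local Notation v0 := (fun _ : 'I_m => 0%N).
Implicit Types (u : pt) (eps : R) (alpha : 'I_m -> nat).

(** The letters stand in the order in which [multi_delta] folds the differences, so the two
    iterations agree literally. *)
Definition index_word alpha : seq 'I_m := flatten [seq nseq (alpha i) i | i <- enum 'I_m].

Lemma count_index_word alpha k : count_mem k (index_word alpha) = alpha k.
Proof.
have -> : count_mem k (index_word alpha) = (\sum_i count_mem k (nseq (alpha i) i))%N.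
  rewrite -(big_enum _ _ predT) /= /index_word.
  by elim: (enum 'I_m) => [|i s IH] /=; rewrite ?big_nil // big_cons count_cat IH.
rewrite (bigD1 k) //= big1 => [|i ik].
  by rewrite count_nseq /= eqxx mul1n addn0.
by rewrite count_nseq /= (negPf ik).
Qed.

Lemma multi_delta_coord eps alpha (g : pt -> 'rV[R]_N) n u :
  multi_delta eps alpha g u 0 n = foldr (dl eps) (fun w => g w 0 n) (index_word alpha) u.
Proof.
rewrite /multi_delta /index_word; elim: (enum 'I_m) u => [//|i s IH] u /=.
rewrite foldr_cat; elim: (alpha i) u => [|q IHq] u /=; first exact: IH.
by rewrite delta_coord; congr (dl eps i _ u); apply/funext => w; exact: IHq.
Qed.

Lemma OE_converges (g : R -> pt -> 'rV[R]_N) (g0 : pt -> 'rV[R]_N) :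
  (forall n, OE r v0 (fun eps u => g eps u 0 n - g0 u 0 n)) -> converges_smoothly r g g0.
Proof.
move=> h alpha; pose s := index_word alpha.
have [C C0 hC] : exists2 C : R, 0 <= C & \forall eps \near (0 : R)^'+, forall n : 'I_N,
    Bd (Ldom eps r) (dl eps) 1 (size s) v0 predT (fun u => g eps u 0 n - g0 u 0 n) (C * eps).
  apply: fin_near => [n M M' eps e0 MM'|n]; last exact: h.
  by apply: Bd_le; rewrite ler_pM2r.
exists C; near=> eps => u ub ub'; have e0 : 0 < eps by near: eps; exact: near_pos.
have hB : forall n : 'I_N, Bd (Ldom eps r) (dl eps) 1 (size s) v0 predT (fun u => g eps u 0 n - g0 u 0 n) (C * eps) by near: eps.
have uL : Ldom eps r (vword v0 s) u.
  apply: lattice_Ldom => // k; have [hb _] := ub'; have /andP[_] := hb k; congr (_ <= _).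
  rewrite !mxE /vword add0n count_index_word; congr (_ + _ * _).
  rewrite summxE (bigD1 k) //= big1 => [|i ik]; first by rewrite !mxE !eqxx mulr1 addr0.
  by rewrite !mxE eqxx eq_sym (negPf ik) mulr0.
have Ce : 0 <= C * eps by rewrite mulr_ge0 // ltW.
rewrite /Num.Def.normr /= mx_normrE; apply: bigmax_le => //= -[a n] _ /=.
rewrite (ord1 a) multi_delta_coord.
have -> : (fun w => (g eps w - g0 w) 0 n) = (fun w => g eps w 0 n - g0 w 0 n) by apply/funext => w; rewrite !mxE.
apply: (Bd_word (P := predT) (hB n)) => //; exact: all_predT.
Unshelve. all: by end_near. Qed.

(** Uniqueness determines f only on the lattice cube and c only on its squares, and the equations of
    the transform look at nothing else. *)
Lemma discrete_jonas_transfer eps f f' c c' fp a b cp : 0 < eps ->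
  discrete_jonas (N := N) eps r f c fp a b cp -> (forall u, lattice_box eps r u -> f' u = f u) ->
  (forall i j u, i != j -> cell eps r [:: i; j] u -> c' i j u = c i j u) ->
  discrete_jonas eps r f' c' fp a b cp.
Proof.
move=> e0 [h1 h2 h3] ff cc; split => //.
  move=> u i cl; rewrite (h2 u i cl); have [vu vi] := cl.
  rewrite big_cons big_nil addr0 in vi.
  by rewrite /delta /tau !ff.
by move=> u i j ij cl; have [k1 k2 k3] := h3 u i j ij cl; rewrite !(cc _ _ _ ij cl).
Qed.

End SmoothConvergence.

Theorem theorem3p8 (R : realType) (m N : nat) (m_gt0 : (0 < m)%N)
    (N_ge3 : (3 <= N)%N) (midQ midJ : bool)
    (fQ : 'rV[R]_m -> 'rV[R]_N) (cQ : 'I_m -> 'I_m -> 'rV[R]_m -> R)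
    (p : 'rV[R]_N) (aJ bJ : 'I_m -> 'rV[R]_m -> R)
    (dataQ : smooth_data_Q fQ cQ) (dataJ : smooth_data_J aJ bJ)
    (aJ_neq0 : forall (i : 'I_m) (u : 'rV[R]_m), axis i u -> aJ i u != 0) :
  exists2 r : R, 0 < r &
  exists (f : 'rV[R]_m -> 'rV[R]_N) (c : 'I_m -> 'I_m -> 'rV[R]_m -> R),
  [/\ conjugate_net_for r fQ cQ f c,
      forall f' c', conjugate_net_for r fQ cQ f' c' ->
        forall u, box r u ->
          f' u = f u /\ forall i j, i != j -> c' i j u = c i j u
    & exists fp : 'rV[R]_m -> 'rV[R]_N,
      [/\ jonas_transform_for r f c p aJ bJ fp,
          forall fp', jonas_transform_for r f c p aJ bJ fp' ->
            forall u, box r u -> fp' u = fp u,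
          \forall eps \near (0 : R)^'+,
            (exists fe ce, canonical_qnet midQ eps r fQ cQ fe ce) /\
            (forall fe ce, canonical_qnet midQ eps r fQ cQ fe ce ->
               exists fpe, canonical_jonas midJ eps r fe ce p aJ bJ fpe)
        & forall (fe fpe : R -> 'rV[R]_m -> 'rV[R]_N)
                 (ce : R -> 'I_m -> 'I_m -> 'rV[R]_m -> R),
            (\forall eps \near (0 : R)^'+,
               canonical_qnet midQ eps r fQ cQ (fe eps) (ce eps) /\
               canonical_jonas midJ eps r (fe eps) (ce eps) p aJ bJ
                 (fpe eps)) ->
            converges_smoothly r fpe fp]].
Proof.
have [r [M [f [fp [c [cp [a [b [fe [fpe [ce [cpe [ae [be [r0 hconj [hj hp0 hab a_neq0] hnear hOE]]]]]]]]]]]]]]] :=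
  nets_exist midQ midJ p dataQ dataJ aJ_neq0.
exists r => //; exists f, c.
have [h1 h2 h3] := hconj.
(* The uniqueness lemmas compare powers of the bound, for which it has to be at least 1. *)
pose M1 := `|M| + 1.
have M11 : 1 <= M1 by rewrite lerDr.
have near_small : \forall eps \near (0 : R)^'+, 7 * (eps * M1 ^+ 3) < 1.
  have q0 : 0 < 7 * M1 ^+ 3 by rewrite mulr_gt0 // exprn_gt0 // (lt_le_trans ltr01).
  near=> eps; have : eps < 1 / (7 * M1 ^+ 3) by near: eps; apply: near_lt; rewrite divr_gt0.
  by rewrite ltr_pdivlMr // mulrCA.
(* What is used at a fixed small eps: the explicit nets with their bounds, and eps below the
   threshold of the uniqueness lemmas. *)
pose good eps := [/\ 0 < eps, 7 * (eps * M1 ^+ 3) < 1, canonical_qnet midQ eps r fQ cQ (fe eps) (ce eps),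
  discrete_jonas eps r (fe eps) (ce eps) (fpe eps) (ae eps) (be eps) (cpe eps) &
  [/\ fpe eps 0 = p, data_J midJ aJ bJ eps r (ae eps) (be eps) & net_bounds eps r M1 (ce eps) (ae eps) (be eps)]].
have near_good : \forall eps \near (0 : R)^'+, good eps.
  near=> eps; have [g1 g2 g3 g4 [g5 g6]] : [/\ canonical_qnet midQ eps r fQ cQ (fe eps) (ce eps),
     discrete_jonas eps r (fe eps) (ce eps) (fpe eps) (ae eps) (be eps) (cpe eps), fpe eps 0 = p,
     data_J midJ aJ bJ eps r (ae eps) (be eps) & net_bounds eps r M (ce eps) (ae eps) (be eps)] by near: eps.
  have MM x : x <= M -> x <= M1 by move=> /le_trans; apply; rewrite (le_trans (ler_norm _)) // lerDl.
  split; [by near: eps; exact: near_pos|by near: eps|exact: g1|exact: g2|split; [exact: g3|exact: g4|split]].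
    by move=> i j u ij cl; apply: MM; exact: g5.
  by move=> j u cl; have [x1 x2 x3 x4] := g6 j u cl; split => //; exact: MM.
have discrete_unique eps : good eps -> forall f' c', canonical_qnet midQ eps r fQ cQ f' c' ->
    (forall u, lattice_box eps r u -> f' u = fe eps u) /\
    (forall i j u, i != j -> cell eps r [:: i; j] u -> c' i j u = ce eps i j u).
  move=> [e0 small [[q1 q2] q3 q4] _ [_ _ [bc _]]] f' c' [[q1' q2'] q3' q4'].
  have cc : forall i j u, i != j -> cell eps r [:: i; j] u -> c' i j u = ce eps i j u.
    apply: (qnet_c_unique e0 M11 small q2 q2' bc) => u i j ij ul up.
    by rewrite q4' // q4.
  split; last exact: cc.
  have s1 : square_equations eps r (ce eps) (fe eps) := q1.
  have s2 : square_equations eps r c' f' := q1'.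
  have s3 u i : lattice_box eps r u -> axis i u -> f' u = fe eps u.
    by move=> ul ua; rewrite (q3' u i) // (q3 u i).
  exact: (qnet_f_unique e0 M11 small s1 s2 cc s3 m_gt0).
have transfer eps : good eps -> forall f' c', canonical_qnet midQ eps r fQ cQ f' c' ->
    discrete_jonas eps r f' c' (fpe eps) (ae eps) (be eps) (cpe eps).
  move=> ge f' c' hq; have [ff cc] := discrete_unique eps ge f' c' hq.
  by have [e0 _ _ hdj _] := ge; exact: (discrete_jonas_transfer e0 hdj ff cc).
split; first exact: hconj.
  move=> f' c' [h1' h2' h3'] u ub.
  have cc : forall u i j, box r u -> i != j -> c' i j u = c i j u.
    apply: (conjugate_c_unique h1 h1') => w i j wb ij wp.
    by rewrite h3' // h3.
  split; last by move=> i j ij; exact: cc.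
  apply: (conjugate_f_unique r0 m_gt0 h1 h1' _ cc ub) => w i wb wa.
  by rewrite (h2' w i) // (h2 w i).
exists fp; split.
- by exists a, b, cp.
- move=> fp' [a' [b' [cp' [hj' hp' hab']]]] u ub.
  have ab : forall u i, box r u -> a' i u = a i u /\ b' i u = b i u.
    apply: (jonas_ab_unique_smooth h1 hj hj' a_neq0) => w i wb wa.
    by have [-> ->] := hab w i wb wa; exact: hab'.
  by apply: (jonas_fp_unique_smooth h1 hj hj' _ ab ub); rewrite hp' hp0.
- near=> eps; have ge : good eps by near: eps.
  have [e0 small hq hdj [g1 g2 g3]] := ge; split; first by exists (fe eps), (ce eps).
  move=> f' c' hq'; exists (fpe eps), (ae eps), (be eps), (cpe eps); split; [exact: transfer|exact: g1|exact: g2].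
(* At every good eps an arbitrary canonical transform coincides with the explicit one at the lattice
   points, so it inherits the order of convergence. *)
move=> fe' fpe' ce' hnear'; apply: OE_converges => n; apply: (OE_congr _ (hOE n)).
near=> eps => u uL; have ge : good eps by near: eps.
have [hq' [a' [b' [cp' [hj' hp' hab']]]]] : canonical_qnet midQ eps r fQ cQ (fe' eps) (ce' eps) /\
  canonical_jonas midJ eps r (fe' eps) (ce' eps) p aJ bJ (fpe' eps) by near: eps.
have [e0 small hq _ [g1 g2 [bc bab]]] := ge.
have hj0 := transfer eps ge _ _ hq'; have [ff cc] := discrete_unique eps ge _ _ hq'.
have bc' : net_bounds eps r M1 (ce' eps) (ae eps) (be eps).
  by split => // i j w ij cl; rewrite cc //; exact: bc.
have [_ k2 k3] := hj0; have [_ k2' k3'] := hj'.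
have ab : forall j w, cell eps r [:: j] w -> a' j w = ae eps j w /\ b' j w = be eps j w.
  apply: (jonas_ab_unique e0 M11 small k3 k3' bc') => w i wl wa.
  by have [-> ->] := g2 w i wl wa; exact: hab'.
have -> // : fpe' eps u = fpe eps u.
apply: (jonas_fp_unique e0 k2 k2' ab); first by rewrite hp' g1.
exact/(lattice_boxP _ _ e0).
Unshelve. all: by end_near. Qed.
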